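(* Assume $\delta\in(0,1]$ and fix $\underline\beta\in(0,1)$. Suppose each firm $i$ has a propensity to learn $\beta_i\in[\underline\beta,1)$. Then for all sufficiently large $n$ there exists an investment equilibrium, and every sequence of investment equilibria is critical (in the sense defined with the matrix $(\beta_i\delta\iota(q_i,q_j))_{i,j}$).
   Context: Model (for each number of firms $n\ge 2$). There are $n$ firms $1,\dots,n$; firm $i$ can discover a single idea, also labelled $i$. Fixed parameters (independent of $n$): an integer complexity $k\ge 2$, an indirect-learning probability $\delta\in[0,1]$, and a cost function $c:[0,1)\to[0,\infty)$ that is continuously differentiable, increasing and convex with $c(0)=0$ and $c(p)\to\infty$ as $p\to1^-$. Each firm $i$ chooses $(p_i,q_i)\in[0,1)\times[0,1]$. Idea $i$ is discovered independently with probability $p_i$; $I$ is the random set of discovered ideas. The interaction rate is $\iota(q_i,q_j)=q_iq_j$. In this variant, for each ordered pair $i\neq j$, independently, firm $i$ learns directly from $j$ with probability $\beta_i\iota(q_i,q_j)$, and conditional on this, independently with probability $\delta$, $i$ also learns indirectly through $j$. The indirect-learning network has an edge $j\to i$ whenever $i$ learns indirectly through $j$. The set of ideas learned by $i$ is $I_i(\mathbf p,\mathbf q)=\{j\in I\setminus\{i\}:$ some firm $m$, with $m=i$ or with a directed path from $m$ to $i$ in the indirect-learning network, learns directly from $j\}$. A technology is a $k$-element subset $t\subseteq I$; firm $i$ knows $t$ if $t\subseteq\{i\}\cup I_i$. $PT_i(\mathbf p,\mathbf q)$ is the set of technologies $t$ with $i\in t$ known by $i$ and by no other firm. Payoff $U_i=\mathbb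 E|PT_i|-c(p_i)$. An equilibrium is a pure-strategy Nash equilibrium; an investment equilibrium has $p_i>0$ for all $i$. Criticality: let $\lambda$ be the spectral radius of the matrix with $(i,j)$ entry $\beta_i\delta\iota(q_i,q_j)$; a sequence (indexed by $n\to\infty$) of action profiles is subcritical if $\limsup\lambda<1$, critical if $\lim\lambda=1$, supercritical if $\liminf\lambda>1$. *)

(* Defs.v *)
From Stdlib Require Import Reals Lra Lia List Arith Classical ClassicalEpsilon
  ClassicalDescription Relation_Operators.
Import ListNotations.
Open Scope R_scope.

(* Firms / ideas are indexed 0, ..., n-1. *)

Fixpoint sumR (n : nat) (f : nat -> R) : R :=
  match n with O => 0 | S m => sumR m f + f m end.

Definition ind (P : Prop) : R :=
  if excluded_middle_informative P then 1 else 0.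

Definition in01 (x : R) : Prop := 0 <= x < 1.

Definition cost_ok (c : R -> R) : Prop :=
  (exists c' : R -> R,
     (forall x, in01 x ->
        limit1_in (fun y => (c y - c x) / (y - x)) (fun y => in01 y /\ y <> x) (c' x) x) /\
     (forall x, in01 x -> limit1_in c' in01 (c' x) x)) /\
  (forall x, in01 x -> 0 <= c x) /\
  (forall x y, in01 x -> in01 y -> x < y -> c x < c y) /\
  (forall x y t, in01 x -> in01 y -> 0 <= t <= 1 ->
     c (t * x + (1 - t) * y) <= t * c x + (1 - t) * c y) /\
  c 0 = 0 /\
  (forall M, exists eta, 0 < eta /\ forall x, 1 - eta < x < 1 -> M < c x).

Inductive Var : Type :=
| Disc (i : nat)        (* idea i is discovered *)
| Dir (i j : nat)       (* firm i learns directly from firm j *)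
| Ind (i j : nat).      (* coin (prob. delta) deciding whether i also learns indirectly through j *)

Definition Var_eq_dec (x y : Var) : {x = y} + {x <> y}.
Proof. decide equality; apply Nat.eq_dec. Defined.

Definition Outcome := Var -> bool.

Definition setv (w : Outcome) (v : Var) (b : bool) : Outcome :=
  fun u => if Var_eq_dec u v then b else w u.

(** Expectation of f over independent Bernoulli variables listed in [keys]
    with success probabilities [prob]; variables not listed are false. *)
Fixpoint Expect (keys : list Var) (prob : Var -> R) (f : Outcome -> R) : R :=
  match keys with
  | [] => f (fun _ => false)
  | v :: ks =>
      prob v * Expect ks prob (fun w => f (setv w v true))
      + (1 - prob v) * Expect ks prob (fun w => f (setv w v false))
  end.

Definition pairs (n : nat) : list (nat * nat) :=
  filter (fun ij => negb (Nat.eqb (fst ij) (snd ij))) (list_prod (seq 0 n) (seq 0 n)).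

Definition keys (n : nat) : list Var :=
  map Disc (seq 0 n) ++ map (fun ij => Dir (fst ij) (snd ij)) (pairs n)
                     ++ map (fun ij => Ind (fst ij) (snd ij)) (pairs n).

Definition iota (x y : R) : R := x * y.

Definition prob (beta : nat -> R) (delta : R) (p q : nat -> R) (v : Var) : R :=
  match v with
  | Disc i => p i
  | Dir i j => beta i * iota (q i) (q j)
  | Ind _ _ => delta
  end.

(** Indirect-learning network: edge j -> i iff i learns indirectly through j
    (i.e. i learns directly from j and, conditionally, the delta-coin succeeds). *)
Definition ind_edge (w : Outcome) (j i : nat) : Prop :=
  w (Dir i j) = true /\ w (Ind i j) = true.

Definition reach (w : Outcome) (m i : nat) : Prop :=
  clos_refl_trans nat (ind_edge w) m i.

Definition learned (n : nat) (w : Outcome) (i j : nat) : Prop :=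
  (j < n)%nat /\ w (Disc j) = true /\ j <> i /\
  exists m, (m < n)%nat /\ reach w m i /\ w (Dir m j) = true.

(** Subsets of {0..n-1} as characteristic bool lists of length n. *)
Fixpoint blists (n : nat) : list (list bool) :=
  match n with
  | O => [[]]
  | S m => map (cons true) (blists m) ++ map (cons false) (blists m)
  end.

Definition mem (t : list bool) (j : nat) : Prop := nth j t false = true.

Definition technology (n k : nat) (w : Outcome) (t : list bool) : Prop :=
  length t = n /\ length (filter (fun b => b) t) = k /\
  forall j, (j < n)%nat -> mem t j -> w (Disc j) = true.

Definition knows (n : nat) (w : Outcome) (i : nat) (t : list bool) : Prop :=
  forall j, (j < n)%nat -> mem t j -> j = i \/ learned n w i j.

Definition in_PT (n k : nat) (w : Outcome) (i : nat) (t : list bool) : Prop :=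
  technology n k w t /\ mem t i /\ knows n w i t /\
  forall m, (m < n)%nat -> m <> i -> ~ knows n w m t.

Definition numPT (n k : nat) (w : Outcome) (i : nat) : R :=
  fold_right (fun t acc => ind (in_PT n k w i t) + acc) 0 (blists n).

Definition payoff (n k : nat) (delta : R) (beta : nat -> R) (c : R -> R)
  (p q : nat -> R) (i : nat) : R :=
  Expect (keys n) (prob beta delta p q) (fun w => numPT n k w i) - c (p i).

Definition upd (f : nat -> R) (i : nat) (x : R) : nat -> R :=
  fun j => if Nat.eq_dec j i then x else f j.

Definition valid_action (x y : R) : Prop := 0 <= x < 1 /\ 0 <= y <= 1.

Definition valid_profile (n : nat) (p q : nat -> R) : Prop :=
  forall i, (i < n)%nat -> valid_action (p i) (q i).

Definition equilibrium (n k : nat) (delta : R) (beta : nat -> R) (c : R -> R)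
  (p q : nat -> R) : Prop :=
  valid_profile n p q /\
  forall i, (i < n)%nat -> forall x y, valid_action x y ->
    payoff n k delta beta c (upd p i x) (upd q i y) i <= payoff n k delta beta c p q i.

Definition investment_equilibrium (n k : nat) (delta : R) (beta : nat -> R)
  (c : R -> R) (p q : nat -> R) : Prop :=
  equilibrium n k delta beta c p q /\ forall i, (i < n)%nat -> 0 < p i.

(** z = a + ib is a (complex) eigenvalue: M (xr + i xi) = (a + ib)(xr + i xi), x <> 0. *)
Definition eigenvalue (n : nat) (M : nat -> nat -> R) (a b : R) : Prop :=
  exists xr xi : nat -> R,
    (exists j, (j < n)%nat /\ (xr j <> 0 \/ xi j <> 0)) /\
    forall i, (i < n)%nat ->
      sumR n (fun j => M i j * xr j) = a * xr i - b * xi i /\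
      sumR n (fun j => M i j * xi j) = b * xr i + a * xi i.

Definition spectral_radius (n : nat) (M : nat -> nat -> R) : R :=
  epsilon (inhabits 0)
    (fun r => is_lub (fun m => exists a b, eigenvalue n M a b /\ m = sqrt (a * a + b * b)) r).

Definition crit_matrix (beta : nat -> R) (delta : R) (q : nat -> R) : nat -> nat -> R :=
  fun i j => beta i * delta * iota (q i) (q j).

Definition lambda (n : nat) (beta : nat -> R) (delta : R) (q : nat -> R) : R :=
  spectral_radius n (crit_matrix beta delta q).

Definition critical (beta : nat -> R) (delta : R) (q : nat -> nat -> R) : Prop :=
  Un_cv (fun n => lambda n beta delta (q n)) 1.

(* Main.v *)
(** The payoff of firm [i] is [p_i * GG_i - c (p_i)], where [GG_i] is the expected number of technologies
    proprietary to [i] given that idea [i] is discovered. Differentiating [GG_i] in [q_i] and multiplying by [q_i]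
    gives [SX - SY]: the first term counts the listening links of [i] that are pivotal for a proprietary technology,
    the second the links through which such a technology would leak. Always [SX <= (k-1) GG] and
    [SY >= zz GG], where [zz] is the expected number of firms learning indirectly through [i], and [SX] dominates
    when [q_i] is small; so in equilibrium every [q_i] has order [n^(-1/2)], and the indirect-learning network is a sparse rank-one random digraph whose
    criticality parameter is [lam0 = delta * sum_j beta_j q_j^2].
    If [lam0] is not above one, few firms hear of a given technology, so [SX >= (1 - o(1)) GG], [SY <= (zz + o(1)) GG], and the balance
    [SX = SY] forces [zz >= 1 - o(1)] for all firms, hence [lam0 >= 1 - o(1)]. If [lam0 >= 1 + eps], a firm learns
    all of a technology through the giant component, hence almost always through one link: [SX = (1 + o(1)) GG],
    [zz <= 1 + o(1)] and [lam0 <= 1 + o(1)].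
    Existence: a variational inequality on a box (a cubical Sperner lemma, proved by a mod 2 cup product) gives
    a profile satisfying the first-order conditions. It is near critical, where the clusters have unbounded mean:
    [GG] is large, so the investments are interior, and a single link is pivotal for most of [GG], so every
    stationary point of [GG] in [q_i] is a strict local maximum and the first-order conditions suffice. *)

From Stdlib Require Import Reals Lra Lia List Arith Bool ClassicalEpsilon
  ClassicalDescription FunctionalExtensionality PropExtensionality Relation_Operators Operators_Properties.
From Stdlib Require FinFun.
Require Import Defs.
Import ListNotations.
Open Scope R_scope.

(** Three obstacles shape the proof. The event that a firm learns a given technology may be only
    polynomially likely, so the claim that few firms hear of it must hold conditionally on that
    event; tail bounds alone do not give this, and an exponential bound against linear backward
    clusters is needed. Near criticality a single technology is hard to control, so there the
    pivotal links are estimated only after summing over all technologies, where counts become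
    elementary symmetric polynomials of what a firm learns. Finally, the closed profile [q = 0]
    solves every first-order condition trivially; the box used for existence therefore starts at
    [1 / n], far below the true order of openness but away from this solution. No branching process
    limit is taken. The edge probabilities have rank one, so the action vector is an eigenvector of
    the mean matrix, and products of affine functions of it are explicit test functions for an
    exploration, with constants uniform in [n]. All conditioning goes through [Expect_fresh]: reveal
    a random set together with the coins that determine it, then use the coins not yet read. *)

Ltac em P := destruct (excluded_middle_informative P).

(** * Finite sums, products and indicators *)

Lemma sumR_ext n f g : (forall i, (i < n)%nat -> f i = g i) -> sumR n f = sumR n g.
Proof. induction n; simpl; intros H; [reflexivity|]. rewrite IHn, H; auto. Qed.

Lemma sumR_le n f g : (forall i, (i < n)%nat -> f i <= g i) -> sumR n f <= sumR n g.
Proof.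
  induction n; simpl; intros H; [lra|].
  assert (f n <= g n) by auto. assert (sumR n f <= sumR n g) by auto. lra.
Qed.

Lemma sumR_plus n f g : sumR n (fun i => f i + g i) = sumR n f + sumR n g.
Proof. induction n; simpl; [lra|]. rewrite IHn; lra. Qed.

Lemma sumR_scal n a f : sumR n (fun i => a * f i) = a * sumR n f.
Proof. induction n; simpl; [lra|]. rewrite IHn; lra. Qed.

Lemma sumR_const n a : sumR n (fun _ => a) = INR n * a.
Proof. induction n; [simpl; lra|]. rewrite S_INR; simpl; rewrite IHn; lra. Qed.

Lemma sumR_nonneg n f : (forall i, (i < n)%nat -> 0 <= f i) -> 0 <= sumR n f.
Proof.
  intros H. replace 0 with (sumR n (fun _ => 0)) by (rewrite sumR_const; lra).
  now apply sumR_le.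
Qed.

Lemma sumR_zero n f : (forall i, (i < n)%nat -> f i = 0) -> sumR n f = 0.
Proof.
  intros H. rewrite (sumR_ext n f (fun _ => 0) H), sumR_const. lra.
Qed.

Lemma sumR_swap n m f :
  sumR n (fun i => sumR m (fun j => f i j)) = sumR m (fun j => sumR n (fun i => f i j)).
Proof.
  induction n; simpl; [now rewrite sumR_zero|].
  rewrite IHn, <- sumR_plus. reflexivity.
Qed.

Lemma sumR_ge_term n f i : (forall j, (j < n)%nat -> 0 <= f j) -> (i < n)%nat -> f i <= sumR n f.
Proof.
  induction n; intros H Hi; [lia|]. simpl.
  destruct (Nat.eq_dec i n) as [->|].
  - assert (0 <= sumR n f) by (apply sumR_nonneg; auto). lra.
  - assert (0 <= f n) by auto. assert (f i <= sumR n f) by (apply IHn; auto; lia). lra.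
Qed.

Lemma sumR_single n i a : (i < n)%nat -> sumR n (fun j => if Nat.eq_dec j i then a else 0) = a.
Proof.
  induction n; intros Hi; [lia|]. simpl. destruct (Nat.eq_dec n i) as [->|].
  - rewrite sumR_zero; [lra|]. intros j Hj. destruct (Nat.eq_dec j i); [lia|reflexivity].
  - rewrite IHn by lia. lra.
Qed.

Fixpoint prodR (n : nat) (f : nat -> R) : R :=
  match n with O => 1 | S m => prodR m f * f m end.

Lemma prodR_ext n f g : (forall i, (i < n)%nat -> f i = g i) -> prodR n f = prodR n g.
Proof. induction n; simpl; intros H; [reflexivity|]. rewrite IHn, H; auto. Qed.

Lemma prodR_nonneg n f : (forall i, (i < n)%nat -> 0 <= f i) -> 0 <= prodR n f.
Proof. induction n; simpl; intros H; [lra|]. apply Rmult_le_pos; auto. Qed.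

Lemma prodR_pos n f : (forall i, (i < n)%nat -> 0 < f i) -> 0 < prodR n f.
Proof. induction n; simpl; intros H; [lra|]. apply Rmult_lt_0_compat; auto. Qed.

Lemma prodR_mult n f g : prodR n (fun i => f i * g i) = prodR n f * prodR n g.
Proof. induction n; simpl; [lra|]. rewrite IHn; ring. Qed.

Lemma prodR_one n f : (forall i, (i < n)%nat -> f i = 1) -> prodR n f = 1.
Proof. induction n; simpl; intros H; [reflexivity|]. rewrite IHn, H; auto; lra. Qed.

Lemma prodR_le n f g :
  (forall i, (i < n)%nat -> 0 <= f i <= g i) -> prodR n f <= prodR n g.
Proof.
  induction n; simpl; intros H; [lra|].
  apply Rmult_le_compat; auto; try apply H; auto.
  apply prodR_nonneg; intros; apply H; lia.
Qed.

Lemma prodR_zero n f i : (i < n)%nat -> f i = 0 -> prodR n f = 0.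
Proof.
  induction n; intros Hi H; [lia|]. simpl. destruct (Nat.eq_dec i n) as [->|].
  - rewrite H; lra.
  - rewrite IHn; [lra|lia|assumption].
Qed.

Lemma prodR_exp n f : prodR n (fun i => exp (f i)) = exp (sumR n f).
Proof. induction n; simpl; [now rewrite exp_0|]. now rewrite IHn, exp_plus. Qed.

(** The Weierstrass product inequality; the induction also has to carry the bounds [0] and [1] on
    the product. *)
Lemma prodR_ge_1_sub n f :
  (forall i, (i < n)%nat -> 0 <= f i <= 1) -> 1 - sumR n f <= prodR n (fun i => 1 - f i).
Proof.
  intros H. enough (0 <= prodR n (fun i => 1 - f i) <= 1 /\ 1 - sumR n f <= prodR n (fun i => 1 - f i))
    by tauto.
  induction n; simpl; [lra|].
  assert (Hn := H n ltac:(lia)). destruct IHn as [[A B] C]; [intros; apply H; lia|].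
  split; [|nra]. split; nra.
Qed.

Lemma prodR_single n i (f : nat -> R) :
  (i < n)%nat ->
  prodR n f = f i * prodR n (fun j => if Nat.eq_dec j i then 1 else f j).
Proof.
  induction n; intros Hi; [lia|]. simpl. destruct (Nat.eq_dec n i) as [->|].
  - rewrite Rmult_1_r, Rmult_comm. f_equal. apply prodR_ext.
    intros j Hj. destruct (Nat.eq_dec j i); [lia|reflexivity].
  - rewrite IHn by lia. ring.
Qed.

Lemma ind_true (P : Prop) : P -> ind P = 1.
Proof. intros H; unfold ind; em P; [reflexivity|contradiction]. Qed.

Lemma ind_false (P : Prop) : ~ P -> ind P = 0.
Proof. intros H; unfold ind; em P; [contradiction|reflexivity]. Qed.

Lemma ind_range P : 0 <= ind P <= 1.
Proof. unfold ind; em P; lra. Qed.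

Lemma ind_pos P : 0 <= ind P.
Proof. apply ind_range. Qed.

Lemma ind_le (P Q : Prop) : (P -> Q) -> ind P <= ind Q.
Proof. intros H; unfold ind; em P; em Q; try lra; tauto. Qed.

Lemma ind_iff (P Q : Prop) : (P <-> Q) -> ind P = ind Q.
Proof. intros H. f_equal. now apply propositional_extensionality. Qed.

Lemma ind_and P Q : ind (P /\ Q) = ind P * ind Q.
Proof. unfold ind; em P; em Q; em (P /\ Q); try lra; tauto. Qed.

Lemma ind_not P : ind (~ P) = 1 - ind P.
Proof. unfold ind; em P; em (~ P); try lra; tauto. Qed.

Lemma ind_or_le P Q : ind (P \/ Q) <= ind P + ind Q.
Proof. unfold ind; em P; em Q; em (P \/ Q); try lra; tauto. Qed.

Lemma ind_ex_le n (P : nat -> Prop) :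
  ind (exists i, (i < n)%nat /\ P i) <= sumR n (fun i => ind (P i)).
Proof.
  em (exists i, (i < n)%nat /\ P i).
  - destruct e as [i [Hi HP]]. rewrite ind_true by eauto.
    rewrite <- (ind_true (P i) HP).
    apply (sumR_ge_term n (fun i => ind (P i))); auto. intros; apply ind_pos.
  - rewrite ind_false by assumption. apply sumR_nonneg; intros; apply ind_pos.
Qed.

Definition lsum {A} (l : list A) (f : A -> R) : R := fold_right (fun a s => f a + s) 0 l.

Lemma lsum_cons {A} (a : A) l f : lsum (a :: l) f = f a + lsum l f.
Proof. reflexivity. Qed.

Lemma lsum_ext {A} (l : list A) f g : (forall a, In a l -> f a = g a) -> lsum l f = lsum l g.
Proof. induction l; simpl; intros H; [reflexivity|]. rewrite IHl, H; auto. Qed.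

Lemma lsum_le {A} (l : list A) f g : (forall a, In a l -> f a <= g a) -> lsum l f <= lsum l g.
Proof.
  induction l as [|a l IH]; simpl; intros H; [lra|].
  assert (f a <= g a) by auto. assert (lsum l f <= lsum l g) by auto. unfold lsum in *; lra.
Qed.

Lemma lsum_plus {A} (l : list A) f g : lsum l (fun a => f a + g a) = lsum l f + lsum l g.
Proof. induction l as [|a l IH]; simpl; [lra|]. unfold lsum in *; rewrite IH; lra. Qed.

Lemma lsum_scal {A} (l : list A) c f : lsum l (fun a => c * f a) = c * lsum l f.
Proof. induction l as [|a l IH]; simpl; [lra|]. unfold lsum in *; rewrite IH; lra. Qed.

Lemma lsum_zero {A} (l : list A) f : (forall a, In a l -> f a = 0) -> lsum l f = 0.
Proof. induction l as [|a l IH]; simpl; intros H; [reflexivity|]. rewrite IH, H; auto; lra. Qed.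

Lemma lsum_nonneg {A} (l : list A) f : (forall a, In a l -> 0 <= f a) -> 0 <= lsum l f.
Proof.
  intros H. rewrite <- (lsum_zero l (fun _ => 0)) by auto. now apply lsum_le.
Qed.

Lemma lsum_app {A} (l l' : list A) f : lsum (l ++ l') f = lsum l f + lsum l' f.
Proof. induction l as [|a l IH]; simpl; [lra|]. unfold lsum in *; rewrite IH; lra. Qed.

Lemma lsum_map {A B} (h : A -> B) (l : list A) f : lsum (map h l) f = lsum l (fun a => f (h a)).
Proof. induction l as [|a l IH]; simpl; [reflexivity|]. unfold lsum in *; now rewrite IH. Qed.

Lemma lsum_seq n f : lsum (seq 0 n) f = sumR n f.
Proof.
  induction n; [reflexivity|]. rewrite seq_S, lsum_app, IHn. simpl. lra.
Qed.

Lemma lsum_sumR_swap {A} (l : list A) n (f : A -> nat -> R) :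
  lsum l (fun a => sumR n (f a)) = sumR n (fun j => lsum l (fun a => f a j)).
Proof.
  induction l as [|a l IH]; simpl; [now rewrite sumR_zero|].
  rewrite IH, <- sumR_plus. reflexivity.
Qed.

Lemma lsum_filter {A} (b : A -> bool) (l : list A) f :
  lsum (filter b l) f = lsum l (fun a => if b a then f a else 0).
Proof.
  induction l as [|a l IH]; simpl; [reflexivity|].
  destruct (b a); simpl; unfold lsum in *; rewrite IH; lra.
Qed.

Lemma lsum_prod {A B} (l : list A) (l' : list B) f :
  lsum (list_prod l l') f = lsum l (fun a => lsum l' (fun b => f (a, b))).
Proof.
  induction l as [|a l IH]; simpl; [reflexivity|].
  rewrite lsum_app, lsum_map, IH. reflexivity.
Qed.

(** * Independent Bernoulli variables *)

Definition dep {A} (P : Var -> Prop) (f : Outcome -> A) : Prop :=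
  forall w w', (forall v, P v -> w v = w' v) -> f w = f w'.

(** [Expect] evaluates its function only at outcomes that are false off the list, so pointwise
    hypotheses are needed there alone; in particular all links present are between firms below
    [n]. *)
Definition supp (ks : list Var) (w : Outcome) : Prop := forall v, w v = true -> In v ks.

Definition okp (ks : list Var) (pr : Var -> R) : Prop := forall v, In v ks -> 0 <= pr v <= 1.

Lemma setv_same w v b : setv w v b v = b.
Proof. unfold setv. destruct (Var_eq_dec v v); congruence. Qed.

Lemma setv_other w v b u : u <> v -> setv w v b u = w u.
Proof. unfold setv. destruct (Var_eq_dec u v); congruence. Qed.

Lemma setv_setv w v b b' : setv (setv w v b) v b' = setv w v b'.
Proof. extensionality u. unfold setv. destruct (Var_eq_dec u v); reflexivity. Qed.

Lemma setv_comm w v v' b b' : v <> v' -> setv (setv w v b) v' b' = setv (setv w v' b') v b.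
Proof.
  intros H. extensionality u. unfold setv.
  destruct (Var_eq_dec u v), (Var_eq_dec u v'); congruence.
Qed.

Lemma setv_id w v b : w v = b -> setv w v b = w.
Proof. intros H. extensionality u. unfold setv. destruct (Var_eq_dec u v); congruence. Qed.

Lemma supp_setv v ks w b : supp ks w -> supp (v :: ks) (setv w v b).
Proof.
  intros H u Hu. unfold setv in Hu. destruct (Var_eq_dec u v); [left; auto|right; auto].
Qed.

Lemma supp_setv_in v ks w b : In v ks -> supp ks w -> supp ks (setv w v b).
Proof.
  intros Hv H u Hu. unfold setv in Hu. destruct (Var_eq_dec u v); [subst; auto|auto].
Qed.

Lemma dep_weaken {A} (P Q : Var -> Prop) (f : Outcome -> A) :
  (forall v, P v -> Q v) -> dep P f -> dep Q f.
Proof. intros H D w w' E. apply D. auto. Qed.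

Lemma dep_setv {A} P (f : Outcome -> A) v b : dep P f -> dep P (fun w => f (setv w v b)).
Proof. intros D w w' E. apply D. intros u Hu. unfold setv. destruct (Var_eq_dec u v); auto. Qed.

Lemma dep_no {A} P (f : Outcome -> A) v b w : dep P f -> ~ P v -> f (setv w v b) = f w.
Proof. intros D H. apply D. intros u Hu. apply setv_other. congruence. Qed.

Lemma dep_ind P (Q : Outcome -> Prop) :
  (forall w w', (forall v, P v -> w v = w' v) -> Q w -> Q w') -> dep P (fun w => ind (Q w)).
Proof.
  intros H w w' E. apply ind_iff. split; apply H; auto. intros v Hv; symmetry; auto.
Qed.

Lemma Expect_le ks pr f g :
  okp ks pr -> (forall w, supp ks w -> f w <= g w) -> Expect ks pr f <= Expect ks pr g.
Proof.
  revert f g; induction ks as [|v ks IH]; intros f g Hok H; simpl.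
  - apply H. intros u Hu; discriminate.
  - assert (Hv := Hok v (or_introl eq_refl)).
    assert (Hk : okp ks pr) by (intros u Hu; apply Hok; now right).
    assert (forall b, Expect ks pr (fun w => f (setv w v b)) <= Expect ks pr (fun w => g (setv w v b))).
    { intros b; apply IH; auto. intros w Hw; apply H; now apply supp_setv. }
    apply Rplus_le_compat; apply Rmult_le_compat_l; auto; lra.
Qed.

Lemma Expect_ext ks pr f g :
  (forall w, supp ks w -> f w = g w) -> Expect ks pr f = Expect ks pr g.
Proof.
  revert f g; induction ks as [|v ks IH]; intros f g H; simpl.
  - apply H. intros u Hu; discriminate.
  - assert (forall b, Expect ks pr (fun w => f (setv w v b)) = Expect ks pr (fun w => g (setv w v b))).
    { intros b; apply IH; auto. intros w Hw; apply H; now apply supp_setv. }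
    now rewrite !H0.
Qed.

Lemma Expect_const ks pr a : Expect ks pr (fun _ => a) = a.
Proof. induction ks as [|v ks IH]; simpl; [reflexivity|]. rewrite IH; lra. Qed.

Lemma Expect_plus ks pr f g :
  Expect ks pr (fun w => f w + g w) = Expect ks pr f + Expect ks pr g.
Proof.
  revert f g; induction ks as [|v ks IH]; intros f g; simpl; [reflexivity|]. rewrite !IH; lra.
Qed.

Lemma Expect_scal ks pr a f : Expect ks pr (fun w => a * f w) = a * Expect ks pr f.
Proof. revert f; induction ks as [|v ks IH]; intros f; simpl; [reflexivity|]. rewrite !IH; lra. Qed.

Lemma Expect_minus ks pr f g :
  Expect ks pr (fun w => f w - g w) = Expect ks pr f - Expect ks pr g.
Proof.
  replace (Expect ks pr f - Expect ks pr g) with (Expect ks pr f + (-1) * Expect ks pr g) by lra.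
  rewrite <- Expect_scal, <- Expect_plus. apply Expect_ext; intros; lra.
Qed.

Lemma Expect_sumR ks pr n (f : nat -> Outcome -> R) :
  Expect ks pr (fun w => sumR n (fun i => f i w)) = sumR n (fun i => Expect ks pr (f i)).
Proof. induction n; simpl; [apply Expect_const|]. now rewrite Expect_plus, IHn. Qed.

Lemma Expect_lsum ks pr {A} (l : list A) (f : A -> Outcome -> R) :
  Expect ks pr (fun w => lsum l (fun i => f i w)) = lsum l (fun i => Expect ks pr (f i)).
Proof. induction l; simpl; [apply Expect_const|]. rewrite Expect_plus. now rewrite IHl. Qed.

Lemma Expect_nonneg ks pr f :
  okp ks pr -> (forall w, supp ks w -> 0 <= f w) -> 0 <= Expect ks pr f.
Proof. intros Hok H. rewrite <- (Expect_const ks pr 0). now apply Expect_le. Qed.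

Lemma Expect_ind_range ks pr (P : Outcome -> Prop) :
  okp ks pr -> 0 <= Expect ks pr (fun w => ind (P w)) <= 1.
Proof.
  intros Hok. split.
  - apply Expect_nonneg; auto. intros; apply ind_pos.
  - rewrite <- (Expect_const ks pr 1). apply Expect_le; auto. intros; apply ind_range.
Qed.

Lemma Expect_union ks pr (P Q S : Outcome -> Prop) :
  okp ks pr -> (forall w, supp ks w -> P w -> Q w \/ S w) ->
  Expect ks pr (fun w => ind (P w)) <= Expect ks pr (fun w => ind (Q w)) + Expect ks pr (fun w => ind (S w)).
Proof.
  intros Hok H. rewrite <- Expect_plus. apply Expect_le; auto. intros w Hw.
  eapply Rle_trans; [apply ind_le, (H w Hw)|apply ind_or_le].
Qed.

Lemma Expect_union_sum ks pr n (P : Outcome -> Prop) (Q : nat -> Outcome -> Prop) :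
  okp ks pr -> (forall w, supp ks w -> P w -> exists i, (i < n)%nat /\ Q i w) ->
  Expect ks pr (fun w => ind (P w)) <= sumR n (fun i => Expect ks pr (fun w => ind (Q i w))).
Proof.
  intros Hok H. rewrite <- Expect_sumR. apply Expect_le; auto. intros w Hw.
  eapply Rle_trans; [apply ind_le, (H w Hw)|apply ind_ex_le].
Qed.

Lemma Expect_split ks pr f v : NoDup ks -> In v ks ->
  Expect ks pr f = pr v * Expect ks pr (fun w => f (setv w v true))
                   + (1 - pr v) * Expect ks pr (fun w => f (setv w v false)).
Proof.
  revert f; induction ks as [|u ks IH]; intros f Hnd Hin; [destruct Hin|].
  inversion Hnd; subst. destruct (Var_eq_dec u v) as [->|Huv]; simpl.
  - assert (S : forall b b', Expect ks pr (fun w => f (setv (setv w v b) v b'))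
                          = Expect ks pr (fun w => f (setv w v b'))).
    { intros; apply Expect_ext; intros; now rewrite setv_setv. }
    rewrite !S. lra.
  - destruct Hin as [|Hin]; [congruence|].
    rewrite (IH (fun w => f (setv w u true))), (IH (fun w => f (setv w u false))) by auto.
    assert (S : forall b b', Expect ks pr (fun w => f (setv (setv w u b) v b'))
                          = Expect ks pr (fun w => f (setv (setv w v b') u b))).
    { intros; apply Expect_ext; intros; now rewrite setv_comm. }
    rewrite !S. lra.
Qed.

(** Induction on the list: each coin is read by at most one of the two factors. *)
Lemma Expect_indep ks pr P f g :
  dep P f -> dep (fun v => ~ P v) g ->
  Expect ks pr (fun w => f w * g w) = Expect ks pr f * Expect ks pr g.
Proof.
  revert f g; induction ks as [|v ks IH]; intros f g Hf Hg; simpl; [reflexivity|].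
  rewrite (IH (fun w => f (setv w v true))), (IH (fun w => f (setv w v false)))
    by (apply dep_setv; auto).
  em (P v).
  - assert (S : forall b, Expect ks pr (fun w => g (setv w v b)) = Expect ks pr g).
    { intros b; apply Expect_ext; intros; apply (dep_no _ _ _ _ _ Hg). tauto. }
    rewrite !S. lra.
  - assert (S : forall b, Expect ks pr (fun w => f (setv w v b)) = Expect ks pr f).
    { intros b; apply Expect_ext; intros; now apply (dep_no _ _ _ _ _ Hf). }
    rewrite !S. lra.
Qed.

Lemma Expect_prob_ext ks pr pr' P f :
  dep P f -> (forall v, In v ks -> P v -> pr v = pr' v) -> Expect ks pr f = Expect ks pr' f.
Proof.
  revert f; induction ks as [|v ks IH]; intros f Hf H; simpl; [reflexivity|].
  rewrite (IH (fun w => f (setv w v true))), (IH (fun w => f (setv w v false)))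
    by (try (apply dep_setv; auto); intros; apply H; simpl; auto).
  em (P v).
  - rewrite H by (simpl; auto). reflexivity.
  - assert (S : forall b, Expect ks pr' (fun w => f (setv w v b)) = Expect ks pr' f).
    { intros b; apply Expect_ext; intros; now apply (dep_no _ _ _ _ _ Hf). }
    rewrite !S. lra.
Qed.

Lemma Expect_var ks pr v : NoDup ks -> In v ks ->
  Expect ks pr (fun w => ind (w v = true)) = pr v.
Proof.
  intros Hnd Hin. rewrite (Expect_split _ _ _ v Hnd Hin).
  rewrite (Expect_ext _ _ _ (fun _ => 1)), (Expect_ext _ _ (fun w => ind (setv w v false v = true)) (fun _ => 0)).
  - rewrite !Expect_const. lra.
  - intros w _. apply ind_false. rewrite setv_same. discriminate.
  - intros w _. apply ind_true. apply setv_same.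
Qed.

Lemma dep_prodR P n (f : nat -> Outcome -> R) :
  (forall i, (i < n)%nat -> dep P (f i)) -> dep P (fun w => prodR n (fun i => f i w)).
Proof. intros H w w' E. apply prodR_ext. intros i Hi. now apply (H i Hi). Qed.

Lemma Expect_prodR ks pr n (Q : nat -> Var -> Prop) (f : nat -> Outcome -> R) :
  (forall i, (i < n)%nat -> dep (Q i) (f i)) ->
  (forall i j v, (i < n)%nat -> (j < n)%nat -> Q i v -> Q j v -> i = j) ->
  Expect ks pr (fun w => prodR n (fun i => f i w)) = prodR n (fun i => Expect ks pr (f i)).
Proof.
  induction n; intros Hd Hq; simpl; [apply Expect_const|].
  rewrite (Expect_indep ks pr (fun v => ~ Q n v) (fun w => prodR n (fun i => f i w)) (f n)).
  - rewrite IHn; auto. intros; eapply Hq; eauto.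
  - apply dep_prodR. intros i Hi. eapply dep_weaken; [|apply Hd; lia].
    intros v Hv Hn. assert (i = n) by (eapply (Hq i n); eauto). lia.
  - eapply dep_weaken; [|apply Hd; lia]. simpl; intros; tauto.
Qed.

Definition incr (f : Outcome -> R) : Prop :=
  forall w w', (forall v, w v = true -> w' v = true) -> f w <= f w'.

Lemma incr_setv f v b : incr f -> incr (fun w => f (setv w v b)).
Proof.
  intros H w w' L. apply H. intros u. unfold setv. destruct (Var_eq_dec u v); auto.
Qed.

(** Positive association of increasing functions under a product measure: conditioning on one coin
    leaves Chebyshev's inequality for that coin, which is the nonnegative product of the two
    increments. *)
Lemma Harris ks pr f g : okp ks pr -> incr f -> incr g ->
  Expect ks pr f * Expect ks pr g <= Expect ks pr (fun w => f w * g w).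
Proof.
  revert f g; induction ks as [|v ks IH]; intros f g Hok Hf Hg; simpl; [lra|].
  assert (Hv := Hok v (or_introl eq_refl)).
  assert (Hk : okp ks pr) by (intros u Hu; apply Hok; now right).
  assert (M : forall h, incr h -> Expect ks pr (fun w => h (setv w v false)) <= Expect ks pr (fun w => h (setv w v true))).
  { intros h Hh. apply Expect_le; auto. intros w _. apply Hh. intros u. unfold setv.
    destruct (Var_eq_dec u v); [discriminate|auto]. }
  assert (Mf := M f Hf). assert (Mg := M g Hg).
  assert (I1 := IH _ _ Hk (incr_setv f v true Hf) (incr_setv g v true Hg)).
  assert (I0 := IH _ _ Hk (incr_setv f v false Hf) (incr_setv g v false Hg)).
  set (a1 := Expect ks pr (fun w => f (setv w v true))) in *.
  set (a0 := Expect ks pr (fun w => f (setv w v false))) in *.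
  set (b1 := Expect ks pr (fun w => g (setv w v true))) in *.
  set (b0 := Expect ks pr (fun w => g (setv w v false))) in *.
  set (p := pr v) in *.
  assert (0 <= p * (1 - p) * ((a1 - a0) * (b1 - b0))).
  { apply Rmult_le_pos; apply Rmult_le_pos; lra. }
  nra.
Qed.

(** Makes conditioning elementary for variables with values in any type, such as sets of firms:
    expectations split into finite sums over the events [X w = s]. *)
Lemma finite_values {S : Type} ks (X : Outcome -> S) :
  exists l : list S, forall w, supp ks w -> In (X w) l.
Proof.
  revert X; induction ks as [|v ks IH]; intros X.
  - exists [X (fun _ => false)]. intros w Hw. left. f_equal. extensionality u.
    destruct (w u) eqn:E; [destruct (Hw u E)|reflexivity].
  - destruct (IH (fun w => X (setv w v true))) as [l1 H1].
    destruct (IH (fun w => X (setv w v false))) as [l0 H0].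
    exists (l1 ++ l0). intros w Hw. apply in_or_app.
    assert (Hs : supp ks (setv w v false) \/ In v ks).
    { destruct (in_dec Var_eq_dec v ks) as [i|i]; [now right|left].
      intros u Hu. unfold setv in Hu. destruct (Var_eq_dec u v); [discriminate|].
      destruct (Hw u Hu); [congruence|assumption]. }
    assert (Hs' : exists w0, supp ks w0 /\ setv w0 v (w v) = w).
    { destruct Hs as [Hs|Hs].
      - exists (setv w v false). split; auto. rewrite setv_setv. now apply setv_id.
      - exists w. split; [|now apply setv_id].
        intros u Hu. destruct (Hw u Hu); [subst; auto|assumption]. }
    destruct Hs' as [w0 [S0 E0]]. rewrite <- E0.
    destruct (w v); [left; apply H1|right; apply H0]; assumption.
Qed.

(** The set-valued variable [X] is determined by the coordinates in [D (X w)], so the remaining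
    coordinates are still fresh once [X] is known. *)
Lemma Expect_fresh {S : Type} ks pr (X : Outcome -> S) (D : S -> Var -> Prop)
  (g : S -> Outcome -> R) (b : S -> R) : okp ks pr ->
  (forall w w', (forall v, D (X w) v -> w v = w' v) -> X w' = X w) ->
  (forall w, supp ks w -> dep (fun v => ~ D (X w) v) (g (X w))) ->
  (forall w, supp ks w -> Expect ks pr (g (X w)) <= b (X w)) ->
  Expect ks pr (fun w => g (X w) w) <= Expect ks pr (fun w => b (X w)).
Proof.
  intros Hok HX Hg Hb.
  assert (dec : forall a b : S, {a = b} + {a <> b}) by (intros; apply excluded_middle_informative).
  destruct (finite_values ks X) as [l0 Hl0].
  (* Without repetitions each outcome is counted exactly once in the sum over values. *)
  set (l := nodup dec l0).
  assert (Hl : forall w, supp ks w -> In (X w) l) by (intros; apply nodup_In; auto).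
  assert (Hnd : NoDup l) by apply NoDup_nodup.
  assert (P : forall h : S -> Outcome -> R, Expect ks pr (fun w => h (X w) w)
              = lsum l (fun s => Expect ks pr (fun w => ind (X w = s) * h s w))).
  { intros h. rewrite <- Expect_lsum. apply Expect_ext. intros w Hw.
    specialize (Hl w Hw). induction l as [|s l IH]; [destruct Hl|].
    inversion Hnd; subst. rewrite lsum_cons. destruct Hl as [->|Hl].
    - rewrite (lsum_zero l); [rewrite ind_true by reflexivity; lra|].
      intros s' Hs'. rewrite ind_false; [lra|]. intros Ex. now rewrite Ex in *.
    - rewrite (ind_false (X w = s)) by congruence. rewrite IH by auto. lra. }
  rewrite (P g), (P (fun s _ => b s)). apply lsum_le. intros s _.
  em (exists w0, supp ks w0 /\ X w0 = s).
  - destruct e as [w0 [S0 <-]].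
    rewrite (Expect_indep ks pr (D (X w0)) (fun w => ind (X w = X w0)) (g (X w0))).
    + rewrite (Expect_ext ks pr (fun w => ind (X w = X w0) * b (X w0))
                 (fun w => b (X w0) * ind (X w = X w0))) by (intros; lra).
      rewrite Expect_scal, Rmult_comm. apply Rmult_le_compat_r; auto.
      apply Expect_ind_range; auto.
    + apply dep_ind. intros w w' E Ew. rewrite <- Ew. apply HX. now rewrite Ew.
    + auto.
  - rewrite (Expect_ext ks pr (fun w => ind (X w = s) * g s w) (fun _ => 0)),
      (Expect_ext ks pr (fun w => ind (X w = s) * b s) (fun _ => 0)).
    + lra.
    + intros w Hw. rewrite ind_false; [lra|]. intros E; apply n; eauto.
    + intros w Hw. rewrite ind_false; [lra|]. intros E; apply n; eauto.
Qed.

(** Russo's formula with a separate parameter for each coin. *)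
Lemma derivable_Expect ks (pr : R -> Var -> R) (dp : Var -> R) f y :
  NoDup ks -> (forall v, In v ks -> derivable_pt_lim (fun t => pr t v) y (dp v)) ->
  derivable_pt_lim (fun t => Expect ks (pr t) f) y
    (lsum ks (fun v => dp v * (Expect ks (pr y) (fun w => f (setv w v true))
                               - Expect ks (pr y) (fun w => f (setv w v false))))).
Proof.
  revert f; induction ks as [|v ks IH]; intros f Hnd Hd; simpl.
  - apply derivable_pt_lim_const.
  - apply NoDup_cons_iff in Hnd. destruct Hnd as [Hnin Hnd].
    assert (H1 := IH (fun w => f (setv w v true)) Hnd (fun u Hu => Hd u (or_intror Hu))).
    assert (H0 := IH (fun w => f (setv w v false)) Hnd (fun u Hu => Hd u (or_intror Hu))).
    assert (Hv := Hd v (or_introl eq_refl)).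
    assert (Hc : derivable_pt_lim (fun t => 1 - pr t v) y (0 - dp v)).
    { apply (derivable_pt_lim_minus (fun _ => 1) (fun t => pr t v)); auto.
      apply derivable_pt_lim_const. }
    assert (K := derivable_pt_lim_plus _ _ _ _ _
      (derivable_pt_lim_mult _ _ _ _ _ Hv H1) (derivable_pt_lim_mult _ _ _ _ _ Hc H0)).
    match type of K with derivable_pt_lim _ _ ?a =>
      match goal with |- derivable_pt_lim _ _ ?b => replace b with a end end.
    + exact K.
    +
      assert (S : forall b b', Expect ks (pr y) (fun w => f (setv (setv w v b) v b'))
                            = Expect ks (pr y) (fun w => f (setv w v b'))).
      { intros; apply Expect_ext; intros; now rewrite setv_setv. }
      rewrite !S.
      match goal with |- _ = _ + ?r => replace r with (
         pr y v * lsum ks (fun u => dp u * (Expect ks (pr y) (fun w => f (setv (setv w v true) u true))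
                           - Expect ks (pr y) (fun w => f (setv (setv w v true) u false))))
         + (1 - pr y v) * lsum ks (fun u => dp u * (Expect ks (pr y) (fun w => f (setv (setv w v false) u true))
                           - Expect ks (pr y) (fun w => f (setv (setv w v false) u false))))) end.
      * assert (C : forall b, lsum ks (fun u => dp u * (Expect ks (pr y) (fun w => f (setv (setv w u true) v b))
                           - Expect ks (pr y) (fun w => f (setv (setv w u false) v b))))
               = lsum ks (fun u => dp u * (Expect ks (pr y) (fun w => f (setv (setv w v b) u true))
                           - Expect ks (pr y) (fun w => f (setv (setv w v b) u false))))).
        { intros b. apply lsum_ext. intros u Hu. assert (u <> v) by congruence.
          f_equal. f_equal; apply Expect_ext; intros; now rewrite setv_comm. }
        rewrite !C. ring.
      * rewrite <- !lsum_scal, <- lsum_plus. apply lsum_ext. intros u Hu. ring.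
Qed.

Lemma Un_cv_Expect ks (pr : nat -> Var -> R) (pr0 : Var -> R) f :
  (forall v, In v ks -> Un_cv (fun m => pr m v) (pr0 v)) ->
  Un_cv (fun m => Expect ks (pr m) f) (Expect ks pr0 f).
Proof.
  revert f; induction ks as [|v ks IH]; intros f H; simpl.
  - intros e He. exists 0%nat. intros. rewrite (Rfunctions.Rdist_eq). assumption.
  - assert (Hv := H v (or_introl eq_refl)).
    assert (H1 := IH (fun w => f (setv w v true)) (fun u Hu => H u (or_intror Hu))).
    assert (H0 := IH (fun w => f (setv w v false)) (fun u Hu => H u (or_intror Hu))).
    apply (CV_plus (fun m => pr m v * _) (fun m => (1 - pr m v) * _)).
    + apply (CV_mult (fun m => pr m v)); assumption.
    + apply (CV_mult (fun m => 1 - pr m v)); [|assumption].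
      apply (CV_minus (fun _ => 1)); [|assumption].
      intros e He. exists 0%nat. intros. rewrite (Rfunctions.Rdist_eq). assumption.
Qed.

(** * Exploring a random directed graph *)

Definition card (n : nat) (A : nat -> Prop) : R := sumR n (fun v => ind (A v)).

Lemma card_nonneg n A : 0 <= card n A.
Proof. apply sumR_nonneg; intros; apply ind_pos. Qed.

Lemma card_le n (A B : nat -> Prop) : (forall v, (v < n)%nat -> A v -> B v) -> card n A <= card n B.
Proof. intros H. apply sumR_le. intros v Hv. apply ind_le. auto. Qed.

Lemma card_ext n (A B : nat -> Prop) : (forall v, (v < n)%nat -> A v <-> B v) -> card n A = card n B.
Proof. intros H. apply sumR_ext. intros v Hv. apply ind_iff. auto. Qed.

Lemma card_le_n n A : card n A <= INR n.
Proof.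
  replace (INR n) with (sumR n (fun _ => 1)) by (rewrite sumR_const; lra).
  apply sumR_le; intros; apply ind_range.
Qed.

Lemma card_empty n (A : nat -> Prop) : (forall v, (v < n)%nat -> ~ A v) -> card n A = 0.
Proof. intros H. apply sumR_zero. intros. apply ind_false. auto. Qed.

Lemma card_split n (A B : nat -> Prop) :
  card n A = card n (fun v => A v /\ B v) + card n (fun v => A v /\ ~ B v).
Proof.
  unfold card. rewrite <- sumR_plus. apply sumR_ext. intros v _.
  rewrite !ind_and, ind_not. lra.
Qed.

Lemma card_union_le n (A B : nat -> Prop) : card n (fun v => A v \/ B v) <= card n A + card n B.
Proof. unfold card. rewrite <- sumR_plus. apply sumR_le. intros; apply ind_or_le. Qed.

Lemma card_union n (A B : nat -> Prop) : (forall v, (v < n)%nat -> A v -> ~ B v) ->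
  card n (fun v => A v \/ B v) = card n A + card n B.
Proof.
  intros H. rewrite (card_split n _ A). f_equal; apply card_ext; intros v Hv; specialize (H v Hv); tauto.
Qed.

Lemma card_single n a : (a < n)%nat -> card n (fun v => v = a) = 1.
Proof.
  intros H. rewrite <- (sumR_single n a 1 H). apply sumR_ext. intros j _.
  destruct (Nat.eq_dec j a); [now apply ind_true|now apply ind_false].
Qed.

Lemma card_all n (A : nat -> Prop) : (forall v, (v < n)%nat -> A v) -> card n A = INR n.
Proof.
  intros H. unfold card. rewrite (sumR_ext n _ (fun _ => 1)), sumR_const; [lra|].
  intros; apply ind_true; auto.
Qed.

Lemma card_ge_1 n (A : nat -> Prop) a : (a < n)%nat -> A a -> 1 <= card n A.
Proof.
  intros Ha HA. rewrite <- (card_single n a Ha). apply card_le. now intros v _ ->.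
Qed.

Lemma card_INR n A : exists m : nat, card n A = INR m.
Proof.
  unfold card. induction n; simpl; [now exists 0%nat|]. destruct IHn as [m ->].
  unfold ind. em (A n); [exists (S m); rewrite S_INR|exists m]; lra.
Qed.

(** A guarded factor: it turns a product over a subset of firms into a [prodR] over all of them. *)
Definition pw (P : Prop) (r : R) : R := if excluded_middle_informative P then r else 1.

Lemma pw_true (P : Prop) r : P -> pw P r = r.
Proof. intros H; unfold pw; em P; tauto. Qed.

Lemma pw_false (P : Prop) r : ~ P -> pw P r = 1.
Proof. intros H; unfold pw; em P; tauto. Qed.

Definition prodA (n : nat) (A : nat -> Prop) (x : nat -> R) : R := prodR n (fun v => pw (A v) (x v)).

Lemma prodA_nonneg n A x : (forall v, (v < n)%nat -> 0 <= x v) -> 0 <= prodA n A x.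
Proof. intros H. apply prodR_nonneg. intros v Hv. unfold pw. em (A v); auto; lra. Qed.

Lemma prodA_ext n A B x : (forall v, (v < n)%nat -> A v <-> B v) -> prodA n A x = prodA n B x.
Proof.
  intros H. apply prodR_ext. intros v Hv. specialize (H v Hv). unfold pw. em (A v); em (B v); tauto.
Qed.

Lemma prodA_union n (A B : nat -> Prop) x : (forall v, (v < n)%nat -> A v -> ~ B v) ->
  prodA n (fun v => A v \/ B v) x = prodA n A x * prodA n B x.
Proof.
  intros H. unfold prodA. rewrite <- prodR_mult. apply prodR_ext. intros v Hv. specialize (H v Hv).
  unfold pw. em (A v); em (B v); em (A v \/ B v); try lra; tauto.
Qed.

Lemma prodA_single n a x : (a < n)%nat -> prodA n (fun v => v = a) x = x a.
Proof.
  intros Ha. unfold prodA. rewrite (prodR_single n a) by assumption.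
  rewrite pw_true by reflexivity. rewrite prodR_one; [lra|].
  intros j _. destruct (Nat.eq_dec j a); [reflexivity|now apply pw_false].
Qed.

Lemma prodA_empty n A x : (forall v, (v < n)%nat -> ~ A v) -> prodA n A x = 1.
Proof. intros H. apply prodR_one. intros. apply pw_false; auto. Qed.

(** The cluster of the active set [A] when only firms of [U] may be entered. With [A] and [U]
    disjoint, [U] is the set of firms not yet explored, and shrinking it records which edges have
    already been read. *)
Inductive Rch (e : nat -> nat -> Prop) (A U : nat -> Prop) : nat -> Prop :=
| Rch_base v : A v -> Rch e A U v
| Rch_step u v : Rch e A U u -> U v -> e u v -> Rch e A U v.

Lemma Rch_mono (e e' : nat -> nat -> Prop) (A A' U U' : nat -> Prop) v :
  (forall a u, e a u -> e' a u) -> (forall a, A a -> A' a) -> (forall a, U a -> U' a) ->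
  Rch e A U v -> Rch e' A' U' v.
Proof.
  intros He HA HU H. induction H; [now apply Rch_base; auto|].
  eapply Rch_step; eauto.
Qed.

Lemma Rch_absorb (e : nat -> nat -> Prop) (A A' U U' : nat -> Prop) v :
  (forall a, A a -> A' a \/ U' a) -> (forall a, U a -> A' a \/ U' a) ->
  (forall a, A a -> Rch e A' U' a) ->
  Rch e A U v -> Rch e A' U' v.
Proof.
  intros HA HU H0 H. induction H; [auto|]. destruct (HU _ H1).
  - now apply Rch_base.
  - eapply Rch_step; eauto.
Qed.

Lemma Rch_in (e : nat -> nat -> Prop) (A U : nat -> Prop) v : Rch e A U v -> A v \/ U v.
Proof. destruct 1; auto. Qed.

Lemma Rch_edge_ext (e e' : nat -> nat -> Prop) (A U : nat -> Prop) :
  (forall a u, A a \/ U a -> U u -> e a u -> e' a u) ->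
  forall v, Rch e A U v -> Rch e' A U v.
Proof.
  intros He v H. induction H; [now apply Rch_base|].
  eapply Rch_step; eauto. apply He; auto. eapply Rch_in; eauto.
Qed.

Lemma Rch_unfold (e : nat -> nat -> Prop) (A U : nat -> Prop) a v : A a -> ~ U a ->
  Rch e A U v <->
  v = a \/ Rch e (fun u => (A u /\ u <> a) \/ (U u /\ e a u)) (fun u => U u /\ ~ e a u) v.
Proof.
  intros Ha Hu. split.
  - induction 1 as [v Hv|u v Hr IH Hv Huv].
    + destruct (Nat.eq_dec v a); [now left|right]. apply Rch_base. auto.
    + right. em (e a v); [apply Rch_base; auto|]. destruct IH as [->|IH]; [contradiction|].
      eapply Rch_step; eauto.
  - intros [->|H]; [now apply Rch_base|].
    induction H as [v [[Hv _]|[Hv He]]|u v Hr IH [Hv _] Huv].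
    + now apply Rch_base.
    + eapply Rch_step; eauto. now apply Rch_base.
    + eapply Rch_step; eauto.
Qed.

Section Explore.

Variables (ks : list Var) (pr : Var -> R) (n : nat).
Hypothesis Hok : okp ks pr.
Variables (e : Outcome -> nat -> nat -> Prop) (vr : nat -> nat -> Var -> Prop).
Hypothesis He : forall a u, dep (vr a u) (fun w => e w a u).
Hypothesis Hvr : forall a u a' u' v, vr a u v -> vr a' u' v -> a = a' /\ u = u'.
Variables xi zeta : nat -> R.
Hypothesis Hp : forall a u, (a < n)%nat -> (u < n)%nat -> a <> u ->
  Expect ks pr (fun w => ind (e w a u)) = xi a * zeta u.

(** A supermartingale argument done by induction on the number of active and unexplored firms. The
    test function is [g s] times the product of the weights [x] over active firms, [s] being the
    number of processed ones. The last hypothesis is the supermartingale property: replacing [a] by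
    its random offspring does not increase the expected weight. It is required only up to the
    threshold [m]; beyond it the exploration stops. *)
Lemma explore (x : nat -> R) (phi g : R -> R) (m : R) :
  (forall v, (v < n)%nat -> 0 <= x v) ->
  (forall s, 0 <= s <= m -> phi s <= g s) ->
  (forall s r A, 0 <= s -> m < s + card n A -> s + card n A <= r <= INR n ->
     phi r <= g s * prodA n A x) ->
  (forall s A U a, 0 <= s -> (a < n)%nat -> s + card n A <= m ->
     s + card n A + card n U = INR n ->
     1 <= card n A ->
     g (s + 1) * prodR n (fun u => pw (U u) (1 + xi a * zeta u * (x u - 1))) <= g s * x a) ->
  forall A U s, 0 <= s -> (forall v, A v -> (v < n)%nat) -> (forall v, U v -> (v < n)%nat) ->
  (forall v, A v -> ~ U v) -> s + card n A + card n U = INR n ->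
  Expect ks pr (fun w => phi (s + card n (Rch (e w) A U))) <= g s * prodA n A x.
Proof.
  intros Hx Hend Hbig Hstep A U s Hs HA HU Hd Hc.
  destruct (card_INR n (fun v => A v \/ U v)) as [d Hcd].
  revert A U s Hs HA HU Hd Hc Hcd. induction d as [d IH] using lt_wf_ind.
  intros A U s Hs HA HU Hd Hc Hcd.
  destruct (Rle_dec (s + card n A) m) as [Hm|Hm].
  (* Past the threshold only the trivial bounds on the final size are used: at least [s + card n A],
     at most [n]. *)
  2: { rewrite <- (Expect_const ks pr (g s * prodA n A x)). apply Expect_le; auto.
       intros w _. apply Hbig; [assumption|lra|].
       assert (card n A <= card n (Rch (e w) A U)) by (apply card_le; intros; now apply Rch_base).
       assert (card n (Rch (e w) A U) <= card n A + card n U).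
       { eapply Rle_trans; [|apply card_union_le]. apply card_le. intros. eapply Rch_in; eauto. }
       lra. }
  em (exists a, A a).
  2: { assert (card n A = 0) by (apply card_empty; intros v _ Hv; eauto).
       rewrite prodA_empty by (intros v _ Hv; eauto). rewrite Rmult_1_r.
       rewrite <- (Expect_const ks pr (g s)). apply Expect_le; auto. intros w _.
       rewrite card_empty; [rewrite Rplus_0_r; apply Hend; lra|].
       intros v _ Hv. induction Hv; eauto. }
  destruct e0 as [a Ha].
  assert (Han := HA a Ha). assert (HUa := Hd a Ha).
  set (Sw := fun w u => U u /\ e w a u).
  (* Given the set [S] of neighbours of [a], what remains reads only edges leaving other firms, so
     the induction hypothesis applies to fresh coins. *)
  set (G := fun S w => phi (s + 1 + card n (Rch (e w) (fun u => (A u /\ u <> a) \/ S u) (fun u => U u /\ ~ S u)))).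
  rewrite (Expect_ext _ _ _ (fun w => G (Sw w) w)).
  2: { intros w _. unfold G, Sw. f_equal. rewrite Rplus_assoc. f_equal.
       rewrite <- (card_single n a Han), <- card_union.
       - apply card_ext. intros v _. rewrite (Rch_unfold _ _ _ a) by auto.
         replace (fun u : nat => U u /\ ~ (U u /\ e w a u)) with (fun u : nat => U u /\ ~ e w a u).
         + tauto.
         + extensionality u. apply propositional_extensionality. tauto.
       - intros v _ -> Hv. apply Rch_in in Hv. tauto. }
  assert (Hcard1 : card n A = card n (fun v => A v /\ v <> a) + 1).
  { rewrite (card_split n A (fun v => v = a)). rewrite Rplus_comm. f_equal.
    rewrite <- (card_single n a Han). apply card_ext. intros v _. split; [tauto|now intros ->]. }
  eapply Rle_trans.
  { apply (Expect_fresh ks pr Sw (fun _ v => exists u, vr a u v) G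
      (fun S => g (s + 1) * prodA n (fun u => (A u /\ u <> a) \/ S u) x)); auto.
    - intros w w' E. unfold Sw. extensionality u. apply propositional_extensionality.
      rewrite (He a u w w') by (intros; apply E; eauto). tauto.
    - intros w _. set (S := Sw w). intros w1 w2 E. unfold G. f_equal. f_equal.
      assert (HS : forall u, S u -> U u) by (unfold S, Sw; tauto).
      assert (Heq : forall b u, b <> a -> e w1 b u = e w2 b u).
      { intros b u Hb. apply (He b u). intros v Hv. apply E. intros [u' Hu'].
        destruct (Hvr _ _ _ _ _ Hv Hu'). congruence. }
      assert (Hna : forall b, ((A b /\ b <> a) \/ S b) \/ (U b /\ ~ S b) -> b <> a).
      { intros b Hb ->. destruct Hb as [[[_ H]|H]|[H _]]; auto. }
      apply card_ext. intros v _. split; apply Rch_edge_ext; intros b u Hb _ Hbu;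
        [rewrite <- Heq|rewrite Heq]; auto.
    - intros w _. set (S := Sw w).
      assert (HS : forall u, S u -> U u) by (unfold S, Sw; tauto).
      assert (CU : card n U = card n S + card n (fun u => U u /\ ~ S u)).
      { rewrite (card_split n U S). f_equal. apply card_ext. intros u _. split; [tauto|auto]. }
      assert (CA : card n (fun u => (A u /\ u <> a) \/ S u) = card n (fun v => A v /\ v <> a) + card n S).
      { apply card_union. intros v _ [Hv _] HSv. apply (Hd v); auto. }
      destruct (card_INR n (fun v => ((A v /\ v <> a) \/ S v) \/ (U v /\ ~ S v))) as [d' Hd'].
      apply (IH d').
      + apply INR_lt. rewrite <- Hd', <- Hcd.
        rewrite (card_union n A U) by auto.
        rewrite (card_union n (fun v => (A v /\ v <> a) \/ S v)), CA.
        * lra.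
        * intros v _ [[Hv _]|Hv] [Hu Hns]; [apply (Hd v Hv Hu)|auto].
      + lra.
      + intros v [[Hv _]|Hv]; auto.
      + intros v [Hv _]; auto.
      + intros v [[Hv _]|Hv] [Hu Hns]; [apply (Hd v Hv Hu)|auto].
      + lra.
      + assumption. }
  rewrite (Expect_ext ks pr _ (fun w => (g (s + 1) * prodA n (fun u => A u /\ u <> a) x)
     * prodR n (fun u => pw (Sw w u) (x u)))).
  2: { intros w _. rewrite prodA_union; [unfold prodA; ring|].
       intros v _ [Hv _] [HSv _]. apply (Hd v); auto. }
  rewrite Expect_scal.
  (* Distinct edges out of [a] read disjoint coins, so the weight of the offspring factorises. *)
  rewrite (Expect_prodR ks pr n (fun u => vr a u) (fun u w => pw (Sw w u) (x u))).
  - assert (Hprod : prodR n (fun i => Expect ks pr (fun w => pw (Sw w i) (x i)))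
       = prodR n (fun u => pw (U u) (1 + xi a * zeta u * (x u - 1)))).
    { apply prodR_ext. intros u Hu. em (U u).
      - rewrite (pw_true (U u)) by assumption.
        rewrite (Expect_ext _ _ _ (fun w => 1 + (x u - 1) * ind (e w a u))).
        + rewrite Expect_plus, Expect_const, Expect_scal, Hp; auto; [ring|congruence].
        + intros w _. unfold Sw, pw, ind. em (U u /\ e w a u); em (e w a u); try lra; tauto.
      - rewrite (pw_false (U u)) by assumption.
        rewrite (Expect_ext _ _ _ (fun _ => 1)), Expect_const; [reflexivity|].
        intros w _. apply pw_false. unfold Sw; tauto. }
    rewrite Hprod.
    assert (HP : prodA n A x = prodA n (fun u => A u /\ u <> a) x * x a).
    { rewrite <- (prodA_single n a x Han), <- prodA_union.
      - apply prodA_ext. intros v _. split; [|intros [?| ->]; tauto].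
        intros Hv. destruct (Nat.eq_dec v a); auto.
      - intros v _ [_ H]; auto. }
    rewrite HP.
    assert (St := Hstep s A U a Hs Han Hm Hc (card_ge_1 n A a Han Ha)).
    assert (0 <= prodA n (fun u => A u /\ u <> a) x) by (apply prodA_nonneg; auto).
    nra.
  - intros u Hu w w' E. unfold pw, Sw. rewrite (He a u w w') by auto. reflexivity.
  - intros i j v _ _ H1 H2. now destruct (Hvr _ _ _ _ _ H1 H2).
Qed.

End Explore.

(** * Exponential inequalities *)

Lemma exp_ge_1 x : 1 + x <= exp x.
Proof.
  destruct (Req_dec x 0) as [->|H]; [rewrite exp_0; lra|]. left. now apply exp_ineq1.
Qed.

Lemma exp_le_mono x y : x <= y -> exp x <= exp y.
Proof. intros [H| ->]; [left; now apply exp_increasing|lra]. Qed.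

Lemma exp_opp_le_inv x : 0 <= x -> exp (- x) <= / (1 + x).
Proof.
  intros H. rewrite exp_Ropp. apply Rinv_le_contravar; [lra|apply exp_ge_1].
Qed.

Lemma one_sub_ge_exp t : 0 <= t <= 1/2 -> exp (- (t + 2 * (t * t))) <= 1 - t.
Proof.
  intros H. eapply Rle_trans; [apply exp_opp_le_inv; nra|].
  apply (Rmult_le_reg_l (1 + (t + 2 * (t * t)))); [nra|].
  rewrite Rinv_r by nra. nra.
Qed.

Lemma exp_opp_ge u : u <= 2 -> 1 - u + u * u / 4 <= exp (- u).
Proof.
  intros H. replace (- u) with (- (u/2) + - (u/2)) by field. rewrite exp_plus.
  assert (1 + - (u/2) <= exp (- (u/2))) by apply exp_ge_1.
  apply Rle_trans with ((1 + - (u/2)) * (1 + - (u/2))); [nra|].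
  apply Rmult_le_compat; lra.
Qed.

Lemma one_add_ge_exp z : 0 <= z -> exp (z - z * z) <= 1 + z.
Proof.
  intros H. destruct (Rle_dec z 1) as [H1|H1].
  - assert (K := exp_ge_1 (- (z - z * z))). rewrite exp_Ropp in K.
    assert (P := exp_pos (z - z * z)).
    assert (Q : (1 + - (z - z * z)) * exp (z - z * z) <= 1).
    { apply Rle_trans with (/ exp (z - z * z) * exp (z - z * z)); [apply Rmult_le_compat_r; lra|].
      rewrite Rinv_l; lra. }
    apply (Rmult_le_reg_l (1 + - (z - z * z))); [nra|].
    eapply Rle_trans; [apply Q|]. nra.
  - apply Rle_trans with (exp 0); [apply exp_le_mono; nra|]. rewrite exp_0; lra.
Qed.

(** * Cluster sizes in a sparse rank-one random digraph *)

(** Because the edge probabilities are [xi a * zeta u], the vector [xi] is an eigenvector of the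
    mean offspring matrix, with eigenvalue the sum of [xi v * zeta v]. All bounds below test the
    exploration with weights affine in [xi]. The field [gk_n] keeps every edge probability at most
    [1/2]. *)
Record graph_ok (ks : list Var) (pr : Var -> R) (n : nat) (e : Outcome -> nat -> nat -> Prop)
  (vr : nat -> nat -> Var -> Prop) (xi zeta : nat -> R) (c C : R) : Prop := {
  gk_ok : okp ks pr;
  gk_dep : forall a u, dep (vr a u) (fun w => e w a u);
  gk_disj : forall a u a' u' v, vr a u v -> vr a' u' v -> a = a' /\ u = u';
  gk_prob : forall a u, (a < n)%nat -> (u < n)%nat -> a <> u ->
    Expect ks pr (fun w => ind (e w a u)) = xi a * zeta u;
  gk_c : 0 < c <= C;
  gk_n : 2 * (C * C) <= INR n;
  gk_xi : forall v, (v < n)%nat -> c <= sqrt (INR n) * xi v <= C;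
  gk_zeta : forall v, (v < n)%nat -> c <= sqrt (INR n) * zeta v <= C }.

Section Bounds.

Variables (ks : list Var) (pr : Var -> R) (n : nat) (e : Outcome -> nat -> nat -> Prop)
  (vr : nat -> nat -> Var -> Prop) (xi zeta : nat -> R) (c C : R).
Hypothesis Hg : graph_ok ks pr n e vr xi zeta c C.

Let lam := sumR n (fun v => xi v * zeta v).
Let sn := sqrt (INR n).

Lemma gk_n_pos : 0 < INR n.
Proof. destruct Hg as [_ _ _ _ H1 H2 _ _]. nra. Qed.

Lemma gk_sn_sq : sn * sn = INR n.
Proof. apply sqrt_sqrt. left. apply gk_n_pos. Qed.

Lemma gk_xz v : (v < n)%nat -> c * c <= INR n * (xi v * zeta v) <= C * C.
Proof.
  intros H. assert (K1 := gk_xi _ _ _ _ _ _ _ _ _ Hg v H).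
  assert (K2 := gk_zeta _ _ _ _ _ _ _ _ _ Hg v H).
  assert (Q := gk_c _ _ _ _ _ _ _ _ _ Hg). fold sn in K1, K2.
  replace (INR n * (xi v * zeta v)) with ((sn * xi v) * (sn * zeta v))
    by (rewrite <- gk_sn_sq; ring).
  split; apply Rmult_le_compat; lra.
Qed.

(** The eigenvalue that is left when offspring must lie in [U]. It falls linearly in the number of
    firms already used, which bounds clusters in all regimes. *)
Definition lamU (U : nat -> Prop) : R := sumR n (fun v => ind (U v) * (xi v * zeta v)).

Lemma lamU_split U : lam = lamU U + sumR n (fun v => (1 - ind (U v)) * (xi v * zeta v)).
Proof. unfold lamU, lam. rewrite <- sumR_plus. apply sumR_ext. intros; ring. Qed.

Lemma card_compl_sum U : sumR n (fun v => 1 - ind (U v)) = INR n - card n U.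
Proof.
  assert (sumR n (fun v => 1 - ind (U v)) + card n U = INR n); [|lra].
  unfold card. rewrite <- sumR_plus, (sumR_ext n _ (fun _ => 1)), sumR_const; [lra|]. intros; lra.
Qed.

Lemma lamU_lower U : lam - (INR n - card n U) * (C * C) / INR n <= lamU U.
Proof.
  rewrite (lamU_split U), <- card_compl_sum.
  assert (N := gk_n_pos).
  assert (sumR n (fun v => (1 - ind (U v)) * (xi v * zeta v))
     <= sumR n (fun v => 1 - ind (U v)) * (C * C) / INR n); [|lra].
  replace (sumR n (fun v => 1 - ind (U v)) * (C * C) / INR n)
    with (C * C / INR n * sumR n (fun v => 1 - ind (U v))) by lra.
  rewrite <- sumR_scal. apply sumR_le. intros v Hv. rewrite Rmult_comm.
  apply Rmult_le_compat_r; [assert (H := ind_range (U v)); lra|].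
  assert (K := gk_xz v Hv). apply (Rmult_le_reg_l (INR n)); auto.
  replace (INR n * (C * C / INR n)) with (C * C) by (field; lra). lra.
Qed.

Lemma lamU_upper U : lamU U <= lam - (INR n - card n U) * (c * c) / INR n.
Proof.
  rewrite (lamU_split U), <- card_compl_sum.
  assert (N := gk_n_pos).
  assert (sumR n (fun v => 1 - ind (U v)) * (c * c) / INR n <=
    sumR n (fun v => (1 - ind (U v)) * (xi v * zeta v))); [|lra].
  replace (sumR n (fun v => 1 - ind (U v)) * (c * c) / INR n)
    with (c * c / INR n * sumR n (fun v => 1 - ind (U v))) by lra.
  rewrite <- sumR_scal. apply sumR_le. intros v Hv. rewrite (Rmult_comm (1 - _)).
  apply Rmult_le_compat_r; [assert (H := ind_range (U v)); lra|].
  assert (K := gk_xz v Hv). apply (Rmult_le_reg_l (INR n)); auto.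
  replace (INR n * (c * c / INR n)) with (c * c) by (field; lra). lra.
Qed.

Lemma step_z kap a : 0 < kap -> (a < n)%nat ->
  kap * c <= kap * sn * xi a <= kap * C.
Proof.
  intros Hk Ha. assert (K := gk_xi _ _ _ _ _ _ _ _ _ Hg a Ha). fold sn in K.
  rewrite Rmult_assoc. split; apply Rmult_le_compat_l; lra.
Qed.

(** An active firm [b] has weight [1 - z] with [z = kap * sn * xi b]. By the eigenvector property
    its offspring have expected weight at most [exp (- z * lamU)], while [1 - z] is at least
    [exp (- (z + 2 * z^2))]; the hypothesis on [z] says that discount and drift win as long as at
    most [m] firms are used. With [theta = 0] this gives survival above criticality, with small
    [theta] large means near it. *)
Lemma laplace_upper kap theta m : 0 < kap -> kap * C <= 1/2 -> 0 <= theta -> 0 <= m ->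
  (forall z, kap * c <= z <= kap * C -> z + 2 * (z * z) <= theta + z * (lam - m * (C * C) / INR n)) ->
  forall a, (a < n)%nat ->
  Expect ks pr (fun w => exp (- (theta * card n (Rch (e w) (fun v => v = a) (fun v => (v < n)%nat /\ v <> a))))
     * ind (card n (Rch (e w) (fun v => v = a) (fun v => (v < n)%nat /\ v <> a)) <= m)) <= 1 - kap * c.
Proof.
  intros Hk HkC Ht Hm0 Hz a Ha.
  assert (Hcc := gk_c _ _ _ _ _ _ _ _ _ Hg). assert (N := gk_n_pos).
  set (x := fun v => 1 - kap * sn * xi v).
  assert (Hx : forall v, (v < n)%nat -> 0 <= x v).
  { intros v Hv. assert (K := step_z kap v Hk Hv). unfold x. lra. }
  assert (K := explore ks pr n (gk_ok _ _ _ _ _ _ _ _ _ Hg) e vr (gk_dep _ _ _ _ _ _ _ _ _ Hg)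
    (gk_disj _ _ _ _ _ _ _ _ _ Hg) xi zeta (gk_prob _ _ _ _ _ _ _ _ _ Hg) x
    (fun r => exp (- (theta * r)) * ind (r <= m)) (fun s => exp (- (theta * s))) m Hx).
  assert (Hca : 0 + card n (fun v => v = a) + card n (fun v => (v < n)%nat /\ v <> a) = INR n).
  { rewrite Rplus_0_l, <- card_union by lia. apply card_all. intros v Hv.
    destruct (Nat.eq_dec v a); auto. }
  rewrite (Expect_ext ks pr _ (fun w =>
      (fun r => exp (- (theta * r)) * ind (r <= m)) (0 + card n (Rch (e w) (fun v => v = a) (fun v => (v < n)%nat /\ v <> a)))))
    by (intros; now rewrite Rplus_0_l).
  eapply Rle_trans.
  - apply K.
    + intros s Hs. rewrite ind_true by lra. lra.
    + intros s r A Hs H1 H2. rewrite ind_false by lra. rewrite Rmult_0_r.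
      apply Rmult_le_pos; [left; apply exp_pos|apply prodA_nonneg; auto].
    + intros s A U b Hs Hb H1 H2 H3.
      assert (Zb := step_z kap b Hk Hb). set (z := kap * sn * xi b) in *.
      replace (exp (- (theta * (s + 1)))) with (exp (- (theta * s)) * exp (- theta))
        by (rewrite <- exp_plus; f_equal; ring).
      rewrite Rmult_assoc. apply Rmult_le_compat_l; [left; apply exp_pos|].
      apply Rle_trans with (exp (- theta) * exp (- (z * lamU U))).
      * apply Rmult_le_compat_l; [left; apply exp_pos|].
        unfold lamU. rewrite <- Ropp_mult_distr_l_reverse, <- sumR_scal, <- prodR_exp.
        apply prodR_le. intros u Hu.
        replace (xi b * zeta u * (x u - 1)) with (- (z * (xi u * zeta u))) by (unfold x, z; ring).
        assert (Kx := gk_xz u Hu).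
        assert (Hxz : 0 <= xi u * zeta u <= 1/2).
        { assert (Hn2 := gk_n _ _ _ _ _ _ _ _ _ Hg). split; [nra|].
          apply (Rmult_le_reg_l (INR n)); lra. }
        unfold pw, ind. em (U u).
        -- split; [|rewrite Rmult_1_l].
           { nra. }
           replace (- z * (xi u * zeta u)) with (- (z * (xi u * zeta u))) by ring. apply exp_ge_1.
        -- rewrite Rmult_0_l, Rmult_0_r, exp_0. lra.
      * rewrite <- exp_plus.
        apply Rle_trans with (exp (- (z + 2 * (z * z)))).
        -- apply exp_le_mono. assert (Q := Hz z Zb). assert (L := lamU_lower U).
           assert (lam - m * (C * C) / INR n <= lamU U).
           { eapply Rle_trans; [|apply L]. apply Rplus_le_compat_l, Ropp_le_contravar.
             apply Rmult_le_compat_r; [left; now apply Rinv_0_lt_compat|].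
             apply Rmult_le_compat_r; nra. }
           assert (0 <= z) by nra. nra.
        -- apply one_sub_ge_exp. split; [nra|lra].
    + lra.
    + now intros v ->.
    + tauto.
    + intros v -> [_ H]; auto.
    + exact Hca.
  - rewrite prodA_single by assumption. rewrite Rmult_0_r, Ropp_0, exp_0, Rmult_1_l. unfold x.
    assert (Zb := step_z kap a Hk Ha). lra.
Qed.

(** The same weights, now with [explore] applied to the negative of the exponential. The quadratic
    term of [exp_opp_ge] leaves room [z^2 / 4]; it is shared by [theta], [eps * z] and the
    correction [s2] for edge probabilities, each at most [z^2 / 16]. *)
Lemma laplace_lower kap theta eps : 0 < kap -> kap * C <= 1/4 -> 0 <= theta -> 0 <= eps ->
  lam <= 1 + eps -> eps <= kap * c / 16 -> theta <= kap * kap * (c * c) / 16 ->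
  32 * (C * C * (C * C)) <= INR n ->
  forall A, (forall v, A v -> (v < n)%nat) ->
  1 - kap * C * card n A <=
  Expect ks pr (fun w => exp (- (theta * card n (Rch (e w) A (fun v => (v < n)%nat /\ ~ A v))))).
Proof.
  intros Hk HkC Ht He Hlam Hek Htk HnC A HA.
  assert (Hcc := gk_c _ _ _ _ _ _ _ _ _ Hg). assert (N := gk_n_pos).
  set (x := fun v => 1 - kap * sn * xi v).
  assert (Hx : forall v, (v < n)%nat -> 0 <= x v).
  { intros v Hv. assert (K := step_z kap v Hk Hv). unfold x. lra. }
  assert (K := explore ks pr n (gk_ok _ _ _ _ _ _ _ _ _ Hg) e vr (gk_dep _ _ _ _ _ _ _ _ _ Hg)
    (gk_disj _ _ _ _ _ _ _ _ _ Hg) xi zeta (gk_prob _ _ _ _ _ _ _ _ _ Hg) x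
    (fun r => - exp (- (theta * r))) (fun s => - exp (- (theta * s))) (INR n) Hx).
  assert (K2 : Expect ks pr (fun w =>
      (fun r => - exp (- (theta * r))) (0 + card n (Rch (e w) A (fun v => (v < n)%nat /\ ~ A v))))
      <= - exp (- (theta * 0)) * prodA n A x).
  { apply K.
    + intros s Hs. lra.
    + intros s r A' Hs H1 H2. lra.
    + intros s A' U b Hs Hb H1 H2 H3.
      assert (Zb := step_z kap b Hk Hb). set (z := kap * sn * xi b) in *.
      replace (exp (- (theta * (s + 1)))) with (exp (- (theta * s)) * exp (- theta))
        by (rewrite <- exp_plus; f_equal; ring).
      rewrite <- !Ropp_mult_distr_l, Rmult_assoc. apply Ropp_le_contravar.
      apply Rmult_le_compat_l; [left; apply exp_pos|].
      replace (x b) with (1 - z) by reflexivity.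
      set (s2 := z * z * (C * C * (C * C)) * 2 / INR n).
      apply Rle_trans with (exp (- theta) * exp (- (z * lam + s2))).
      * rewrite <- exp_plus.
        set (u := theta + (z * lam + s2)).
        replace (- theta + - (z * lam + s2)) with (- u) by (unfold u; ring).
        assert (Hs2 : 0 <= s2 <= z * z / 16).
        { assert (0 <= z * z * (C * C * (C * C)) * 2) by nra.
          unfold s2. split; [apply Rmult_le_pos; [lra|left; now apply Rinv_0_lt_compat]|].
          apply (Rmult_le_reg_l (INR n)); auto.
          replace (INR n * (z * z * (C * C * (C * C)) * 2 / INR n)) with (z * z * (C * C * (C * C)) * 2) by (field; lra).
          nra. }
        assert (Hu : u <= z + z * z / 4) by (unfold u; nra).
        apply Rle_trans with (exp (- (z + z * z / 4))); [|apply exp_le_mono; lra].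
        eapply Rle_trans; [|apply exp_opp_ge; nra]. nra.
      * apply Rmult_le_compat_l; [left; apply exp_pos|].
        apply Rle_trans with (exp (sumR n (fun u => - (z * (xi u * zeta u) + 2 * (z * (xi u * zeta u) * (z * (xi u * zeta u))))))).
        -- apply exp_le_mono.
           rewrite (sumR_ext n _ (fun u => (-1) * (z * (xi u * zeta u) + 2 * (z * (xi u * zeta u) * (z * (xi u * zeta u))))))
             by (intros; ring).
           rewrite sumR_scal, sumR_plus, sumR_scal. fold lam.
           assert (sumR n (fun i => 2 * (z * (xi i * zeta i) * (z * (xi i * zeta i)))) <= s2); [|lra].
           replace s2 with (sumR n (fun _ => 2 * (z * (C * C / INR n) * (z * (C * C / INR n)))))
             by (rewrite sumR_const; unfold s2; field; lra).
           apply sumR_le. intros u Hu. assert (Kx := gk_xz u Hu).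
           assert (0 <= xi u * zeta u <= C * C / INR n).
           { split; [nra|]. apply (Rmult_le_reg_l (INR n)); auto.
             replace (INR n * (C * C / INR n)) with (C * C) by (field; lra). lra. }
           apply Rmult_le_compat_l; [lra|]. apply Rmult_le_compat; nra.
        -- rewrite <- prodR_exp. apply prodR_le. intros u Hu. split; [left; apply exp_pos|].
           replace (xi b * zeta u * (x u - 1)) with (- (z * (xi u * zeta u))) by (unfold x, z; ring).
           assert (Kx := gk_xz u Hu).
           assert (Hxz : 0 <= xi u * zeta u <= 1/2).
           { assert (Hn2 := gk_n _ _ _ _ _ _ _ _ _ Hg). split; [nra|].
             apply (Rmult_le_reg_l (INR n)); lra. }
           assert (E1 : exp (- (z * (xi u * zeta u) + 2 * (z * (xi u * zeta u) * (z * (xi u * zeta u))))) <= 1 - z * (xi u * zeta u)).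
           { apply one_sub_ge_exp. nra. }
           unfold pw. em (U u); [lra|]. assert (0 <= z * (xi u * zeta u)) by nra. lra.
    + lra.
    + assumption.
    + tauto.
    + tauto.
    + rewrite Rplus_0_l, <- card_union by (intros; tauto). apply card_all. intros v Hv. tauto. }
  rewrite Rmult_0_r, Ropp_0, exp_0 in K2.
  assert (K3 : prodA n A x <= Expect ks pr (fun w => exp (- (theta * card n (Rch (e w) A (fun v => (v < n)%nat /\ ~ A v)))))).
  { rewrite (Expect_ext ks pr _ (fun w => (-1) * exp (- (theta * card n (Rch (e w) A (fun v => (v < n)%nat /\ ~ A v)))))) in K2
      by (intros; rewrite Rplus_0_l; ring).
    rewrite Expect_scal in K2. lra. }
  eapply Rle_trans; [|apply K3].
  apply Rle_trans with (1 - sumR n (fun v => kap * C * ind (A v))).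
  { rewrite sumR_scal. unfold card. lra. }
  apply Rle_trans with (prodR n (fun v => 1 - kap * C * ind (A v))).
  - apply prodR_ge_1_sub. intros v Hv. assert (R1 := ind_range (A v)).
    assert (0 <= kap * C) by nra. split; [apply Rmult_le_pos; lra|].
    assert (kap * C * ind (A v) <= kap * C * 1) by nra. lra.
  - apply prodR_le. intros v Hv. assert (Zv := step_z kap v Hk Hv). unfold pw, ind, x. em (A v); nra.
Qed.

(** Every explored firm lowers the remaining eigenvalue by at least [c^2 / n], so on the way to size
    [eta * n] the drift turns negative once [eps] is small against [eta]; surviving this costs an
    exponential factor. *)
Lemma deviation kap eps eta : 0 < kap -> kap * C <= c * (c * c) * eta / (16 * C) -> 0 <= eps ->
  lam <= 1 + eps -> eps <= c * (c * c) * eta / (16 * C) -> 0 < eta <= 1 -> 4 <= eta * INR n ->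
  forall a, (a < n)%nat ->
  Expect ks pr (fun w => ind (eta * INR n <= card n (Rch (e w) (fun v => v = a) (fun v => (v < n)%nat /\ v <> a))))
    <= (1 + kap * C) * exp (- (kap * (c * (c * c)) * (eta * eta) / 4 * INR n)).
Proof.
  intros Hk HkC He Hlam Hee Heta Hn4 a Ha.
  assert (Hcc := gk_c _ _ _ _ _ _ _ _ _ Hg). assert (N := gk_n_pos).
  set (c3 := c * (c * c)) in *. assert (c3p : 0 < c3) by (unfold c3; assert (0 < c * c) by nra; nra).
  set (x := fun v => 1 + kap * sn * xi v).
  assert (Hx : forall v, (v < n)%nat -> 0 <= x v).
  { intros v Hv. assert (K := step_z kap v Hk Hv). unfold x. nra. }
  (* The drift lambda_U - 1 decreases linearly in the number s of explored vertices, which makes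
     the exponential weight quadratic in s. *)
  set (aa := kap * c3 / 2). set (b := kap * C * (eps + kap * C) + aa / INR n).
  assert (aap : 0 < aa) by (unfold aa; nra).
  set (psi := fun s => aa * (s * s) / INR n - b * s - (aa * (eta * eta) - b * eta) * INR n).
  assert (Hb : b <= aa * eta / 2).
  { assert (kap * C * (eps + kap * C) <= kap * C * (c3 * eta / (8 * C))).
    { apply Rmult_le_compat_l; [nra|].
      replace (c3 * eta / (8 * C)) with (c3 * eta / (16 * C) + c3 * eta / (16 * C)) by (field; lra). lra. }
    replace (kap * C * (c3 * eta / (8 * C))) with (kap * c3 * eta / 8) in H by (field; lra).
    assert (aa / INR n <= aa * eta / 4).
    { apply (Rmult_le_reg_l (INR n)); auto. replace (INR n * (aa / INR n)) with aa by (field; lra). nra. }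
    unfold b. unfold aa in *. nra. }
  assert (K := explore ks pr n (gk_ok _ _ _ _ _ _ _ _ _ Hg) e vr (gk_dep _ _ _ _ _ _ _ _ _ Hg)
    (gk_disj _ _ _ _ _ _ _ _ _ Hg) xi zeta (gk_prob _ _ _ _ _ _ _ _ _ Hg) x
    (fun r => ind (eta * INR n <= r)) (fun s => exp (psi s)) (INR n) Hx).
  rewrite (Expect_ext ks pr _ (fun w =>
      (fun r => ind (eta * INR n <= r)) (0 + card n (Rch (e w) (fun v => v = a) (fun v => (v < n)%nat /\ v <> a)))))
    by (intros; now rewrite Rplus_0_l).
  eapply Rle_trans.
  - apply K.
    + intros s Hs. unfold ind. em (eta * INR n <= s); [|left; apply exp_pos].
      rewrite <- exp_0. apply exp_le_mono. unfold psi.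
      replace (aa * (s * s) / INR n - b * s - (aa * (eta * eta) - b * eta) * INR n)
        with ((s - eta * INR n) * (aa * ((s + eta * INR n) / INR n) - b)) by (field; lra).
      apply Rmult_le_pos; [lra|].
      assert (eta <= (s + eta * INR n) / INR n).
      { apply (Rmult_le_reg_l (INR n)); auto.
        replace (INR n * ((s + eta * INR n) / INR n)) with (s + eta * INR n) by (field; lra). lra. }
      nra.
    + intros s r A Hs H1 H2. lra.
    + intros s A U b' Hs Hb' H1 H2 H3.
      assert (Zb := step_z kap b' Hk Hb'). set (z := kap * sn * xi b') in *.
      apply Rle_trans with (exp (psi (s + 1)) * exp (z * lamU U)).
      * apply Rmult_le_compat_l; [left; apply exp_pos|].
        unfold lamU. rewrite <- sumR_scal, <- prodR_exp.
        apply prodR_le. intros u Hu.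
        replace (xi b' * zeta u * (x u - 1)) with (z * (xi u * zeta u)) by (unfold x, z; ring).
        assert (Kx := gk_xz u Hu).
        assert (0 <= z * (xi u * zeta u)) by (apply Rmult_le_pos; nra).
        unfold pw, ind. em (U u).
        -- rewrite Rmult_1_l. split; [lra|apply exp_ge_1].
        -- rewrite Rmult_0_l, Rmult_0_r, exp_0. lra.
      * replace (x b') with (1 + z) by reflexivity.
        apply Rle_trans with (exp (psi s) * exp (z - z * z)).
        2: { apply Rmult_le_compat_l; [left; apply exp_pos|]. apply one_add_ge_exp. nra. }
        rewrite <- !exp_plus. apply exp_le_mono.
        assert (L := lamU_upper U).
        assert (L2 : lamU U <= 1 + eps - s * (c * c) / INR n).
        { eapply Rle_trans; [apply L|].
          assert (s * (c * c) / INR n <= (INR n - card n U) * (c * c) / INR n); [|lra].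
          apply Rmult_le_compat_r; [left; now apply Rinv_0_lt_compat|].
          apply Rmult_le_compat_r; nra. }
        unfold psi.
        enough (aa * ((2 * s + 1) / INR n) - b <= z * (1 - z - lamU U)).
        { replace (aa * ((s + 1) * (s + 1)) / INR n)
            with (aa * (s * s) / INR n + aa * ((2 * s + 1) / INR n)) by lra. lra. }
        apply Rle_trans with (z * (s * (c * c) / INR n - eps - z)).
        2: apply Rmult_le_compat_l; nra.
        assert (0 <= s * (c * c) / INR n).
        { apply Rmult_le_pos; [nra|left; now apply Rinv_0_lt_compat]. }
        assert (kap * c * (s * (c * c) / INR n) <= z * (s * (c * c) / INR n)) by nra.
        assert (z0 : 0 <= z) by nra.
        assert (z * (eps + z) <= kap * C * (eps + kap * C)) by nra.
        replace (aa * ((2 * s + 1) / INR n)) with (kap * c * (s * (c * c) / INR n) + aa / INR n)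
          by (unfold aa, c3; field; lra).
        unfold b. lra.
    + lra.
    + now intros v ->.
    + tauto.
    + intros v -> [_ H]; auto.
    + rewrite Rplus_0_l, <- card_union by lia. apply card_all. intros v Hv.
      destruct (Nat.eq_dec v a); auto.
  - rewrite prodA_single by assumption. unfold x. rewrite Rmult_comm.
    apply Rmult_le_compat; [|left; apply exp_pos| |].
    + assert (Zb := step_z kap a Hk Ha). nra.
    + assert (Zb := step_z kap a Hk Ha). lra.
    + apply exp_le_mono. unfold psi.
      replace (kap * c3 * (eta * eta) / 4) with (aa * (eta * eta) / 2) by (unfold aa; field).
      nra.
Qed.

End Bounds.

Lemma INR_large (x : R) : exists N : nat, forall n, (N <= n)%nat -> x <= INR n.
Proof.
  destruct (INR_unbounded x) as [N HN]. exists N. intros n H.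
  apply le_INR in H. lra.
Qed.

(** [laplace_upper] without discount. The constant [eta] is such that using up [eta * n] firms costs
    at most half of the excess [eps]. *)
Lemma survival c C eps : 0 < c <= C -> 0 < eps ->
  exists eta kap, 0 < eta /\ 0 < kap /\
  forall ks pr n e vr xi zeta, graph_ok ks pr n e vr xi zeta c C ->
  1 + eps <= sumR n (fun v => xi v * zeta v) ->
  forall a, (a < n)%nat ->
  Expect ks pr (fun w => ind (card n (Rch (e w) (fun v => v = a) (fun v => (v < n)%nat /\ v <> a)) <= eta * INR n))
    <= 1 - kap.
Proof.
  intros Hc He. set (kap := Rmin (1 / (2 * C)) (eps / (4 * C))).
  assert (Hk : 0 < kap) by (apply Rmin_glb_lt; apply Rdiv_lt_0_compat; lra).
  assert (K1 : kap * C <= 1/2).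
  { apply Rle_trans with (1 / (2 * C) * C); [apply Rmult_le_compat_r; [lra|apply Rmin_l]|]. right; field; lra. }
  assert (K2 : kap * C <= eps / 4).
  { apply Rle_trans with (eps / (4 * C) * C); [apply Rmult_le_compat_r; [lra|apply Rmin_r]|]. right; field; lra. }
  set (eta := eps / (2 * (C * C))).
  assert (Heta : 0 < eta) by (apply Rdiv_lt_0_compat; nra).
  exists eta, (kap * c). split; [assumption|]. split; [nra|].
  intros ks pr n e vr xi zeta Hg Hl a Ha.
  assert (N := gk_n_pos _ _ _ _ _ _ _ _ _ Hg).
  assert (Hz : forall z, kap * c <= z <= kap * C -> z + 2 * (z * z) <=
     0 + z * (sumR n (fun v => xi v * zeta v) - eta * INR n * (C * C) / INR n)).
  { intros z Hz. replace (eta * INR n * (C * C) / INR n) with (eps / 2) by (unfold eta; field; lra).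
    assert (0 <= z) by nra.
    assert (z * (1 + 2 * z) <= z * (sumR n (fun v => xi v * zeta v) - eps / 2)); [|nra].
    apply Rmult_le_compat_l; lra. }
  assert (Hm : 0 <= eta * INR n) by nra.
  eapply Rle_trans;
    [|apply (laplace_upper ks pr n e vr xi zeta c C Hg kap 0 (eta * INR n) Hk K1 (Rle_refl 0) Hm Hz a Ha)].
  apply Expect_le; [apply (gk_ok _ _ _ _ _ _ _ _ _ Hg)|]. intros w _.
  rewrite Rmult_0_l, Ropp_0, exp_0, Rmult_1_l. apply Rle_refl.
Qed.

(** The truncated Laplace transform is at most [1 - kap * c] with [theta] only of order [kap^2], and
    at least [1 - (theta + 1 / m)] times the mean; so the mean is of order at least [1 / kap], and
    [kap] is free. *)
Lemma large_mean c C K : 0 < c <= C -> 0 < K ->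
  exists eps N, 0 < eps /\
  forall ks pr n e vr xi zeta, graph_ok ks pr n e vr xi zeta c C -> (N <= n)%nat ->
  1 - eps <= sumR n (fun v => xi v * zeta v) ->
  forall a, (a < n)%nat ->
  K <= Expect ks pr (fun w => card n (Rch (e w) (fun v => v = a) (fun v => (v < n)%nat /\ v <> a))).
Proof.
  intros Hc HK. set (kap := Rmin (1 / (2 * C)) (c / (8 * K * (C * C)))).
  assert (C2 : 0 < C * C) by nra.
  assert (Hk : 0 < kap) by (apply Rmin_glb_lt; apply Rdiv_lt_0_compat; try lra; nra).
  assert (K1 : kap * C <= 1/2).
  { apply Rle_trans with (1 / (2 * C) * C); [apply Rmult_le_compat_r; [lra|apply Rmin_l]|]. right; field; lra. }
  assert (K2 : kap * (8 * K * (C * C)) <= c).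
  { apply Rle_trans with (c / (8 * K * (C * C)) * (8 * K * (C * C))); [apply Rmult_le_compat_r; [nra|apply Rmin_r]|].
    right; field; lra. }
  (* For [z <= eps] the loss [2 * z^2 + 2 * eps * z] is at most [4 * eps^2]. One [eps] is the
     distance of the eigenvalue to one, the other pays for the firms used up. *)
  set (eps := kap * C). set (theta := 4 * (kap * C * (kap * C))).
  assert (Hep : 0 < eps) by (unfold eps; nra).
  assert (Hth : 0 < theta) by (unfold theta; unfold eps in *; nra).
  set (eta := eps / (C * C)). assert (Heta : 0 < eta) by (apply Rdiv_lt_0_compat; nra).
  destruct (INR_large (/ (eta * theta))) as [N HN].
  exists eps, N. split; [assumption|].
  intros ks pr n e vr xi zeta Hg HNn Hl a Ha.
  assert (Hn := gk_n_pos _ _ _ _ _ _ _ _ _ Hg). specialize (HN n HNn).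
  set (m := eta * INR n). assert (Hm : 0 < m) by (unfold m; nra).
  set (Rc := fun w => card n (Rch (e w) (fun v => v = a) (fun v => (v < n)%nat /\ v <> a))).
  assert (L : Expect ks pr (fun w => exp (- (theta * Rc w)) * ind (Rc w <= m)) <= 1 - kap * c).
  { apply (laplace_upper ks pr n e vr xi zeta c C Hg kap theta m Hk K1); auto; try lra.
    intros z Hz. replace (m * (C * C) / INR n) with eps by (unfold m, eta; field; lra).
    assert (0 <= z) by nra. assert (z <= eps) by (unfold eps; lra).
    assert (z * (2 * z + 2 * eps) <= theta); [|nra].
    apply Rle_trans with (eps * (4 * eps)); [apply Rmult_le_compat; lra|].
    right. unfold theta, eps. ring. }
  assert (L2 : 1 - (theta + / m) * Expect ks pr Rc <= Expect ks pr (fun w => exp (- (theta * Rc w)) * ind (Rc w <= m))).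
  { rewrite <- Expect_scal, <- (Expect_const ks pr 1), <- Expect_minus.
    apply Expect_le; [apply (gk_ok _ _ _ _ _ _ _ _ _ Hg)|]. intros w _.
    assert (R0 : 0 <= Rc w) by apply card_nonneg.
    assert (E := exp_ge_1 (- (theta * Rc w))).
    assert (0 < / m) by now apply Rinv_0_lt_compat.
    unfold ind. em (Rc w <= m).
    - assert (0 <= / m * Rc w) by nra. lra.
    - assert (1 < / m * Rc w).
      { apply (Rmult_lt_reg_l m); auto. rewrite <- Rmult_assoc, Rinv_r; lra. }
      assert (0 <= theta * Rc w) by nra. lra. }
  assert (Hmt : / m <= theta).
  { apply (Rmult_le_reg_l m); auto. rewrite Rinv_r by lra. unfold m.
    apply (Rmult_le_compat_r (eta * theta)) in HN; [|nra]. rewrite Rinv_l in HN by nra. nra. }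
  assert (ER : 0 <= Expect ks pr Rc).
  { apply Expect_nonneg; [apply (gk_ok _ _ _ _ _ _ _ _ _ Hg)|]. intros; apply card_nonneg. }
  assert (2 * theta * K <= 2 * theta * Expect ks pr Rc) by (unfold theta in *; nra).
  apply (Rmult_le_reg_l (2 * theta)); lra.
Qed.

(** Markov's inequality for [1 - exp (- theta * size)], with [M = 1 / theta] independent of [n]:
    cluster sizes stay tight up to slightly above criticality, where their means do not stay
    bounded. *)
Lemma cluster_tail c C tau : 0 < c <= C -> 0 < tau ->
  exists M eps N, 0 < M /\ 0 < eps /\
  forall ks pr n e vr xi zeta, graph_ok ks pr n e vr xi zeta c C -> (N <= n)%nat ->
  sumR n (fun v => xi v * zeta v) <= 1 + eps ->
  forall A U : nat -> Prop, (forall v, A v -> (v < n)%nat) -> (forall v, U v -> (v < n)%nat) ->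
  Expect ks pr (fun w => ind (M < card n (Rch (e w) A U))) <= tau * card n A.
Proof.
  intros Hc Ht. set (kap := Rmin (1 / (4 * C)) (tau / (2 * C))).
  assert (Hk : 0 < kap) by (apply Rmin_glb_lt; apply Rdiv_lt_0_compat; lra).
  assert (K1 : kap * C <= 1/4).
  { apply Rle_trans with (1 / (4 * C) * C); [apply Rmult_le_compat_r; [lra|apply Rmin_l]|]. right; field; lra. }
  assert (K2 : kap * C <= tau / 2).
  { apply Rle_trans with (tau / (2 * C) * C); [apply Rmult_le_compat_r; [lra|apply Rmin_r]|]. right; field; lra. }
  set (eps := kap * c / 16). set (theta := kap * kap * (c * c) / 16).
  assert (Hth : 0 < theta) by (unfold theta; assert (0 < kap * kap) by nra; assert (0 < c * c) by nra; nra).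
  assert (Hep : 0 < eps) by (unfold eps; nra).
  destruct (INR_large (32 * (C * C * (C * C)))) as [N HN].
  exists (/ theta), eps, N. split; [now apply Rinv_0_lt_compat|]. split; [assumption|].
  intros ks pr n e vr xi zeta Hg HNn Hl A U HA HU.
  set (V := fun v => (v < n)%nat /\ ~ A v).
  assert (Hok := gk_ok _ _ _ _ _ _ _ _ _ Hg).
  assert (L := laplace_lower ks pr n e vr xi zeta c C Hg kap theta eps Hk K1 (Rlt_le _ _ Hth) (Rlt_le _ _ Hep) Hl
     ltac:(unfold eps; lra) ltac:(unfold theta; lra) (HN n HNn) A HA).
  fold V in L.
  assert (S : Expect ks pr (fun w => ind (/ theta < card n (Rch (e w) A U)))
     <= Expect ks pr (fun w => 2 * (1 - exp (- (theta * card n (Rch (e w) A V)))))).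
  { apply Expect_le; auto. intros w _.
    assert (Hm : card n (Rch (e w) A U) <= card n (Rch (e w) A V)).
    { apply card_le. intros v _. apply Rch_absorb; auto.
      - intros u Hu. unfold V. specialize (HU u Hu). tauto.
      - intros; now apply Rch_base. }
    assert (R0 : 0 <= card n (Rch (e w) A V)) by apply card_nonneg.
    unfold ind. em (/ theta < card n (Rch (e w) A U)).
    - assert (1 <= theta * card n (Rch (e w) A V)).
      { apply (Rmult_le_reg_l (/ theta)); [now apply Rinv_0_lt_compat|].
        rewrite <- Rmult_assoc, Rinv_l by lra. lra. }
      assert (E := exp_opp_le_inv (theta * card n (Rch (e w) A V)) ltac:(lra)).
      assert (/ (1 + theta * card n (Rch (e w) A V)) <= / 2) by (apply Rinv_le_contravar; lra). lra.
    - assert (exp (- (theta * card n (Rch (e w) A V))) <= exp 0) by (apply exp_le_mono; nra).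
      rewrite exp_0 in H. lra. }
  rewrite Expect_scal, Expect_minus, Expect_const in S.
  assert (CA := card_nonneg n A). nra.
Qed.

Lemma exp_beats_pow gam (k : nat) (A : R) : 0 < gam -> 0 < A ->
  exists N : nat, forall n, (N <= n)%nat -> A * INR n ^ k * exp (- (gam * INR n)) <= 1.
Proof.
  intros Hg HA. set (d := gam / INR (S k)).
  assert (HSk : 0 < INR (S k)) by (apply lt_0_INR; lia).
  assert (Hd : 0 < d) by (now apply Rdiv_lt_0_compat).
  destruct (INR_large (A / d ^ (S k))) as [N HN]. exists N. intros n Hn. specialize (HN n Hn).
  assert (Hpow : 0 < d ^ S k) by now apply pow_lt.
  assert (Hn0 : 0 <= INR n) by apply pos_INR.
  assert (E : (d * INR n) ^ S k <= exp (gam * INR n)).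
  { replace (gam * INR n) with (INR (S k) * (d * INR n)) by (unfold d; field; lra).
    assert (X : forall j x, exp (INR j * x) = exp x ^ j).
    { intros j x. induction j; [simpl; rewrite Rmult_0_l; apply exp_0|].
      rewrite S_INR, Rmult_plus_distr_r, Rmult_1_l, exp_plus, IHj. simpl. ring. }
    rewrite X. apply pow_incr. split; [nra|]. assert (G := exp_ge_1 (d * INR n)). lra. }
  rewrite exp_Ropp. assert (P := exp_pos (gam * INR n)).
  apply (Rmult_le_reg_r (exp (gam * INR n))); auto.
  rewrite Rmult_assoc, Rinv_l, Rmult_1_r, Rmult_1_l by lra.
  eapply Rle_trans; [|apply E]. rewrite Rpow_mult_distr. simpl (INR n ^ S k).
  assert (A <= d ^ S k * INR n).
  { apply (Rmult_le_compat_l (d ^ S k)) in HN; [|lra].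
    replace (d ^ S k * (A / d ^ S k)) with A in HN by (field; lra). assumption. }
  assert (0 <= INR n ^ k) by now apply pow_le. nra.
Qed.

Lemma large_deviation c C eta : 0 < c <= C -> 0 < eta <= 1 ->
  exists eps gam N, 0 < eps /\ 0 < gam /\
  forall ks pr n e vr xi zeta, graph_ok ks pr n e vr xi zeta c C -> (N <= n)%nat ->
  sumR n (fun v => xi v * zeta v) <= 1 + eps ->
  forall a, (a < n)%nat ->
  Expect ks pr (fun w => ind (eta * INR n <= card n (Rch (e w) (fun v => v = a) (fun v => (v < n)%nat /\ v <> a))))
    <= 2 * exp (- (gam * INR n)).
Proof.
  intros Hc He. set (c3 := c * (c * c)). assert (c3p : 0 < c3) by (unfold c3; assert (0 < c * c) by nra; nra).
  set (eps := c3 * eta / (16 * C)). assert (Hep : 0 < eps) by (apply Rdiv_lt_0_compat; nra).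
  set (kap := Rmin (1 / C) (eps / C)).
  assert (Hk : 0 < kap) by (apply Rmin_glb_lt; apply Rdiv_lt_0_compat; lra).
  assert (K1 : kap * C <= 1).
  { apply Rle_trans with (1 / C * C); [apply Rmult_le_compat_r; [lra|apply Rmin_l]|]. right; field; lra. }
  assert (K2 : kap * C <= eps).
  { apply Rle_trans with (eps / C * C); [apply Rmult_le_compat_r; [lra|apply Rmin_r]|]. right; field; lra. }
  set (gam := kap * c3 * (eta * eta) / 4).
  assert (Hgam : 0 < gam) by (unfold gam; assert (0 < kap * c3) by nra; assert (0 < eta * eta) by nra; nra).
  destruct (INR_large (4 / eta)) as [N HN].
  exists eps, gam, N. split; [assumption|]. split; [assumption|].
  intros ks pr n e vr xi zeta Hg HNn Hl a Ha. specialize (HN n HNn).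
  eapply Rle_trans.
  - apply (deviation ks pr n e vr xi zeta c C Hg kap eps eta); auto; try lra; try (fold c3; fold eps; lra).
    apply (Rmult_le_compat_l eta) in HN; [|lra]. replace (eta * (4 / eta)) with 4 in HN by (field; lra). lra.
  - apply Rmult_le_compat_r; [left; apply exp_pos|lra].
Qed.

(** * The learning network *)

Lemma in_pairs n i j : In (i, j) (pairs n) <-> (i < n)%nat /\ (j < n)%nat /\ i <> j.
Proof.
  unfold pairs. rewrite filter_In, in_prod_iff, !in_seq. simpl.
  destruct (Nat.eqb_spec i j); simpl; intuition (try discriminate; lia).
Qed.

Lemma in_keys_Disc n i : In (Disc i) (keys n) <-> (i < n)%nat.
Proof.
  unfold keys. rewrite !in_app_iff, !in_map_iff. split.
  - intros [[x [H1 H2]]|[[x [H1 _]]|[x [H1 _]]]]; try discriminate.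
    injection H1 as ->. apply in_seq in H2. lia.
  - intros H. left. exists i. split; [reflexivity|]. apply in_seq. lia.
Qed.

Lemma in_keys_Dir n i j : In (Dir i j) (keys n) <-> (i < n)%nat /\ (j < n)%nat /\ i <> j.
Proof.
  unfold keys. rewrite !in_app_iff, !in_map_iff, <- in_pairs. split.
  - intros [[x [H1 _]]|[[x [H1 H2]]|[x [H1 _]]]]; try discriminate.
    injection H1 as <- <-. now destruct x.
  - intros H. right; left. now exists (i, j).
Qed.

Lemma in_keys_Ind n i j : In (Ind i j) (keys n) <-> (i < n)%nat /\ (j < n)%nat /\ i <> j.
Proof.
  unfold keys. rewrite !in_app_iff, !in_map_iff, <- in_pairs. split.
  - intros [[x [H1 _]]|[[x [H1 _]]|[x [H1 H2]]]]; try discriminate.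
    injection H1 as <- <-. now destruct x.
  - intros H. right; right. now exists (i, j).
Qed.

Lemma NoDup_pairs n : NoDup (pairs n).
Proof.
  apply NoDup_filter. generalize (seq_NoDup n 0). generalize (seq_NoDup n 0).
  generalize (seq 0 n) at 1 3. intros l H1 H2. induction H1 as [|a l Ha H1 IH]; simpl; [constructor|].
  apply NoDup_app.
  - apply FinFun.Injective_map_NoDup; [|assumption]. intros x y E; congruence.
  - assumption.
  - intros [x y] Hin Hin2. apply in_map_iff in Hin. destruct Hin as [z [E _]]. injection E as -> ->.
    apply in_prod_iff in Hin2. tauto.
Qed.

Lemma NoDup_keys n : NoDup (keys n).
Proof.
  apply NoDup_app; [|apply NoDup_app|].
  - apply FinFun.Injective_map_NoDup; [|apply seq_NoDup]. intros x y E; congruence.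
  - apply FinFun.Injective_map_NoDup; [|apply NoDup_pairs].
    intros [x1 x2] [y1 y2] E; simpl in E; congruence.
  - apply FinFun.Injective_map_NoDup; [|apply NoDup_pairs].
    intros [x1 x2] [y1 y2] E; simpl in E; congruence.
  - intros v H1 H2. apply in_map_iff in H1, H2. destruct H1 as [x [<- _]], H2 as [y [E _]]. discriminate.
  - intros v H1 H2. apply in_map_iff in H1. destruct H1 as [x [<- _]].
    apply in_app_or in H2. destruct H2 as [H|H]; apply in_map_iff in H; destruct H as [y [E _]]; discriminate.
Qed.

(** The discovery probabilities are set to zero: network events read no [Disc] coin, and discovery
    will enter only through the weights [wt]. *)
Definition EN (n : nat) (beta : nat -> R) (delta : R) (q : nat -> R) (f : Outcome -> R) : R :=
  Expect (keys n) (prob beta delta (fun _ => 0) q) f.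

Definition lam0 (n : nat) (beta : nat -> R) (delta : R) (q : nat -> R) : R :=
  delta * sumR n (fun j => beta j * (q j * q j)).

(** Actions of order [n^(-1/2)], as in every investment equilibrium. *)
Record net_ok (n : nat) (beta : nat -> R) (delta : R) (q : nat -> R) (bl c1 c2 : R) : Prop := {
  nk_delta : 0 < delta <= 1;
  nk_bl : 0 < bl;
  nk_beta : forall j, (j < n)%nat -> bl <= beta j < 1;
  nk_c : 0 < c1 <= c2;
  nk_n : 2 * (c2 * c2) <= INR n;
  nk_q : forall j, (j < n)%nat -> c1 <= sqrt (INR n) * q j <= c2 }.

(** Two orientations: [fwd] follows what a firm knows to its indirect learners, [bwd] follows a firm
    to its sources. [fvr] and [bvr] are the coins read by an edge in each. *)
Definition fwd (w : Outcome) (a u : nat) : Prop := ind_edge w a u.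
Definition bwd (w : Outcome) (a u : nat) : Prop := ind_edge w u a.
Definition fvr (a u : nat) (v : Var) : Prop := v = Dir u a \/ v = Ind u a.
Definition bvr (a u : nat) (v : Var) : Prop := v = Dir a u \/ v = Ind a u.

Definition act_ok (n : nat) (beta : nat -> R) (delta : R) (q : nat -> R) : Prop :=
  0 <= delta <= 1 /\ forall j, (j < n)%nat -> 0 <= beta j <= 1 /\ 0 <= q j <= 1.

Lemma act_okp n beta delta q : act_ok n beta delta q -> okp (keys n) (prob beta delta (fun _ => 0) q).
Proof.
  intros [Hd H] v Hv. destruct v as [i|i j|i j]; simpl; [lra| |lra].
  apply in_keys_Dir in Hv. destruct Hv as [Hi [Hj _]].
  destruct (H i Hi), (H j Hj). unfold iota.
  assert (0 <= q i * q j <= 1) by nra. nra.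
Qed.

Lemma EN_Dir n beta delta q i j : (i < n)%nat -> (j < n)%nat -> i <> j ->
  EN n beta delta q (fun w => ind (w (Dir i j) = true)) = beta i * (q i * q j).
Proof.
  intros. unfold EN. rewrite Expect_var; [reflexivity|apply NoDup_keys|]. now apply in_keys_Dir.
Qed.

Lemma dep_var v b : dep (fun u => u = v) (fun w : Outcome => ind (w v = b)).
Proof. apply dep_ind. intros w w' E H. rewrite <- E; auto. Qed.

Lemma EN_edge n beta delta q i j : (i < n)%nat -> (j < n)%nat -> i <> j ->
  EN n beta delta q (fun w => ind (ind_edge w j i)) = beta i * (q i * q j) * delta.
Proof.
  intros. unfold EN, ind_edge.
  rewrite (Expect_ext _ _ _ (fun w => ind (w (Dir i j) = true) * ind (w (Ind i j) = true)))
    by (intros; apply ind_and).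
  rewrite (Expect_indep _ _ (fun u => u = Dir i j)).
  - rewrite !Expect_var; try apply NoDup_keys; [reflexivity| |].
    + now apply in_keys_Ind.
    + now apply in_keys_Dir.
  - apply dep_var.
  - eapply dep_weaken; [|apply dep_var]. intros v -> E. discriminate.
Qed.

Section Net.

Variables (n : nat) (beta : nat -> R) (delta : R) (q : nat -> R) (bl c1 c2 : R).
Hypothesis Hnet : net_ok n beta delta q bl c1 c2.

Lemma net_n_pos : 0 < INR n.
Proof. destruct Hnet. nra. Qed.

Lemma net_q_pos j : (j < n)%nat -> 0 < q j.
Proof.
  intros Hj. destruct Hnet. specialize (nk_q0 j Hj).
  assert (0 < sqrt (INR n)) by (apply sqrt_lt_R0, net_n_pos). nra.
Qed.

Lemma net_qq i j : (i < n)%nat -> (j < n)%nat -> c1 * c1 / INR n <= q i * q j <= c2 * c2 / INR n.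
Proof.
  intros Hi Hj. destruct Hnet. assert (Qi := nk_q0 i Hi). assert (Qj := nk_q0 j Hj).
  assert (N := net_n_pos). assert (S := sqrt_sqrt (INR n) (Rlt_le _ _ N)).
  assert (c1 * c1 <= (sqrt (INR n) * q i) * (sqrt (INR n) * q j) <= c2 * c2)
    by nra.
  replace ((sqrt (INR n) * q i) * (sqrt (INR n) * q j)) with (INR n * (q i * q j)) in H
    by nra.
  split; apply (Rmult_le_reg_l (INR n)); auto.
  - replace (INR n * (c1 * c1 / INR n)) with (c1 * c1) by (field; lra). lra.
  - replace (INR n * (c2 * c2 / INR n)) with (c2 * c2) by (field; lra). lra.
Qed.

Lemma net_q_le_1 j : (j < n)%nat -> q j <= 1.
Proof.
  intros Hj. assert (K := net_qq j j Hj Hj). assert (N := net_n_pos). destruct Hnet.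
  assert (c2 * c2 / INR n <= 1).
  { apply (Rmult_le_reg_l (INR n)); auto. replace (INR n * (c2 * c2 / INR n)) with (c2 * c2) by (field; lra). nra. }
  nra.
Qed.

Lemma net_act : act_ok n beta delta q.
Proof.
  destruct Hnet. split; [lra|]. intros j Hj. specialize (nk_beta0 j Hj).
  assert (Q1 := net_q_pos j Hj). assert (Q2 := net_q_le_1 j Hj). lra.
Qed.

Lemma net_okp : okp (keys n) (prob beta delta (fun _ => 0) q).
Proof. apply act_okp, net_act. Qed.

Lemma net_p i j : (i < n)%nat -> (j < n)%nat ->
  bl * (c1 * c1) / INR n <= beta i * (q i * q j) <= c2 * c2 / INR n.
Proof.
  intros Hi Hj. assert (K := net_qq i j Hi Hj). destruct Hnet. specialize (nk_beta0 i Hi).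
  assert (N := net_n_pos).
  assert (0 < c1 * c1 / INR n) by (apply Rdiv_lt_0_compat; nra).
  split; [|nra].
  replace (bl * (c1 * c1) / INR n) with (bl * (c1 * c1 / INR n)) by lra.
  apply Rmult_le_compat; lra.
Qed.

Lemma net_consts : 0 < delta * bl * c1 <= c2.
Proof.
  destruct Hnet. assert (0 < delta * bl) by nra.
  destruct n as [|m]; [simpl in nk_n0; nra|].
  specialize (nk_beta0 0%nat ltac:(lia)). assert (delta * bl <= 1) by nra. nra.
Qed.

(** The edge probability factorises in both orientations: forward the propensity [beta] goes with
    the endpoint, backward with the origin. Both have eigenvalue [lam0]. *)
Lemma fwd_ok : graph_ok (keys n) (prob beta delta (fun _ => 0) q) n fwd fvr
  q (fun u => delta * (beta u * q u)) (delta * bl * c1) c2.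
Proof.
  assert (H1 := net_okp). assert (H2 := net_consts). destruct Hnet.
  constructor; auto.
  - intros a u w w' E. unfold fwd, ind_edge. rewrite !E by (unfold fvr; auto). reflexivity.
  - intros a u a' u' v [-> | ->] [H|H]; try discriminate; injection H; auto.
  - intros a u Ha Hu Hau. etransitivity; [apply (EN_edge n beta delta q u a); auto|]. ring.
  - intros v Hv. specialize (nk_q0 v Hv). specialize (nk_beta0 v Hv).
    assert (delta * bl <= 1) by nra. nra.
  - intros v Hv. specialize (nk_q0 v Hv). specialize (nk_beta0 v Hv).
    replace (sqrt (INR n) * (delta * (beta v * q v))) with ((delta * beta v) * (sqrt (INR n) * q v)) by ring.
    split.
    + apply Rmult_le_compat; nra.
    + replace c2 with (1 * c2) by ring. apply Rmult_le_compat; nra.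
Qed.

Lemma bwd_ok : graph_ok (keys n) (prob beta delta (fun _ => 0) q) n bwd bvr
  (fun u => beta u * q u) (fun u => delta * q u) (delta * bl * c1) c2.
Proof.
  assert (H1 := net_okp). assert (H2 := net_consts). destruct Hnet.
  constructor; auto.
  - intros a u w w' E. unfold bwd, ind_edge. rewrite !E by (unfold bvr; auto). reflexivity.
  - intros a u a' u' v [-> | ->] [H|H]; try discriminate; injection H; auto.
  - intros a u Ha Hu Hau. etransitivity; [apply (EN_edge n beta delta q a u); auto|]. ring.
  - intros v Hv. specialize (nk_q0 v Hv). specialize (nk_beta0 v Hv).
    replace (sqrt (INR n) * (beta v * q v)) with (beta v * (sqrt (INR n) * q v)) by ring.
    split.
    + apply Rmult_le_compat; nra.
    + replace c2 with (1 * c2) by ring. apply Rmult_le_compat; nra.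
  - intros v Hv. specialize (nk_q0 v Hv). specialize (nk_beta0 v Hv).
    replace (sqrt (INR n) * (delta * q v)) with (delta * (sqrt (INR n) * q v)) by ring.
    split.
    + apply Rmult_le_compat; nra.
    + replace c2 with (1 * c2) by ring. apply Rmult_le_compat; nra.
Qed.

Lemma fwd_lam : sumR n (fun v => q v * (delta * (beta v * q v))) = lam0 n beta delta q.
Proof. unfold lam0. rewrite <- sumR_scal. apply sumR_ext. intros; ring. Qed.

Lemma bwd_lam : sumR n (fun v => beta v * q v * (delta * q v)) = lam0 n beta delta q.
Proof. unfold lam0. rewrite <- sumR_scal. apply sumR_ext. intros; ring. Qed.

End Net.

(* [Bk n w i]: the firms whose knowledge reaches [i]. [dsc n w i b] and [bko n w i x]: the firms
   reached by the knowledge of [b], resp. whose knowledge reaches [x], without passing through [i]. *)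
Definition Bk (n : nat) (w : Outcome) (i : nat) : nat -> Prop :=
  Rch (bwd w) (fun v => v = i) (fun v => (v < n)%nat /\ v <> i).

Definition Lrn (n : nat) (w : Outcome) (i t : nat) : Prop :=
  (t < n)%nat /\ t <> i /\ exists m, Bk n w i m /\ w (Dir m t) = true.

Definition hT (n : nat) (w : Outcome) (i : nat) (T : nat -> Prop) : Prop := forall t, T t -> Lrn n w i t.

Definition dsc (n : nat) (w : Outcome) (i b : nat) : nat -> Prop :=
  Rch (fwd w) (fun v => v = b) (fun v => (v < n)%nat /\ v <> i /\ v <> b).

Definition bko (n : nat) (w : Outcome) (i x : nat) : nat -> Prop :=
  Rch (bwd w) (fun v => v = x) (fun v => (v < n)%nat /\ v <> i /\ v <> x).

Definition touch (n : nat) (w : Outcome) (i : nat) (T : nat -> Prop) (m : nat) : Prop :=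
  exists t, T t /\ (m = t \/ exists m', bko n w i m m' /\ w (Dir m' t) = true).

(** Access to a single idea of [T] suffices here, so that one estimate covers both a second
    listening link that could help with [T] and a leak to a firm that knows all of [T]. *)
Definition crowd' (n : nat) (w : Outcome) (i : nat) (T : nat -> Prop) (b : nat) : Prop :=
  exists m, dsc n w i b m /\ touch n w i T m.

Lemma Bk_lt n w i m : (i < n)%nat -> Bk n w i m -> (m < n)%nat.
Proof. intros Hi H. apply Rch_in in H. destruct H as [-> |H]; tauto. Qed.

(** A cluster is determined by the edges that leave its own members; this is the measurability
    demanded by [Expect_fresh]. *)
Lemma Rch_closed_ext (e e' : nat -> nat -> Prop) (A U : nat -> Prop) :
  (forall a u, Rch e A U a -> (e a u <-> e' a u)) ->
  Rch e A U = Rch e' A U.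
Proof.
  intros H. extensionality v. apply propositional_extensionality. split.
  - induction 1; [now apply Rch_base|]. eapply Rch_step; eauto. now apply H.
  - induction 1 as [|u v Hr IH Hv Huv]; [now apply Rch_base|]. eapply Rch_step; eauto. now apply H.
Qed.

Lemma pow_le_prodA (T : nat -> Prop) p0 : 0 <= p0 <= 1 ->
  forall m j, card m T <= INR j -> p0 ^ j <= prodR m (fun t => pw (T t) p0).
Proof.
  intros Hp0. induction m; intros j Hj; simpl.
  - rewrite <- (pow1 j). now apply pow_incr.
  - unfold card in Hj. simpl in Hj. fold (card m T) in Hj. unfold ind in Hj. unfold pw at 2.
    em (T m).
    + destruct j as [|j].
      { assert (K := card_nonneg m T). simpl in Hj. lra. }
      rewrite S_INR in Hj. simpl. rewrite Rmult_comm. apply Rmult_le_compat_r; [lra|].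
      apply IHm. lra.
    + rewrite Rmult_1_r. apply IHm. lra.
Qed.

(** Learning [T] directly from its members already has polynomial probability. *)
Lemma hT_lower n beta delta q bl c1 c2 : net_ok n beta delta q bl c1 c2 ->
  forall i (T : nat -> Prop) (k : nat), (i < n)%nat -> (forall t, T t -> (t < n)%nat /\ t <> i) ->
  card n T <= INR k ->
  (Rmin 1 (bl * (c1 * c1)) / INR n) ^ k <= EN n beta delta q (fun w => ind (hT n w i T)).
Proof.
  intros Hnet i T k Hi HT Hk.
  assert (Hok := net_okp _ _ _ _ _ _ _ Hnet). assert (N := net_n_pos _ _ _ _ _ _ _ Hnet).
  assert (N1 : 1 <= INR n) by (apply (le_INR 1); lia).
  set (p0 := Rmin 1 (bl * (c1 * c1)) / INR n).
  assert (Hp0 : 0 <= p0 <= 1).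
  { assert (0 < Rmin 1 (bl * (c1 * c1)) <= 1).
    { split; [destruct Hnet; apply Rmin_glb_lt; [lra|apply Rmult_lt_0_compat; nra]|apply Rmin_l]. }
    unfold p0. split; [apply Rmult_le_pos; [lra|left; now apply Rinv_0_lt_compat]|].
    apply (Rmult_le_reg_l (INR n)); auto. unfold Rdiv.
    rewrite (Rmult_comm (Rmin _ _)), <- Rmult_assoc, Rinv_r by lra. lra. }
  apply Rle_trans with (prodR n (fun t => pw (T t) p0)).
  - now apply pow_le_prodA.
  - apply Rle_trans with (EN n beta delta q (fun w => prodR n (fun t => pw (T t) (ind (w (Dir i t) = true))))).
    + unfold EN. rewrite (Expect_prodR _ _ n (fun t v => v = Dir i t)
        (fun t w => pw (T t) (ind (w (Dir i t) = true)))).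
      * apply prodR_le. intros t Ht. unfold pw. em (T t).
        -- split; [lra|]. change (p0 <= EN n beta delta q (fun w => ind (w (Dir i t) = true))).
           destruct (HT t t0) as [_ Hti]. rewrite EN_Dir by auto.
           eapply Rle_trans; [|apply (net_p _ _ _ _ _ _ _ Hnet i t Hi Ht)].
           apply Rmult_le_compat_r; [left; now apply Rinv_0_lt_compat|apply Rmin_r].
        -- rewrite Expect_const. lra.
      * intros t _ w w' E. unfold pw. em (T t); [|reflexivity]. now rewrite E.
      * intros t t' v _ _ -> E. now injection E.
    + apply Expect_le; auto. intros w _. unfold ind at 2. em (hT n w i T).
      * rewrite <- (prodR_one n (fun _ => 1)) by auto. apply prodR_le. intros t _.
        unfold pw. em (T t); [apply ind_range|lra].
      * apply not_all_ex_not in n0. destruct n0 as [t Ht]. apply imply_to_and in Ht. destruct Ht as [Ht Hn].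
        right. apply (prodR_zero n _ t); [now apply HT|]. rewrite pw_true by assumption.
        apply ind_false. intros Hd. apply Hn. split; [now apply HT|]. split; [now apply HT|].
        exists i. split; [now apply Rch_base|assumption].
Qed.

(** * Few firms are close to a set of ideas known to a given firm *)

Lemma Rch_ext_on (e e' : nat -> nat -> Prop) (A U : nat -> Prop) :
  (forall a u, A a \/ U a -> U u -> (e a u <-> e' a u)) -> Rch e A U = Rch e' A U.
Proof.
  intros H. extensionality v. apply propositional_extensionality.
  split; apply Rch_edge_ext; intros; now apply H.
Qed.

Lemma Expect_ind_const_and ks pr (P : Prop) (Q : Outcome -> Prop) :
  Expect ks pr (fun w => ind (P /\ Q w)) = ind P * Expect ks pr (fun w => ind (Q w)).
Proof. rewrite <- Expect_scal. apply Expect_ext. intros; apply ind_and. Qed.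

Definition vars_in (U : nat -> Prop) (v : Var) : Prop :=
  exists a b, U a /\ U b /\ (v = Dir a b \/ v = Ind a b).

Lemma edge_eq (w w' : Outcome) a b :
  w (Dir b a) = w' (Dir b a) -> w (Ind b a) = w' (Ind b a) -> ind_edge w a b <-> ind_edge w' a b.
Proof. intros H1 H2. unfold ind_edge. now rewrite H1, H2. Qed.

Section Crowd.

Variables (n : nat) (beta : nat -> R) (delta : R) (q : nat -> R) (pbar : R).
Let ks := keys n.
Let pr := prob beta delta (fun _ => 0) q.
Hypothesis Hok : okp ks pr.
Hypothesis Hp0 : 0 <= pbar.
Hypothesis Hdir : forall i j, (i < n)%nat -> (j < n)%nat -> i <> j ->
  Expect ks pr (fun w => ind (w (Dir i j) = true)) <= pbar.

Lemma dir_hit (R1 R2 : nat -> Prop) : (forall v, R1 v -> ~ R2 v) ->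
  Expect ks pr (fun w => ind (exists m s, (m < n)%nat /\ (s < n)%nat /\ R1 m /\ R2 s /\ w (Dir m s) = true))
   <= card n R1 * card n R2 * pbar.
Proof.
  intros Hd. eapply Rle_trans.
  { apply (Expect_union_sum ks pr n _ (fun m w => exists s, (s < n)%nat /\ R1 m /\ R2 s /\ w (Dir m s) = true)); auto.
    intros w _ [m [s H]]. exists m. split; [tauto|]. exists s. tauto. }
  replace (card n R1 * card n R2 * pbar) with (sumR n (fun m => ind (R1 m) * (card n R2 * pbar))).
  2: { unfold card at 2. rewrite (sumR_ext n _ (fun m => (card n R2 * pbar) * ind (R1 m))) by (intros; ring).
       rewrite sumR_scal. ring. }
  apply sumR_le. intros m Hm. eapply Rle_trans.
  { apply (Expect_union_sum ks pr n _ (fun s w => R1 m /\ R2 s /\ w (Dir m s) = true)); auto. }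
  unfold card. rewrite <- Rmult_assoc, (Rmult_comm _ pbar), <- Rmult_assoc, <- sumR_scal.
  apply sumR_le. intros s Hs. rewrite Expect_ind_const_and, Expect_ind_const_and.
  unfold ind at 1 2 4 5. em (R1 m); em (R2 s); try lra. rewrite !Rmult_1_l, !Rmult_1_r.
  apply Hdir; auto. intros ->. now apply (Hd s).
Qed.

Variables (M1 M2 tau1 tau2 : R).
Hypothesis HM1 : 0 <= M1.
Hypothesis HM2 : 0 <= M2.
Hypothesis Ht2 : 0 <= tau2.
Hypothesis Htail1 : forall A U : nat -> Prop, (forall v, A v -> (v < n)%nat) -> (forall v, U v -> (v < n)%nat) ->
  Expect ks pr (fun w => ind (M1 < card n (Rch (fwd w) A U))) <= tau1 * card n A.
Hypothesis Htail2 : forall A U : nat -> Prop, (forall v, A v -> (v < n)%nat) -> (forall v, U v -> (v < n)%nat) ->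
  Expect ks pr (fun w => ind (M2 < card n (Rch (bwd w) A U))) <= tau2 * card n A.

(** The set [A] will be the backward cluster of [i], already revealed. From a firm [b] outside [A]
    and [T], [Des] explores forward, and [Nb] then backward from [Des], both inside the untouched
    firms. Contact with [A] or [T] needs one more direct link: one by which [Nb] listens to them
    ([hit_in]), or one by which a firm of [T] listens to [Des] ([hit_out]). *)
Definition Uset (A T : nat -> Prop) (v : nat) : Prop := (v < n)%nat /\ ~ A v /\ ~ T v.
Definition Des (A T : nat -> Prop) (b : nat) (w : Outcome) : nat -> Prop :=
  Rch (fwd w) (fun v => v = b) (fun v => Uset A T v /\ v <> b).
Definition Nb (A T : nat -> Prop) (b : nat) (w : Outcome) : nat -> Prop :=
  Rch (bwd w) (Des A T b w) (fun v => Uset A T v /\ ~ Des A T b w v).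
Definition hit_in (A T : nat -> Prop) (b : nat) (w : Outcome) : Prop :=
  exists m s, (m < n)%nat /\ (s < n)%nat /\ Nb A T b w m /\ (A s \/ T s) /\ w (Dir m s) = true.
Definition hit_out (A T : nat -> Prop) (b : nat) (w : Outcome) : Prop :=
  exists t d, (t < n)%nat /\ (d < n)%nat /\ (T t /\ ~ A t) /\ Des A T b w d /\ w (Dir t d) = true.

Lemma Des_in A T b w v : Uset A T b -> Des A T b w v -> Uset A T v.
Proof. intros Hb H. apply Rch_in in H. destruct H as [-> |H]; tauto. Qed.

Lemma Nb_in A T b w v : Uset A T b -> Nb A T b w v -> Uset A T v.
Proof. intros Hb H. apply Rch_in in H. destruct H as [H|H]; [eapply Des_in; eauto|tauto]. Qed.

Lemma Des_dep A T b : Uset A T b -> dep (vars_in (Uset A T)) (Des A T b).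
Proof.
  intros Hb w w' E. apply Rch_ext_on. intros a u Ha Hu.
  assert (Uset A T a) by (destruct Ha as [-> |Ha]; tauto).
  apply edge_eq; apply E; exists u, a; tauto.
Qed.

Lemma Nb_dep A T b : Uset A T b -> dep (vars_in (Uset A T)) (Nb A T b).
Proof.
  intros Hb w w' E. unfold Nb. rewrite (Des_dep A T b Hb w w' E). apply Rch_ext_on. intros a u Ha Hu.
  assert (Uset A T a) by (destruct Ha as [Ha|Ha]; [eapply Des_in; eauto|tauto]).
  apply edge_eq; apply E; exists a, u; tauto.
Qed.

(** Four contributions: [Des] is large; [Des] is small but [Nb] is large, by the tail bound with up
    to [M1] roots; or both are small and one of the boundedly many unread links per target is
    present. *)
Lemma crowd_bad_prob A T b : Uset A T b ->
  Expect ks pr (fun w => ind (hit_in A T b w \/ hit_out A T b w)) <=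
  tau1 + M1 * tau2 + (M2 * (card n A + card n T) + M1 * card n T) * pbar.
Proof.
  intros Hb. assert (Hbn : (b < n)%nat) by apply Hb.
  assert (C0 := card_nonneg n A). assert (C1 := card_nonneg n T).
  assert (P1 : Expect ks pr (fun w => ind (M1 < card n (Des A T b w))) <= tau1).
  { eapply Rle_trans; [apply Htail1|rewrite card_single; auto; lra].
    - now intros v ->.
    - unfold Uset; tauto. }
  assert (P2 : Expect ks pr (fun w => ind (card n (Des A T b w) <= M1 /\ M2 < card n (Nb A T b w))) <= M1 * tau2).
  { eapply Rle_trans.
    - apply (Expect_fresh ks pr (Des A T b) (fun D v => exists u d, D d /\ (v = Dir u d \/ v = Ind u d))
        (fun D w => ind (card n D <= M1 /\ M2 < card n (Rch (bwd w) D (fun v => Uset A T v /\ ~ D v))))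
        (fun _ => M1 * tau2)); auto.
      + intros w w' E. symmetry. apply Rch_closed_ext. intros a u Ha.
        apply edge_eq; apply E; exists u, a; auto.
      + intros w _ w1 w2 E. apply ind_iff.
        rewrite (Rch_ext_on (bwd w1) (bwd w2)); [tauto|]. intros a u Ha Hu. apply edge_eq; apply E;
          intros [u' [d [Hd [X|X]]]]; try discriminate; injection X as -> ->; tauto.
      + intros w _. rewrite Expect_ind_const_and. unfold ind at 1.
        em (card n (Des A T b w) <= M1); [|rewrite Rmult_0_l; apply Rmult_le_pos; auto].
        rewrite Rmult_1_l. eapply Rle_trans; [apply Htail2|].
        * intros v Hv. apply (Des_in A T b w v Hb Hv).
        * unfold Uset; tauto.
        * rewrite Rmult_comm. apply Rmult_le_compat_r; auto.
    - rewrite Expect_const. lra. }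
  assert (P3 : Expect ks pr (fun w => ind (card n (Nb A T b w) <= M2 /\ hit_in A T b w))
      <= M2 * (card n A + card n T) * pbar).
  { eapply Rle_trans.
    - apply (Expect_fresh ks pr (Nb A T b) (fun _ => vars_in (Uset A T))
        (fun N w => ind (card n N <= M2 /\ exists m s, (m < n)%nat /\ (s < n)%nat /\ N m /\ (A s \/ T s) /\ w (Dir m s) = true))
        (fun _ => M2 * (card n A + card n T) * pbar)); auto.
      + intros w w' E. symmetry. now apply Nb_dep.
      + intros w _ w1 w2 E. apply ind_iff. split; intros [H [m [s H']]]; (split; [assumption|]);
          exists m, s; [rewrite <- E|rewrite E]; try tauto;
          intros [a [u [Ha [Hu [X|X]]]]]; try discriminate; injection X as -> ->;
          unfold Uset in Hu; tauto.
      + intros w _. rewrite Expect_ind_const_and. unfold ind at 1.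
        em (card n (Nb A T b w) <= M2).
        2: { rewrite Rmult_0_l. apply Rmult_le_pos; [apply Rmult_le_pos; lra|auto]. }
        rewrite Rmult_1_l. eapply Rle_trans; [apply (dir_hit (Nb A T b w) (fun s => A s \/ T s))|].
        * intros v Hv. apply (Nb_in A T b w v Hb) in Hv. unfold Uset in Hv. tauto.
        * apply Rmult_le_compat_r; auto. assert (X := card_union_le n A T).
          apply Rmult_le_compat; auto; apply card_nonneg.
    - rewrite Expect_const. lra. }
  assert (P4 : Expect ks pr (fun w => ind (card n (Des A T b w) <= M1 /\ hit_out A T b w))
      <= M1 * card n T * pbar).
  { eapply Rle_trans.
    - apply (Expect_fresh ks pr (Des A T b) (fun _ => vars_in (Uset A T))
        (fun D w => ind (card n D <= M1 /\ exists t d, (t < n)%nat /\ (d < n)%nat /\ (T t /\ ~ A t) /\ D d /\ w (Dir t d) = true))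
        (fun _ => M1 * card n T * pbar)); auto.
      + intros w w' E. symmetry. now apply Des_dep.
      + intros w _ w1 w2 E. apply ind_iff. split; intros [H [m [s H']]]; (split; [assumption|]);
          exists m, s; [rewrite <- E|rewrite E]; try tauto;
          intros [a [u [Ha [Hu [X|X]]]]]; try discriminate; injection X as -> ->;
          unfold Uset in Ha; tauto.
      + intros w _. rewrite Expect_ind_const_and. unfold ind at 1.
        em (card n (Des A T b w) <= M1).
        2: { rewrite Rmult_0_l. apply Rmult_le_pos; [apply Rmult_le_pos; lra|auto]. }
        rewrite Rmult_1_l. eapply Rle_trans; [apply (dir_hit (fun t => T t /\ ~ A t) (Des A T b w))|].
        * intros v Hv Hu. apply (Des_in A T b w v Hb) in Hu. unfold Uset in Hu. tauto.
        * apply Rmult_le_compat_r; auto. rewrite Rmult_comm.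
          apply Rmult_le_compat; try apply card_nonneg.
          -- assumption.
          -- apply card_le. tauto.
    - rewrite Expect_const. lra. }
  assert (S : Expect ks pr (fun w => ind (hit_in A T b w \/ hit_out A T b w)) <=
    Expect ks pr (fun w => ind (M1 < card n (Des A T b w))
      + ind (card n (Des A T b w) <= M1 /\ M2 < card n (Nb A T b w))
      + (ind (card n (Nb A T b w) <= M2 /\ hit_in A T b w)
         + ind (card n (Des A T b w) <= M1 /\ hit_out A T b w)))).
  { apply Expect_le; auto. intros w _. unfold ind.
    destruct (Rle_dec (card n (Des A T b w)) M1), (Rle_dec (card n (Nb A T b w)) M2);
    em (hit_in A T b w \/ hit_out A T b w); em (M1 < card n (Des A T b w));
    em (card n (Des A T b w) <= M1 /\ M2 < card n (Nb A T b w));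
    em (card n (Nb A T b w) <= M2 /\ hit_in A T b w);
    em (card n (Des A T b w) <= M1 /\ hit_out A T b w); try lra; exfalso;
    try (assert (M1 < card n (Des A T b w)) by lra); try (assert (M2 < card n (Nb A T b w)) by lra); tauto. }
  rewrite !Expect_plus in S. lra.
Qed.

(** Follow the forward path from [b], then the backward path to the source of an idea of [T]; the
    first exit from the untouched firms is a hit. *)
Lemma crowd_hits w i T b : (i < n)%nat -> (forall t, T t -> (t < n)%nat /\ t <> i) -> (b < n)%nat ->
  crowd' n w i T b -> Bk n w i b \/ T b \/
   (Uset (Bk n w i) T b /\ (hit_in (Bk n w i) T b w \/ hit_out (Bk n w i) T b w)).
Proof.
  intros Hi HT Hb [m [Hd [t [Ht Hm]]]].
  set (A := Bk n w i) in *.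
  em (A b); [now left|]. em (T b); [now right; left|]. right; right.
  assert (HU : Uset A T b) by (unfold Uset; tauto). split; [assumption|].
  assert (Ai : A i) by now apply Rch_base.
  assert (Claim1 : forall v, dsc n w i b v -> Des A T b w v \/ hit_out A T b w).
  { intros v Hv. induction Hv as [v ->|u v Hr IH Hv Huv]; [left; now apply Rch_base|].
    destruct IH as [IH|IH]; [|now right]. assert (Uu := Des_in A T b w u HU IH).
    em (A v).
    (* A backward cluster is closed under sources: a firm whose knowledge flows into [A] would
       belong to [A]. *)
    - exfalso. destruct Uu as [Hu [Hu2 _]]. apply Hu2. apply (Rch_step _ _ _ v u); auto.
      split; auto. intros ->. tauto.
    - em (T v).
      + right. exists v, u. split; [tauto|]. split; [apply Uu|]. split; [tauto|]. split; [assumption|apply Huv].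
      + left. apply (Rch_step _ _ _ u v); auto. unfold Uset. tauto. }
  destruct (Claim1 m Hd) as [Dm|]; [|now right]. left.
  assert (Um := Des_in A T b w m HU Dm).
  assert (Claim2 : forall v, bko n w i m v -> Nb A T b w v \/ hit_in A T b w).
  { intros v Hv. induction Hv as [v ->|u v Hr IH Hv Huv]; [left; now apply Rch_base|].
    destruct IH as [IH|IH]; [|now right]. assert (Uu := Nb_in A T b w u HU IH).
    em (A v \/ T v).
    - right. exists u, v. split; [apply Uu|]. split; [tauto|]. split; [assumption|]. split; [assumption|apply Huv].
    - left. em (Des A T b w v); [now apply Rch_base|].
      apply (Rch_step _ _ _ u v); auto. unfold Uset. tauto. }
  destruct Hm as [-> |[m' [Hm' Hdir']]]; [destruct Um; tauto|].
  destruct (Claim2 m' Hm') as [Nm|]; [|assumption].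
  exists m', t. destruct (Nb_in A T b w m' HU Nm). destruct (HT t Ht). tauto.
Qed.

(** Revealing the backward cluster of [i], and whether it provides [T], reads only coins of links by
    which its members listen. The links that decide a hit from [b] are still fresh. *)
Lemma crowd_single i T b : (i < n)%nat -> (forall t, T t -> (t < n)%nat /\ t <> i) -> (b < n)%nat ->
  0 <= tau1 ->
  Expect ks pr (fun w => ind (hT n w i T /\ crowd' n w i T b)) <=
  Expect ks pr (fun w => ind (hT n w i T) * ind (Bk n w i b)) + ind (T b) * Expect ks pr (fun w => ind (hT n w i T))
  + Expect ks pr (fun w => ind (hT n w i T) * (tau1 + M1 * tau2 + (M2 * (card n (Bk n w i) + card n T) + M1 * card n T) * pbar)).
Proof.
  intros Hi HT Hb Ht1.
  set (X := fun w => (Bk n w i, hT n w i T)).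
  set (g := fun (s : (nat -> Prop) * Prop) w => ind (snd s) *
     ind (Uset (fst s) T b /\ (hit_in (fst s) T b w \/ hit_out (fst s) T b w))).
  set (bd := fun s : (nat -> Prop) * Prop => ind (snd s) *
     (tau1 + M1 * tau2 + (M2 * (card n (fst s) + card n T) + M1 * card n T) * pbar)).
  assert (F : Expect ks pr (fun w => g (X w) w) <= Expect ks pr (fun w => bd (X w))).
  { apply (Expect_fresh ks pr X (fun s v => exists a u, fst s a /\ (v = Dir a u \/ v = Ind a u))); auto.
    - intros w w' E. unfold X.
      assert (EB : Bk n w' i = Bk n w i).
      { symmetry. apply Rch_closed_ext. intros a u Ha. apply edge_eq; apply E; exists a, u; auto. }
      f_equal; [assumption|]. apply propositional_extensionality. unfold hT, Lrn. rewrite EB.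
      assert (ED : forall m t, Bk n w i m -> w' (Dir m t) = w (Dir m t)).
      { intros m t Hm. symmetry. apply E. exists m, t. auto. }
      split; intros H t Ht; destruct (H t Ht) as [H1 [H2 [m [H3 H4]]]]; (split; [auto|]); (split; [auto|]);
        exists m; (split; [auto|]); [rewrite <- ED|rewrite ED]; auto.
    - intros w _. set (s := X w). intros w1 w2 E. unfold g. f_equal.
      destruct (excluded_middle_informative (Uset (fst s) T b)) as [HUb|HUb].
      + assert (ED : forall v, vars_in (Uset (fst s) T) v -> w1 v = w2 v).
        { intros v [a [u [Ha [Hu [-> | ->]]]]]; apply E; intros [a' [u' [Ha' [Y|Y]]]]; try discriminate;
            injection Y as -> ->; unfold Uset in Ha; tauto. }
        unfold hit_in, hit_out. rewrite (Nb_dep (fst s) T b HUb w1 w2 ED), (Des_dep (fst s) T b HUb w1 w2 ED).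
        apply ind_iff.
        assert (EN1 : forall m t, Nb (fst s) T b w2 m -> w1 (Dir m t) = w2 (Dir m t)).
        { intros m t Hm. apply E. intros [a' [u' [Ha' [Y|Y]]]]; try discriminate.
          injection Y as -> ->. apply Nb_in in Hm; auto. unfold Uset in Hm; tauto. }
        assert (EN2 : forall m t, ~ fst s m -> w1 (Dir m t) = w2 (Dir m t)).
        { intros m t Hm. apply E. intros [a' [u' [Ha' [Y|Y]]]]; try discriminate.
          injection Y as -> ->. tauto. }
        split; intros [Hu H]; (split; [assumption|]); destruct H as [[m [t H]]|[m [t H]]];
          [left|right|left|right]; exists m, t;
          [rewrite <- EN1|rewrite <- EN2|rewrite EN1|rewrite EN2]; tauto.
      + rewrite !ind_false by tauto. reflexivity.
    - intros w _. unfold g, bd. rewrite Expect_scal. apply Rmult_le_compat_l; [apply ind_pos|].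
      rewrite Expect_ind_const_and. unfold ind at 1. em (Uset (fst (X w)) T b).
      + rewrite Rmult_1_l. now apply crowd_bad_prob.
      + rewrite Rmult_0_l. assert (C0 := card_nonneg n (fst (X w))). assert (C1 := card_nonneg n T).
        assert (0 <= M1 * tau2) by nra.
        assert (0 <= M2 * (card n (fst (X w)) + card n T)) by nra.
        assert (0 <= M1 * card n T) by nra.
        assert (0 <= (M2 * (card n (fst (X w)) + card n T) + M1 * card n T) * pbar) by nra.
        lra. }
  rewrite <- Expect_scal, <- Expect_plus. eapply Rle_trans; [|apply Rplus_le_compat_l, F].
  rewrite <- Expect_plus. apply Expect_le; auto. intros w _. unfold g, X. simpl.
  rewrite ind_and. em (crowd' n w i T b).
  - rewrite (ind_true (crowd' n w i T b)) by assumption. rewrite Rmult_1_r.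
    assert (I0 := ind_range (hT n w i T)). assert (I1 := ind_range (Bk n w i b)). assert (I2 := ind_range (T b)).
    match goal with |- _ <= _ + _ + _ * ind ?P => assert (I3 := ind_range P) end.
    destruct (crowd_hits w i T b Hi HT Hb c) as [H|[H|H]].
    + rewrite (ind_true _ H). nra.
    + rewrite (ind_true _ H). nra.
    + rewrite (ind_true _ H). nra.
  - rewrite (ind_false (crowd' n w i T b)) by assumption. rewrite Rmult_0_r.
    assert (I0 := ind_range (hT n w i T)).
    assert (I1 := ind_range (Bk n w i b)). assert (I2 := ind_range (T b)).
    match goal with |- _ <= _ + _ + _ * ind ?P => assert (I3 := ind_range P) end.
    nra.
Qed.

End Crowd.

Lemma Rmult_div_cancel a b : b <> 0 -> b * (a / b) = a.
Proof. intros; field; assumption. Qed.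

Lemma consts_ok delta bl c1 c2 : 0 < delta <= 1 -> 0 < bl < 1 -> 0 < c1 <= c2 -> 0 < delta * bl * c1 <= c2.
Proof. intros. assert (0 < delta * bl <= 1) by nra. nra. Qed.

(** After summing [crowd_single] over [b], the difficulty is the size of the backward cluster of [i]
    on the event [hT], whose probability may decay polynomially. A cluster beyond [eta * n] has
    exponentially small probability and is negligible even against that event; a smaller one
    contributes at most a fraction [eta] of the firms. *)
Lemma crowd_rare (k : nat) delta bl c1 c2 tau :
  0 < delta <= 1 -> 0 < bl < 1 -> 0 < c1 <= c2 -> 0 < tau ->
  exists eps N, 0 < eps /\ forall n beta q, (N <= n)%nat -> net_ok n beta delta q bl c1 c2 ->
  lam0 n beta delta q <= 1 + eps ->
  forall i (T : nat -> Prop), (i < n)%nat -> (forall t, T t -> (t < n)%nat /\ t <> i) -> card n T <= INR k ->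
  sumR n (fun b => EN n beta delta q (fun w => ind (hT n w i T /\ crowd' n w i T b)))
    <= tau * INR n * EN n beta delta q (fun w => ind (hT n w i T)).
Proof.
  intros Hd Hbl Hc Ht. assert (HcC := consts_ok _ _ _ _ Hd Hbl Hc).
  destruct (cluster_tail (delta * bl * c1) c2 (tau / 8) HcC ltac:(lra)) as [M1 [e1 [N1 [HM1 [He1 T1]]]]].
  destruct (cluster_tail (delta * bl * c1) c2 (tau / (8 * M1)) HcC) as [M2 [e2 [N2 [HM2 [He2 T2]]]]].
  { apply Rdiv_lt_0_compat; lra. }
  set (B := 1 + M2 * (c2 * c2)). assert (HB : 1 < B) by (unfold B; assert (0 < c2 * c2) by nra; nra).
  set (eta := Rmin 1 (tau / (8 * B))).
  assert (Heta : 0 < eta <= 1).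
  { split; [apply Rmin_glb_lt; [lra|apply Rdiv_lt_0_compat; lra]|apply Rmin_l]. }
  assert (HetaB : eta * B <= tau / 8).
  { apply Rle_trans with (tau / (8 * B) * B); [apply Rmult_le_compat_r; [lra|apply Rmin_r]|]. right; field; lra. }
  destruct (large_deviation (delta * bl * c1) c2 eta HcC Heta) as [e3 [gam [N3 [He3 [Hgam T3]]]]].
  set (p0 := Rmin 1 (bl * (c1 * c1))).
  assert (Hp0 : 0 < p0) by (apply Rmin_glb_lt; [lra|assert (0 < c1 * c1) by nra; nra]).
  destruct (exp_beats_pow gam k (16 * B / (tau * p0 ^ k)) Hgam) as [N4 HN4].
  { apply Rdiv_lt_0_compat; [lra|]. apply Rmult_lt_0_compat; [lra|now apply pow_lt]. }
  destruct (INR_large (8 * (INR k * (1 + (M1 + M2) * (c2 * c2))) / tau)) as [N5 HN5].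
  exists (Rmin e1 (Rmin e2 e3)), (N1 + N2 + N3 + N4 + N5)%nat.
  split; [repeat apply Rmin_glb_lt; assumption|].
  intros n beta q HN Hnet Hl i T Hi HT Hk.
  assert (L1 : lam0 n beta delta q <= 1 + e1) by (eapply Rle_trans; [apply Hl|]; apply Rplus_le_compat_l, Rmin_l).
  assert (L2 : lam0 n beta delta q <= 1 + e2).
  { eapply Rle_trans; [apply Hl|]. apply Rplus_le_compat_l. eapply Rle_trans; [apply Rmin_r|apply Rmin_l]. }
  assert (L3 : lam0 n beta delta q <= 1 + e3).
  { eapply Rle_trans; [apply Hl|]. apply Rplus_le_compat_l. eapply Rle_trans; [apply Rmin_r|apply Rmin_r]. }
  assert (Nn := net_n_pos _ _ _ _ _ _ _ Hnet).
  assert (Hok := net_okp _ _ _ _ _ _ _ Hnet).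
  set (ks := keys n) in *. set (pr := prob beta delta (fun _ => 0) q) in *.
  set (pbar := c2 * c2 / INR n). assert (Hpb : 0 <= pbar) by (apply Rmult_le_pos; [nra|left; now apply Rinv_0_lt_compat]).
  assert (Hdir : forall i j, (i < n)%nat -> (j < n)%nat -> i <> j ->
     Expect ks pr (fun w => ind (w (Dir i j) = true)) <= pbar).
  { intros a b Ha Hb Hab. eapply Rle_trans; [right; apply (EN_Dir n beta delta q a b Ha Hb Hab)|].
    apply (net_p _ _ _ _ _ _ _ Hnet a b Ha Hb). }
  assert (F := fwd_ok _ _ _ _ _ _ _ Hnet). assert (Bo := bwd_ok _ _ _ _ _ _ _ Hnet).
  assert (FT := T1 _ _ _ _ _ _ _ F ltac:(lia)). cbv beta in FT. rewrite fwd_lam in FT. specialize (FT L1).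
  assert (BT := T2 _ _ _ _ _ _ _ Bo ltac:(lia)). cbv beta in BT. rewrite bwd_lam in BT. specialize (BT L2).
  assert (LD := T3 _ _ _ _ _ _ _ Bo ltac:(lia)). cbv beta in LD. rewrite bwd_lam in LD. specialize (LD L3 i Hi).
  set (H := EN n beta delta q (fun w => ind (hT n w i T))).
  assert (Hlow := hT_lower n beta delta q bl c1 c2 Hnet i T k Hi HT Hk). fold H p0 in Hlow.
  assert (cT := card_nonneg n T).
  set (tau2 := tau / (8 * M1)) in *.
  assert (Ht2 : 0 < tau2) by (apply Rdiv_lt_0_compat; lra).
  assert (Hm : M1 * tau2 = tau / 8) by (unfold tau2; field; lra).
  eapply Rle_trans.
  { apply sumR_le. intros b Hb.
    apply (crowd_single n beta delta q pbar Hok Hpb Hdir M1 M2 (tau / 8) tau2 ltac:(lra) ltac:(lra) ltac:(lra) FT BT i T b Hi HT Hb ltac:(lra)). }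
  fold ks pr.
  rewrite !sumR_plus, sumR_const.
  rewrite (sumR_ext n (fun b => ind (T b) * _) (fun b => H * ind (T b))) by (intros; unfold H, EN; fold ks pr; ring).
  rewrite sumR_scal. fold (card n T).
  set (Q := Expect ks pr (fun w => ind (hT n w i T) * card n (Bk n w i))).
  assert (EQ1 : sumR n (fun i0 => Expect ks pr (fun w => ind (hT n w i T) * ind (Bk n w i i0))) = Q).
  { rewrite <- Expect_sumR. apply Expect_ext. intros w _. now rewrite sumR_scal. }
  rewrite EQ1.
  assert (EQ2 : Expect ks pr (fun w => ind (hT n w i T) * (tau / 8 + M1 * tau2
       + (M2 * (card n (Bk n w i) + card n T) + M1 * card n T) * pbar))
     = (tau / 4 + (M2 + M1) * card n T * pbar) * H + M2 * pbar * Q).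
  { unfold Q, H, EN. rewrite <- !Expect_scal, <- Expect_plus. apply Expect_ext. intros w _. rewrite Hm. field. }
  rewrite EQ2.
  assert (HQ : Q <= eta * INR n * H + INR n * (2 * exp (- (gam * INR n)))).
  { eapply Rle_trans.
    - apply (Expect_le ks pr _ (fun w => eta * INR n * ind (hT n w i T) +
         INR n * ind (eta * INR n <= card n (Bk n w i)))); auto. intros w _.
      assert (I0 := ind_range (hT n w i T)). assert (CB := card_le_n n (Bk n w i)).
      unfold ind at 3. em (eta * INR n <= card n (Bk n w i)).
      + nra.
      + nra.
    - rewrite Expect_plus, !Expect_scal. apply Rplus_le_compat_l, Rmult_le_compat_l; [lra|apply LD]. }
  (* The exponential bound against the polynomial lower bound of [hT_lower]. *)
  assert (HE : B * (2 * exp (- (gam * INR n))) <= tau / 8 * H).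
  { specialize (HN4 n ltac:(lia)).
    assert (Hpk : 0 < p0 ^ k) by now apply pow_lt.
    assert (Hnk : 0 < INR n ^ k) by now apply pow_lt.
    apply Rle_trans with (tau / 8 * (p0 / INR n) ^ k); [|apply Rmult_le_compat_l; lra].
    unfold Rdiv. rewrite Rpow_mult_distr, pow_inv.
    apply (Rmult_le_reg_r (8 * INR n ^ k / (tau * p0 ^ k))).
    - apply Rdiv_lt_0_compat; [lra|apply Rmult_lt_0_compat; lra].
    - replace (tau * / 8 * (p0 ^ k * / INR n ^ k) * (8 * INR n ^ k / (tau * p0 ^ k))) with 1 by (field; lra).
      eapply Rle_trans; [|apply HN4]. right. field. lra. }
  assert (H0 : 0 <= H) by (apply Expect_ind_range; assumption).
  specialize (HN5 n ltac:(lia)).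
  assert (HcT : card n T * (1 + (M1 + M2) * (c2 * c2)) <= tau / 8 * INR n).
  { apply Rle_trans with (INR k * (1 + (M1 + M2) * (c2 * c2))).
    - apply Rmult_le_compat_r; [assert (0 < c2 * c2) by nra; nra|assumption].
    - apply (Rmult_le_compat_l (tau / 8)) in HN5; [|lra].
      replace (tau / 8 * (8 * (INR k * (1 + (M1 + M2) * (c2 * c2))) / tau))
        with (INR k * (1 + (M1 + M2) * (c2 * c2))) in HN5 by (field; lra). lra. }
  assert (Hnp : INR n * pbar = c2 * c2) by (unfold pbar; field; lra).
  replace (INR n * ((tau / 4 + (M2 + M1) * card n T * pbar) * H + M2 * pbar * Q))
    with (INR n * (tau / 4) * H + (M2 + M1) * card n T * (INR n * pbar) * H + M2 * (INR n * pbar) * Q) by ring.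
  rewrite Hnp.
  assert (S1 : B * Q <= tau / 8 * INR n * H + INR n * (tau / 8 * H)).
  { apply Rle_trans with (B * (eta * INR n * H + INR n * (2 * exp (- (gam * INR n))))).
    - apply Rmult_le_compat_l; lra.
    - assert (eta * B * (INR n * H) <= tau / 8 * (INR n * H)) by (apply Rmult_le_compat_r; [nra|lra]).
      nra. }
  assert (S2 : card n T * (1 + (M1 + M2) * (c2 * c2)) * H <= tau / 8 * INR n * H) by (apply Rmult_le_compat_r; lra).
  assert (S3 : 0 <= INR n * H) by nra.
  replace (Q + H * card n T + (INR n * (tau / 4) * H + (M2 + M1) * card n T * (c2 * c2) * H + M2 * (c2 * c2) * Q))
    with (B * Q + card n T * (1 + (M1 + M2) * (c2 * c2)) * H + INR n * (tau / 4) * H) by (unfold B; ring).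
  nra.
Qed.

(** * Proprietary technologies *)

(** The ideas that a listening link from [i] to [x] would bring, without reading whether that link
    is present. Paths back through [i] are excluded. *)
Definition Kx (n : nat) (w : Outcome) (i x t : nat) : Prop :=
  (t < n)%nat /\ t <> i /\
  (t = x \/ (w (Ind i x) = true /\ exists m, bko n w i x m /\ w (Dir m t) = true)).

Definition knw (n : nat) (w : Outcome) (i : nat) (T : nat -> Prop) (m : nat) : Prop :=
  forall t, T t -> t = m \/ exists m', bko n w i m m' /\ w (Dir m' t) = true.

(** Idea [i], once heard by [j], travels on to a firm that knows [T] independently of [i]. *)
Definition crowd (n : nat) (w : Outcome) (i : nat) (T : nat -> Prop) (j : nat) : Prop :=
  exists m, dsc n w i j m /\ knw n w i T m.

(** A listener [j] of [i] breaks the secret in two ways: by learning indirectly it inherits all that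
    [i] knows, or it passes idea [i] to a firm that already has the rest. *)
Definition leak (n : nat) (w : Outcome) (i : nat) (T : nat -> Prop) (j : nat) : Prop :=
  w (Dir j i) = true /\ (w (Ind j i) = true \/ crowd n w i T j).

Definition sec (n : nat) (w : Outcome) (i : nat) (T : nat -> Prop) : Prop :=
  forall j, (j < n)%nat -> j <> i -> ~ leak n w i T j.

Definition Tof (n : nat) (t : list bool) (i j : nat) : Prop := (j < n)%nat /\ j <> i /\ mem t j.

(** Everything is learned through some first listening link of [i]; a path that returns to [i] can
    be cut at its last visit. *)
Lemma Lrn_cover n w i t : (i < n)%nat ->
  Lrn n w i t <-> exists x, (x < n)%nat /\ x <> i /\ w (Dir i x) = true /\ Kx n w i x t.
Proof.
  intros Hi. split.
  - intros [Ht [Hti [m [Hm Hd]]]].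
    assert (C : m = i \/ exists x, (x < n)%nat /\ x <> i /\ w (Dir i x) = true /\ w (Ind i x) = true /\ bko n w i x m).
    { clear Hd. induction Hm as [v ->|u v Hr IH [Hv Hvi] [E1 E2]]; [now left|right].
      destruct IH as [-> |[x [Hx [Hxi [D1 [D2 B]]]]]].
      - exists v. repeat (split; [assumption|]). now apply Rch_base.
      - exists x. repeat (split; [assumption|]). destruct (Nat.eq_dec v x) as [->|Hvx]; [now apply Rch_base|].
        apply (Rch_step _ _ _ u v); [assumption|tauto|split; assumption]. }
    destruct C as [-> |[x [Hx [Hxi [D1 [D2 B]]]]]].
    + exists t. repeat (split; [assumption|]). now left.
    + exists x. repeat (split; [assumption|]). right. split; [assumption|]. now exists m.
  - intros [x [Hx [Hxi [D1 [Ht [Hti H]]]]]]. split; [assumption|]. split; [assumption|].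
    destruct H as [-> |[D2 [m [B Hd]]]].
    + exists i. split; [now apply Rch_base|assumption].
    + exists m. split; [|assumption]. clear Hd.
      assert (Bx : Bk n w i x) by (apply (Rch_step _ _ _ i x); [now apply Rch_base|tauto|split; assumption]).
      induction B as [v ->|u v Hr IH Hv Huv]; [assumption|].
      apply (Rch_step _ _ _ u v); tauto.
Qed.

Section Reach.

Variables (n : nat) (w : Outcome).
Hypothesis Hw : supp (keys n) w.

Lemma Dir_supp a b : w (Dir a b) = true -> (a < n)%nat /\ (b < n)%nat /\ a <> b.
Proof. intros H. apply in_keys_Dir. now apply Hw. Qed.

Lemma bwd_reach (A U : nat -> Prop) i m : (forall v, A v -> v = i) -> Rch (bwd w) A U m -> reach w m i.
Proof.
  intros HA H. induction H as [v Hv|u v Hr IH Hv Huv].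
  - rewrite (HA v Hv). apply rt_refl.
  - eapply rt_trans; [|apply IH]. now apply rt_step.
Qed.

Lemma fwd_reach (A U : nat -> Prop) j m : (forall v, A v -> v = j) -> Rch (fwd w) A U m -> reach w j m.
Proof.
  intros HA H. induction H as [v Hv|u v Hr IH Hv Huv].
  - rewrite (HA v Hv). apply rt_refl.
  - eapply rt_trans; [apply IH|]. now apply rt_step.
Qed.

Lemma reach_Bk m i : reach w m i -> Bk n w i m.
Proof.
  intros H. apply clos_rt_rt1n in H. induction H as [x|x y z Hxy Hyz IH]; [now apply Rch_base|].
  destruct (Nat.eq_dec x z) as [->|Hx]; [now apply Rch_base|].
  apply (Rch_step _ _ _ y x IH); [|exact Hxy]. split; auto. apply (Dir_supp y x), Hxy.
Qed.

(** If nobody learns indirectly through [i], no path leaves [i], so paths to other firms avoid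
    it. *)
Lemma reach_bko i m x : (forall u, ~ ind_edge w i u) -> m <> i -> reach w x m -> bko n w i m x.
Proof.
  intros Hno Hm H. apply clos_rt_rt1n in H. induction H as [x|x y z Hxy Hyz IH]; [now apply Rch_base|].
  destruct (Nat.eq_dec x z) as [->|Hx]; [now apply Rch_base|].
  apply (Rch_step _ _ _ y x (IH Hm)); [|exact Hxy]. split; [|split; auto].
  - apply (Dir_supp y x), Hxy.
  - intros ->. apply (Hno y), Hxy.
Qed.

Lemma reach_dsc i m x : (forall u, ~ ind_edge w i u) -> m <> i -> reach w x m -> dsc n w i x m.
Proof.
  intros Hno Hm H. apply clos_rt_rtn1 in H. induction H as [|y z Hyz Hxy IH]; [now apply Rch_base|].
  destruct (Nat.eq_dec z x) as [->|Hx]; [now apply Rch_base|].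
  assert (y <> i) by (intros ->; now apply (Hno z)).
  apply (Rch_step _ _ _ y z (IH H)); [|exact Hyz]. split; [|split; auto]. apply (Dir_supp z y), Hyz.
Qed.

(** The purpose is separation of coins: [hT] never reads a link to [i], and [sec] never reads a link
    by which [i] listens. The two effects of openness thus act on different factors. *)
Lemma in_PT_iff k i t : (i < n)%nat ->
  in_PT n k w i t <-> technology n k w t /\ mem t i /\ hT n w i (Tof n t i) /\ sec n w i (Tof n t i).
Proof.
  intros Hi. split.
  - intros [Ht [Hmi [Hk Hno]]]. split; [assumption|]. split; [assumption|].
    assert (Hdisc : forall j, (j < n)%nat -> mem t j -> w (Disc j) = true) by apply Ht.
    split.
    + intros j [Hj [Hji Hjt]]. destruct (Hk j Hj Hjt) as [|[_ [_ [_ [m [Hm [Hr Hd]]]]]]]; [contradiction|].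
      split; [assumption|]. split; [assumption|]. exists m. split; [now apply reach_Bk|assumption].
    + intros j Hj Hji [Hd [Hind|[m [Hdm Hkm]]]].
      * apply (Hno j Hj Hji). intros j2 Hj2 Hmem. destruct (Nat.eq_dec j2 j) as [->|Hne]; [now left|right].
        split; [assumption|]. split; [now apply Hdisc|]. split; [assumption|].
        destruct (Nat.eq_dec j2 i) as [->|Hni].
        -- exists j. split; [assumption|]. split; [apply rt_refl|assumption].
        -- destruct (Hk j2 Hj2 Hmem) as [|[_ [_ [_ [m [Hm [Hr Hdm]]]]]]]; [contradiction|].
           exists m. split; [assumption|]. split; [|assumption].
           eapply rt_trans; [apply Hr|]. apply rt_step. split; assumption.
      * assert (Hmn : (m < n)%nat /\ m <> i) by (apply Rch_in in Hdm; destruct Hdm as [-> |]; tauto).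
        apply (Hno m); [tauto|tauto|]. intros j2 Hj2 Hmem.
        destruct (Nat.eq_dec j2 m) as [->|Hne]; [now left|right].
        split; [assumption|]. split; [now apply Hdisc|]. split; [assumption|].
        destruct (Nat.eq_dec j2 i) as [->|Hni].
        -- exists j. split; [assumption|]. split; [|assumption].
           eapply fwd_reach; [|apply Hdm]. auto.
        -- destruct (Hkm j2) as [|[m' [Hb Hd']]]; [unfold Tof; tauto|contradiction|].
           exists m'. split; [apply Rch_in in Hb; destruct Hb as [-> |]; tauto|].
           split; [|assumption]. eapply bwd_reach; [|apply Hb]. auto.
  - intros [Ht [Hmi [Hh Hs]]]. split; [assumption|]. split; [assumption|].
    assert (Hdisc : forall j, (j < n)%nat -> mem t j -> w (Disc j) = true) by apply Ht.
    split.
    + intros j Hj Hjt. destruct (Nat.eq_dec j i) as [->|Hji]; [now left|right].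
      destruct (Hh j) as [_ [_ [m [Hm Hd]]]]; [unfold Tof; tauto|].
      split; [assumption|]. split; [now apply Hdisc|]. split; [assumption|].
      exists m. split; [now apply (Bk_lt n w i)|]. split; [|assumption].
      eapply bwd_reach; [|apply Hm]. auto.
    + intros m Hm Hmi' Hkn.
      (* Secrecy forbids indirect learning through [i], so the paths used by a rival avoid [i]. *)
      assert (Hno : forall u, ~ ind_edge w i u).
      { intros u [Hd Hi2]. destruct (Dir_supp u i Hd) as [Hu [_ Hui]].
        apply (Hs u Hu Hui). split; auto. }
      destruct (Hkn i Hi Hmi) as [|[_ [_ [_ [m' [Hm' [Hr Hd]]]]]]]; [congruence|].
      destruct (Dir_supp m' i Hd) as [_ [_ Hmi2]].
      apply (Hs m' Hm' Hmi2). split; [assumption|]. right. exists m. split; [now apply reach_dsc|].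
      intros j [Hj [Hji Hjt]]. destruct (Hkn j Hj Hjt) as [|[_ [_ [_ [m2 [Hm2 [Hr2 Hd2]]]]]]]; [now left|right].
      exists m2. split; [now apply reach_bko|assumption].
Qed.

End Reach.

(** Forgets the discoveries. The network events at [w] and at [strip w] are convertible, which
    proves that they read no [Disc] coin. *)
Definition strip (w : Outcome) : Outcome := fun v => match v with Disc _ => false | _ => w v end.

Definition ndisc (v : Var) : Prop := forall j, v <> Disc j.

Lemma strip_eq w w' : (forall v, ndisc v -> w v = w' v) -> strip w = strip w'.
Proof.
  intros H. extensionality v. destruct v; simpl; [reflexivity| |]; apply H; intros j' E; discriminate.
Qed.

Lemma fT_ndisc n i T : dep ndisc (fun w => ind (hT n w i T /\ sec n w i T)).
Proof.
  intros w w' E. apply strip_eq in E.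
  change (ind (hT n (strip w) i T /\ sec n (strip w) i T) = ind (hT n (strip w') i T /\ sec n (strip w') i T)).
  now rewrite E.
Qed.

(* By [in_PT_iff], the probability that [{i}] together with [T] is proprietary to [i], given that
   all its ideas are discovered. *)
Definition GT (n : nat) (beta : nat -> R) (delta : R) (q : nat -> R) (i : nat) (T : nat -> Prop) : R :=
  EN n beta delta q (fun w => ind (hT n w i T /\ sec n w i T)).

Definition tech_of (k : nat) (i : nat) (t : list bool) : Prop :=
  length (filter (fun b => b) t) = k /\ mem t i.

(** The probability that the other ideas of a technology of [i] are discovered. *)
Definition wt (n k : nat) (p : nat -> R) (i : nat) (t : list bool) : R :=
  ind (tech_of k i t) * prodA n (Tof n t i) p.

Definition GG (n k : nat) (beta : nat -> R) (delta : R) (p q : nat -> R) (i : nat) : R :=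
  lsum (blists n) (fun t => wt n k p i t * GT n beta delta q i (Tof n t i)).

Lemma blists_length n t : In t (blists n) -> length t = n.
Proof.
  revert t; induction n; simpl; intros t H.
  - destruct H as [<-|[]]. reflexivity.
  - apply in_app_or in H. destruct H as [H|H]; apply in_map_iff in H; destruct H as [s [<- Hs]];
      simpl; rewrite IHn; auto.
Qed.

(** Discoveries are independent of the network and idea [i] itself contributes the factor [p i].
    Hence [GG] is free of [p i], and the choice of [q i] affects the payoff only through [GG]. *)
Lemma payoff_eq n k delta beta c p q i : (i < n)%nat ->
  payoff n k delta beta c p q i = p i * GG n k beta delta p q i - c (p i).
Proof.
  intros Hi. unfold payoff. f_equal.
  change (Expect (keys n) (prob beta delta p q) (fun w => lsum (blists n) (fun t => ind (in_PT n k w i t)))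
    = p i * GG n k beta delta p q i).
  rewrite Expect_lsum. unfold GG. rewrite <- lsum_scal. apply lsum_ext. intros t Ht.
  apply blists_length in Ht.
  set (T := Tof n t i).
  rewrite (Expect_ext _ _ _ (fun w => ind (tech_of k i t) *
     (prodR n (fun j => pw (mem t j) (ind (w (Disc j) = true))) * ind (hT n w i T /\ sec n w i T)))).
  2: { intros w Hw. rewrite (ind_iff _ _ (in_PT_iff n w Hw k i t Hi)).
       assert (D : prodR n (fun j => pw (mem t j) (ind (w (Disc j) = true)))
                   = ind (forall j, (j < n)%nat -> mem t j -> w (Disc j) = true)).
       { unfold ind at 2. em (forall j, (j < n)%nat -> mem t j -> w (Disc j) = true).
         - apply prodR_one. intros j Hj. unfold pw. em (mem t j); [apply ind_true; auto|reflexivity].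
         - apply not_all_ex_not in n0. destruct n0 as [j Hj]. apply imply_to_and in Hj. destruct Hj as [Hj Hj'].
           apply imply_to_and in Hj'. destruct Hj' as [Hm Hd].
           apply (prodR_zero n _ j); auto. rewrite pw_true by assumption. now apply ind_false. }
       rewrite D, <- !ind_and. apply ind_iff. unfold technology, tech_of. tauto. }
  rewrite Expect_scal.
  rewrite (Expect_indep _ _ (fun v => exists j, v = Disc j)).
  - rewrite (Expect_prodR _ _ n (fun j v => v = Disc j) (fun j w => pw (mem t j) (ind (w (Disc j) = true)))).
    + rewrite (Expect_prob_ext _ _ (prob beta delta (fun _ => 0) q) ndisc (fun w => ind (hT n w i T /\ sec n w i T))).
      *
        unfold wt. destruct (classic (tech_of k i t)) as [Htk|Htk];
          [|rewrite (ind_false _ Htk); ring].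
        rewrite (ind_true _ Htk). destruct Htk as [_ Hmi]. rewrite !Rmult_1_l.
        rewrite <- Rmult_assoc. f_equal.
        rewrite (prodR_single n i) by assumption. f_equal.
        -- unfold pw. em (mem t i); [|contradiction].
           rewrite Expect_var; [reflexivity|apply NoDup_keys|now apply in_keys_Disc].
        -- apply prodR_ext. intros j Hj. destruct (Nat.eq_dec j i) as [->|Hji].
           ++ rewrite pw_false; [reflexivity|]. unfold T, Tof; tauto.
           ++ fold T. unfold pw. em (mem t j); em (T j); try (unfold T, Tof in *; tauto).
              ** rewrite Expect_var; [reflexivity|apply NoDup_keys|now apply in_keys_Disc].
              ** apply Expect_const.
      * apply fT_ndisc.
      * intros v _ Hv. destruct v as [j| |]; [now destruct (Hv j)|reflexivity|reflexivity].
    + intros j _ w w' E. unfold pw. em (mem t j); [|reflexivity]. now rewrite E.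
    + intros j j' v _ _ -> E. now injection E.
  - apply dep_prodR. intros j _ w w' E. unfold pw. em (mem t j); [|reflexivity]. now rewrite E by eauto.
  - eapply dep_weaken; [|apply fT_ndisc]. intros v Hv [j Hj]. now apply (Hv j).
Qed.

Lemma wt_upd n k p i x t : wt n k (upd p i x) i t = wt n k p i t.
Proof.
  unfold wt. f_equal. apply prodR_ext. intros j _. unfold pw. em (Tof n t i j); [|reflexivity].
  unfold upd. destruct (Nat.eq_dec j i); [unfold Tof in *; tauto|reflexivity].
Qed.

Lemma GG_upd n k beta delta p q i x : GG n k beta delta (upd p i x) q i = GG n k beta delta p q i.
Proof. apply lsum_ext. intros t _. now rewrite wt_upd. Qed.

Lemma Tof_ok n t i : forall j, Tof n t i j -> (j < n)%nat /\ j <> i.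
Proof. unfold Tof; tauto. Qed.

Lemma card_mem n t : length t = n -> card n (mem t) = INR (length (filter (fun b => b) t)).
Proof.
  revert n; induction t as [|b t IH] using rev_ind; intros n Hn.
  - subst n. reflexivity.
  - rewrite length_app in Hn. simpl in Hn. destruct n as [|m]; [lia|].
    rewrite filter_app, length_app, plus_INR. unfold card. simpl.
    assert (Hm : length t = m) by lia.
    f_equal.
    + rewrite <- (IH m Hm). apply sumR_ext. intros j Hj. apply ind_iff. unfold mem. rewrite app_nth1; [tauto|lia].
    + unfold mem. rewrite app_nth2 by lia. rewrite Hm, Nat.sub_diag.
      destruct b; [now apply ind_true|now apply ind_false].
Qed.

Lemma card_Tof n k t i : (i < n)%nat -> length t = n -> tech_of k i t ->
  card n (Tof n t i) = INR k - 1.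
Proof.
  intros Hi Hl [Hk Hm]. rewrite <- Hk, <- (card_mem n t Hl), (card_split n (mem t) (fun j => j = i)).
  assert (E : card n (fun v => mem t v /\ v = i) = 1).
  { rewrite <- (card_single n i Hi). apply card_ext. intros v _. split; [tauto|now intros ->]. }
  rewrite E. replace (card n (fun v => mem t v /\ v <> i)) with (card n (Tof n t i)); [ring|].
  apply card_ext. intros v Hv. unfold Tof. tauto.
Qed.

(** * First-order effects of openness *)

(** [nx] leaves out the coins of links by which [i] listens, [ny] those of links by which others
    listen to [i]; neither contains discoveries. *)
Definition nx (i : nat) (v : Var) : Prop :=
  match v with Disc _ => False | Dir a _ => a <> i | Ind a _ => a <> i end.
Definition ny (i : nat) (v : Var) : Prop :=
  match v with Disc _ => False | Dir _ b => b <> i | Ind _ b => b <> i end.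

Definition nsum (n i : nat) (f : nat -> R) : R :=
  sumR n (fun x => if Nat.eq_dec x i then 0 else f x).

Lemma nsum_le n i f g : (forall x, (x < n)%nat -> x <> i -> f x <= g x) -> nsum n i f <= nsum n i g.
Proof. intros H. apply sumR_le. intros x Hx. destruct (Nat.eq_dec x i); [lra|auto]. Qed.

Lemma nsum_ext n i f g : (forall x, (x < n)%nat -> x <> i -> f x = g x) -> nsum n i f = nsum n i g.
Proof. intros H. apply sumR_ext. intros x Hx. destruct (Nat.eq_dec x i); auto. Qed.

Lemma nsum_plus n i f g : nsum n i (fun x => f x + g x) = nsum n i f + nsum n i g.
Proof. unfold nsum. rewrite <- sumR_plus. apply sumR_ext. intros x _. destruct (Nat.eq_dec x i); lra. Qed.

Lemma nsum_scal n i a f : nsum n i (fun x => a * f x) = a * nsum n i f.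
Proof. unfold nsum. rewrite <- sumR_scal. apply sumR_ext. intros x _. destruct (Nat.eq_dec x i); lra. Qed.

Lemma nsum_nonneg n i f : (forall x, (x < n)%nat -> x <> i -> 0 <= f x) -> 0 <= nsum n i f.
Proof. intros H. apply sumR_nonneg. intros x Hx. destruct (Nat.eq_dec x i); [lra|auto]. Qed.

Lemma nsum_le_sumR n i f g : (forall x, (x < n)%nat -> 0 <= g x) ->
  (forall x, (x < n)%nat -> x <> i -> f x <= g x) -> nsum n i f <= sumR n g.
Proof. intros H0 H. apply sumR_le. intros x Hx. destruct (Nat.eq_dec x i); auto. Qed.

Lemma Expect_nsum ks pr n i (f : nat -> Outcome -> R) :
  Expect ks pr (fun w => nsum n i (fun x => f x w)) = nsum n i (fun x => Expect ks pr (f x)).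
Proof.
  unfold nsum. rewrite Expect_sumR. apply sumR_ext. intros x _.
  destruct (Nat.eq_dec x i); [apply Expect_const|reflexivity].
Qed.

Lemma Expect_on_true ks pr f v : NoDup ks -> In v ks ->
  pr v * Expect ks pr (fun w => f (setv w v true)) = Expect ks pr (fun w => ind (w v = true) * f w).
Proof.
  intros Hnd Hin. rewrite (Expect_split ks pr (fun w => ind (w v = true) * f w) v Hnd Hin).
  rewrite (Expect_ext ks pr (fun w => ind (setv w v true v = true) * f (setv w v true)) (fun w => f (setv w v true))),
    (Expect_ext ks pr (fun w => ind (setv w v false v = true) * f (setv w v false)) (fun _ => 0)).
  - rewrite Expect_const. ring.
  - intros w _. rewrite setv_same, ind_false; [ring|discriminate].
  - intros w _. rewrite setv_same, ind_true; [ring|reflexivity].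
Qed.

Lemma Expect_on_false ks pr f v : NoDup ks -> In v ks ->
  pr v * Expect ks pr (fun w => f (setv w v false)) = Expect ks pr (fun w => ind (w v = true) * f (setv w v false)).
Proof.
  intros Hnd Hin. rewrite <- (Expect_on_true ks pr (fun w => f (setv w v false)) v Hnd Hin).
  f_equal. apply Expect_ext. intros w _. now rewrite setv_setv.
Qed.

Lemma Expect_off_le ks pr f v : okp ks pr -> NoDup ks -> In v ks -> (forall w, supp ks w -> 0 <= f w) ->
  (1 - pr v) * Expect ks pr (fun w => f (setv w v false)) <= Expect ks pr f.
Proof.
  intros Hok Hnd Hin Hf. rewrite (Expect_split ks pr f v Hnd Hin).
  assert (0 <= pr v * Expect ks pr (fun w => f (setv w v true))); [|lra].
  apply Rmult_le_pos; [now apply Hok|]. apply Expect_nonneg; auto.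
  intros w Hw. apply Hf. now apply supp_setv_in.
Qed.

Section Deps.

Variables (n i : nat) (T : nat -> Prop).
Hypothesis Hi : (i < n)%nat.
Hypothesis HT : forall t, T t -> (t < n)%nat /\ t <> i.

Lemma hT_ext w w' : (forall v, ny i v -> w v = w' v) -> hT n w i T -> hT n w' i T.
Proof.
  intros E H t Ht. destruct (H t Ht) as [H1 [H2 [m [H3 H4]]]]. split; [auto|]. split; [auto|].
  exists m. split; [|rewrite <- E; auto].
  unfold Bk in *. rewrite <- (Rch_ext_on (bwd w) (bwd w')); [assumption|].
  intros a u _ [_ Hu]. apply edge_eq; apply E; simpl; auto.
Qed.

Lemma hT_dep : dep (ny i) (fun w => hT n w i T).
Proof.
  intros w w' E. apply propositional_extensionality. split; apply hT_ext; auto. intros; symmetry; auto.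
Qed.

Lemma bko_ext w w' x : x <> i -> (forall v, nx i v -> ny i v -> w v = w' v) -> bko n w i x = bko n w' i x.
Proof.
  intros Hx E. apply Rch_ext_on. intros a u Ha [_ [Hu _]].
  assert (a <> i) by (destruct Ha as [-> |]; tauto). apply edge_eq; apply E; simpl; auto.
Qed.

Lemma bko_in w x m : x <> i -> bko n w i x m -> m <> i.
Proof. intros Hx H. apply Rch_in in H. destruct H as [-> |]; tauto. Qed.

Lemma touch_dep x : x <> i -> dep (fun v => nx i v /\ ny i v) (fun w => touch n w i T x).
Proof.
  intros Hx w w' E. assert (E' : forall v, nx i v -> ny i v -> w v = w' v) by auto.
  apply propositional_extensionality. unfold touch. rewrite (bko_ext w w' x Hx E').
  split; intros [t [Ht H]]; exists t; (split; [assumption|]); destruct H as [|[m [Hm Hd]]]; [now left|right|now left|right];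
    exists m; (split; [assumption|]); destruct (HT t Ht); [rewrite <- E'|rewrite E']; simpl; auto; eapply (bko_in w' x); eauto.
Qed.

Lemma crowd_dep j : j <> i -> dep (fun v => nx i v /\ ny i v) (fun w => crowd n w i T j).
Proof.
  intros Hj w w' E. assert (E' : forall v, nx i v -> ny i v -> w v = w' v) by auto.
  apply propositional_extensionality. unfold crowd.
  assert (Ed : dsc n w i j = dsc n w' i j).
  { apply Rch_ext_on. intros a u Ha [_ [Hu _]].
    assert (a <> i) by (destruct Ha as [-> |]; tauto). apply edge_eq; apply E'; simpl; auto. }
  rewrite Ed.
  assert (Hm : forall m, dsc n w' i j m -> m <> i).
  { intros m Hd. apply Rch_in in Hd. destruct Hd as [-> |]; tauto. }
  assert (Ek : forall m, m <> i -> knw n w i T m <-> knw n w' i T m).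
  { intros m Hmi. unfold knw. rewrite (bko_ext w w' m Hmi E').
    split; intros H t Ht; (destruct (H t Ht) as [|[m' [Hm' Hd]]]; [now left|right]);
      exists m'; (split; [assumption|]); destruct (HT t Ht); [rewrite <- E'|rewrite E']; simpl; auto;
      eapply (bko_in w' m); eauto. }
  split; intros [m [H1 H2]]; exists m; (split; [assumption|]); apply Ek; auto.
Qed.

Lemma Kx_dep x : x <> i -> dep (fun v => (nx i v /\ ny i v) \/ v = Ind i x) (fun w => Kx n w i x).
Proof.
  intros Hx w w' E. assert (E' : forall v, nx i v -> ny i v -> w v = w' v) by auto.
  extensionality t. apply propositional_extensionality. unfold Kx.
  rewrite (bko_ext w w' x Hx E'), (E (Ind i x)) by auto.
  split; intros [H1 [H2 H]]; (split; [assumption|]); (split; [assumption|]);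
    (destruct H as [|[Hd [m [Hm H]]]]; [now left|right]; split; [assumption|]; exists m; split; [assumption|]);
    [rewrite <- E'|rewrite E']; simpl; auto; eapply (bko_in w' x); eauto.
Qed.

Lemma hT_mono w w' : (forall v, w v = true -> w' v = true) -> hT n w i T -> hT n w' i T.
Proof.
  intros L H t Ht. destruct (H t Ht) as [H1 [H2 [m [H3 H4]]]]. split; [auto|]. split; [auto|].
  exists m. split; [|auto]. eapply Rch_mono; [| | |apply H3]; auto.
  intros a u [E1 E2]. split; auto.
Qed.

Lemma setv_false_le w v u : setv w v false u = true -> w u = true.
Proof. unfold setv. destruct (Var_eq_dec u v); [discriminate|auto]. Qed.

Lemma setv_true_ge w v u : w u = true -> setv w v true u = true.
Proof. unfold setv. destruct (Var_eq_dec u v); auto. Qed.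

(** Secrecy with the firms of [J] exempted, so that the coins of their links to [i] remain
    unread. *)
Definition secx (w : Outcome) (J : nat -> Prop) : Prop :=
  forall j, (j < n)%nat -> j <> i -> ~ J j -> ~ leak n w i T j.

Lemma sec_secx w : sec n w i T <-> secx w (fun _ => False).
Proof. split; intros H j; intros; apply H; auto. Qed.

Lemma secx_add w (J : nat -> Prop) j : (j < n)%nat -> j <> i -> ~ J j ->
  secx w J <-> secx w (fun a => J a \/ a = j) /\ ~ leak n w i T j.
Proof.
  intros Hj Hji HJ. split.
  - intros H. split; [|now apply H]. intros a; intros; apply H; auto.
  - intros [H1 H2] a Ha Hai HJa. destruct (Nat.eq_dec a j) as [->|]; [assumption|]. apply H1; tauto.
Qed.

Lemma secx_ext w w' J : (forall v, nx i v -> (forall j, J j -> v <> Dir j i /\ v <> Ind j i) -> w v = w' v) ->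
  secx w J -> secx w' J.
Proof.
  intros E H j Hj Hji HJ [Hd Hl]. apply (H j Hj Hji HJ).
  assert (Hne : forall j', J j' -> j <> j') by (intros j' Hj' ->; contradiction).
  split; [rewrite E; auto; intros j' Hj'; split; intros X; try discriminate; injection X as ->; eapply Hne; eauto|].
  destruct Hl as [Hl|Hl]; [left; rewrite E; auto; intros j' Hj'; split; intros X; try discriminate; injection X as ->; eapply Hne; eauto|right].
  rewrite (crowd_dep j Hji w w'); [assumption|]. intros v [Hv1 Hv2]. apply E; auto.
  intros j' _. split; intros ->; simpl in Hv2; congruence.
Qed.

Lemma secx_dep J : dep (fun v => nx i v /\ forall j, J j -> v <> Dir j i /\ v <> Ind j i) (fun w => secx w J).
Proof.
  intros w w' E. apply propositional_extensionality. split; apply secx_ext; intros; [|symmetry]; apply E; auto.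
Qed.

(** The condition under which a link from [j] to [i], if present, is a leak; it does not read that
    link. *)
Definition gj (w : Outcome) (j : nat) : Prop := w (Ind j i) = true \/ crowd n w i T j.

Lemma gj_dep j : j <> i -> dep (fun v => (nx i v /\ ny i v) \/ v = Ind j i) (fun w => gj w j).
Proof.
  intros Hj w w' E. unfold gj. rewrite (E (Ind j i)) by auto.
  rewrite (crowd_dep j Hj w w') by auto. reflexivity.
Qed.

Lemma secx_set w (J : nat -> Prop) j b : (j < n)%nat -> j <> i -> ~ J j ->
  secx (setv w (Dir j i) b) J <-> secx w (fun a => J a \/ a = j) /\ ~ (b = true /\ gj w j).
Proof.
  intros Hj Hji HJ. rewrite (secx_add _ J j Hj Hji HJ).
  rewrite (secx_dep (fun a => J a \/ a = j) (setv w (Dir j i) b) w).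
  - unfold leak. rewrite setv_same. rewrite setv_other by discriminate.
    rewrite (crowd_dep j Hji (setv w (Dir j i) b) w); [tauto|].
    intros v [_ Hv]. apply setv_other. intros ->. simpl in Hv; congruence.
  - intros v [_ Hv]. apply setv_other. apply (Hv j); auto.
Qed.

Lemma secx_setx w J x b : secx (setv w (Dir i x) b) J = secx w J.
Proof.
  apply secx_dep. intros v [Hv _]. apply setv_other. intros ->. now apply Hv.
Qed.

Lemma hT_sety w j b : hT n (setv w (Dir j i) b) i T = hT n w i T.
Proof. apply hT_dep. intros v Hv. apply setv_other. intros ->. now apply Hv. Qed.

Lemma crowd_crowd' w j : (exists t, T t) -> crowd n w i T j -> crowd' n w i T j.
Proof.
  intros [t Ht] [m [Hd Hk]]. exists m. split; [assumption|]. exists t. split; [assumption|].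
  destruct (Hk t Ht); auto.
Qed.

Lemma touch_crowd' w x : touch n w i T x -> crowd' n w i T x.
Proof. intros H. exists x. split; [now apply Rch_base|assumption]. Qed.

Definition piv (w : Outcome) (x : nat) : Prop :=
  x <> i /\ w (Dir i x) = true /\ ~ hT n (setv w (Dir i x) false) i T.

Definition npiv (w : Outcome) : R := card n (piv w).

(** What another link covers does not depend on the coin [Dir i x], so it survives the removal of
    that link. *)
Lemma Lrn_setx w x x' t : (x' < n)%nat -> x' <> i -> w (Dir i x') = true -> Kx n w i x' t ->
  ~ Lrn n (setv w (Dir i x) false) i t -> x' = x.
Proof.
  intros Hx' Hxi' Hd HK Hn. destruct (Nat.eq_dec x' x) as [|Hne]; [assumption|]. exfalso. apply Hn.
  apply Lrn_cover; auto. exists x'. split; [assumption|]. split; [assumption|].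
  split; [rewrite setv_other; congruence|].
  rewrite (Kx_dep x' Hxi' (setv w (Dir i x) false) w); [assumption|].
  intros v Hv. apply setv_other. intros ->. destruct Hv as [[Hv _]|Hv]; [now apply Hv|discriminate].
Qed.

Lemma card_le_1 (P : nat -> Prop) : (forall x x', (x < n)%nat -> (x' < n)%nat -> P x -> P x' -> x = x') -> card n P <= 1.
Proof.
  intros H. destruct (classic (exists x, (x < n)%nat /\ P x)) as [[x [Hx HP]]|Hn].
  - rewrite <- (card_single n x Hx). apply card_le. intros v Hv HPv. now apply H.
  - rewrite card_empty; [lra|]. intros v Hv HPv. apply Hn; eauto.
Qed.

(* A pivotal link is the only one covering some idea of [T]. *)
Lemma npiv_le_card w : hT n w i T -> npiv w <= card n T.
Proof.
  intros H.
  set (Q := fun t x => x <> i /\ w (Dir i x) = true /\ ~ Lrn n (setv w (Dir i x) false) i t).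
  apply Rle_trans with (sumR n (fun x => sumR n (fun t => ind (T t) * ind (Q t x)))).
  - apply sumR_le. intros x Hx. unfold ind at 1. em (piv w x).
    + destruct p as [Hxi [Hd Hn]]. apply not_all_ex_not in Hn. destruct Hn as [t Ht].
      apply imply_to_and in Ht. destruct Ht as [Ht HL].
      apply Rle_trans with (ind (T t) * ind (Q t x)).
      * rewrite (ind_true (T t)), (ind_true (Q t x)); [lra|unfold Q; auto|assumption].
      * apply (sumR_ge_term n (fun t => ind (T t) * ind (Q t x))); [|now apply HT].
        intros; apply Rmult_le_pos; apply ind_pos.
    + apply sumR_nonneg. intros; apply Rmult_le_pos; apply ind_pos.
  - rewrite sumR_swap. apply sumR_le. intros t Ht. rewrite sumR_scal.
    unfold ind. em (T t); [|lra]. rewrite Rmult_1_l.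
    apply card_le_1. intros x x' Hx Hx' [H1 [H2 H3]] [H1' [H2' H3']].
    specialize (H t t0). apply Lrn_cover in H; auto. destruct H as [y [Hy [Hyi [Hd HK]]]].
    rewrite <- (Lrn_setx w x y t), <- (Lrn_setx w x' y t); auto.
Qed.

End Deps.

Section FirstOrder.

Variables (n : nat) (beta : nat -> R) (delta : R) (q : nat -> R) (i : nat) (T : nat -> Prop).
Hypothesis Hact : act_ok n beta delta q.
Hypothesis Hi : (i < n)%nat.
Hypothesis HT : forall t, T t -> (t < n)%nat /\ t <> i.

Let ks := keys n.
Let pr := prob beta delta (fun _ => 0) q.

Lemma fo_ok : okp ks pr.
Proof. now apply act_okp. Qed.

Definition fT (w : Outcome) : R := ind (hT n w i T /\ sec n w i T).

Lemma fT_pos w : 0 <= fT w.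
Proof. apply ind_pos. Qed.

Definition px (x : nat) : R := beta i * (q i * q x).
Definition py (j : nat) : R := beta j * (q j * q i).

(* The openness of [i] acts through its listening links ([X1]) and through the links of those
   who listen to it ([Y1]); [zz] is the expected number of firms learning indirectly through [i]. *)
Definition X1 : R := nsum n i (fun x => px x *
  (Expect ks pr (fun w => fT (setv w (Dir i x) true)) - Expect ks pr (fun w => fT (setv w (Dir i x) false)))).
Definition Y1 : R := nsum n i (fun j => py j *
  (Expect ks pr (fun w => fT (setv w (Dir j i) false)) - Expect ks pr (fun w => fT (setv w (Dir j i) true)))).
Definition zz : R := delta * nsum n i py.

Let G := GT n beta delta q i T.

Lemma px_nonneg x : (x < n)%nat -> 0 <= px x.
Proof. intros Hx. destruct Hact as [_ H]. destruct (H i Hi), (H x Hx). repeat apply Rmult_le_pos; lra. Qed.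

Lemma py_nonneg x : (x < n)%nat -> 0 <= py x.
Proof. intros Hx. destruct Hact as [_ H]. destruct (H i Hi), (H x Hx). repeat apply Rmult_le_pos; lra. Qed.

Lemma in_x x : (x < n)%nat -> x <> i -> In (Dir i x) ks.
Proof. intros. apply in_keys_Dir. auto. Qed.

Lemma in_y x : (x < n)%nat -> x <> i -> In (Dir x i) ks.
Proof. intros. apply in_keys_Dir. auto. Qed.

Lemma G_eq : G = Expect ks pr fT.
Proof. reflexivity. Qed.

Lemma G_nonneg : 0 <= G.
Proof. rewrite G_eq. apply Expect_nonneg; [apply fo_ok|]. intros; apply fT_pos. Qed.

Lemma fT_setx w x b : fT (setv w (Dir i x) b) = ind (hT n (setv w (Dir i x) b) i T) * ind (sec n w i T).
Proof.
  unfold fT. rewrite ind_and. f_equal. apply ind_iff. rewrite !sec_secx.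
  now rewrite secx_setx.
Qed.

(** Multiplied by the probability of its link, each difference becomes an expectation over outcomes
    in which the link is present and pivotal. *)
Lemma X1_piv : X1 = Expect ks pr (fun w => fT w * npiv n i T w).
Proof.
  unfold X1. rewrite (nsum_ext n i _ (fun x => Expect ks pr (fun w => fT w * ind (piv n i T w x)))).
  - rewrite <- Expect_nsum. apply Expect_ext. intros w _. unfold nsum, npiv, card.
    rewrite <- sumR_scal. apply sumR_ext. intros x _. destruct (Nat.eq_dec x i) as [->|]; [|reflexivity].
    rewrite (ind_false (piv n i T w i)); [ring|]. unfold piv; tauto.
  - intros x Hx Hxi. rewrite Rmult_minus_distr_l.
    change (px x) with (pr (Dir i x)).
    rewrite (Expect_on_true ks pr fT _ (NoDup_keys n) (in_x x Hx Hxi)),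
      (Expect_on_false ks pr fT _ (NoDup_keys n) (in_x x Hx Hxi)), <- Expect_minus.
    apply Expect_ext. intros w _. rewrite fT_setx. unfold fT. rewrite ind_and.
    assert (M : hT n (setv w (Dir i x) false) i T -> hT n w i T).
    { apply hT_mono; intros; eapply setv_false_le; eauto. }
    unfold ind. em (w (Dir i x) = true); em (hT n w i T); em (sec n w i T);
      em (hT n (setv w (Dir i x) false) i T); em (piv n i T w x); try ring; unfold piv in *; exfalso; tauto.
Qed.

Lemma X1_upper_card : X1 <= card n T * G.
Proof.
  rewrite X1_piv, G_eq, <- Expect_scal. apply Expect_le; [apply fo_ok|]. intros w _.
  unfold fT, ind. em (hT n w i T /\ sec n w i T); [|lra].
  assert (K := npiv_le_card n i T Hi HT w (proj1 a)). lra.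
Qed.

(** The second factorial moment of the number of pivotal links: it measures how often [T] has to be
    assembled from several links. It bounds both the excess of [X1] over [G] and the convexity in
    the listening links. *)
Definition PP : R := Expect ks pr (fun w => fT w * (npiv n i T w * (npiv n i T w - 1))).

Lemma X1_upper_PP : X1 <= G + PP.
Proof.
  rewrite X1_piv, G_eq. unfold PP. rewrite <- Expect_plus. apply Expect_le; [apply fo_ok|]. intros w _.
  assert (F := fT_pos w). unfold npiv. destruct (card_INR n (piv n i T w)) as [m ->].
  enough (INR m <= 1 + INR m * (INR m - 1)) by nra.
  destruct m as [|m]; [simpl; lra|]. rewrite S_INR. nra.
Qed.

(** Fix one idea of [T] and a link that brings it. Either this link is pivotal, or [T] is learned
    even without it although its far end has access to [T]; the second event does not read the coin
    of the link, which is then resampled. *)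
Lemma X1_lower : (exists t, T t) ->
  G - nsum n i (fun x => px x * Expect ks pr (fun w => fT w * ind (touch n w i T x))) <= X1.
Proof.
  intros [t Ht].
  set (gx := fun x w => ind (sec n w i T) * ind (touch n w i T x) * ind (hT n (setv w (Dir i x) false) i T)).
  assert (S1 : nsum n i (fun x => Expect ks pr (fun w => ind (w (Dir i x) = true) * gx x w))
     <= nsum n i (fun x => px x * Expect ks pr (fun w => fT w * ind (touch n w i T x)))).
  { apply nsum_le. intros x Hx Hxi.
    rewrite <- (Expect_on_true ks pr (gx x) _ (NoDup_keys n) (in_x x Hx Hxi)).
    apply Rmult_le_compat_l; [now apply px_nonneg|]. apply Expect_le; [apply fo_ok|]. intros w _.
    unfold gx. rewrite setv_setv.
    rewrite (touch_dep n i T HT x Hxi (setv w (Dir i x) true) w).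
    2: { intros v [Hv _]. apply setv_other. intros ->. now apply Hv. }
    rewrite (ind_iff (sec n (setv w (Dir i x) true) i T) (sec n w i T)) by (rewrite !sec_secx; now rewrite secx_setx).
    unfold fT. rewrite ind_and.
    assert (M : ind (hT n (setv w (Dir i x) false) i T) <= ind (hT n w i T)).
    { apply ind_le, hT_mono; intros; eapply setv_false_le; eauto. }
    assert (I1 := ind_range (sec n w i T)). assert (I2 := ind_range (touch n w i T x)).
    assert (0 <= ind (sec n w i T) * ind (touch n w i T x)) by nra. nra. }
  enough (G <= X1 + nsum n i (fun x => Expect ks pr (fun w => ind (w (Dir i x) = true) * gx x w))) by lra.
  rewrite X1_piv, G_eq, <- Expect_nsum, <- Expect_plus. apply Expect_le; [apply fo_ok|]. intros w _.
  assert (N0 : 0 <= npiv n i T w) by apply card_nonneg.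
  assert (Sp : forall x, 0 <= ind (w (Dir i x) = true) * gx x w).
  { intros x. repeat apply Rmult_le_pos; apply ind_pos. }
  assert (S0 : 0 <= nsum n i (fun x => ind (w (Dir i x) = true) * gx x w)) by (apply nsum_nonneg; auto).
  unfold fT, ind at 1 2. em (hT n w i T /\ sec n w i T); [|lra].
  destruct a as [Hh Hs]. assert (HL := Hh t Ht). apply Lrn_cover in HL; auto.
  destruct HL as [x [Hx [Hxi [Hd HK]]]].
  destruct (classic (hT n (setv w (Dir i x) false) i T)) as [H0|H0].
  - assert (1 <= nsum n i (fun x => ind (w (Dir i x) = true) * gx x w)).
    { apply Rle_trans with (ind (w (Dir i x) = true) * gx x w).
      - unfold gx. rewrite (ind_true _ Hd), (ind_true _ Hs), (ind_true _ H0), ind_true; [lra|].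
        exists t. split; [assumption|]. destruct HK as [_ [_ [-> |[_ H]]]]; auto.
      - eapply Rle_trans; [|apply (sumR_ge_term n _ x)]; [|intros y _|assumption]; cbv beta.
        + destruct (Nat.eq_dec x i); [contradiction|lra].
        + destruct (Nat.eq_dec y i); [lra|auto]. }
    lra.
  - assert (1 <= npiv n i T w).
    { apply (card_ge_1 n _ x Hx). unfold piv; auto. }
    lra.
Qed.

Lemma fT_sety w j b : (j < n)%nat -> j <> i ->
  fT (setv w (Dir j i) b) = ind (hT n w i T) * (ind (secx n i T w (fun a => a = j)) * (1 - ind (b = true /\ gj n i T w j))).
Proof.
  intros Hj Hji. unfold fT. rewrite ind_and, (hT_sety n i T w j b). f_equal.
  rewrite (ind_iff _ _ (sec_secx n i T (setv w (Dir j i) b))), (ind_iff _ _ (secx_set n i T HT w (fun _ => False) j b Hj Hji (fun H => H))).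
  rewrite ind_and, ind_not. f_equal. apply ind_iff.
  split; intros H a; intros; apply H; tauto.
Qed.

(** The success probability when leaks through [j] are forgiven. It reads neither [Dir j i] nor
    [Ind j i], and [G] lies between [(1 - py j)] times it and itself. *)
Definition sx (j : nat) : R := Expect ks pr (fun w => ind (hT n w i T) * ind (secx n i T w (fun a => a = j))).

Lemma sx_ge j : (j < n)%nat -> j <> i -> G <= sx j.
Proof.
  intros Hj Hji. rewrite G_eq. apply Expect_le; [apply fo_ok|]. intros w _.
  rewrite <- ind_and. apply ind_le. intros [H1 H2]. split; [assumption|]. intros a; intros; now apply H2.
Qed.

Lemma sx_le j : (j < n)%nat -> j <> i -> (1 - py j) * sx j <= G.
Proof.
  intros Hj Hji. rewrite G_eq.
  eapply Rle_trans; [|apply (Expect_off_le ks pr fT (Dir j i) fo_ok (NoDup_keys n) (in_y j Hj Hji))].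
  - right. f_equal. apply Expect_ext. intros w _.
    rewrite (fT_sety w j false Hj Hji), (ind_false (false = true /\ _)); [ring|]. intros [H _]; discriminate.
  - intros; apply fT_pos.
Qed.

Lemma sx_Ind j : (j < n)%nat -> j <> i ->
  Expect ks pr (fun w => ind (w (Ind j i) = true) * (ind (hT n w i T) * ind (secx n i T w (fun a => a = j)))) = delta * sx j.
Proof.
  intros Hj Hji. rewrite (Expect_indep ks pr (fun v => v = Ind j i)).
  - f_equal. rewrite Expect_var; [reflexivity|apply NoDup_keys|]. apply in_keys_Ind; auto.
  - apply dep_var.
  - intros w w' E. rewrite (hT_dep n i T w w'), (secx_dep n i T HT _ w w'); [reflexivity| |].
    + intros v [_ Hv]. apply E. now apply (Hv j).
    + intros v Hv. apply E. intros ->. now apply Hv.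
Qed.

Lemma Y1_eq : Y1 = nsum n i (fun j => py j *
  Expect ks pr (fun w => ind (gj n i T w j) * (ind (hT n w i T) * ind (secx n i T w (fun a => a = j))))).
Proof.
  apply nsum_ext. intros j Hj Hji. f_equal. rewrite <- Expect_minus. apply Expect_ext. intros w _.
  rewrite !(fT_sety w j) by auto. rewrite (ind_false (false = true /\ _)) by lra.
  rewrite (ind_iff (true = true /\ gj n i T w j) (gj n i T w j)) by tauto. ring.
Qed.

(** An indirect learner always leaks, and its coin is independent of the rest; the crowd is
    dropped. *)
Lemma Y1_lower : zz * G <= Y1.
Proof.
  rewrite Y1_eq. unfold zz. rewrite Rmult_assoc, (Rmult_comm _ G), <- Rmult_assoc, <- nsum_scal.
  apply nsum_le. intros j Hj Hji. rewrite (Rmult_comm (delta * G)). apply Rmult_le_compat_l; [now apply py_nonneg|].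
  apply Rle_trans with (delta * sx j).
  - apply Rmult_le_compat_l; [apply Hact|now apply sx_ge].
  - rewrite <- sx_Ind by auto. apply Expect_le; [apply fo_ok|]. intros w _.
    apply Rmult_le_compat_r; [apply Rmult_le_pos; apply ind_pos|]. apply ind_le. unfold gj; auto.
Qed.

(** The two reasons for a leak are added. Forgiving leaks through one firm costs only the factor
    [1 / (1 - pb)]. *)
Lemma Y1_upper pb : pb < 1 -> (forall j, (j < n)%nat -> j <> i -> py j <= pb) ->
  Y1 <= zz * G / (1 - pb) + nsum n i (fun j => py j * Expect ks pr (fun w => ind (hT n w i T /\ crowd n w i T j))).
Proof.
  intros Hpb Hpy. rewrite Y1_eq. unfold zz.
  replace (delta * nsum n i py * G / (1 - pb)) with (delta * G / (1 - pb) * nsum n i py) by lra.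
  rewrite <- nsum_scal, <- nsum_plus. apply nsum_le. intros j Hj Hji.
  rewrite (Rmult_comm (delta * G / (1 - pb))), <- Rmult_plus_distr_l.
  apply Rmult_le_compat_l; [now apply py_nonneg|].
  apply Rle_trans with (delta * sx j + Expect ks pr (fun w => ind (hT n w i T /\ crowd n w i T j))).
  - rewrite <- sx_Ind, <- Expect_plus by auto. apply Expect_le; [apply fo_ok|]. intros w _.
    assert (I1 := ind_range (hT n w i T)). assert (I2 := ind_range (secx n i T w (fun a => a = j))).
    assert (I3 := ind_or_le (w (Ind j i) = true) (crowd n w i T j)).
    fold (gj n i T w j) in I3. rewrite ind_and.
    assert (I4 := ind_range (crowd n w i T j)).
    set (h := ind (hT n w i T)) in *. set (s := ind (secx n i T w (fun a => a = j))) in *.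
    assert (0 <= h * s <= h) by nra.
    nra.
  - apply Rplus_le_compat_r. assert (K := sx_le j Hj Hji). specialize (Hpy j Hj Hji).
    assert (D := proj1 Hact).
    assert (G0 := G_nonneg).
    unfold Rdiv. rewrite Rmult_assoc. apply Rmult_le_compat_l; [lra|].
    apply (Rmult_le_reg_r (1 - pb)); [lra|]. rewrite Rmult_assoc, Rinv_l by lra. nra.
Qed.

End FirstOrder.

(** * Derivatives with respect to openness *)

Definition dl (v : Var) (f : Outcome -> R) (w : Outcome) : R := f (setv w v true) - f (setv w v false).

Lemma lsum_keys n (F : Var -> R) : (forall i, F (Disc i) = 0) -> (forall a b, F (Ind a b) = 0) ->
  lsum (keys n) F = sumR n (fun a => sumR n (fun b => if Nat.eq_dec a b then 0 else F (Dir a b))).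
Proof.
  intros H1 H2. unfold keys. rewrite !lsum_app, !lsum_map.
  rewrite (lsum_zero (seq 0 n)), (lsum_zero (pairs n) (fun a => F (Ind (fst a) (snd a)))) by auto.
  rewrite Rplus_0_l, Rplus_0_r. unfold pairs. rewrite lsum_filter, lsum_prod, lsum_seq.
  apply sumR_ext. intros a _. rewrite lsum_seq. apply sumR_ext. intros b _. simpl.
  destruct (Nat.eqb_spec a b), (Nat.eq_dec a b); simpl; try reflexivity; congruence.
Qed.

Lemma lsum_keys_i n i (F : Var -> R) : (i < n)%nat -> (forall i, F (Disc i) = 0) -> (forall a b, F (Ind a b) = 0) ->
  (forall a b, a <> i -> b <> i -> F (Dir a b) = 0) ->
  lsum (keys n) F = nsum n i (fun x => F (Dir i x)) + nsum n i (fun j => F (Dir j i)).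
Proof.
  intros Hi H1 H2 H3. rewrite lsum_keys by assumption.
  rewrite (sumR_ext n _ (fun a => (if Nat.eq_dec a i then nsum n i (fun x => F (Dir i x)) else 0)
     + (if Nat.eq_dec a i then 0 else F (Dir a i)))).
  - rewrite sumR_plus, sumR_single by assumption. reflexivity.
  - intros a Ha. destruct (Nat.eq_dec a i) as [->|Hai].
    + rewrite Rplus_0_r. apply sumR_ext. intros b _.
      destruct (Nat.eq_dec i b), (Nat.eq_dec b i); congruence.
    + rewrite Rplus_0_l, <- (sumR_single n i (F (Dir a i)) Hi). apply sumR_ext. intros b _.
      destruct (Nat.eq_dec b i) as [->|Hb].
      * destruct (Nat.eq_dec a i); congruence.
      * destruct (Nat.eq_dec a b); auto.
Qed.

Lemma derivable_sumR n (f : nat -> R -> R) (d : nat -> R) y :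
  (forall j, (j < n)%nat -> derivable_pt_lim (f j) y (d j)) ->
  derivable_pt_lim (fun t => sumR n (fun j => f j t)) y (sumR n d).
Proof.
  induction n; intros H; simpl; [apply derivable_pt_lim_const|].
  apply (derivable_pt_lim_plus (fun t => sumR n (fun j => f j t)) (f n)); auto.
Qed.

Lemma derivable_lsum {A} (l : list A) (f : A -> R -> R) (d : A -> R) y :
  (forall a, In a l -> derivable_pt_lim (f a) y (d a)) ->
  derivable_pt_lim (fun t => lsum l (fun a => f a t)) y (lsum l d).
Proof.
  induction l as [|a l IH]; intros H; simpl; [apply derivable_pt_lim_const|].
  apply (derivable_pt_lim_plus (f a) (fun t => lsum l (fun a => f a t))); [apply H; simpl; auto|].
  apply IH. intros; apply H; simpl; auto.
Qed.

Lemma derivable_nsum n i (f : nat -> R -> R) (d : nat -> R) y :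
  (forall j, (j < n)%nat -> derivable_pt_lim (f j) y (d j)) ->
  derivable_pt_lim (fun t => nsum n i (fun j => f j t)) y (nsum n i d).
Proof.
  intros H. apply (derivable_sumR n (fun j t => if Nat.eq_dec j i then 0 else f j t)). intros j Hj.
  destruct (Nat.eq_dec j i); [apply derivable_pt_lim_const|auto].
Qed.

Section Deriv.

Variables (n : nat) (beta : nat -> R) (delta : R) (q : nat -> R) (i : nat).
Hypothesis Hi : (i < n)%nat.

(** Russo's formula for the parameter [q i], which enters only the links at [i], in both
    directions. *)
Definition D1 (f : Outcome -> R) (y : R) : R :=
  nsum n i (fun x => beta i * q x * EN n beta delta (upd q i y) (dl (Dir i x) f))
  + nsum n i (fun j => beta j * q j * EN n beta delta (upd q i y) (dl (Dir j i) f)).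

Lemma upd_same (f : nat -> R) y : upd f i y i = y.
Proof. unfold upd. destruct (Nat.eq_dec i i); congruence. Qed.

Lemma upd_other (f : nat -> R) y j : j <> i -> upd f i y j = f j.
Proof. intros H. unfold upd. destruct (Nat.eq_dec j i); congruence. Qed.

Lemma EN_deriv f y : derivable_pt_lim (fun t => EN n beta delta (upd q i t) f) y (D1 f y).
Proof.
  set (dp := fun v => match v with
     | Dir a b => if Nat.eq_dec a i then (if Nat.eq_dec b i then 0 else beta i * q b)
                  else if Nat.eq_dec b i then beta a * q a else 0
     | _ => 0 end).
  assert (K := derivable_Expect (keys n) (fun t => prob beta delta (fun _ => 0) (upd q i t)) dp f y (NoDup_keys n)).
  replace (D1 f y) with (lsum (keys n) (fun v => dp v *
     (Expect (keys n) (prob beta delta (fun _ => 0) (upd q i y)) (fun w => f (setv w v true))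
      - Expect (keys n) (prob beta delta (fun _ => 0) (upd q i y)) (fun w => f (setv w v false))))).
  - apply K. intros v Hv. destruct v as [a|a b|a b]; simpl; try apply derivable_pt_lim_const.
    apply in_keys_Dir in Hv. destruct Hv as [_ [_ Hab]].
    destruct (Nat.eq_dec a i) as [->|Ha]; destruct (Nat.eq_dec b i) as [->|Hb]; try congruence.
    + replace (beta i * q b) with (beta i * (1 * q b)) by ring.
      apply (derivable_pt_lim_ext (fun t => beta i * (t * q b))).
      { intros t. now rewrite upd_same, upd_other. }
      apply (derivable_pt_lim_scal (fun t => t * q b)).
      replace (1 * q b) with (1 * q b + y * 0) by ring.
      apply (derivable_pt_lim_mult (fun t => t) (fun _ => q b)); [apply derivable_pt_lim_id|apply derivable_pt_lim_const].
    + replace (beta a * q a) with (beta a * (q a * 1)) by ring.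
      apply (derivable_pt_lim_ext (fun t => beta a * (q a * t))).
      { intros t. now rewrite upd_same, upd_other. }
      apply (derivable_pt_lim_scal (fun t => q a * t)). apply (derivable_pt_lim_scal (fun t => t)).
      apply derivable_pt_lim_id.
    + apply (derivable_pt_lim_ext (fun t => beta a * (q a * q b))); [|apply derivable_pt_lim_const].
      intros t. now rewrite !upd_other.
  - rewrite (lsum_keys_i n i) by (auto; try (intros; simpl; lra);
      intros a b Ha Hb; simpl; destruct (Nat.eq_dec a i), (Nat.eq_dec b i); try congruence; lra).
    unfold D1, dl, EN. f_equal; apply nsum_ext; intros x Hx Hxi; rewrite Expect_minus; f_equal; simpl.
    + destruct (Nat.eq_dec i i); [|congruence]. destruct (Nat.eq_dec x i); [congruence|reflexivity].
    + destruct (Nat.eq_dec x i); [congruence|]. destruct (Nat.eq_dec i i); [reflexivity|congruence].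
Qed.

Definition D2 (f : Outcome -> R) (y : R) : R :=
  nsum n i (fun x => beta i * q x * D1 (dl (Dir i x) f) y)
  + nsum n i (fun j => beta j * q j * D1 (dl (Dir j i) f) y).

Lemma D1_deriv f y : derivable_pt_lim (D1 f) y (D2 f y).
Proof.
  apply (derivable_pt_lim_plus
     (fun y => nsum n i (fun x => beta i * q x * EN n beta delta (upd q i y) (dl (Dir i x) f)))
     (fun y => nsum n i (fun j => beta j * q j * EN n beta delta (upd q i y) (dl (Dir j i) f)))).
  - apply (derivable_nsum n i (fun x y => beta i * q x * EN n beta delta (upd q i y) (dl (Dir i x) f))).
    intros j _. apply (derivable_pt_lim_scal (fun y => EN n beta delta (upd q i y) (dl (Dir i j) f))). apply EN_deriv.
  - apply (derivable_nsum n i (fun x y => beta x * q x * EN n beta delta (upd q i y) (dl (Dir x i) f))).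
    intros j _. apply (derivable_pt_lim_scal (fun y => EN n beta delta (upd q i y) (dl (Dir j i) f))). apply EN_deriv.
Qed.

Variables (k : nat) (p : nat -> R).

Definition FF (y : R) : R := lsum (blists n) (fun t => wt n k p i t * D1 (fT n i (Tof n t i)) y).
Definition FF2 (y : R) : R := lsum (blists n) (fun t => wt n k p i t * D2 (fT n i (Tof n t i)) y).

Lemma GG_deriv y : derivable_pt_lim (fun t => GG n k beta delta p (upd q i t) i) y (FF y).
Proof.
  apply (derivable_lsum (blists n) (fun t y => wt n k p i t * GT n beta delta (upd q i y) i (Tof n t i))).
  intros t _. apply (derivable_pt_lim_scal (fun y => GT n beta delta (upd q i y) i (Tof n t i))). apply EN_deriv.
Qed.

Lemma FF_deriv y : derivable_pt_lim FF y (FF2 y).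
Proof.
  apply (derivable_lsum (blists n) (fun t y => wt n k p i t * D1 (fT n i (Tof n t i)) y)).
  intros t _. apply (derivable_pt_lim_scal (fun y => D1 (fT n i (Tof n t i)) y)). apply D1_deriv.
Qed.

Lemma D1_XY (T : nat -> Prop) y :
  y * D1 (fT n i T) y = X1 n beta delta (upd q i y) i T - Y1 n beta delta (upd q i y) i T.
Proof.
  unfold D1, X1, Y1. rewrite Rmult_plus_distr_l, <- !nsum_scal.
  match goal with |- _ = ?a - ?b => replace (a - b) with (a + (-1) * b) by ring end.
  rewrite <- nsum_scal. f_equal; apply nsum_ext; intros x Hx Hxi; unfold EN, dl, px, py; rewrite Expect_minus, upd_same, upd_other by assumption; ring.
Qed.

End Deriv.

(** * Second-order effects of openness *)

Section SecondOrder.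

Variables (n : nat) (beta : nat -> R) (delta : R) (q : nat -> R) (i : nat) (T : nat -> Prop).
Hypothesis Hact : act_ok n beta delta q.
Hypothesis Hi : (i < n)%nat.
Hypothesis HT : forall t, T t -> (t < n)%nat /\ t <> i.

Let ks := keys n.
Let pr := prob beta delta (fun _ => 0) q.
Let px := px beta q i.
Let py := py beta q i.
Let f := fT n i T.
Let G := GT n beta delta q i T.

Lemma so_ok : okp ks pr.
Proof. now apply act_okp. Qed.

(** The blocks of the second derivative times the square of the openness: each of the two
    differentiated links is either listened to by [i] ([X]) or a link to [i] ([Y]). *)
Definition XX : R := nsum n i (fun x => px x * nsum n i (fun x' => px x' * Expect ks pr (dl (Dir i x') (dl (Dir i x) f)))).
Definition XYs : R := nsum n i (fun x => px x * nsum n i (fun j => py j * Expect ks pr (dl (Dir j i) (dl (Dir i x) f)))).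
Definition YXs : R := nsum n i (fun j => py j * nsum n i (fun x => px x * Expect ks pr (dl (Dir i x) (dl (Dir j i) f)))).
Definition YY : R := nsum n i (fun j => py j * nsum n i (fun j' => py j' * Expect ks pr (dl (Dir j' i) (dl (Dir j i) f)))).

Lemma dl_same v g w : dl v (dl v g) w = 0.
Proof. unfold dl. rewrite !setv_setv. ring. Qed.

Lemma dl_comm u v g w : u <> v -> dl u (dl v g) w = dl v (dl u g) w.
Proof. intros H. unfold dl. rewrite !(setv_comm _ u v) by assumption. ring. Qed.

(** Over the four states of the two links, the mixed difference of the monotone indicator [hT] is at
    most the indicator that [T] is learned with both links and lost on removal of either one. *)
Lemma XX_pair x x' : (x < n)%nat -> x <> i -> (x' < n)%nat -> x' <> i -> x <> x' ->
  px x * (px x' * Expect ks pr (dl (Dir i x') (dl (Dir i x) f)))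
  <= Expect ks pr (fun w => f w * (ind (piv n i T w x) * ind (piv n i T w x'))).
Proof.
  intros Hx Hxi Hx' Hxi' Hne.
  set (v := Dir i x). set (v' := Dir i x'). assert (Hv : v <> v') by (unfold v, v'; congruence).
  set (Rr := fun w => f w * (ind (~ hT n (setv w v false) i T) * ind (~ hT n (setv w v' false) i T))).
  assert (S1 : Expect ks pr (dl v' (dl v f)) <= Expect ks pr (fun w => Rr (setv (setv w v' true) v true))).
  { apply Expect_le; [apply so_ok|]. intros w _. unfold dl, Rr, f.
    rewrite !setv_setv. rewrite (setv_comm _ v v' true false) by assumption. rewrite setv_setv.
    unfold v, v'. rewrite !fT_setx by assumption. fold v v'.
    assert (Ss : forall b, ind (sec n (setv w v' b) i T) = ind (sec n w i T)).
    { intros b. apply ind_iff. rewrite !sec_secx. unfold v'. now rewrite secx_setx by assumption. }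
    rewrite !Ss.
    set (h := fun b' b => hT n (setv (setv w v' b') v b) i T).
    replace (hT n (setv (setv w v' true) v true) i T) with (h true true) by reflexivity.
    replace (hT n (setv (setv w v' true) v false) i T) with (h true false) by reflexivity.
    replace (hT n (setv (setv w v' false) v true) i T) with (h false true) by reflexivity.
    replace (hT n (setv (setv w v' false) v false) i T) with (h false false) by reflexivity.
    assert (M1 : h false false -> h true false).
    { apply hT_mono. intros u. unfold setv. destruct (Var_eq_dec u v), (Var_eq_dec u v'); auto. }
    assert (M2 : h false false -> h false true).
    { apply hT_mono. intros u. unfold setv. destruct (Var_eq_dec u v), (Var_eq_dec u v'); auto. }
    rewrite !ind_not.
    unfold ind. em (h true true); em (h true false); em (h false true); em (h false false); em (sec n w i T);
      try lra; exfalso; tauto. }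
  eapply Rle_trans.
  { apply Rmult_le_compat_l; [now apply (px_nonneg n beta delta q i Hact Hi)|].
    apply Rmult_le_compat_l; [now apply (px_nonneg n beta delta q i Hact Hi)|]. apply S1. }
  rewrite <- Rmult_assoc, (Rmult_comm (px x)), Rmult_assoc.
  change (px x) with (pr v).
  rewrite (Expect_ext ks pr _ (fun w => (fun w' => Rr (setv w' v' true)) (setv w v true))).
  2: { intros w _. now rewrite setv_comm by auto. }
  rewrite (Expect_on_true ks pr (fun w => Rr (setv w v' true)) v (NoDup_keys n)) by (apply in_keys_Dir; auto).
  change (px x') with (pr v').
  rewrite (Expect_ext ks pr _ (fun w => (fun w' => ind (w' v = true) * Rr w') (setv w v' true))).
  2: { intros w _. now rewrite setv_other by auto. }
  rewrite (Expect_on_true ks pr (fun w => ind (w v = true) * Rr w) v' (NoDup_keys n)) by (apply in_keys_Dir; auto).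
  right. apply Expect_ext. intros w _. unfold Rr, piv. fold v v'.
  rewrite !ind_and, (ind_true (x <> i)), (ind_true (x' <> i)) by assumption. ring.
Qed.

Lemma XX_le_PP : XX <= PP n beta delta q i T.
Proof.
  apply Rle_trans with (nsum n i (fun x => nsum n i (fun x' =>
     if Nat.eq_dec x x' then 0 else Expect ks pr (fun w => f w * (ind (piv n i T w x) * ind (piv n i T w x')))))).
  - apply nsum_le. intros x Hx Hxi. rewrite <- nsum_scal. apply nsum_le. intros x' Hx' Hxi'.
    destruct (Nat.eq_dec x x') as [->|Hne].
    + rewrite (Expect_ext ks pr _ (fun _ => 0)), Expect_const; [lra|]. intros; apply dl_same.
    + now apply XX_pair.
  - rewrite (nsum_ext n i _ (fun x => Expect ks pr (fun w => nsum n i (fun x' =>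
       if Nat.eq_dec x x' then 0 else f w * (ind (piv n i T w x) * ind (piv n i T w x')))))).
    2: { intros x Hx Hxi. rewrite Expect_nsum. apply nsum_ext. intros x' _ _.
         destruct (Nat.eq_dec x x'); [now rewrite Expect_const|reflexivity]. }
    rewrite <- Expect_nsum. right. apply Expect_ext. intros w _.
    assert (NI : ind (piv n i T w i) = 0) by (apply ind_false; unfold piv; tauto).
    unfold nsum.
    rewrite (sumR_ext n _ (fun x => f w * (ind (piv n i T w x) * (npiv n i T w) - ind (piv n i T w x)))).
    + rewrite sumR_scal. f_equal.
      rewrite (sumR_ext n _ (fun x => (npiv n i T w - 1) * ind (piv n i T w x))) by (intros; ring).
      rewrite sumR_scal. fold (card n (piv n i T w)). fold (npiv n i T w). ring.
    + intros x Hx. destruct (Nat.eq_dec x i) as [->|Hxi]; [rewrite NI; ring|].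
      rewrite (sumR_ext n _ (fun x' => f w * ind (piv n i T w x) * ind (piv n i T w x')
          + (if Nat.eq_dec x' x then - (f w * ind (piv n i T w x)) else 0))).
      * rewrite sumR_plus, sumR_scal, sumR_single by assumption. unfold npiv, card. ring.
      * intros x' _. destruct (Nat.eq_dec x' i) as [->|]; [rewrite NI; destruct (Nat.eq_dec i x); [congruence|ring]|].
        destruct (Nat.eq_dec x x') as [->|].
        -- destruct (Nat.eq_dec x' x'); [|congruence]. unfold ind. em (piv n i T w x'); ring.
        -- destruct (Nat.eq_dec x' x); [congruence|ring].
Qed.

(** A listening link can only help, and its gain is destroyed at least when the coin [Ind j i]
    succeeds; that coin is read by neither the gain nor the secrecy towards the other firms. *)
Lemma XY_pair x j : (x < n)%nat -> x <> i -> (j < n)%nat -> j <> i ->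
  Expect ks pr (dl (Dir j i) (dl (Dir i x) f)) <= - (delta * Expect ks pr (dl (Dir i x) f)).
Proof.
  intros Hx Hxi Hj Hji.
  set (hd := fun w => ind (hT n (setv w (Dir i x) true) i T) - ind (hT n (setv w (Dir i x) false) i T)).
  assert (H0 : forall w, 0 <= hd w).
  { intros w. unfold hd. assert (ind (hT n (setv w (Dir i x) false) i T) <= ind (hT n (setv w (Dir i x) true) i T)); [|lra].
    apply ind_le, hT_mono. intros u Hu. apply setv_true_ge. eapply setv_false_le; eauto. }
  set (s := fun w => ind (secx n i T w (fun a => a = j))).
  assert (Ed : Expect ks pr (fun w => ind (w (Ind j i) = true) * (hd w * s w)) = delta * Expect ks pr (fun w => hd w * s w)).
  { rewrite (Expect_indep ks pr (fun v => v = Ind j i)).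
    - f_equal. rewrite Expect_var; [reflexivity|apply NoDup_keys|]. apply in_keys_Ind; auto.
    - apply dep_var.
    - intros w w' E. unfold hd, s. rewrite (secx_dep n i T HT _ w w').
      2: { intros v [_ Hv]. apply E. now apply (Hv j). }
      assert (Eh : forall b, hT n (setv w (Dir i x) b) i T = hT n (setv w' (Dir i x) b) i T).
      { intros b. apply hT_dep. intros v Hv. unfold setv. destruct (Var_eq_dec v (Dir i x)); auto.
        apply E. intros ->. now apply Hv. }
      now rewrite !Eh. }
  apply Rle_trans with (- Expect ks pr (fun w => ind (w (Ind j i) = true) * (hd w * s w))).
  - rewrite <- (Ropp_involutive (Expect ks pr (dl _ _))). apply Ropp_le_contravar.
    replace (- Expect ks pr (dl (Dir j i) (dl (Dir i x) f))) with ((-1) * Expect ks pr (dl (Dir j i) (dl (Dir i x) f))) by ring.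
    rewrite <- Expect_scal. apply Expect_le; [apply so_ok|]. intros w _.
    assert (E1 : dl (Dir j i) (dl (Dir i x) f) w = - (ind (gj n i T w j) * (hd w * s w))).
    { rewrite dl_comm by congruence. unfold dl, f. rewrite !fT_sety by auto.
      assert (Es : forall b, secx n i T (setv w (Dir i x) b) (fun a => a = j) = secx n i T w (fun a => a = j)).
      { intros b. now apply secx_setx. }
      assert (Eg : forall b, gj n i T (setv w (Dir i x) b) j = gj n i T w j).
      { intros b. apply (gj_dep n i T HT j Hji). intros v Hv. apply setv_other. intros ->.
        destruct Hv as [[Hv _]|Hv]; [now apply Hv|discriminate]. }
      rewrite !Es, !Eg. rewrite (ind_false (false = true /\ _)) by lra.
      rewrite (ind_iff (true = true /\ gj n i T w j) (gj n i T w j)) by tauto. unfold hd, s. ring. }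
    rewrite E1. replace (-1 * - (ind (gj n i T w j) * (hd w * s w))) with (ind (gj n i T w j) * (hd w * s w)) by ring.
    apply Rmult_le_compat_r; [apply Rmult_le_pos; [auto|apply ind_pos]|]. apply ind_le. unfold gj; auto.
  - apply Ropp_le_contravar. rewrite Ed. apply Rmult_le_compat_l; [apply Hact|].
    apply Expect_le; [apply so_ok|]. intros w _. unfold dl, f. rewrite !fT_setx by assumption.
    assert (ind (sec n w i T) <= s w).
    { apply ind_le. intros H a; intros; now apply H. }
    specialize (H0 w). unfold hd in *. nra.
Qed.

Lemma XYs_le : XYs <= - (zz n beta delta q i * X1 n beta delta q i T).
Proof.
  unfold XYs, X1, zz. fold ks pr px py.
  replace (- (delta * nsum n i py * nsum n i (fun x => px x * (Expect ks pr (fun w => fT n i T (setv w (Dir i x) true)) -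
     Expect ks pr (fun w => fT n i T (setv w (Dir i x) false))))))
   with ((- (delta * nsum n i py)) * nsum n i (fun x => px x * (Expect ks pr (fun w => fT n i T (setv w (Dir i x) true)) -
     Expect ks pr (fun w => fT n i T (setv w (Dir i x) false))))) by ring.
  rewrite <- nsum_scal. apply nsum_le. intros x Hx Hxi.
  rewrite <- Rmult_assoc, (Rmult_comm _ (px x)), Rmult_assoc.
  apply Rmult_le_compat_l; [now apply (px_nonneg n beta delta q i Hact Hi)|].
  rewrite <- Expect_minus.
  change (fun w => fT n i T (setv w (Dir i x) true) - fT n i T (setv w (Dir i x) false)) with (dl (Dir i x) f).
  replace (- (delta * nsum n i py) * Expect ks pr (dl (Dir i x) f))
    with (- (delta * Expect ks pr (dl (Dir i x) f)) * nsum n i py) by ring.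
  rewrite <- nsum_scal. apply nsum_le. intros j Hj Hji. rewrite (Rmult_comm (- _)).
  apply Rmult_le_compat_l; [now apply (py_nonneg n beta delta q i Hact Hi)|]. now apply XY_pair.
Qed.

Lemma nsum_swap (g : nat -> nat -> R) :
  nsum n i (fun a => nsum n i (fun b => g a b)) = nsum n i (fun b => nsum n i (fun a => g a b)).
Proof.
  unfold nsum.
  rewrite (sumR_ext n _ (fun a => sumR n (fun b => if Nat.eq_dec a i then 0 else if Nat.eq_dec b i then 0 else g a b))).
  - rewrite sumR_swap. apply sumR_ext. intros b _. destruct (Nat.eq_dec b i).
    + apply sumR_zero. intros a _. destruct (Nat.eq_dec a i); reflexivity.
    + reflexivity.
  - intros a _. destruct (Nat.eq_dec a i); [|reflexivity]. symmetry. now apply sumR_zero.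
Qed.

Lemma YXs_eq : YXs = XYs.
Proof.
  unfold YXs, XYs.
  rewrite (nsum_ext n i (fun j => py j * _) (fun j => nsum n i (fun x => py j * (px x * Expect ks pr (dl (Dir i x) (dl (Dir j i) f))))))
    by (intros; now rewrite nsum_scal).
  rewrite nsum_swap. apply nsum_ext. intros x Hx Hxi. rewrite <- nsum_scal. apply nsum_ext. intros j Hj Hji.
  rewrite (Expect_ext ks pr (dl (Dir i x) (dl (Dir j i) f)) (dl (Dir j i) (dl (Dir i x) f))); [ring|].
  intros; apply dl_comm. congruence.
Qed.

Definition Cw (j : nat) : R := Expect ks pr (fun w => ind (hT n w i T /\ crowd n w i T j)).

Lemma Cw_nonneg j : 0 <= Cw j.
Proof. apply Expect_ind_range, so_ok. Qed.

(** The mixed difference is exactly the product of the two leak conditions with the forgiven success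
    event. Independent indirect coins give [delta^2]; each crowd is split off by a union bound. *)
Lemma YY_pair pb j j' : pb < 1 -> (forall j, (j < n)%nat -> j <> i -> py j <= pb) ->
  (j < n)%nat -> j <> i -> (j' < n)%nat -> j' <> i ->
  Expect ks pr (dl (Dir j' i) (dl (Dir j i) f)) <= delta * delta * G / ((1 - pb) * (1 - pb)) + (Cw j + Cw j').
Proof.
  intros Hpb Hpy Hj Hji Hj' Hji'.
  assert (G0 := G_nonneg n beta delta q i T Hact). fold G in G0.
  assert (D := proj1 Hact). assert (C1 := Cw_nonneg j).
  assert (Hb0 : 0 <= delta * delta * G / ((1 - pb) * (1 - pb))).
  { apply Rmult_le_pos; [apply Rmult_le_pos; nra|]. left; apply Rinv_0_lt_compat. nra. }
  destruct (Nat.eq_dec j' j) as [->|Hne].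
  { rewrite (Expect_ext ks pr _ (fun _ => 0)), Expect_const; [lra|]. intros; apply dl_same. }
  set (J := fun a => a = j \/ a = j').
  set (s2 := fun w => ind (secx n i T w J)). set (h := fun w => ind (hT n w i T)).
  assert (E1 : forall w, dl (Dir j' i) (dl (Dir j i) f) w = ind (gj n i T w j) * ind (gj n i T w j') * (h w * s2 w)).
  { intros w.
    assert (Eb : forall b b', f (setv (setv w (Dir j' i) b') (Dir j i) b)
       = h w * (s2 w * (1 - ind (b = true /\ gj n i T w j)) * (1 - ind (b' = true /\ gj n i T w j')))).
    { intros b b'. rewrite (fT_sety n i T HT) by auto. rewrite hT_sety.
      assert (Egj : gj n i T (setv w (Dir j' i) b') j = gj n i T w j).
      { apply (gj_dep n i T HT j Hji). intros v Hv. apply setv_other. intros ->.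
        destruct Hv as [[_ Hv]|Hv]; [now apply Hv|discriminate]. }
      rewrite Egj.
      rewrite (ind_iff _ _ (secx_set n i T HT w (fun a => a = j) j' b' Hj' Hji' Hne)).
      rewrite ind_and, ind_not. unfold h, s2, J. ring. }
    unfold dl. rewrite !Eb.
    rewrite !(ind_false (false = true /\ _)) by lra.
    assert (Et : forall a, ind (true = true /\ gj n i T w a) = ind (gj n i T w a)) by (intros; apply ind_iff; tauto).
    rewrite !Et. ring. }
  set (s2m := Expect ks pr (fun w => h w * s2 w)).
  assert (Eind : Expect ks pr (fun w => ind (w (Ind j i) = true) * (ind (w (Ind j' i) = true) * (h w * s2 w)))
      = delta * (delta * s2m)).
  { rewrite (Expect_indep ks pr (fun v => v = Ind j i)).
    - f_equal; [rewrite Expect_var; [reflexivity|apply NoDup_keys|]; apply in_keys_Ind; auto|].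
      rewrite (Expect_indep ks pr (fun v => v = Ind j' i)).
      + f_equal. rewrite Expect_var; [reflexivity|apply NoDup_keys|]. apply in_keys_Ind; auto.
      + apply dep_var.
      + intros w w' E. unfold h, s2. rewrite (hT_dep n i T w w'), (secx_dep n i T HT _ w w'); [reflexivity| |].
        * intros v [_ Hv]. apply E. apply (Hv j'). now right.
        * intros v Hv. apply E. intros ->. now apply Hv.
    - apply dep_var.
    - intros w w' E. unfold h, s2. rewrite (E (Ind j' i)) by congruence.
      rewrite (hT_dep n i T w w'), (secx_dep n i T HT _ w w'); [reflexivity| |].
      * intros v [_ Hv]. apply E. apply (Hv j). now left.
      * intros v Hv. apply E. intros ->. now apply Hv. }
  assert (Ss : (1 - py j') * s2m <= sx n beta delta q i T j).
  {
    eapply Rle_trans; [|apply (Expect_off_le ks pr (fun w => ind (hT n w i T) * ind (secx n i T w (fun a => a = j))) (Dir j' i) so_ok (NoDup_keys n))].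
    - right. f_equal. apply Expect_ext. intros w _.
      rewrite hT_sety. f_equal.
      rewrite (ind_iff _ _ (secx_set n i T HT w (fun a => a = j) j' false Hj' Hji' Hne)).
      apply ind_iff. split; [intros H; split; [assumption|intros [X _]; discriminate]|tauto].
    - apply in_keys_Dir; auto.
    - intros; apply Rmult_le_pos; apply ind_pos. }
  assert (Sg := sx_le n beta delta q i T Hact Hi HT j Hj Hji). fold py G in Sg.
  assert (P1 := Hpy j Hj Hji). assert (P2 := Hpy j' Hj' Hji').
  assert (S0 : 0 <= s2m) by (apply Expect_nonneg; [apply so_ok|]; intros; apply Rmult_le_pos; apply ind_pos).
  assert (Sfin : s2m <= G / ((1 - pb) * (1 - pb))).
  { apply (Rmult_le_reg_r ((1 - pb) * (1 - pb))); [nra|].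
    replace (G / ((1 - pb) * (1 - pb)) * ((1 - pb) * (1 - pb))) with G by (field; lra).
    assert ((1 - pb) * s2m <= sx n beta delta q i T j) by nra.
    assert (0 <= sx n beta delta q i T j) by nra. nra. }
  apply Rle_trans with (delta * (delta * s2m) + (Cw j + Cw j')).
  - rewrite <- Eind. unfold Cw. rewrite <- !Expect_plus. apply Expect_le; [apply so_ok|]. intros w _. rewrite E1.
    assert (I1 := ind_or_le (w (Ind j i) = true) (crowd n w i T j)). fold (gj n i T w j) in I1.
    assert (I2 := ind_or_le (w (Ind j' i) = true) (crowd n w i T j')). fold (gj n i T w j') in I2.
    rewrite !ind_and.
    assert (R2 := ind_range (gj n i T w j')).
    assert (R3 := ind_range (secx n i T w J)). assert (R4 := ind_range (hT n w i T)).
    assert (R5 := ind_range (crowd n w i T j)). assert (R6 := ind_range (crowd n w i T j')).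
    assert (R7 := ind_range (w (Ind j i) = true)).
    fold (s2 w) in R3. fold (h w) in R4. fold (h w).
    set (g1 := ind (gj n i T w j)) in *. set (g2 := ind (gj n i T w j')) in *.
    set (a1 := ind (w (Ind j i) = true)) in *. set (a2 := ind (w (Ind j' i) = true)) in *.
    set (b1 := ind (crowd n w i T j)) in *. set (b2 := ind (crowd n w i T j')) in *.
    assert (Q1 : g1 * g2 <= a1 * a2 + (b1 + b2)) by nra.
    assert (Q2 : 0 <= h w * s2 w <= h w) by nra.
    assert (g1 * g2 * (h w * s2 w) <= (a1 * a2 + (b1 + b2)) * (h w * s2 w)) by nra.
    assert ((b1 + b2) * (h w * s2 w) <= (b1 + b2) * h w) by nra. lra.
  - apply Rplus_le_compat_r. unfold Rdiv. rewrite Rmult_assoc, Rmult_assoc.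
    apply Rmult_le_compat_l; [lra|]. apply Rmult_le_compat_l; [lra|]. apply Sfin.
Qed.

Lemma YY_le pb : pb < 1 -> (forall j, (j < n)%nat -> j <> i -> py j <= pb) ->
  YY <= zz n beta delta q i * zz n beta delta q i * G / ((1 - pb) * (1 - pb))
        + 2 * (nsum n i py * nsum n i (fun j => py j * Cw j)).
Proof.
  intros Hpb Hpy.
  assert (P0 : forall j, (j < n)%nat -> 0 <= py j) by (intros; now apply (py_nonneg n beta delta q i Hact Hi)).
  set (B := delta * delta * G / ((1 - pb) * (1 - pb))).
  eapply Rle_trans.
  { apply nsum_le. intros j Hj Hji. apply Rmult_le_compat_l; [auto|]. apply nsum_le. intros j' Hj' Hji'.
    apply Rmult_le_compat_l; [auto|]. apply (YY_pair pb j j' Hpb Hpy Hj Hji Hj' Hji'). }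
  fold B.
  rewrite (nsum_ext n i _ (fun j => nsum n i py * (B * py j) + (nsum n i py * (py j * Cw j) + nsum n i (fun j => py j * Cw j) * py j))).
  - rewrite !nsum_plus, !nsum_scal. right. unfold zz, B. fold py. field. lra.
  - intros j Hj Hji.
    rewrite (nsum_ext n i (fun j' => py j' * (B + (Cw j + Cw j'))) (fun j' => (B + Cw j) * py j' + py j' * Cw j')) by (intros; ring).
    rewrite nsum_plus, nsum_scal. ring.
Qed.

End SecondOrder.

Lemma D2_split n beta delta q i (Hi : (i < n)%nat) (T : nat -> Prop) y :
  y * (y * D2 n beta delta q i (fT n i T) y) =
  XX n beta delta (upd q i y) i T + XYs n beta delta (upd q i y) i T
  + (YXs n beta delta (upd q i y) i T + YY n beta delta (upd q i y) i T).
Proof.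
  set (E := Expect (keys n) (prob beta delta (fun _ => 0) (upd q i y))).
  assert (Hx : forall a : nat -> R, nsum n i (fun x => px beta (upd q i y) i x * a x) = y * nsum n i (fun x => beta i * q x * a x)).
  { intros a. rewrite <- nsum_scal. apply nsum_ext. intros x _ Hxi. unfold px. rewrite upd_same, upd_other by assumption. ring. }
  assert (Hy : forall a : nat -> R, nsum n i (fun x => py beta (upd q i y) i x * a x) = y * nsum n i (fun x => beta x * q x * a x)).
  { intros a. rewrite <- nsum_scal. apply nsum_ext. intros x _ Hxi. unfold py. rewrite upd_same, upd_other by assumption. ring. }
  unfold XX, XYs, YXs, YY. rewrite !Hx, !Hy.
  rewrite (nsum_ext n i (fun x => beta i * q x * nsum n i (fun x' => px beta (upd q i y) i x' * _))
     (fun x => y * (beta i * q x * nsum n i (fun x' => beta i * q x' * E (dl (Dir i x') (dl (Dir i x) (fT n i T)))))))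
    by (intros; rewrite Hx; unfold E; ring).
  rewrite (nsum_ext n i (fun x => beta i * q x * nsum n i (fun j => py beta (upd q i y) i j * _))
     (fun x => y * (beta i * q x * nsum n i (fun j => beta j * q j * E (dl (Dir j i) (dl (Dir i x) (fT n i T)))))))
    by (intros; rewrite Hy; unfold E; ring).
  rewrite (nsum_ext n i (fun x => beta x * q x * nsum n i (fun x' => px beta (upd q i y) i x' * _))
     (fun x => y * (beta x * q x * nsum n i (fun x' => beta i * q x' * E (dl (Dir i x') (dl (Dir x i) (fT n i T)))))))
    by (intros; rewrite Hx; unfold E; ring).
  rewrite (nsum_ext n i (fun x => beta x * q x * nsum n i (fun j => py beta (upd q i y) i j * _))
     (fun x => y * (beta x * q x * nsum n i (fun j => beta j * q j * E (dl (Dir j i) (dl (Dir x i) (fT n i T)))))))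
    by (intros; rewrite Hy; unfold E; ring).
  rewrite !nsum_scal.
  unfold D2, D1. change (EN n beta delta (upd q i y)) with E.
  rewrite (nsum_ext n i (fun x => beta i * q x * (_ + _)) (fun x =>
      beta i * q x * nsum n i (fun x' => beta i * q x' * E (dl (Dir i x') (dl (Dir i x) (fT n i T))))
      + beta i * q x * nsum n i (fun j => beta j * q j * E (dl (Dir j i) (dl (Dir i x) (fT n i T))))))
    by (intros; ring).
  rewrite (nsum_ext n i (fun x => beta x * q x * (_ + _)) (fun x =>
      beta x * q x * nsum n i (fun x' => beta i * q x' * E (dl (Dir i x') (dl (Dir x i) (fT n i T))))
      + beta x * q x * nsum n i (fun j => beta j * q j * E (dl (Dir j i) (dl (Dir x i) (fT n i T))))))
    by (intros; ring).
  rewrite !nsum_plus. ring.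
Qed.

(** * Two ideas with large audiences have almost the same audience *)

Definition chl (A U : nat -> Prop) (w : Outcome) (u : nat) : Prop := U u /\ exists a, A a /\ bwd w a u.

(** Breadth-first generations of the backward cluster, with firms already reached removed from
    [U]. *)
Fixpoint Gen (l : nat) (A U : nat -> Prop) (w : Outcome) : nat -> Prop :=
  match l with
  | O => A
  | S l' => Gen l' (chl A U w) (fun u => U u /\ ~ chl A U w u) w
  end.

Definition alive (l : nat) (A U : nat -> Prop) (w : Outcome) : Prop := exists a, Gen l A U w a.

Lemma Gen_in l A U w m : Gen l A U w m -> A m \/ U m.
Proof.
  revert A U; induction l as [|l IH]; simpl; intros A U H; [now left|].
  apply IH in H. unfold chl in H. tauto.
Qed.

Lemma Rch_gen l A U w m : ~ alive l A U w -> Rch (bwd w) A U m -> exists l', (l' < l)%nat /\ Gen l' A U w m.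
Proof.
  revert A U; induction l as [|l IH]; intros A U Hn H.
  - exfalso. induction H; [apply Hn; now exists v|assumption].
  - assert (C : A m \/ Rch (bwd w) (chl A U w) (fun u => U u /\ ~ chl A U w u) m).
    { clear Hn IH. induction H as [v Hv|u v Hr IHr Hv Huv]; [now left|right].
      em (chl A U w v); [now apply Rch_base|].
      destruct IHr as [Ha|Hr2]; [exfalso; apply n; split; eauto|].
      eapply Rch_step; eauto. }
    destruct C as [C|C]; [exists 0%nat; split; [lia|assumption]|].
    destruct (IH _ _ Hn C) as [l' [Hl Hg]]. exists (S l'). split; [lia|assumption].
Qed.

Lemma Gen_ext l A U w w' : (forall a u, A a \/ U a -> U u -> (bwd w a u <-> bwd w' a u)) -> Gen l A U w = Gen l A U w'.
Proof.
  revert A U; induction l as [|l IH]; simpl; intros A U H; [reflexivity|].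
  assert (E : chl A U w = chl A U w').
  { extensionality u. apply propositional_extensionality.
    split; intros [Hu [a [Ha Hau]]]; (split; [assumption|]); exists a; (split; [assumption|]); apply (H a u); auto. }
  rewrite E. apply IH. intros a u Ha Hu. apply H; unfold chl in *; tauto.
Qed.

Section Uniq.

Variables (n : nat) (beta : nat -> R) (delta : R) (q : nat -> R) (bl c1 c2 : R).
Hypothesis Hnet : net_ok n beta delta q bl c1 c2.

Let ks := keys n.
Let pr := prob beta delta (fun _ => 0) q.
Let pbar := c2 * c2 / INR n.
Let pmin := delta * bl * (c1 * c1) / INR n.

Lemma uq_ok : okp ks pr.
Proof. apply (net_okp _ _ _ _ _ _ _ Hnet). Qed.

Lemma uq_n : 0 < INR n.
Proof. apply (net_n_pos _ _ _ _ _ _ _ Hnet). Qed.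

Lemma uq_pbar : 0 <= pbar <= 1/2.
Proof.
  assert (N := uq_n). destruct Hnet. unfold pbar. split.
  - apply Rmult_le_pos; [nra|left; now apply Rinv_0_lt_compat].
  - apply (Rmult_le_reg_l (INR n)); auto. rewrite Rmult_div_cancel by lra. lra.
Qed.

Lemma uq_edge r a : (r < n)%nat -> (a < n)%nat -> r <> a ->
  pmin <= Expect ks pr (fun w => ind (ind_edge w r a)) <= pbar.
Proof.
  intros Hr Ha Hne. assert (E := EN_edge n beta delta q a r Ha Hr (not_eq_sym Hne)).
  unfold EN in E. fold ks pr in E. rewrite E.
  assert (P := net_p _ _ _ _ _ _ _ Hnet a r Ha Hr). fold pbar in P.
  assert (D := nk_delta _ _ _ _ _ _ _ Hnet). assert (N := uq_n).
  assert (0 < bl * (c1 * c1) / INR n).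
  { destruct Hnet. apply Rdiv_lt_0_compat; [apply Rmult_lt_0_compat; nra|lra]. }
  split; [|nra]. unfold pmin. replace (delta * bl * (c1 * c1) / INR n) with (bl * (c1 * c1) / INR n * delta) by lra.
  apply Rmult_le_compat_r; lra.
Qed.

Lemma uq_dir r a : (r < n)%nat -> (a < n)%nat -> r <> a ->
  Expect ks pr (fun w => ind (w (Dir r a) = true)) <= pbar.
Proof.
  intros Hr Ha Hne. assert (E := EN_Dir n beta delta q r a Hr Ha Hne). unfold EN in E. fold ks pr in E. rewrite E.
  apply (net_p _ _ _ _ _ _ _ Hnet r a Hr Ha).
Qed.

Definition noedge (R A : nat -> Prop) (w : Outcome) : Prop := forall r a, R r -> A a -> ~ ind_edge w r a.

(** Independence of the edges together with [exp (- 2 t) <= 1 - t <= exp (- t)], valid as edge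
    probabilities are at most [1/2]. *)
Lemma noedge_prob (R A : nat -> Prop) : (forall v, R v -> (v < n)%nat) -> (forall v, A v -> (v < n)%nat) ->
  (forall v, R v -> ~ A v) ->
  exp (- (2 * pbar * card n R * card n A)) <= Expect ks pr (fun w => ind (noedge R A w)) <= exp (- (pmin * card n R * card n A)).
Proof.
  intros HR HA Hd.
  rewrite (Expect_ext ks pr _ (fun w => prodR n (fun a => prodR n (fun r => pw (A a /\ R r) (1 - ind (ind_edge w r a)))))).
  2: { intros w _. unfold ind at 1. em (noedge R A w).
       - symmetry. apply prodR_one. intros a Ha. apply prodR_one. intros r Hr. unfold pw. em (A a /\ R r); [|reflexivity].
         rewrite ind_false; [ring|]. now apply n0.
       - symmetry. apply not_all_ex_not in n0. destruct n0 as [r n0]. apply not_all_ex_not in n0. destruct n0 as [a n0].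
         apply imply_to_and in n0. destruct n0 as [Hr n0]. apply imply_to_and in n0. destruct n0 as [Ha He].
         apply NNPP in He. apply (prodR_zero n _ a); [auto|]. apply (prodR_zero n _ r); [auto|].
         rewrite pw_true by auto. rewrite ind_true by assumption. ring. }
  rewrite (Expect_prodR ks pr n (fun a v => exists r, v = Dir a r \/ v = Ind a r)
     (fun a w => prodR n (fun r => pw (A a /\ R r) (1 - ind (ind_edge w r a))))).
  2: { intros a _. apply dep_prodR. intros r _ w w' E. unfold pw. em (A a /\ R r); [|reflexivity].
       unfold ind_edge. rewrite !E by eauto. reflexivity. }
  2: { intros a a' v _ _ [r [-> | ->]] [r' [H|H]]; try discriminate; now injection H. }
  rewrite (prodR_ext n _ (fun a => prodR n (fun r => pw (A a /\ R r) (1 - Expect ks pr (fun w => ind (ind_edge w r a)))))).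
  2: { intros a _. rewrite (Expect_prodR ks pr n (fun r v => v = Dir a r \/ v = Ind a r)
         (fun r w => pw (A a /\ R r) (1 - ind (ind_edge w r a)))).
       - apply prodR_ext. intros r _. unfold pw. em (A a /\ R r); [|apply Expect_const].
         now rewrite Expect_minus, Expect_const.
       - intros r _ w w' E. unfold pw. em (A a /\ R r); [|reflexivity]. unfold ind_edge. rewrite !E by eauto. reflexivity.
       - intros r r' v _ _ [-> | ->] [H|H]; try discriminate; now injection H. }
  assert (S : forall c, exp (- (c * card n R * card n A)) =
     prodR n (fun a => prodR n (fun r => exp (- (c * (ind (A a) * ind (R r))))))).
  { intros c. rewrite (prodR_ext n _ (fun a => exp (- (c * card n R) * ind (A a)))).
    - rewrite prodR_exp, sumR_scal. f_equal. unfold card. ring.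
    - intros a _. rewrite prodR_exp. f_equal.
      rewrite (sumR_ext n _ (fun r => (- (c * ind (A a))) * ind (R r))) by (intros; ring).
      rewrite sumR_scal. unfold card. ring. }
  rewrite !S. assert (PB := uq_pbar).
  split; apply prodR_le; intros a Ha; (split; [apply prodR_nonneg; intros r Hr|apply prodR_le; intros r Hr]).
  - left; apply exp_pos.
  - split; [left; apply exp_pos|]. unfold pw. em (A a /\ R r).
    + destruct a0 as [Aa Rr]. assert (E := uq_edge r a Hr Ha ltac:(intros ->; now apply (Hd a))).
      assert (0 <= Expect ks pr (fun w => ind (ind_edge w r a))) by apply (Expect_ind_range ks pr _ uq_ok).
      rewrite !ind_true, !Rmult_1_r by assumption.
      eapply Rle_trans; [|apply one_sub_ge_exp; lra]. apply exp_le_mono. nra.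
    + rewrite <- exp_0. apply exp_le_mono. rewrite <- ind_and, ind_false by assumption. lra.
  - unfold pw. em (A a /\ R r); [|lra]. assert (Expect ks pr (fun w => ind (ind_edge w r a)) <= 1) by apply (Expect_ind_range ks pr _ uq_ok). lra.
  - unfold pw. em (A a /\ R r).
    + destruct a0 as [Aa Rr]. assert (E := uq_edge r a Hr Ha ltac:(intros ->; now apply (Hd a))).
      rewrite !ind_true, !Rmult_1_r by assumption. split; [lra|].
      eapply Rle_trans; [|apply exp_ge_1]. lra.
    + rewrite <- ind_and, ind_false by assumption. rewrite Rmult_0_r, Ropp_0, exp_0. lra.
Qed.

Lemma chl_card A U : (forall v, A v -> (v < n)%nat) -> (forall v, U v -> (v < n)%nat) -> (forall v, A v -> ~ U v) ->
  Expect ks pr (fun w => card n (chl A U w)) <= c2 * c2 * card n A.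
Proof.
  intros HA HU Hd. unfold card at 1. rewrite Expect_sumR.
  apply Rle_trans with (sumR n (fun _ => pbar * card n A)).
  - apply sumR_le. intros u Hu. eapply Rle_trans.
    { apply (Expect_union_sum ks pr n _ (fun a w => A a /\ U u /\ ind_edge w u a) uq_ok).
      intros w _ [Hu' [a [Ha Hau]]]. exists a. split; auto. }
    unfold card. rewrite <- sumR_scal. apply sumR_le. intros a Ha. rewrite !Expect_ind_const_and.
    assert (PB := uq_pbar). unfold ind at 1 2 4. em (A a); em (U u); try lra.
    rewrite !Rmult_1_l, Rmult_1_r. apply uq_edge; auto. intros ->. now apply (Hd a).
  - rewrite sumR_const. right. unfold pbar. assert (N := uq_n). field. lra.
Qed.

Lemma chl_dep A U : dep (fun v => exists a u, A a /\ (v = Dir a u \/ v = Ind a u)) (chl A U).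
Proof.
  intros w w' E. extensionality u. apply propositional_extensionality.
  assert (H : forall a, A a -> bwd w a u <-> bwd w' a u) by (intros a Ha; apply edge_eq; apply E; eauto).
  split; intros [Hu [a [Ha Hau]]]; (split; [assumption|]); exists a; (split; [assumption|]); now apply H.
Qed.

(** A first-moment bound: generation [l] has mean size at most [(c2^2)^l] per root, and each member
    listens to [t1] with probability at most [pbar]. *)
Lemma short_path l t1 : (t1 < n)%nat -> forall A U, (forall v, A v -> (v < n)%nat) -> (forall v, U v -> (v < n)%nat) ->
  (forall v, A v -> ~ U v) ->
  Expect ks pr (fun w => ind (exists m, Gen l A U w m /\ m <> t1 /\ w (Dir m t1) = true)) <= card n A * (c2 * c2) ^ l * pbar.
Proof.
  intros Ht1. assert (PB := uq_pbar). assert (C2 : 0 <= c2 * c2) by nra.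
  induction l as [|l IH]; intros A U HA HU Hd.
  - eapply Rle_trans.
    { apply (Expect_union_sum ks pr n _ (fun m w => (A m /\ m <> t1) /\ w (Dir m t1) = true) uq_ok).
      intros w _ [m [Hm [Hne Hdm]]]. exists m. split; auto. }
    rewrite Rmult_1_r. unfold card. rewrite Rmult_comm, <- sumR_scal. apply sumR_le. intros m Hm.
    rewrite Expect_ind_const_and. em (A m /\ m <> t1).
    + rewrite !ind_true by tauto. rewrite Rmult_1_l, Rmult_1_r. apply uq_dir; tauto.
    + rewrite ind_false by assumption. assert (I := ind_pos (A m)). nra.
  - eapply Rle_trans.
    + apply (Expect_fresh ks pr (chl A U) (fun _ v => exists a u, A a /\ (v = Dir a u \/ v = Ind a u))
        (fun Sx w => ind (exists m, Gen l Sx (fun u => U u /\ ~ Sx u) w m /\ m <> t1 /\ w (Dir m t1) = true))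
        (fun Sx => card n Sx * (c2 * c2) ^ l * pbar) uq_ok).
      * intros w w' E. symmetry. now apply chl_dep.
      * intros w _. set (Sx := chl A U w). assert (HS : forall u, Sx u -> U u) by (unfold Sx, chl; tauto).
        intros w1 w2 E. apply ind_iff.
        assert (EE : forall a u, U a -> w1 (Dir a u) = w2 (Dir a u) /\ w1 (Ind a u) = w2 (Ind a u)).
        { intros a u Ha. split; apply E; intros [a' [u' [Ha' [X|X]]]]; try discriminate; injection X as -> ->; now apply (Hd a'). }
        rewrite (Gen_ext l Sx (fun u => U u /\ ~ Sx u) w1 w2).
        2: { intros a u Ha Hu. assert (Ua : U a) by (destruct Ha as [Ha|Ha]; [auto|tauto]). apply edge_eq; now apply EE. }
        split; intros [m [Hm [Hne Hdm]]]; exists m; (split; [assumption|]); (split; [assumption|]);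
          (assert (Um : U m) by (apply Gen_in in Hm; destruct Hm as [Hm|Hm]; [auto|tauto]));
          destruct (EE m t1 Um); congruence.
      * intros w _. apply IH.
        -- intros v [Hv _]; auto.
        -- intros v [Hv _]; auto.
        -- intros v Hv [_ Hv']; auto.
    + rewrite (Expect_ext ks pr _ (fun w => ((c2 * c2) ^ l * pbar) * card n (chl A U w))) by (intros; ring).
      rewrite Expect_scal.
      apply Rle_trans with ((c2 * c2) ^ l * pbar * (c2 * c2 * card n A)).
      * apply Rmult_le_compat_l; [apply Rmult_le_pos; [now apply pow_le|lra]|]. now apply chl_card.
      * right. simpl. ring.
Qed.

(** The audience of idea [t2] within [U]. *)
Definition R2 (t2 : nat) (U : nat -> Prop) (w : Outcome) : nat -> Prop :=
  Rch (fwd w) (fun m => U m /\ w (Dir m t2) = true) U.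

Lemma R2_in t2 U w v : R2 t2 U w v -> U v.
Proof. intros H. apply Rch_in in H. tauto. Qed.

Lemma R2_ext t2 U w w' : (forall m, U m -> w (Dir m t2) = w' (Dir m t2)) ->
  (forall a u, U a -> U u -> (fwd w a u <-> fwd w' a u)) -> R2 t2 U w = R2 t2 U w'.
Proof.
  intros H1 H2. unfold R2.
  replace (fun m => U m /\ w (Dir m t2) = true) with (fun m => U m /\ w' (Dir m t2) = true).
  - apply Rch_ext_on. intros a u Ha Hu. apply H2; tauto.
  - extensionality m. apply propositional_extensionality.
    split; intros [Hm Hd]; (split; [assumption|]); [rewrite H1|rewrite <- H1]; assumption.
Qed.

Definition sepev (t2 l : nat) (A U : nat -> Prop) (m0 : R) (w : Outcome) : Prop :=
  alive l A U w /\ m0 < card n (R2 t2 U w) /\ noedge (R2 t2 U w) A w.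

(** A backward cluster that lives long cannot miss a large audience. A generation with at least [fq]
    firms would have to avoid every edge from more than [m0] firms, which has probability at most
    [ef]; a smaller generation dies out at once with probability at least [1 - th]. Surviving [l]
    small generations gives [th ^ l]. *)
Lemma separation t2 m0 fq l : 0 <= m0 -> 0 <= fq -> forall A U, (forall v, A v -> (v < n)%nat) -> (forall v, U v -> (v < n)%nat) ->
  (forall v, A v -> ~ U v) -> ~ U t2 ->
  Expect ks pr (fun w => ind (sepev t2 l A U m0 w)) <=
    (1 - exp (- (2 * (c2 * c2) * fq))) ^ l + exp (- (pmin * m0 * fq)).
Proof.
  intros Hm0 Hf. set (th := 1 - exp (- (2 * (c2 * c2) * fq))). set (ef := exp (- (pmin * m0 * fq))).
  assert (Hth : 0 <= th <= 1).
  { unfold th. assert (P := exp_pos (- (2 * (c2 * c2) * fq))).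
    assert (exp (- (2 * (c2 * c2) * fq)) <= exp 0) by (apply exp_le_mono; nra). rewrite exp_0 in H. lra. }
  assert (Hef : 0 < ef) by apply exp_pos.
  assert (N := uq_n). assert (PB := uq_pbar).
  assert (Pm : 0 <= pmin).
  { apply Rmult_le_pos; [|left; now apply Rinv_0_lt_compat]. destruct Hnet. repeat apply Rmult_le_pos; lra. }
  induction l as [|l IH]; intros A U HA HU Hd Ht2.
  - assert (K := Expect_ind_range ks pr (sepev t2 0 A U m0) uq_ok). lra.
  - destruct (Rle_dec fq (card n A)) as [Hbig|Hsmall].
    + apply Rle_trans with ef; [|assert (0 <= th ^ S l) by (apply pow_le; lra); lra].
      eapply Rle_trans.
      { apply (Expect_le ks pr _ (fun w => ind (m0 < card n (R2 t2 U w) /\ noedge (R2 t2 U w) A w)) uq_ok).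
        intros w _. apply ind_le. unfold sepev. tauto. }
      eapply Rle_trans.
      * apply (Expect_fresh ks pr (R2 t2 U) (fun _ v => exists a u, U a /\ (v = Dir a u \/ v = Ind a u))
          (fun Rr w => ind (m0 < card n Rr /\ noedge Rr A w)) (fun _ => ef) uq_ok).
        -- intros w w' E. symmetry. apply R2_ext.
           ++ intros m Hm. apply E. eauto.
           ++ intros a u Ha Hu. apply edge_eq; apply E; eauto.
        -- intros w _ w1 w2 E. apply ind_iff.
           assert (H : forall r a, A a -> ind_edge w1 r a <-> ind_edge w2 r a).
           { intros r a Ha. apply edge_eq; apply E; intros [a' [u' [Ha' [X|X]]]]; try discriminate;
               injection X as -> ->; now apply (Hd a'). }
           split; intros [H1 H2]; (split; [assumption|]); intros r a Hr Ha He; apply (H2 r a Hr Ha); now apply H.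
        -- intros w _. rewrite Expect_ind_const_and. unfold ind at 1. em (m0 < card n (R2 t2 U w)); [|lra].
           rewrite Rmult_1_l. eapply Rle_trans; [apply noedge_prob; auto|].
           ++ intros v Hv. apply HU. eapply R2_in; eauto.
           ++ intros v Hv HAv. apply (Hd v HAv). eapply R2_in; eauto.
           ++ apply exp_le_mono, Ropp_le_contravar.
              assert (pmin * m0 <= pmin * card n (R2 t2 U w)) by nra.
              apply Rmult_le_compat; try lra. apply Rmult_le_pos; lra.
      * rewrite Expect_const. lra.
    + eapply Rle_trans.
      { apply (Expect_le ks pr _ (fun w => (fun Sx w' => ind ((exists u, Sx u) /\ sepev t2 l Sx (fun u => U u /\ ~ Sx u) m0 w')) (chl A U w) w) uq_ok).
        intros w _. apply ind_le. intros [Hal [Hc Hno]].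
        set (Sx := chl A U w).
        (* Since no edge joins the audience to [A], the audience contains no child of [A]. Removing
           the children from the unexplored firms leaves it intact, and the event passes to the next
           generation. *)
        assert (Hdis : forall r, R2 t2 U w r -> ~ Sx r).
        { intros r Hr [Hu [a [Ha Hra]]]. now apply (Hno r a). }
        assert (ER : R2 t2 (fun u => U u /\ ~ Sx u) w = R2 t2 U w).
        { extensionality v. apply propositional_extensionality. split.
          - apply Rch_mono; tauto.
          - intros Hv. assert (Hs := Hdis v Hv). revert Hs. induction Hv as [v [Hv1 Hv2]|u v Hr IHr Hv Huv]; intros Hs.
            + apply Rch_base. tauto.
            + eapply Rch_step; [apply IHr, Hdis, Hr|tauto|exact Huv]. }
        split.
        - destruct Hal as [m Hm]. destruct l as [|l']; simpl in Hm; [now exists m|].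
          em (exists u, Sx u); [assumption|]. exfalso.
          assert (K : forall l A U, (forall a, ~ A a) -> forall m, ~ Gen l A U w m).
          { clear. induction l as [|l IHl]; simpl; intros A U H m; [apply H|]. apply IHl.
            intros a [_ [b [Hb _]]]. now apply (H b). }
          apply (K (S l') Sx (fun u => U u /\ ~ Sx u)) with (m := m); [|exact Hm]. intros a Ha. apply n0; eauto.
        - unfold sepev. rewrite ER. split; [exact Hal|]. split; [assumption|].
          intros r s Hr Hs He. apply (Hdis s); [|assumption].
          eapply Rch_step; [apply Hr|apply Hs|exact He]. }
      eapply Rle_trans.
      * apply (Expect_fresh ks pr (chl A U) (fun _ v => exists a u, A a /\ (v = Dir a u \/ v = Ind a u))
          (fun Sx w' => ind ((exists u, Sx u) /\ sepev t2 l Sx (fun u => U u /\ ~ Sx u) m0 w'))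
          (fun Sx => ind (exists u, Sx u) * (th ^ l + ef)) uq_ok).
        -- intros w w' E. symmetry. now apply chl_dep.
        -- intros w _. set (Sx := chl A U w). assert (HS : forall u, Sx u -> U u) by (unfold Sx, chl; tauto).
           intros w1 w2 E. apply ind_iff.
           assert (EE : forall a u, U a -> w1 (Dir a u) = w2 (Dir a u) /\ w1 (Ind a u) = w2 (Ind a u)).
           { intros a u Ha. split; apply E; intros [a' [u' [Ha' [X|X]]]]; try discriminate; injection X as -> ->; now apply (Hd a'). }
           unfold sepev, alive.
           rewrite (Gen_ext l Sx (fun u => U u /\ ~ Sx u) w1 w2).
           2: { intros a u Ha Hu. assert (Ua : U a) by (destruct Ha as [Ha|Ha]; [auto|tauto]). apply edge_eq; now apply EE. }
           rewrite (R2_ext t2 (fun u => U u /\ ~ Sx u) w1 w2).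
           2: { intros m [Hm _]. now apply EE. }
           2: { intros a u Ha Hu. apply edge_eq; apply EE; tauto. }
           assert (H : forall r a, Sx a -> ind_edge w1 r a <-> ind_edge w2 r a).
           { intros r a Ha. apply edge_eq; apply EE; auto. }
           split; intros [H0 [H1 [H2 H3]]]; (split; [assumption|]); (split; [assumption|]); (split; [assumption|]);
             intros r a Hr Ha He; apply (H3 r a Hr Ha); now apply H.
        -- intros w _. rewrite Expect_ind_const_and. apply Rmult_le_compat_l; [apply ind_pos|]. apply IH.
           ++ intros v [Hv _]; auto.
           ++ intros v [Hv _]; auto.
           ++ intros v Hv [_ Hv']; auto.
           ++ tauto.
      * rewrite (Expect_ext ks pr _ (fun w => (th ^ l + ef) * ind (exists u, chl A U w u))) by (intros; ring).
        rewrite Expect_scal.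
        assert (Hp : Expect ks pr (fun w => ind (exists u, chl A U w u)) <= th).
        { assert (Hq := noedge_prob U A HU HA ltac:(intros v Hv Ha; now apply (Hd v))).
          assert (E1 : Expect ks pr (fun w => ind (exists u, chl A U w u)) = 1 - Expect ks pr (fun w => ind (noedge U A w))).
          { rewrite <- (Expect_const ks pr 1) at 1. rewrite <- Expect_minus. apply Expect_ext. intros w _.
            rewrite <- ind_not. apply ind_iff. split.
            - intros [u [Hu [a [Ha Hau]]]] Hn. now apply (Hn u a).
            - intros Hn. apply not_all_ex_not in Hn. destruct Hn as [r Hn]. apply not_all_ex_not in Hn. destruct Hn as [a Hn].
              apply imply_to_and in Hn. destruct Hn as [Hr Hn]. apply imply_to_and in Hn. destruct Hn as [Ha He].
              apply NNPP in He. exists r. split; [assumption|]. exists a. auto. }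
          rewrite E1. unfold th. destruct Hq as [Hq _].
          assert (exp (- (2 * (c2 * c2) * fq)) <= exp (- (2 * pbar * card n U * card n A))); [|lra].
          apply exp_le_mono, Ropp_le_contravar.
          assert (CU := card_le_n n U). assert (CU0 := card_nonneg n U). assert (CA0 := card_nonneg n A).
          assert (pbar * card n U <= c2 * c2).
          { apply Rle_trans with (pbar * INR n); [apply Rmult_le_compat_l; lra|]. unfold pbar. right. field. lra. }
          apply Rmult_le_compat; try lra. assert (0 <= pbar * card n U) by nra. lra. }
        assert (0 <= th ^ l) by (apply pow_le; lra).
        apply Rle_trans with ((th ^ l + ef) * th); [apply Rmult_le_compat_l; lra|]. simpl. nra.
Qed.

End Uniq.

Lemma card_pairs n (P : nat -> Prop) :
  card n P * (card n P - 1) = sumR n (fun x => sumR n (fun x' => if Nat.eq_dec x x' then 0 else ind (P x) * ind (P x'))).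
Proof.
  rewrite (sumR_ext n _ (fun x => ind (P x) * card n P - ind (P x))).
  - rewrite (sumR_ext n _ (fun x => (card n P - 1) * ind (P x))) by (intros; ring).
    rewrite sumR_scal. fold (card n P). ring.
  - intros x Hx.
    rewrite (sumR_ext n _ (fun x' => ind (P x) * ind (P x') + (if Nat.eq_dec x' x then - ind (P x) else 0))).
    + rewrite sumR_plus, sumR_scal, sumR_single by assumption. unfold card. ring.
    + intros x' _. destruct (Nat.eq_dec x x') as [->|].
      * destruct (Nat.eq_dec x' x'); [|congruence]. unfold ind. em (P x'); ring.
      * destruct (Nat.eq_dec x' x); [congruence|ring].
Qed.

Definition lrno (n : nat) (w : Outcome) (i x t : nat) : Prop := exists m, bko n w i x m /\ w (Dir m t) = true.

Definition U0 (n i t2 : nat) (v : nat) : Prop := (v < n)%nat /\ v <> i /\ v <> t2.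

Lemma R2_bko n w i x t2 r : (x < n)%nat -> x <> i -> R2 t2 (U0 n i t2) w r -> bko n w i x r -> lrno n w i x t2.
Proof.
  intros Hx Hxi H. induction H as [v [Hv Hd]|u v Hr IH Hv Huv]; intros Hb; [now exists v|].
  apply IH. destruct (Nat.eq_dec u x) as [->|Hux]; [now apply Rch_base|].
  apply R2_in in Hr. apply (Rch_step _ _ _ v u Hb); [|exact Huv]. unfold U0 in Hr. tauto.
Qed.

Lemma lrno_R2 n w i x t2 : supp (keys n) w -> (x < n)%nat -> x <> i -> x <> t2 ->
  lrno n w i x t2 -> R2 t2 (U0 n i t2) w x.
Proof.
  intros Hw Hx Hxi Hxt [m [Hm Hd]].
  set (U := U0 n i t2).
  assert (C : R2 t2 U w x \/ (U m /\ Rch (fwd w) (fun v => v = m) U x)).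
  { clear Hd. induction Hm as [v ->|u v Hr IH Hv Huv].
    - right. split; [unfold U, U0; tauto|now apply Rch_base].
    - destruct IH as [IH|[Uu IH]]; [now left|]. destruct (Nat.eq_dec v t2) as [->|Hvt].
      + left. eapply Rch_mono; [| | |apply IH]; auto. intros a ->. split; [assumption|apply Huv].
      + right. split; [unfold U, U0; tauto|].
        eapply Rch_absorb; [| | |apply IH]; auto.
        * intros a ->. now right.
        * intros a ->. apply (Rch_step _ _ _ v u); [now apply Rch_base|assumption|exact Huv]. }
  destruct C as [C|[Um C]]; [assumption|].
  eapply Rch_mono; [| | |apply C]; auto. intros a ->. auto.
Qed.

Section Super.

Variables (n : nat) (beta : nat -> R) (delta : R) (q : nat -> R) (bl c1 c2 : R).
Hypothesis Hnet : net_ok n beta delta q bl c1 c2.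

Let ks := keys n.
Let pr := prob beta delta (fun _ => 0) q.
Let pbar := c2 * c2 / INR n.
Let pmin := delta * bl * (c1 * c1) / INR n.
Let Hok : okp ks pr := net_okp _ _ _ _ _ _ _ Hnet.

(** Short-path bounds for the first [L] generations, plus the separation bound for longer lives. *)
Definition psib (L : nat) (m0 fq : R) : R :=
  sumR L (fun l => (c2 * c2) ^ l * pbar) + ((1 - exp (- (2 * (c2 * c2) * fq))) ^ L + exp (- (pmin * m0 * fq))).

(** Suppose [x] hears of [t1] but not of [t2]. If the backward cluster of [x] dies within [L]
    generations, a listener of [t1] is close to [x]; otherwise it is long-lived and separated from
    the audience of [t2]. *)
Lemma audience_diff L m0 fq i x t1 t2 : 0 <= m0 -> 0 <= fq -> (i < n)%nat -> (x < n)%nat -> x <> i -> x <> t2 ->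
  (t1 < n)%nat ->
  Expect ks pr (fun w => ind (lrno n w i x t1 /\ ~ lrno n w i x t2 /\ m0 < card n (R2 t2 (U0 n i t2) w))) <= psib L m0 fq.
Proof.
  intros Hm Hf Hi Hx Hxi Hxt Ht1.
  set (A := fun v => v = x). set (U := fun v => U0 n i t2 v /\ v <> x).
  assert (HA : forall v, A v -> (v < n)%nat) by now intros v ->.
  assert (HU : forall v, U v -> (v < n)%nat) by (unfold U, U0; tauto).
  assert (Hd : forall v, A v -> ~ U v) by (intros v ->; unfold U; tauto).
  assert (Ht2 : ~ U t2) by (unfold U, U0; tauto).
  eapply Rle_trans.
  { apply (Expect_union ks pr _ (fun w => exists l, (l < L)%nat /\ exists m, Gen l A U w m /\ m <> t1 /\ w (Dir m t1) = true)
      (fun w => sepev n t2 L A U m0 w) Hok).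
    intros w Hw [[m [Hbm Hdm]] [Hn Hc]].
    assert (Hb' : forall v, bko n w i x v -> Rch (bwd w) A U v).
    { intros v Hv. induction Hv as [v ->|u v Hr IH Hv Huv]; [now apply Rch_base|].
      apply (Rch_step _ _ _ u v IH); [|assumption]. unfold U, U0.
      assert (v <> t2); [|tauto]. intros ->. apply Hn. exists u. split; [assumption|apply Huv]. }
    destruct (classic (alive L A U w)) as [Hal|Hal].
    - right. split; [assumption|].
      assert (HRx : forall r, R2 t2 (U0 n i t2) w r -> ~ bko n w i x r).
      { intros r Hr Hb. apply Hn. eapply R2_bko; eauto. }
      assert (Hxb : bko n w i x x) by now apply Rch_base.
      assert (Hne : forall r, R2 t2 (U0 n i t2) w r -> r <> x) by (intros r Hr ->; now apply (HRx x)).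
      assert (ER : forall v, R2 t2 (U0 n i t2) w v -> R2 t2 U w v).
      { intros v Hv. assert (Hvx := Hne v Hv). revert Hvx. induction Hv as [v [Hv1 Hv2]|u v Hr IHr Hv Huv]; intros Hvx.
        - apply Rch_base. unfold U; tauto.
        - eapply Rch_step; [apply IHr, Hne, Hr|unfold U; tauto|exact Huv]. }
      split.
      + eapply Rlt_le_trans; [apply Hc|]. apply card_le. intros v _. apply ER.
      + intros r a Hr -> He. assert (Hr' : R2 t2 (U0 n i t2) w r).
        { eapply Rch_mono; [| | |apply Hr]; auto; unfold U; intros; tauto. }
        apply (HRx r Hr'). assert (Ur := R2_in _ _ _ _ Hr'). unfold U0 in Ur.
        assert (r <> x) by now apply Hne.
        apply (Rch_step _ _ _ x r Hxb); [tauto|exact He].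
    - left. destruct (Rch_gen L A U w m Hal (Hb' m Hbm)) as [l [Hl Hg]]. exists l. split; [assumption|].
      exists m. split; [assumption|]. split; [|assumption]. apply (Dir_supp n w Hw m t1 Hdm). }
  apply Rplus_le_compat.
  - eapply Rle_trans.
    { apply (Expect_union_sum ks pr L _ (fun l w => exists m, Gen l A U w m /\ m <> t1 /\ w (Dir m t1) = true) Hok). auto. }
    apply sumR_le. intros l _.
    eapply Rle_trans; [apply (short_path n beta delta q bl c1 c2 Hnet l t1 Ht1 A U HA HU Hd)|].
    unfold A. rewrite card_single by assumption. fold pbar. lra.
  - apply (separation n beta delta q bl c1 c2 Hnet t2 m0 fq L Hm Hf A U HA HU Hd Ht2).
Qed.

(** Two pivotal links are each the only cover of some idea. Apart from the rare case that an idea is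
    the end of its own link, one of them hears of [t1] and not of [t2] while the other belongs to
    the audience of [t2]. *)
Lemma piv_pair i T w x x' : (i < n)%nat -> (forall t, T t -> (t < n)%nat /\ t <> i) -> supp (keys n) w ->
  (x < n)%nat -> (x' < n)%nat -> x <> x' ->
  hT n w i T -> piv n i T w x -> piv n i T w x' ->
  w (Dir i x) = true /\ w (Dir i x') = true /\ exists t1 t2, T t1 /\ T t2 /\
    (t1 = x \/ t2 = x' \/ (x <> i /\ x' <> i /\ x <> t2 /\ lrno n w i x t1 /\ ~ lrno n w i x t2 /\ R2 t2 (U0 n i t2) w x')).
Proof.
  intros Hi HT Hw Hx Hx' Hne Hh [Hxi [Hd Hn]] [Hxi' [Hd' Hn']]. split; [assumption|]. split; [assumption|].
  apply not_all_ex_not in Hn. destruct Hn as [t1 Hn]. apply imply_to_and in Hn. destruct Hn as [Ht1 Hn].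
  apply not_all_ex_not in Hn'. destruct Hn' as [t2 Hn']. apply imply_to_and in Hn'. destruct Hn' as [Ht2 Hn'].
  exists t1, t2. split; [assumption|]. split; [assumption|].
  assert (K1 : Kx n w i x t1).
  { assert (HL := Hh t1 Ht1). apply Lrn_cover in HL; auto. destruct HL as [y [Hy [Hyi [Hdy HK]]]].
    rewrite <- (Lrn_setx n i Hi w x y t1 Hy Hyi Hdy HK Hn). assumption. }
  assert (K2 : Kx n w i x' t2).
  { assert (HL := Hh t2 Ht2). apply Lrn_cover in HL; auto. destruct HL as [y [Hy [Hyi [Hdy HK]]]].
    rewrite <- (Lrn_setx n i Hi w x' y t2 Hy Hyi Hdy HK Hn'). assumption. }
  assert (K3 : ~ Kx n w i x t2).
  { intros HK. apply Hne. apply (Lrn_setx n i Hi w x' x t2 Hx Hxi Hd HK Hn'). }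
  destruct (HT t1 Ht1) as [Ht1n Ht1i]. destruct (HT t2 Ht2) as [Ht2n Ht2i].
  destruct (Nat.eq_dec t2 x') as [|Hxt']; [now right; left|].
  destruct K1 as [_ [_ [K1|[I1 L1]]]]; [now left|].
  destruct K2 as [_ [_ [K2|[I2 L2]]]]; [now right; left|].
  right; right. split; [assumption|]. split; [assumption|].
  assert (Hxt2 : x <> t2) by (intros ->; apply K3; unfold Kx; auto).
  split; [assumption|]. split; [exact L1|].
  split; [intros HL; apply K3; unfold Kx; auto|]. apply lrno_R2; auto.
Qed.

Lemma pair_prob i x x' (M : Outcome -> Prop) : (i < n)%nat -> (x < n)%nat -> (x' < n)%nat -> x <> i -> x' <> i -> x <> x' ->
  dep (nx i) M ->
  Expect ks pr (fun w => ind (w (Dir i x) = true) * (ind (w (Dir i x') = true) * ind (M w)))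
    <= pbar * (pbar * Expect ks pr (fun w => ind (M w))).
Proof.
  intros Hi Hx Hx' Hxi Hxi' Hne HM.
  assert (Hd : forall y, (y < n)%nat -> y <> i -> 0 <= Expect ks pr (fun w => ind (w (Dir i y) = true)) <= pbar).
  { intros y Hy Hyi. split; [apply Expect_ind_range, Hok|]. apply (uq_dir n beta delta q bl c1 c2 Hnet); auto. }
  rewrite (Expect_indep ks pr (fun v => v = Dir i x)).
  - rewrite (Expect_indep ks pr (fun v => v = Dir i x')).
    + assert (I := Expect_ind_range ks pr M Hok). assert (H1 := Hd x Hx Hxi). assert (H2 := Hd x' Hx' Hxi').
      apply Rmult_le_compat; try lra; [apply Rmult_le_pos; lra|]. apply Rmult_le_compat_r; lra.
    + apply dep_var.
    + intros w w' E. rewrite (HM w w'); [reflexivity|]. intros v Hv. apply E. intros ->. now apply Hv.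
  - apply dep_var.
  - intros w w' E. rewrite (E (Dir i x')) by congruence. f_equal. rewrite (HM w w'); [reflexivity|].
    intros v Hv. apply E. intros ->. now apply Hv.
Qed.

Lemma lrno_dep i x t : x <> i -> dep (nx i) (fun w => lrno n w i x t).
Proof.
  intros Hx w w' E. apply propositional_extensionality. unfold lrno.
  assert (Eb : bko n w i x = bko n w' i x) by (apply bko_ext; auto). rewrite Eb.
  split; intros [m [Hm Hd]]; exists m; (split; [assumption|]);
    [rewrite <- E|rewrite E]; auto; apply (bko_in n i w' x m Hx Hm).
Qed.

Lemma R2_dep i t2 : dep (nx i) (fun w => R2 t2 (U0 n i t2) w).
Proof.
  intros w w' E. apply R2_ext.
  - intros m Hm. apply E. unfold U0 in Hm. tauto.
  - intros a u Ha Hu. unfold U0 in *. apply edge_eq; apply E; simpl; tauto.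
Qed.

(** The two link probabilities of order [1 / n] balance the double sum. If the audience of [t2] has
    at most [eta * n] members, the choice of [x'] contributes a factor [eta]; if it is larger,
    [audience_diff] applies to [x]. *)
Lemma main_term L eta fq i t1 t2 : 0 <= eta -> 0 <= fq -> (i < n)%nat -> (t1 < n)%nat -> (t2 < n)%nat -> t2 <> i ->
  sumR n (fun x => sumR n (fun x' => if Nat.eq_dec x x' then 0 else
    Expect ks pr (fun w => ind (w (Dir i x) = true) * (ind (w (Dir i x') = true) *
      ind (x <> i /\ x' <> i /\ x <> t2 /\ lrno n w i x t1 /\ ~ lrno n w i x t2 /\ R2 t2 (U0 n i t2) w x')))))
  <= c2 * c2 * (c2 * c2) * (eta + psib L (eta * INR n) fq).
Proof.
  intros Heta Hf Hi Ht1 Ht2 Ht2i.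
  assert (N := uq_n n beta delta q bl c1 c2 Hnet).
  assert (PB := uq_pbar n beta delta q bl c1 c2 Hnet). fold pbar in PB.
  assert (C2 : 0 <= c2 * c2) by nra.
  assert (Hnp : INR n * pbar = c2 * c2) by (unfold pbar; field; lra).
  set (Psi := psib L (eta * INR n) fq).
  assert (P0 : 0 <= Psi).
  { assert (K := separation n beta delta q bl c1 c2 Hnet t2 (eta * INR n) fq L ltac:(nra) Hf (fun _ => False) (fun _ => False)
      ltac:(tauto) ltac:(tauto) ltac:(tauto) ltac:(tauto)).
    assert (K2 := Expect_ind_range ks pr (sepev n t2 L (fun _ => False) (fun _ => False) (eta * INR n)) Hok).
    unfold Psi, psib. assert (0 <= sumR L (fun l => (c2 * c2) ^ l * pbar)).
    { apply sumR_nonneg. intros l _. apply Rmult_le_pos; [now apply pow_le|lra]. }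
    unfold pmin. unfold ks, pr in K2. lra. }
  apply Rle_trans with (sumR n (fun x => pbar * (c2 * c2 * (eta + Psi)))).
  2: { rewrite sumR_const. right. rewrite <- Rmult_assoc, Hnp. ring. }
  apply sumR_le. intros x Hx.
  destruct (classic (x <> i /\ x <> t2)) as [[Hxi Hxt]|Hbad].
  2: { rewrite sumR_zero; [apply Rmult_le_pos; [lra|]; apply Rmult_le_pos; lra|].
       intros x' Hx'. destruct (Nat.eq_dec x x'); [reflexivity|].
       rewrite (Expect_ext ks pr _ (fun _ => 0)), Expect_const; [reflexivity|].
       intros w _. rewrite (ind_false (x <> i /\ _)) by tauto. ring. }
  set (Ev := fun w => lrno n w i x t1 /\ ~ lrno n w i x t2).
  apply Rle_trans with (sumR n (fun x' => pbar * (pbar * Expect ks pr (fun w => ind (Ev w) * ind (R2 t2 (U0 n i t2) w x'))))).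
  - apply sumR_le. intros x' Hx'.
    assert (E0 : 0 <= pbar * (pbar * Expect ks pr (fun w => ind (Ev w) * ind (R2 t2 (U0 n i t2) w x')))).
    { apply Rmult_le_pos; [lra|]. apply Rmult_le_pos; [lra|]. apply Expect_nonneg; [apply Hok|].
      intros; apply Rmult_le_pos; apply ind_pos. }
    destruct (Nat.eq_dec x x') as [|Hne]; [assumption|].
    destruct (Nat.eq_dec x' i) as [->|Hxi'].
    { rewrite (Expect_ext ks pr _ (fun _ => 0)), Expect_const; [assumption|].
      intros w _. rewrite (ind_false (x <> i /\ _)) by tauto. ring. }
    eapply Rle_trans.
    { apply (pair_prob i x x' (fun w => x <> i /\ x' <> i /\ x <> t2 /\ lrno n w i x t1 /\ ~ lrno n w i x t2 /\ R2 t2 (U0 n i t2) w x')); auto.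
      intros w w' E. rewrite (lrno_dep i x t1 Hxi w w' E), (lrno_dep i x t2 Hxi w w' E), (R2_dep i t2 w w' E). reflexivity. }
    apply Rmult_le_compat_l; [lra|]. apply Rmult_le_compat_l; [lra|].
    apply Expect_le; [apply Hok|]. intros w _. rewrite <- ind_and. apply ind_le. unfold Ev. tauto.
  - rewrite !sumR_scal. apply Rmult_le_compat_l; [lra|].
    rewrite <- Expect_sumR.
    apply Rle_trans with (pbar * (INR n * (eta + Psi))); [|right; rewrite <- Rmult_assoc, (Rmult_comm pbar), Hnp; reflexivity].
    apply Rmult_le_compat_l; [lra|].
    apply Rle_trans with (Expect ks pr (fun w => INR n * eta + INR n * ind (lrno n w i x t1 /\ ~ lrno n w i x t2 /\ eta * INR n < card n (R2 t2 (U0 n i t2) w)))).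
    + apply Expect_le; [apply Hok|]. intros w _. rewrite sumR_scal. fold (card n (R2 t2 (U0 n i t2) w)).
      assert (CB := card_le_n n (R2 t2 (U0 n i t2) w)). assert (CB0 := card_nonneg n (R2 t2 (U0 n i t2) w)).
      assert (I1 := ind_range (Ev w)).
      destruct (Rlt_dec (eta * INR n) (card n (R2 t2 (U0 n i t2) w))) as [Hb|Hb].
      * replace (ind (lrno n w i x t1 /\ ~ lrno n w i x t2 /\ eta * INR n < card n (R2 t2 (U0 n i t2) w))) with (ind (Ev w))
          by (apply ind_iff; unfold Ev; tauto). nra.
      * assert (I2 := ind_pos (lrno n w i x t1 /\ ~ lrno n w i x t2 /\ eta * INR n < card n (R2 t2 (U0 n i t2) w))). nra.
    + rewrite Expect_plus, Expect_const, Expect_scal.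
      assert (K := audience_diff L (eta * INR n) fq i x t1 t2 ltac:(nra) Hf Hi Hx Hxi Hxt Ht1). fold Psi in K. nra.
Qed.

Lemma side_term i t : (i < n)%nat -> (t < n)%nat ->
  sumR n (fun x => sumR n (fun x' => if Nat.eq_dec x x' then 0 else
     Expect ks pr (fun w => ind (w (Dir i x) = true) * (ind (w (Dir i x') = true) * ind (t = x /\ x <> i /\ x' <> i)))))
  <= c2 * c2 * (c2 * c2) / INR n.
Proof.
  intros Hi Ht. assert (N := uq_n n beta delta q bl c1 c2 Hnet).
  assert (PB := uq_pbar n beta delta q bl c1 c2 Hnet). fold pbar in PB.
  apply Rle_trans with (sumR n (fun x => INR n * pbar * pbar * ind (x = t))).
  - apply sumR_le. intros x Hx. apply Rle_trans with (sumR n (fun _ => pbar * (pbar * ind (x = t)))).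
    + apply sumR_le. intros x' Hx'.
      assert (E0 : 0 <= pbar * (pbar * ind (x = t))) by (assert (I := ind_pos (x = t)); apply Rmult_le_pos; [lra|apply Rmult_le_pos; lra]).
      destruct (Nat.eq_dec x x'); [assumption|].
      destruct (classic (x <> i /\ x' <> i)) as [[Hxi Hxi']|Hb].
      * eapply Rle_trans; [apply (pair_prob i x x' (fun _ => t = x /\ x <> i /\ x' <> i)); auto; intros w w' _; reflexivity|].
        rewrite Expect_const. apply Rmult_le_compat_l; [lra|]. apply Rmult_le_compat_l; [lra|].
        apply ind_le. intuition.
      * rewrite (Expect_ext ks pr _ (fun _ => 0)), Expect_const; [assumption|].
        intros w _. rewrite (ind_false (t = x /\ _)) by tauto. ring.
    + rewrite sumR_const. right. ring.
  - rewrite sumR_scal. fold (card n (fun x => x = t)). rewrite card_single by assumption.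
    right. unfold pbar. field. lra.
Qed.

Lemma PP_bound L eta fq i (T : nat -> Prop) : 0 <= eta -> 0 <= fq -> (i < n)%nat ->
  (forall t, T t -> (t < n)%nat /\ t <> i) ->
  PP n beta delta q i T <= card n T * card n T *
    (2 * (c2 * c2 * (c2 * c2) / INR n) + c2 * c2 * (c2 * c2) * (eta + psib L (eta * INR n) fq)).
Proof.
  intros Heta Hf Hi HT.
  set (Bd := 2 * (c2 * c2 * (c2 * c2) / INR n) + c2 * c2 * (c2 * c2) * (eta + psib L (eta * INR n) fq)).
  set (h := fun t1 t2 x x' w => ind (w (Dir i x) = true) * (ind (w (Dir i x') = true) *
     (ind (t1 = x /\ x <> i /\ x' <> i) + ind (t2 = x' /\ x' <> i /\ x <> i) +
      ind (x <> i /\ x' <> i /\ x <> t2 /\ lrno n w i x t1 /\ ~ lrno n w i x t2 /\ R2 t2 (U0 n i t2) w x')))).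
  assert (H0 : forall t1 t2 x x' w, 0 <= h t1 t2 x x' w).
  { intros. apply Rmult_le_pos; [apply ind_pos|]. apply Rmult_le_pos; [apply ind_pos|].
    repeat apply Rplus_le_le_0_compat; apply ind_pos. }
  apply Rle_trans with (sumR n (fun t1 => sumR n (fun t2 => ind (T t1) * (ind (T t2) *
     sumR n (fun x => sumR n (fun x' => if Nat.eq_dec x x' then 0 else Expect ks pr (h t1 t2 x x'))))))).
  - rewrite (sumR_ext n _ (fun t1 => Expect ks pr (fun w => sumR n (fun t2 => ind (T t1) * (ind (T t2) *
      sumR n (fun x => sumR n (fun x' => if Nat.eq_dec x x' then 0 else h t1 t2 x x' w))))))).
    2: { intros t1 _. rewrite Expect_sumR. apply sumR_ext. intros t2 _. rewrite !Expect_scal. f_equal. f_equal.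
         rewrite Expect_sumR. apply sumR_ext. intros x _. rewrite Expect_sumR. apply sumR_ext. intros x' _.
         destruct (Nat.eq_dec x x'); [now rewrite Expect_const|reflexivity]. }
    rewrite <- Expect_sumR. apply Expect_le; [apply Hok|]. intros w Hw.
    unfold npiv. rewrite card_pairs. unfold fT. unfold ind at 1. em (hT n w i T /\ sec n w i T).
    2: { rewrite Rmult_0_l. apply sumR_nonneg. intros t1 _. apply sumR_nonneg. intros t2 _.
         apply Rmult_le_pos; [apply ind_pos|]. apply Rmult_le_pos; [apply ind_pos|].
         apply sumR_nonneg. intros x _. apply sumR_nonneg. intros x' _. destruct (Nat.eq_dec x x'); [lra|auto]. }
    rewrite Rmult_1_l. destruct a as [Hh _].
    match goal with |- _ <= ?rhs => replace rhs with (sumR n (fun t1 => sumR n (fun x => sumR n (fun x' => sumR n (fun t2 =>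
        ind (T t1) * (ind (T t2) * (if Nat.eq_dec x x' then 0 else h t1 t2 x x' w))))))) end.
    2: { apply sumR_ext. intros t1 _. symmetry. rewrite (sumR_ext n _ (fun t2 => sumR n (fun x => sumR n (fun x' =>
           ind (T t1) * (ind (T t2) * (if Nat.eq_dec x x' then 0 else h t1 t2 x x' w)))))).
         - rewrite sumR_swap. apply sumR_ext. intros x _. rewrite sumR_swap. reflexivity.
         - intros t2 _. rewrite <- Rmult_assoc, <- sumR_scal. apply sumR_ext. intros x _. rewrite <- sumR_scal.
           apply sumR_ext. intros x' _. ring. }
    apply Rle_trans with (2 := Req_le _ _ (sumR_swap n n _)). apply sumR_le. intros x Hx.
    apply Rle_trans with (2 := Req_le _ _ (sumR_swap n n _)). apply sumR_le. intros x' Hx'.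
    assert (Hnn : forall t1 t2, 0 <= ind (T t1) * (ind (T t2) * (if Nat.eq_dec x x' then 0 else h t1 t2 x x' w))).
    { intros. apply Rmult_le_pos; [apply ind_pos|]. apply Rmult_le_pos; [apply ind_pos|].
      destruct (Nat.eq_dec x x'); [lra|auto]. }
    assert (Hs : 0 <= sumR n (fun t1 => sumR n (fun t2 => ind (T t1) * (ind (T t2) * (if Nat.eq_dec x x' then 0 else h t1 t2 x x' w))))).
    { apply sumR_nonneg. intros. apply sumR_nonneg. auto. }
    revert Hnn Hs. destruct (Nat.eq_dec x x') as [|Hne]; intros Hnn Hs; [assumption|].
    rewrite <- ind_and. unfold ind at 1. em (piv n i T w x /\ piv n i T w x'); [|assumption].
    destruct a as [P1 P2]. assert (Q1 := proj1 P1). assert (Q2 := proj1 P2).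
    destruct (piv_pair i T w x x' Hi HT Hw Hx Hx' Hne Hh P1 P2) as [D1 [D2 [t1 [t2 [Ht1 [Ht2 Hc]]]]]].
    apply Rle_trans with (ind (T t1) * (ind (T t2) * h t1 t2 x x' w)).
    { rewrite !(ind_true (T _)) by assumption. rewrite !Rmult_1_l. unfold h.
      rewrite !(ind_true (w _ = true)) by assumption. rewrite !Rmult_1_l.
      assert (I1 := ind_pos (t1 = x /\ x <> i /\ x' <> i)). assert (I2 := ind_pos (t2 = x' /\ x' <> i /\ x <> i)).
      assert (I3 := ind_pos (x <> i /\ x' <> i /\ x <> t2 /\ lrno n w i x t1 /\ ~ lrno n w i x t2 /\ R2 t2 (U0 n i t2) w x')).
      destruct Hc as [Hc|[Hc|Hc]].
      - rewrite (ind_true (t1 = x /\ _)) by tauto. lra.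
      - rewrite (ind_true (t2 = x' /\ _)) by tauto. lra.
      - rewrite (ind_true (x <> i /\ x' <> i /\ x <> t2 /\ _)) by tauto. lra. }
    eapply Rle_trans; [|apply (sumR_ge_term n _ t1)]; [|intros; apply sumR_nonneg; auto|now apply HT].
    apply (sumR_ge_term n (fun t2 => ind (T t1) * (ind (T t2) * h t1 t2 x x' w))); [auto|now apply HT].
  - apply Rle_trans with (sumR n (fun t1 => sumR n (fun t2 => ind (T t1) * (ind (T t2) * Bd)))).
    + apply sumR_le. intros t1 Ht1. apply sumR_le. intros t2 Ht2.
      destruct (classic (T t1)) as [t|Hn]; [|rewrite (ind_false _ Hn); lra].
      destruct (classic (T t2)) as [t0|Hn]; [|rewrite (ind_false _ Hn); lra].
      rewrite (ind_true _ t), (ind_true _ t0), !Rmult_1_l.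
      destruct (HT t1 t) as [_ Ht1i]. destruct (HT t2 t0) as [_ Ht2i].
      rewrite (sumR_ext n _ (fun x =>
         sumR n (fun x' => if Nat.eq_dec x x' then 0 else
           Expect ks pr (fun w => ind (w (Dir i x) = true) * (ind (w (Dir i x') = true) * ind (t1 = x /\ x <> i /\ x' <> i))))
         + (sumR n (fun x' => if Nat.eq_dec x x' then 0 else
           Expect ks pr (fun w => ind (w (Dir i x) = true) * (ind (w (Dir i x') = true) * ind (t2 = x' /\ x' <> i /\ x <> i))))
         + sumR n (fun x' => if Nat.eq_dec x x' then 0 else
           Expect ks pr (fun w => ind (w (Dir i x) = true) * (ind (w (Dir i x') = true) *
             ind (x <> i /\ x' <> i /\ x <> t2 /\ lrno n w i x t1 /\ ~ lrno n w i x t2 /\ R2 t2 (U0 n i t2) w x'))))))).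
      2: { intros x _. rewrite <- !sumR_plus. apply sumR_ext. intros x' _. destruct (Nat.eq_dec x x'); [lra|].
           rewrite <- !Expect_plus. apply Expect_ext. intros w _. unfold h. ring. }
      rewrite !sumR_plus.
      assert (S1 := side_term i t1 Hi Ht1). assert (S2 := side_term i t2 Hi Ht2).
      assert (S3 := main_term L eta fq i t1 t2 Heta Hf Hi Ht1 Ht2 Ht2i).
      assert (S2' : sumR n (fun x => sumR n (fun x' => if Nat.eq_dec x x' then 0 else
           Expect ks pr (fun w => ind (w (Dir i x) = true) * (ind (w (Dir i x') = true) * ind (t2 = x' /\ x' <> i /\ x <> i)))))
           <= c2 * c2 * (c2 * c2) / INR n).
      { eapply Rle_trans; [|apply S2]. right. rewrite sumR_swap. apply sumR_ext. intros x _. apply sumR_ext. intros x' _.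
        destruct (Nat.eq_dec x' x), (Nat.eq_dec x x'); try congruence.
        apply Expect_ext. intros w _. ring. }
      unfold Bd. lra.
    + rewrite (sumR_ext n _ (fun t1 => card n T * Bd * ind (T t1))).
      * rewrite sumR_scal. right. unfold card. ring.
      * intros t1 _. rewrite sumR_scal.
        rewrite (sumR_ext n (fun t2 => ind (T t2) * Bd) (fun t2 => Bd * ind (T t2))) by (intros; ring).
        rewrite sumR_scal. unfold card. ring.
Qed.

End Super.

(** * The giant component above criticality *)

Lemma Harris_prod ks pr n (f : nat -> Outcome -> R) : okp ks pr ->
  (forall j, (j < n)%nat -> incr (f j)) -> (forall j w, (j < n)%nat -> 0 <= f j w) ->
  prodR n (fun j => Expect ks pr (f j)) <= Expect ks pr (fun w => prodR n (fun j => f j w)).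
Proof.
  intros Hok. induction n; intros Hi H0; simpl; [rewrite Expect_const; lra|].
  eapply Rle_trans; [|apply Harris; auto].
  - apply Rmult_le_compat_r; [apply Expect_nonneg; auto|]. apply IHn; auto.
  - intros w w' L. apply prodR_le. intros j Hj. split; [auto|]. apply Hi; auto.
Qed.

Section Giant.

Variables (n : nat) (beta : nat -> R) (delta : R) (q : nat -> R) (bl c1 c2 : R).
Hypothesis Hnet : net_ok n beta delta q bl c1 c2.

Let ks := keys n.
Let pr := prob beta delta (fun _ => 0) q.
Let pbar := c2 * c2 / INR n.
Let pmin := delta * bl * (c1 * c1) / INR n.
Let Hok : okp ks pr := net_okp _ _ _ _ _ _ _ Hnet.

Lemma Bk_trans w u v m : Bk n w u m -> bwd w v u -> (u < n)%nat -> Bk n w v m.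
Proof.
  intros H Hvu Hu.
  assert (B : Bk n w v u).
  { destruct (Nat.eq_dec u v) as [->|]; [now apply Rch_base|].
    apply (Rch_step _ _ _ v u); [now apply Rch_base|tauto|assumption]. }
  eapply Rch_absorb; [| | |apply H].
  - intros a ->. destruct (Nat.eq_dec u v); tauto.
  - intros a [Ha _]. destruct (Nat.eq_dec a v); tauto.
  - now intros a ->.
Qed.

(** The forward cluster of [t] is large with probability at least [kap], and then [i] fails to
    receive an edge from it with exponentially small probability. *)
Lemma Lrn_prob i t m kap : (i < n)%nat -> (t < n)%nat -> t <> i -> 0 <= m ->
  Expect ks pr (fun w => ind (card n (Rch (fwd w) (fun v => v = t) (fun v => (v < n)%nat /\ v <> t)) <= m)) <= 1 - kap ->
  kap * (1 - exp (- (pmin * m))) <= Expect ks pr (fun w => ind (Lrn n w i t)).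
Proof.
  intros Hi Ht Hti Hm Hs.
  set (Rf := fun w => Rch (fwd w) (fun v => v = t) (fun v => (v < n)%nat /\ v <> t)).
  (* This cluster avoids [i], so it does not read the listening links of [i]; when [i] does not
     learn [t] it agrees with the full cluster. *)
  set (Ro := fun w => Rch (fwd w) (fun v => v = t) (fun v => (v < n)%nat /\ v <> t /\ v <> i)).
  set (a := Expect ks pr (fun w => ind (card n (Rf w) <= m))).
  change (a <= 1 - kap) in Hs. set (ex := exp (- (pmin * m))).
  assert (Hex : 0 < ex <= 1).
  { split; [apply exp_pos|]. rewrite <- exp_0. apply exp_le_mono.
    assert (0 <= pmin); [|nra]. assert (N := uq_n n beta delta q bl c1 c2 Hnet). destruct Hnet.
    apply Rmult_le_pos; [repeat apply Rmult_le_pos; lra|left; now apply Rinv_0_lt_compat]. }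
  assert (H1 : Expect ks pr (fun w => ind (~ Lrn n w i t)) <= a +
     Expect ks pr (fun w => ind (m < card n (Ro w) /\ noedge (Ro w) (fun v => v = i) w))).
  { apply Expect_union; [apply Hok|]. intros w Hw Hn.
    destruct (Rle_dec (card n (Rf w)) m) as [|Hbig]; [now left|right].
    assert (HL : forall v, Rf w v -> v = t \/ Lrn n w v t).
    { intros v Hv. induction Hv as [v ->|u v Hr IH [Hv Hvt] Huv]; [now left|right].
      split; [assumption|]. split; [auto|]. destruct (Dir_supp n w Hw v u (proj1 Huv)) as [_ [Hu _]].
      destruct IH as [-> |[_ [_ [m' [Hm' Hd]]]]].
      - exists v. split; [now apply Rch_base|apply Huv].
      - exists m'. split; [|assumption]. eapply Bk_trans; eauto. }
    assert (Hiw : ~ Rf w i) by (intros Hiw; destruct (HL i Hiw); [congruence|contradiction]).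
    assert (HR : forall v, Rf w v -> Ro w v).
    { intros v Hv. induction Hv as [v ->|u v Hr IH Hv Huv]; [now apply Rch_base|].
      apply (Rch_step _ _ _ u v IH); [|assumption]. split; [tauto|]. split; [tauto|]. intros ->.
      apply Hiw. apply (Rch_step _ _ _ u i Hr); [tauto|assumption]. }
    split.
    - apply Rlt_le_trans with (card n (Rf w)); [lra|]. apply card_le. auto.
    - intros r b Hr -> He. apply Hiw. apply (Rch_step _ _ _ r i); [|split; auto|exact He].
      eapply Rch_mono; [| | |apply Hr]; auto. tauto. }
  assert (H2 : Expect ks pr (fun w => ind (m < card n (Ro w) /\ noedge (Ro w) (fun v => v = i) w)) <= (1 - a) * ex).
  { eapply Rle_trans.
    - apply (Expect_fresh ks pr Ro (fun _ v => nx i v) (fun R w => ind (m < card n R /\ noedge R (fun v => v = i) w))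
        (fun R => ind (m < card n R) * ex) Hok).
      + intros w w' E. symmetry. apply Rch_ext_on. intros b u Hb Hu. apply edge_eq; apply E; simpl; tauto.
      + intros w _ w1 w2 E. apply ind_iff.
        assert (H : forall r, ind_edge w1 r i <-> ind_edge w2 r i).
        { intros r. apply edge_eq; apply E; simpl; tauto. }
        split; intros [Ha Hb]; (split; [assumption|]); intros r b Hr -> He; apply (Hb r i Hr eq_refl); now apply H.
      + intros w _. rewrite Expect_ind_const_and. unfold ind at 1 3. em (m < card n (Ro w)); [|lra].
        rewrite !Rmult_1_l.
        eapply Rle_trans; [apply (noedge_prob n beta delta q bl c1 c2 Hnet (Ro w) (fun v => v = i))|].
        * intros v Hv. apply Rch_in in Hv. destruct Hv as [-> |]; tauto.
        * now intros v ->.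
        * intros v Hv ->. apply Rch_in in Hv. destruct Hv as [Hv|]; [congruence|tauto].
        * apply exp_le_mono, Ropp_le_contravar. rewrite card_single by assumption. rewrite Rmult_1_r.
          apply Rmult_le_compat_l; [|lra]. assert (N := uq_n n beta delta q bl c1 c2 Hnet). destruct Hnet.
          apply Rmult_le_pos; [repeat apply Rmult_le_pos; lra|left; now apply Rinv_0_lt_compat].
    - rewrite (Expect_ext ks pr _ (fun w => ex * ind (m < card n (Ro w)))) by (intros; ring).
      rewrite Expect_scal, Rmult_comm. apply Rmult_le_compat_r; [lra|].
      apply Rle_trans with (Expect ks pr (fun w => 1 - ind (card n (Rf w) <= m))).
      + apply Expect_le; [apply Hok|]. intros w _. rewrite <- ind_not. apply ind_le. intros H Hc.
        assert (card n (Ro w) <= card n (Rf w)); [|lra]. apply card_le. intros v _. apply Rch_mono; auto. tauto.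
      + rewrite Expect_minus, Expect_const. unfold a. lra. }
  assert (H3 : Expect ks pr (fun w => ind (~ Lrn n w i t)) = 1 - Expect ks pr (fun w => ind (Lrn n w i t))).
  { rewrite <- (Expect_const ks pr 1) at 1. rewrite <- Expect_minus. apply Expect_ext. intros; apply ind_not. }
  rewrite H3 in H1.
  assert (0 <= (1 - a - kap) * (1 - ex)) by nra. lra.
Qed.

(** Learning an idea is increasing in the coins, so the events for different ideas are positively
    associated. *)
Lemma hT_Harris i (T : nat -> Prop) (k : nat) kap : (i < n)%nat -> (forall t, T t -> (t < n)%nat /\ t <> i) -> card n T <= INR k ->
  0 <= kap <= 1 -> (forall t, (t < n)%nat -> t <> i -> kap <= Expect ks pr (fun w => ind (Lrn n w i t))) ->
  kap ^ k <= Expect ks pr (fun w => ind (hT n w i T)).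
Proof.
  intros Hi HT Hk Hkap HL.
  eapply Rle_trans; [apply (pow_le_prodA T kap Hkap n k Hk)|].
  apply Rle_trans with (Expect ks pr (fun w => prodR n (fun t => pw (T t) (ind (Lrn n w i t))))).
  - eapply Rle_trans; [|apply Harris_prod; [apply Hok| |]].
    + apply prodR_le. intros t Ht. unfold pw. em (T t); [|rewrite Expect_const; lra].
      split; [lra|]. apply HL; [assumption|]. now apply HT.
    + intros t Ht w w' L. unfold pw. em (T t); [|lra]. apply ind_le.
      intros H. assert (K := hT_mono n i (fun u => u = t) w w' L). apply K; [|reflexivity]. now intros u ->.
    + intros t w Ht. unfold pw. em (T t); [apply ind_pos|lra].
  - apply Expect_le; [apply Hok|]. intros w _. unfold ind at 2. em (hT n w i T).
    + rewrite <- (prodR_one n (fun _ => 1)) by auto. apply prodR_le. intros t _.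
      unfold pw. em (T t); [apply ind_range|lra].
    + apply not_all_ex_not in n0. destruct n0 as [t Ht]. apply imply_to_and in Ht. destruct Ht as [Ht Hn].
      right. apply (prodR_zero n _ t); [now apply HT|]. rewrite pw_true by assumption. now apply ind_false.
Qed.

(** If nobody listens to [i], nothing leaks. The at most [n] coins involved have probabilities of
    order [1 / n] and are not read by [hT], so this costs a constant factor. *)
Lemma GT_lower i (T : nat -> Prop) : (i < n)%nat -> (forall t, T t -> (t < n)%nat /\ t <> i) ->
  exp (- (2 * (c2 * c2))) * EN n beta delta q (fun w => ind (hT n w i T)) <= GT n beta delta q i T.
Proof.
  intros Hi HT.
  assert (PB := uq_pbar n beta delta q bl c1 c2 Hnet). fold pbar in PB.
  assert (N := uq_n n beta delta q bl c1 c2 Hnet).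
  set (ns := fun w => prodR n (fun j => pw (j <> i) (1 - ind (w (Dir j i) = true)))).
  apply Rle_trans with (Expect ks pr (fun w => ind (hT n w i T) * ns w)).
  - rewrite (Expect_indep ks pr (ny i)).
    + rewrite Rmult_comm. apply Rmult_le_compat_l; [apply Expect_ind_range, Hok|].
      assert (EP := Expect_prodR ks pr n (fun j v => v = Dir j i) (fun j w => pw (j <> i) (1 - ind (w (Dir j i) = true)))).
      change (Expect ks pr ns) with
        (Expect ks pr (fun w => prodR n (fun j => pw (j <> i) (1 - ind (w (Dir j i) = true))))).
      rewrite EP; clear EP.
      * apply Rle_trans with (prodR n (fun _ => exp (- (2 * pbar)))).
        -- rewrite prodR_exp, sumR_const. right. f_equal. unfold pbar. field. lra.
        -- apply prodR_le. intros j Hj. split; [left; apply exp_pos|]. unfold pw. em (j <> i).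
           ++ rewrite Expect_minus, Expect_const. assert (D := uq_dir n beta delta q bl c1 c2 Hnet j i Hj Hi n0). fold ks pr pbar in D.
              assert (0 <= Expect ks pr (fun w => ind (w (Dir j i) = true))) by apply (Expect_ind_range ks pr _ Hok).
              eapply Rle_trans; [|apply one_sub_ge_exp; lra]. apply exp_le_mono. nra.
           ++ rewrite Expect_const. rewrite <- exp_0. apply exp_le_mono. lra.
      * intros j _ w w' E. unfold pw. em (j <> i); [|reflexivity]. now rewrite E.
      * intros j j' v _ _ -> E. now injection E.
    + intros w w' E. rewrite (hT_dep n i T w w' E). reflexivity.
    + apply dep_prodR. intros j _ w w' E. unfold pw. em (j <> i); [|reflexivity]. rewrite E; [reflexivity|]. simpl; tauto.
  - apply Expect_le; [apply Hok|]. intros w _. rewrite ind_and. apply Rmult_le_compat_l; [apply ind_pos|].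
    unfold ind. em (sec n w i T).
    + rewrite <- (prodR_one n (fun _ => 1)) by auto. apply prodR_le. intros j _. unfold pw. em (j <> i); [|lra].
      assert (I := ind_range (w (Dir j i) = true)). lra.
    + apply not_all_ex_not in n0. destruct n0 as [j n0]. apply imply_to_and in n0. destruct n0 as [Hj n0].
      apply imply_to_and in n0. destruct n0 as [Hji n0]. apply NNPP in n0. right.
      apply (prodR_zero n _ j Hj). rewrite pw_true by assumption. destruct n0 as [Hd _].
      rewrite ind_true by assumption. lra.
Qed.

End Giant.

(** Above criticality [GT] is bounded below by a constant [g0], so it is enough that the bound on
    [PP] can be made arbitrarily small. *)
Lemma PP_super (k : nat) delta bl c1 c2 eps tau :
  0 < delta <= 1 -> 0 < bl < 1 -> 0 < c1 <= c2 -> 0 < eps -> 0 < tau ->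
  exists N, forall n beta q, (N <= n)%nat -> net_ok n beta delta q bl c1 c2 ->
  1 + eps <= lam0 n beta delta q ->
  forall i (T : nat -> Prop), (i < n)%nat -> (forall t, T t -> (t < n)%nat /\ t <> i) -> card n T <= INR k ->
  PP n beta delta q i T <= tau * GT n beta delta q i T.
Proof.
  intros Hd Hbl Hc Heps Htau. assert (HcC := consts_ok _ _ _ _ Hd Hbl Hc).
  destruct (survival (delta * bl * c1) c2 eps HcC Heps) as [eta0 [kap0 [He0 [Hk0 Hsurv]]]].
  set (cc := delta * bl * (c1 * c1)).
  assert (Hcc : 0 < cc) by (unfold cc; repeat apply Rmult_lt_0_compat; lra).
  set (kap1 := Rmin 1 (kap0 * (1 - exp (- (cc * eta0))))).
  assert (Hex : exp (- (cc * eta0)) < 1) by (rewrite <- exp_0; apply exp_increasing; nra).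
  assert (Hk1 : 0 < kap1 <= 1) by (split; [apply Rmin_glb_lt; [lra|nra]|apply Rmin_l]).
  set (g0 := exp (- (2 * (c2 * c2))) * kap1 ^ k).
  assert (Hg0 : 0 < g0) by (apply Rmult_lt_0_compat; [apply exp_pos|apply pow_lt; lra]).
  set (c4 := c2 * c2 * (c2 * c2)). assert (Hc4 : 0 < c4) by (unfold c4; assert (0 < c2 * c2) by nra; nra).
  set (K2 := (INR k + 1) * (INR k + 1)). assert (HK2 : 1 <= K2) by (assert (P := pos_INR k); unfold K2; nra).
  set (eta := tau * g0 / (8 * K2 * c4)).
  assert (Heta : 0 < eta) by (apply Rdiv_lt_0_compat; nra).
  (* This makes the exponent [pmin * (eta * n) * fq] equal to [1 / eta]. *)
  set (fq := / (cc * eta * eta)).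
  assert (Hcee : 0 < cc * eta * eta) by (assert (0 < cc * eta) by nra; nra).
  assert (Hfq : 0 < fq) by now apply Rinv_0_lt_compat.
  set (th := 1 - exp (- (2 * (c2 * c2) * fq))).
  assert (Hth : Rabs th < 1).
  { assert (P := exp_pos (- (2 * (c2 * c2) * fq))).
    assert (exp (- (2 * (c2 * c2) * fq)) <= exp 0) by (apply exp_le_mono; assert (0 < c2 * c2) by nra; nra).
    rewrite exp_0 in H. unfold th. rewrite Rabs_right; lra. }
  (* The order of choice matters: [eta] fixes [fq], hence [th], hence [L], and only then does [n]
     suppress the short paths. *)
  destruct (pow_lt_1_zero th Hth eta Heta) as [L HL]. specialize (HL L (le_n L)).
  set (SL := sumR L (fun l => (c2 * c2) ^ l) * (c2 * c2)).
  destruct (INR_large (SL / eta)) as [N1 HN1]. destruct (INR_large (2 / eta)) as [N2 HN2].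
  exists (N1 + N2)%nat. intros n beta q HN Hnet Hlam i T Hi HT Hk.
  specialize (HN1 n ltac:(lia)). specialize (HN2 n ltac:(lia)).
  assert (N := net_n_pos _ _ _ _ _ _ _ Hnet).
  assert (GL := GT_lower n beta delta q bl c1 c2 Hnet i T Hi HT).
  assert (HH : kap1 ^ k <= EN n beta delta q (fun w => ind (hT n w i T))).
  { apply (hT_Harris n beta delta q bl c1 c2 Hnet i T k kap1 Hi HT Hk ltac:(lra)).
    intros t Ht Hti.
    assert (F := fwd_ok _ _ _ _ _ _ _ Hnet). assert (FS := Hsurv _ _ _ _ _ _ _ F). cbv beta in FS. rewrite fwd_lam in FS.
    specialize (FS Hlam t Ht).
    eapply Rle_trans; [|apply (Lrn_prob n beta delta q bl c1 c2 Hnet i t (eta0 * INR n) kap0 Hi Ht Hti ltac:(nra) FS)].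
    fold cc. replace (cc / INR n * (eta0 * INR n)) with (cc * eta0) by (field; lra). apply Rmin_r. }
  assert (GG0 : g0 <= GT n beta delta q i T).
  { eapply Rle_trans; [|apply GL]. apply Rmult_le_compat_l; [left; apply exp_pos|assumption]. }
  eapply Rle_trans; [apply (PP_bound n beta delta q bl c1 c2 Hnet L eta fq i T ltac:(lra) ltac:(lra) Hi HT)|].
  apply Rle_trans with (tau * g0); [|apply Rmult_le_compat_l; lra].
  assert (Hpsi : psib n delta bl c1 c2 L (eta * INR n) fq <= 3 * eta).
  { unfold psib. fold cc th.
    rewrite (sumR_ext L _ (fun l => c2 * c2 / INR n * (c2 * c2) ^ l)) by (intros; ring). rewrite sumR_scal.
    assert (c2 * c2 / INR n * sumR L (fun l => (c2 * c2) ^ l) <= eta).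
    { apply (Rmult_le_reg_l (INR n)); auto.
      replace (INR n * (c2 * c2 / INR n * sumR L (fun l => (c2 * c2) ^ l))) with SL by (unfold SL; field; lra).
      apply (Rmult_le_compat_r eta) in HN1; [|lra]. replace (SL / eta * eta) with SL in HN1 by (field; lra). lra. }
    assert (th ^ L <= eta) by (apply Rle_trans with (Rabs (th ^ L)); [apply Rle_abs|lra]).
    assert (exp (- (cc / INR n * (eta * INR n) * fq)) <= eta).
    { replace (cc / INR n * (eta * INR n) * fq) with (/ eta) by (unfold fq; field; lra).
      assert (0 < / eta) by now apply Rinv_0_lt_compat.
      eapply Rle_trans; [apply exp_opp_le_inv; lra|].
      rewrite <- (Rinv_inv eta) at 2. apply Rinv_le_contravar; lra. }
    change (fun l : nat => (c2 * c2) ^ l) with (pow (c2 * c2)) in H. lra. }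
  assert (H2n : 2 / INR n <= eta).
  { apply (Rmult_le_reg_l (INR n)); auto. rewrite Rmult_div_cancel by lra.
    apply (Rmult_le_compat_r eta) in HN2; [|lra]. replace (2 / eta * eta) with 2 in HN2 by (field; lra). lra. }
  fold c4.
  assert (Hin : 2 * (c4 / INR n) + c4 * (eta + psib n delta bl c1 c2 L (eta * INR n) fq) <= c4 * (5 * eta)) by nra.
  assert (Hin0 : 0 <= c4 * (5 * eta)) by nra.
  assert (cT := card_nonneg n T).
  assert (HcT : card n T * card n T <= K2) by (unfold K2; nra).
  apply Rle_trans with (K2 * (c4 * (5 * eta))).
  - apply Rle_trans with (card n T * card n T * (c4 * (5 * eta))).
    + apply Rmult_le_compat_l; nra.
    + apply Rmult_le_compat_r; lra.
  - replace (K2 * (c4 * (5 * eta))) with (5 / 8 * (tau * g0)) by (unfold eta; field; lra). nra.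
Qed.

(** * Elementary symmetric sums over technologies *)

(** Elementary symmetric polynomials, with the first variable peeled off to match the recursion of
    [blists]. *)
Fixpoint es (n r : nat) (a : nat -> R) : R :=
  match n with
  | O => match r with O => 1 | S _ => 0 end
  | S m => match r with
           | O => 1
           | S r' => a 0%nat * es m r' (fun j => a (S j)) + es m r (fun j => a (S j))
           end
  end.

Lemma es_0 n a : es n 0 a = 1.
Proof. destruct n; reflexivity. Qed.

Lemma sumR_front n f : sumR (S n) f = f 0%nat + sumR n (fun j => f (S j)).
Proof. induction n; [simpl; lra|]. change (sumR (S (S n)) f) with (sumR (S n) f + f (S n)). rewrite IHn. simpl. lra. Qed.

Lemma prodR_front n f : prodR (S n) f = f 0%nat * prodR n (fun j => f (S j)).
Proof. induction n; [simpl; lra|]. change (prodR (S (S n)) f) with (prodR (S n) f * f (S n)). rewrite IHn. simpl. ring. Qed.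

Lemma es_nonneg n r a : (forall j, (j < n)%nat -> 0 <= a j) -> 0 <= es n r a.
Proof.
  revert r a; induction n; intros r a H; destruct r; simpl; try lra.
  assert (0 <= a 0%nat) by (apply H; lia).
  assert (0 <= es n r (fun j => a (S j))) by (apply IHn; intros; apply H; lia).
  assert (0 <= es n (S r) (fun j => a (S j))) by (apply IHn; intros; apply H; lia). nra.
Qed.

Lemma es_ext n r a b : (forall j, (j < n)%nat -> a j = b j) -> es n r a = es n r b.
Proof.
  revert r a b; induction n; intros r a b H; destruct r; simpl; try reflexivity.
  rewrite (H 0%nat) by lia. rewrite !(IHn _ (fun j => a (S j)) (fun j => b (S j))) by (intros; apply H; lia). reflexivity.
Qed.

Lemma es_le_pow n r a : (forall j, (j < n)%nat -> 0 <= a j) -> es n r a <= sumR n a ^ r.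
Proof.
  revert r a; induction n; intros r a H; destruct r as [|r]; simpl es; try (simpl; lra).
  rewrite sumR_front. set (S0 := sumR n (fun j => a (S j))).
  assert (Ha : 0 <= a 0%nat) by (apply H; lia).
  assert (HS : 0 <= S0) by (apply sumR_nonneg; intros; apply H; lia).
  assert (I1 : es n r (fun j => a (S j)) <= S0 ^ r) by (apply IHn; intros; apply H; lia).
  assert (I2 : es n (S r) (fun j => a (S j)) <= S0 ^ S r) by (apply IHn; intros; apply H; lia).
  assert (P1 : S0 ^ r <= (a 0%nat + S0) ^ r) by (apply pow_incr; lra).
  simpl in *. nra.
Qed.

(** The difference collects the monomials that use some [b j]: one factor from the sum of [b], the
    rest arbitrary. *)
Lemma es_diff n r a b : (forall j, (j < n)%nat -> 0 <= a j) -> (forall j, (j < n)%nat -> 0 <= b j) ->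
  es n (S r) (fun j => a j + b j) - es n (S r) a <= sumR n b * (sumR n a + sumR n b) ^ r.
Proof.
  revert r a b; induction n; intros r a b Ha Hb; [simpl; lra|].
  rewrite !sumR_front.
  change (es (S n) (S r) (fun j => a j + b j)) with
    ((a 0%nat + b 0%nat) * es n r (fun j => a (S j) + b (S j)) + es n (S r) (fun j => a (S j) + b (S j))).
  change (es (S n) (S r) a) with (a 0%nat * es n r (fun j => a (S j)) + es n (S r) (fun j => a (S j))).
  set (A := sumR n (fun j => a (S j))). set (B := sumR n (fun j => b (S j))).
  assert (Ha' : forall j, (j < n)%nat -> 0 <= a (S j)) by (intros; apply Ha; lia).
  assert (Hb' : forall j, (j < n)%nat -> 0 <= b (S j)) by (intros; apply Hb; lia).
  assert (A0 : 0 <= A) by now apply sumR_nonneg. assert (B0 : 0 <= B) by now apply sumR_nonneg.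
  assert (a0 : 0 <= a 0%nat) by (apply Ha; lia). assert (b0 : 0 <= b 0%nat) by (apply Hb; lia).
  assert (I1 := IHn r (fun j => a (S j)) (fun j => b (S j)) Ha' Hb'). fold A B in I1.
  assert (I2 : es n r (fun j => a (S j) + b (S j)) <= (A + B) ^ r).
  { unfold A, B. rewrite <- sumR_plus. apply es_le_pow. intros j Hj. specialize (Ha' j Hj). specialize (Hb' j Hj). lra. }
  assert (P : (A + B) ^ r <= (a 0%nat + A + (b 0%nat + B)) ^ r) by (apply pow_incr; lra).
  destruct r as [|r].
  - rewrite !es_0 in *. lra.
  - assert (I3 := IHn r (fun j => a (S j)) (fun j => b (S j)) Ha' Hb'). fold A B in I3.
    assert (P' : (A + B) ^ r <= (a 0%nat + A + (b 0%nat + B)) ^ r) by (apply pow_incr; lra).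
    assert (P0' : 0 <= (A + B) ^ r) by (apply pow_le; lra).
    simpl pow in *. set (X := (A + B) ^ r) in *. set (X' := (a 0%nat + A + (b 0%nat + B)) ^ r) in *.
    assert ((A + B + a 0%nat) * X <= (a 0%nat + A + (b 0%nat + B)) * X') by nra.
    nra.
Qed.

(** What remains are the monomials with a factor from each of [a] and [b]; the other [r] factors are
    arbitrary. *)
Lemma es_mixed n r a b : (forall j, (j < n)%nat -> 0 <= a j) -> (forall j, (j < n)%nat -> 0 <= b j) ->
  es n (S (S r)) (fun j => a j + b j) - es n (S (S r)) a - es n (S (S r)) b
  <= sumR n a * sumR n b * (sumR n a + sumR n b) ^ r.
Proof.
  revert r a b; induction n; intros r a b Ha Hb; [simpl; lra|].
  rewrite !sumR_front.
  change (es (S n) (S (S r)) (fun j => a j + b j)) with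
    ((a 0%nat + b 0%nat) * es n (S r) (fun j => a (S j) + b (S j)) + es n (S (S r)) (fun j => a (S j) + b (S j))).
  change (es (S n) (S (S r)) a) with (a 0%nat * es n (S r) (fun j => a (S j)) + es n (S (S r)) (fun j => a (S j))).
  change (es (S n) (S (S r)) b) with (b 0%nat * es n (S r) (fun j => b (S j)) + es n (S (S r)) (fun j => b (S j))).
  set (A := sumR n (fun j => a (S j))). set (B := sumR n (fun j => b (S j))).
  assert (Ha' : forall j, (j < n)%nat -> 0 <= a (S j)) by (intros; apply Ha; lia).
  assert (Hb' : forall j, (j < n)%nat -> 0 <= b (S j)) by (intros; apply Hb; lia).
  assert (A0 : 0 <= A) by now apply sumR_nonneg. assert (B0 : 0 <= B) by now apply sumR_nonneg.
  assert (a0 : 0 <= a 0%nat) by (apply Ha; lia). assert (b0 : 0 <= b 0%nat) by (apply Hb; lia).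
  assert (I1 := IHn r (fun j => a (S j)) (fun j => b (S j)) Ha' Hb'). fold A B in I1.
  assert (I2 := es_diff n r (fun j => a (S j)) (fun j => b (S j)) Ha' Hb'). fold A B in I2.
  assert (I3 := es_diff n r (fun j => b (S j)) (fun j => a (S j)) Hb' Ha'). cbv beta in I3. fold A B in I3.
  rewrite (es_ext n (S r) (fun j => b (S j) + a (S j)) (fun j => a (S j) + b (S j))) in I3 by (intros; ring).
  rewrite (Rplus_comm B A) in I3.
  assert (P : (A + B) ^ r <= (a 0%nat + A + (b 0%nat + B)) ^ r) by (apply pow_incr; lra).
  assert (P0 : 0 <= (A + B) ^ r) by (apply pow_le; lra).
  set (X := (A + B) ^ r) in *. set (X' := (a 0%nat + A + (b 0%nat + B)) ^ r) in *.
  apply (Rmult_le_compat_l (a 0%nat)) in I2; [|lra]. apply (Rmult_le_compat_l (b 0%nat)) in I3; [|lra].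
  assert ((a 0%nat * B + b 0%nat * A + A * B) * X <= ((a 0%nat + A) * (b 0%nat + B)) * X').
  {
    apply Rmult_le_compat; nra. }
  nra.
Qed.

(** Multiplying by the sum produces every squarefree monomial of degree [r + 1] exactly [r + 1]
    times, and monomials with one square; [a j <= 1] bounds the latter by [r] times the polynomial
    of degree [r]. *)
Lemma es_newton n r a : (forall j, (j < n)%nat -> 0 <= a j <= 1) ->
  sumR n a * es n r a <= (INR r + 1) * es n (S r) a + INR r * es n r a.
Proof.
  revert r a; induction n; intros r a Ha.
  - destruct r; simpl; lra.
  - rewrite sumR_front. set (Z := sumR n (fun j => a (S j))).
    assert (Ha' : forall j, (j < n)%nat -> 0 <= a (S j) <= 1) by (intros; apply Ha; lia).
    assert (a0 := Ha 0%nat ltac:(lia)).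
    destruct r as [|r].
    + assert (I := IHn 0%nat (fun j => a (S j)) Ha'). fold Z in I. rewrite es_0 in I.
      change (es (S n) 1 a) with (a 0%nat * es n 0 (fun j => a (S j)) + es n 1 (fun j => a (S j))).
      rewrite !es_0. simpl (INR 0) in *. lra.
    + assert (I1 := IHn (S r) (fun j => a (S j)) Ha'). assert (I0 := IHn r (fun j => a (S j)) Ha').
      fold Z in I1, I0.
      change (es (S n) (S (S r)) a) with (a 0%nat * es n (S r) (fun j => a (S j)) + es n (S (S r)) (fun j => a (S j))).
      change (es (S n) (S r) a) with (a 0%nat * es n r (fun j => a (S j)) + es n (S r) (fun j => a (S j))).
      assert (E0 : 0 <= es n r (fun j => a (S j))) by (apply es_nonneg; intros; now apply Ha').
      rewrite S_INR in *.
      set (e0 := es n r (fun j => a (S j))) in *.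
      set (t := a 0%nat) in *.
      assert (0 <= t * ((1 - t) * e0)) by (apply Rmult_le_pos; [lra|apply Rmult_le_pos; lra]).
      nra.
Qed.

(** A converse to [es_le_pow] up to a constant. A bounded sum has bounded powers; for a large sum
    [es_newton] raises the degree one step at a time. *)
Lemma es_lower (r : nat) : exists C, 0 < C /\ forall n a, (forall j, (j < n)%nat -> 0 <= a j <= 1) ->
  sumR n a ^ r <= C * (1 + es n r a).
Proof.
  assert (L : forall r, exists c, 0 < c /\ forall n a, (forall j, (j < n)%nat -> 0 <= a j <= 1) ->
     INR r <= sumR n a -> c <= es n r a).
  { induction r0 as [|r0 [c [Hc IH]]].
    - exists 1. split; [lra|]. intros. rewrite es_0. lra.
    - exists (c / (INR r0 + 1)). assert (P := pos_INR r0). split; [apply Rdiv_lt_0_compat; lra|].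
      intros n a Ha HZ. rewrite S_INR in HZ.
      assert (K := es_newton n r0 a Ha). assert (c <= es n r0 a) by (apply IH; [assumption|lra]).
      apply (Rmult_le_reg_r (INR r0 + 1)); [lra|]. replace (c / (INR r0 + 1) * (INR r0 + 1)) with c by (field; lra).
      nra. }
  induction r as [|r [C [HC IH]]].
  - exists 1. split; [lra|]. intros. rewrite es_0. lra.
  - destruct (L r) as [c [Hc Lc]]. assert (P := pos_INR r).
    set (R1 := INR r + 1).
    exists (R1 ^ S r + C * (/ c + 1) * (R1 * R1)).
    assert (0 < R1 ^ S r) by (apply pow_lt; unfold R1; lra).
    assert (0 < / c) by now apply Rinv_0_lt_compat.
    assert (HR1 : 1 <= R1) by (unfold R1; lra).
    assert (0 < C * (/ c + 1) * (R1 * R1)).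
    { apply Rmult_lt_0_compat; [apply Rmult_lt_0_compat; lra|nra]. }
    split; [lra|]. intros n a Ha.
    assert (E1 : 0 <= es n (S r) a) by (apply es_nonneg; intros; now apply Ha).
    assert (Z0 : 0 <= sumR n a) by (apply sumR_nonneg; intros; now apply Ha).
    destruct (Rle_dec R1 (sumR n a)) as [HZ|HZ].
    + assert (Ec : c <= es n r a) by (apply Lc; [assumption|unfold R1 in HZ; lra]).
      assert (K := es_newton n r a Ha).
      assert (K2 : es n r a <= R1 * es n (S r) a).
      { unfold R1 in *; nra. }
      assert (K3 : sumR n a * es n r a <= R1 * R1 * es n (S r) a).
      {
        unfold R1 in *. nra. }
      apply Rle_trans with (sumR n a * (C * (1 + es n r a))).
      { apply Rmult_le_compat_l; [lra|]. now apply IH. }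
      assert (K4 : 1 + es n r a <= (/ c + 1) * es n r a).
      { assert (1 <= / c * es n r a); [|lra]. rewrite <- (Rinv_l c) by lra. apply Rmult_le_compat_l; lra. }
      apply Rle_trans with (C * (/ c + 1) * (sumR n a * es n r a)).
      { replace (C * (/ c + 1) * (sumR n a * es n r a)) with (sumR n a * (C * ((/ c + 1) * es n r a))) by ring.
        apply Rmult_le_compat_l; [lra|]. apply Rmult_le_compat_l; lra. }
      apply Rle_trans with (C * (/ c + 1) * (R1 * R1 * es n (S r) a)).
      { apply Rmult_le_compat_l; [apply Rmult_le_pos; lra|assumption]. }
      nra.
    + apply Rle_trans with (R1 ^ S r); [apply pow_incr; lra|]. nra.
Qed.

Lemma es_blists n r b :
  lsum (blists n) (fun t => ind (length (filter (fun b => b) t) = r) * prodR n (fun j => pw (mem t j) (b j))) = es n r b.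
Proof.
  revert r b; induction n; intros r b.
  - simpl. destruct r; [rewrite ind_true by reflexivity; lra|rewrite ind_false by discriminate; lra].
  - simpl blists. rewrite lsum_app, !lsum_map.
    rewrite (lsum_ext (blists n) (fun a => ind (length (filter (fun b => b) (true :: a)) = r) * _)
      (fun a => b 0%nat * (ind (S (length (filter (fun b => b) a)) = r) * prodR n (fun j => pw (mem a j) (b (S j)))))).
    2: { intros a _. rewrite prodR_front. simpl length. rewrite pw_true by reflexivity.
         replace (prodR n (fun j => pw (mem (true :: a) (S j)) (b (S j)))) with (prodR n (fun j => pw (mem a j) (b (S j)))) by reflexivity. ring. }
    rewrite lsum_scal.
    rewrite (lsum_ext (blists n) (fun a => ind (length (filter (fun b => b) (false :: a)) = r) * _)
      (fun a => ind (length (filter (fun b => b) a) = r) * prodR n (fun j => pw (mem a j) (b (S j))))).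
    2: { intros a _. rewrite prodR_front. rewrite (pw_false (mem (false :: a) 0)) by (unfold mem; simpl; discriminate).
         rewrite Rmult_1_l. reflexivity. }
    rewrite (IHn r (fun j => b (S j))). destruct r as [|r].
    + rewrite lsum_zero by (intros; rewrite ind_false by discriminate; ring). simpl. rewrite es_0. ring.
    + rewrite (lsum_ext (blists n) _ (fun a => ind (length (filter (fun b => b) a) = r) * prodR n (fun j => pw (mem a j) (b (S j))))).
      * rewrite (IHn r (fun j => b (S j))). reflexivity.
      * intros a _. f_equal. apply ind_iff. split; [now intros [=]|now intros ->].
Qed.

Definition noi (i : nat) (b : nat -> R) (j : nat) : R := if Nat.eq_dec j i then 0 else b j.

Lemma es_tech n k i b : (i < n)%nat ->
  lsum (blists n) (fun t => ind (tech_of (S k) i t) * prodA n (Tof n t i) b) = es n k (noi i b).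
Proof.
  assert (Q : forall n k i b, (i < n)%nat ->
    lsum (blists n) (fun t => ind (tech_of k i t) * prodR n (fun j => pw (mem t j /\ j <> i) (b j)))
     = match k with O => 0 | S k' => es n k' (noi i b) end).
  { clear. induction n; intros k i b Hi; [lia|].
    simpl blists. rewrite lsum_app, !lsum_map.
    destruct i as [|i].
    - rewrite (lsum_zero (blists n) (fun a => ind (tech_of k 0 (false :: a)) * _)).
      2: { intros a _. rewrite ind_false; [ring|]. intros [_ H]; discriminate. }
      rewrite Rplus_0_r. destruct k as [|k].
      + apply lsum_zero. intros a _. rewrite ind_false; [ring|]. intros [H _]; discriminate.
      + rewrite (lsum_ext (blists n) _ (fun a => ind (length (filter (fun b => b) a) = k) * prodR n (fun j => pw (mem a j) (b (S j))))).
        * rewrite (es_blists n k (fun j => b (S j))). destruct k as [|k]; simpl; [now rewrite !es_0|].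
          rewrite Rmult_0_l, Rplus_0_l. apply es_ext. intros j _. reflexivity.
        * intros a _. f_equal.
          -- apply ind_iff. unfold tech_of, mem. simpl. split; [intros [[=] _]; auto|intros ->; auto].
          -- rewrite prodR_front. rewrite pw_false by tauto. rewrite Rmult_1_l. apply prodR_ext. intros j _.
             unfold pw. em (mem (true :: a) (S j) /\ S j <> 0%nat); em (mem a j); try reflexivity; unfold mem in *; simpl in *; exfalso; try tauto.
             apply n0. split; [assumption|discriminate].
    - assert (Hi' : (i < n)%nat) by lia.
      assert (IH0 := IHn k i (fun j => b (S j)) Hi').
      rewrite (lsum_ext (blists n) (fun a => ind (tech_of k (S i) (false :: a)) * _)
        (fun t => ind (tech_of k i t) * prodR n (fun j => pw (mem t j /\ j <> i) (b (S j))))).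
      2: { intros a _. f_equal. rewrite prodR_front, pw_false by (unfold mem; simpl; intros [H _]; discriminate).
           rewrite Rmult_1_l. apply prodR_ext. intros j _.
           replace (mem (false :: a) (S j) /\ S j <> S i) with (mem a j /\ j <> i); [reflexivity|].
           apply propositional_extensionality. intuition. }
      rewrite IH0.
      rewrite (lsum_ext (blists n) (fun a => ind (tech_of k (S i) (true :: a)) * _)
        (fun t => b 0%nat * (ind (S (length (filter (fun b => b) t)) = k /\ mem t i) * prodR n (fun j => pw (mem t j /\ j <> i) (b (S j)))))).
      2: { intros a _. rewrite prodR_front, pw_true by (split; [reflexivity|discriminate]).
           replace (prodR n (fun j => pw (mem (true :: a) (S j) /\ S j <> S i) (b (S j)))) with (prodR n (fun j => pw (mem a j /\ j <> i) (b (S j)))).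
           - unfold tech_of. simpl. change (mem (true :: a) (S i)) with (mem a i). ring.
           - apply prodR_ext. intros j _.
             replace (mem (true :: a) (S j) /\ S j <> S i) with (mem a j /\ j <> i); [reflexivity|].
             apply propositional_extensionality. intuition. }
      rewrite lsum_scal. destruct k as [|k].
      + rewrite lsum_zero; [ring|]. intros a _. rewrite ind_false; [ring|]. intros [H _]; discriminate.
      + rewrite (lsum_ext (blists n) _ (fun t => ind (tech_of k i t) * prodR n (fun j => pw (mem t j /\ j <> i) (b (S j))))).
        2: { intros a _. f_equal. apply ind_iff. split; intros [H1 H2]; split; auto; congruence. }
        rewrite (IHn k i (fun j => b (S j)) Hi').
        assert (En : forall r, es n r (noi i (fun j => b (S j))) = es n r (fun j => noi (S i) b (S j))).
        { intros r. apply es_ext. intros j _. unfold noi. destruct (Nat.eq_dec j i), (Nat.eq_dec (S j) (S i)); try reflexivity; congruence. }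
        destruct k as [|k]; simpl; rewrite ?es_0; [ring|].
        rewrite !En. reflexivity. }
  intros Hi. rewrite <- (Q n (S k) i b Hi). apply lsum_ext. intros t _. f_equal. apply prodR_ext. intros j Hj.
  replace (Tof n t i j) with (mem t j /\ j <> i); [reflexivity|].
  apply propositional_extensionality. unfold Tof. tauto.
Qed.

Definition wS (i : nat) (p : nat -> R) (S : nat -> Prop) (j : nat) : R := noi i (fun j => p j * ind (S j)) j.

Lemma wS_nonneg i p n S : (forall j, (j < n)%nat -> 0 <= p j <= 1) -> forall j, (j < n)%nat -> 0 <= wS i p S j <= 1.
Proof.
  intros Hp j Hj. unfold wS, noi. destruct (Nat.eq_dec j i); [lra|]. assert (I := ind_range (S j)). specialize (Hp j Hj). nra.
Qed.

Lemma es_subset n k i p (S : nat -> Prop) : (i < n)%nat ->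
  lsum (blists n) (fun t => wt n (Datatypes.S k) p i t * ind (forall j, Tof n t i j -> S j)) = es n k (wS i p S).
Proof.
  intros Hi. change (wS i p S) with (noi i (fun j => p j * ind (S j))).
  rewrite <- (es_tech n k i (fun j => p j * ind (S j)) Hi). apply lsum_ext. intros t _.
  unfold wt. rewrite Rmult_assoc. f_equal. unfold prodA.
  rewrite (prodR_ext n (fun v => pw (Tof n t i v) (p v * ind (S v)))
    (fun v => pw (Tof n t i v) (p v) * pw (Tof n t i v) (ind (S v)))).
  2: { intros v _. unfold pw. em (Tof n t i v); ring. }
  rewrite prodR_mult. f_equal. unfold ind at 1. em (forall j, Tof n t i j -> S j).
  - symmetry. apply prodR_one. intros j Hj. unfold pw. em (Tof n t i j); [apply ind_true; auto|reflexivity].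
  - apply not_all_ex_not in n0. destruct n0 as [j Hj]. apply imply_to_and in Hj. destruct Hj as [H1 H2].
    symmetry. apply (prodR_zero n _ j); [apply H1|]. rewrite pw_true by assumption. now apply ind_false.
Qed.

Lemma wt_nonneg n k p i t : (forall j, (j < n)%nat -> 0 <= p j) -> 0 <= wt n k p i t.
Proof. intros H. apply Rmult_le_pos; [apply ind_pos|now apply prodA_nonneg]. Qed.

(** Inclusion and exclusion: technologies inside the union, minus those inside either part, are
    mixed sums in the sense of [es_mixed]. *)
Lemma mixed_count n r i p (P Q : nat -> Prop) : (i < n)%nat -> (forall j, (j < n)%nat -> 0 <= p j <= 1) ->
  (forall j, P j -> ~ Q j) ->
  lsum (blists n) (fun t => wt n (S (S (S r))) p i t * ind ((forall j, Tof n t i j -> P j \/ Q j) /\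
     ~ (forall j, Tof n t i j -> P j) /\ ~ (forall j, Tof n t i j -> Q j)))
  <= card n P * card n Q * (card n P + card n Q) ^ r.
Proof.
  intros Hi Hp Hd.
  assert (W0 : forall t, 0 <= wt n (S (S (S r))) p i t) by (intros; apply wt_nonneg; intros; now apply Hp).
  apply Rle_trans with (es n (S (S r)) (fun j => wS i p P j + wS i p Q j) - es n (S (S r)) (wS i p P) - es n (S (S r)) (wS i p Q)).
  - rewrite (es_ext n _ (fun j => wS i p P j + wS i p Q j) (wS i p (fun j => P j \/ Q j))).
    2: { intros j _. unfold wS, noi. destruct (Nat.eq_dec j i); [ring|]. specialize (Hd j).
         unfold ind. em (P j); em (Q j); em (P j \/ Q j); try ring; exfalso; tauto. }
    rewrite <- !es_subset by assumption.
    match goal with |- _ <= ?a - ?b - ?c => replace (a - b - c) with (a + ((-1) * b + (-1) * c)) by ring end.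
    rewrite <- !lsum_scal, <- !lsum_plus. apply lsum_le. intros t Ht. specialize (W0 t).
    destruct (classic (tech_of (S (S (S r))) i t)) as [Hk|Hk].
    2: { unfold wt. rewrite (ind_false _ Hk). lra. }
    (* An empty set of ideas would lie in both parts and be subtracted twice. *)
    assert (Hne : exists j, Tof n t i j).
    { apply NNPP. intros Hn. assert (C := card_Tof n _ t i Hi (blists_length n t Ht) Hk).
      rewrite card_empty in C by (intros v _ Hv; apply Hn; eauto). rewrite !S_INR in C. assert (X := pos_INR r). lra. }
    destruct Hne as [j0 Hj0].
    set (A := forall j, Tof n t i j -> P j \/ Q j). set (B := forall j, Tof n t i j -> P j). set (C := forall j, Tof n t i j -> Q j).
    assert (BC : B -> ~ C) by (intros HB HC; apply (Hd j0); auto).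
    assert (BA : B -> A) by (intros HB j Hj; left; auto). assert (CA : C -> A) by (intros HC j Hj; right; auto).
    enough (ind (A /\ ~ B /\ ~ C) <= ind A + (-1) * ind B + (-1) * ind C) by nra.
    unfold ind. em (A /\ ~ B /\ ~ C); em A; em B; em C; try lra; exfalso; tauto.
  - assert (S1 : sumR n (wS i p P) <= card n P).
    { apply sumR_le. intros j Hj. unfold wS, noi. assert (I := ind_range (P j)). specialize (Hp j Hj).
      destruct (Nat.eq_dec j i); [lra|nra]. }
    assert (S2 : sumR n (wS i p Q) <= card n Q).
    { apply sumR_le. intros j Hj. unfold wS, noi. assert (I := ind_range (Q j)). specialize (Hp j Hj).
      destruct (Nat.eq_dec j i); [lra|nra]. }
    assert (Z1 : 0 <= sumR n (wS i p P)) by (apply sumR_nonneg; intros; now apply (wS_nonneg i p n P Hp)).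
    assert (Z2 : 0 <= sumR n (wS i p Q)) by (apply sumR_nonneg; intros; now apply (wS_nonneg i p n Q Hp)).
    eapply Rle_trans; [apply es_mixed; intros; now apply (wS_nonneg i p n _ Hp)|].
    apply Rmult_le_compat; [nra|apply pow_le; lra|apply Rmult_le_compat; lra|apply pow_incr; lra].
Qed.

(** * Near-critical networks *)

Lemma Lrn_mono n i w w' t : (forall v, w v = true -> w' v = true) -> Lrn n w i t -> Lrn n w' i t.
Proof.
  intros L H. apply (hT_mono n i (fun u => u = t) w w' L); [|reflexivity]. now intros u ->.
Qed.

Section Near.

Variables (n : nat) (beta : nat -> R) (delta : R) (q : nat -> R) (bl c1 c2 : R).
Hypothesis Hnet : net_ok n beta delta q bl c1 c2.

Let ks := keys n.
Let pr := prob beta delta (fun _ => 0) q.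
Let pbar := c2 * c2 / INR n.
Let Hok : okp ks pr := net_okp _ _ _ _ _ _ _ Hnet.

(** At most [M1] listeners, each with at most [c2^2] direct sources on average; the truncation
    replaces a mean that diverges at criticality. *)
Lemma Lrn_truncated x M1 : (x < n)%nat -> 0 <= M1 ->
  Expect ks pr (fun w => ind (card n (Bk n w x) <= M1) * card n (Lrn n w x)) <= M1 * (c2 * c2).
Proof.
  intros Hx HM.
  assert (PB := uq_pbar n beta delta q bl c1 c2 Hnet). fold pbar in PB.
  assert (N := uq_n n beta delta q bl c1 c2 Hnet).
  rewrite (Expect_ext ks pr _ (fun w => sumR n (fun t => ind (card n (Bk n w x) <= M1 /\ Lrn n w x t)))).
  2: { intros w _. unfold card at 2. rewrite <- sumR_scal. apply sumR_ext. intros; symmetry; apply ind_and. }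
  rewrite Expect_sumR. apply Rle_trans with (sumR n (fun _ => M1 * pbar)).
  2: { rewrite sumR_const. unfold pbar. right. field. lra. }
  apply sumR_le. intros t Ht.
  destruct (Nat.eq_dec t x) as [->|Htx].
  { rewrite (Expect_ext ks pr _ (fun _ => 0)), Expect_const; [nra|]. intros w _. apply ind_false. unfold Lrn; tauto. }
  (* The backward cluster is stopped at [t], so that it reads no link to [t] and those links stay
     fresh. *)
  set (Bt := fun w => Rch (bwd w) (fun v => v = x) (fun v => (v < n)%nat /\ v <> x /\ v <> t)).
  eapply Rle_trans.
  { apply (Expect_le ks pr _ (fun w => (fun B w' => ind (card n B <= M1 /\ exists m s, (m < n)%nat /\ (s < n)%nat /\ B m /\ s = t /\ w' (Dir m s) = true)) (Bt w) w) Hok).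
    intros w _. apply ind_le. intros [Hc [_ [_ [m [Hm Hd]]]]].
    assert (Hin : forall v, Bt w v -> Bk n w x v) by (intros v; apply Rch_mono; tauto).
    split; [eapply Rle_trans; [|apply Hc]; apply card_le; auto|].
    assert (C : Bt w m \/ exists m', Bt w m' /\ w (Dir m' t) = true).
    { clear Hd. induction Hm as [v ->|u v Hr IH Hv Huv]; [left; now apply Rch_base|].
      destruct IH as [IH|IH]; [|now right].
      destruct (Nat.eq_dec v t) as [->|]; [right; exists u; split; [assumption|apply Huv]|left].
      apply (Rch_step _ _ _ u v IH); [tauto|assumption]. }
    assert (C' : exists m', Bt w m' /\ w (Dir m' t) = true) by (destruct C; eauto).
    destruct C' as [m' [H1 H2]]. exists m', t. split; [apply Rch_in in H1; destruct H1 as [-> |]; tauto|]. auto. }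
  eapply Rle_trans.
  - apply (Expect_fresh ks pr Bt (fun _ v => ny t v)
      (fun B w' => ind (card n B <= M1 /\ exists m s, (m < n)%nat /\ (s < n)%nat /\ B m /\ s = t /\ w' (Dir m s) = true))
      (fun _ => M1 * pbar) Hok).
    + intros w w' E. symmetry. apply Rch_ext_on. intros a u _ Hu. apply edge_eq; apply E; simpl; tauto.
    + intros w _ w1 w2 E. apply ind_iff.
      split; intros [H [m [s [H1 [H2 [H3 [-> H4]]]]]]]; (split; [assumption|]); exists m, t; repeat (split; [auto|]);
        [rewrite <- E|rewrite E]; simpl; tauto.
    + intros w _. rewrite Expect_ind_const_and. unfold ind at 1. em (card n (Bt w) <= M1); [|nra]. rewrite Rmult_1_l.
      eapply Rle_trans; [apply (dir_hit n beta delta q pbar Hok (uq_dir n beta delta q bl c1 c2 Hnet) (Bt w) (fun s => s = t))|].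
      * intros v Hv ->. apply Rch_in in Hv. destruct Hv as [Hv|]; [congruence|tauto].
      * rewrite card_single by assumption. rewrite Rmult_1_r. apply Rmult_le_compat_r; lra.
  - rewrite Expect_const. lra.
Qed.

(** The ideas that [i] has from elsewhere and that the link to [x] would not bring. Two pivotal
    links force a technology to mix [Kx] and [Qx]. *)
Definition Qx (w : Outcome) (i x t : nat) : Prop := Lrn n (setv w (Dir i x) false) i t /\ ~ Kx n w i x t.

Definition Ax (w : Outcome) (i x m : nat) : Prop := w (Ind i x) = true /\ bko n w i x m.

Definition Dx (i x : nat) (A : nat -> Prop) (v : Var) : Prop :=
  v = Ind i x \/ exists a u, A a /\ (v = Dir a u \/ v = Ind a u).

(** Erases the coins listed by [Dx], which determine [Ax] and [Kx], together with the link from [i]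
    to [x] itself; what is left is independent of them. *)
Definition mask (i x : nat) (A : nat -> Prop) (w : Outcome) : Outcome :=
  fun v => if excluded_middle_informative (Dx i x A v \/ v = Dir i x) then false else w v.

Lemma mask_keep i x A w v : ~ Dx i x A v -> v <> Dir i x -> mask i x A w v = w v.
Proof. intros H1 H2. unfold mask. em (Dx i x A v \/ v = Dir i x); [tauto|reflexivity]. Qed.

Lemma mask_le i x A w v : mask i x A w v = true -> w v = true.
Proof. unfold mask. em (Dx i x A v \/ v = Dir i x); [discriminate|auto]. Qed.

Lemma Ax_noti w i x : x <> i -> ~ Ax w i x i.
Proof. intros Hx [_ H]. apply (bko_in n i w x i Hx H). reflexivity. Qed.

(** No route to an idea of [Qx] passes through [Ax], since otherwise the link to [x] would bring
    that idea too. Erasing what [Ax] listens to is therefore harmless. *)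
Lemma Qx_mask w i x t : (i < n)%nat -> (x < n)%nat -> x <> i -> Qx w i x t -> Lrn n (mask i x (Ax w i x) w) i t.
Proof.
  intros Hi Hx Hxi [HL HK]. set (A := Ax w i x). set (wm := mask i x A w).
  assert (HAi : ~ A i) by now apply Ax_noti.
  apply Lrn_cover in HL; auto. destruct HL as [l [Hl [Hli [Hd HKl]]]].
  assert (Hlx : l <> x) by (intros ->; rewrite setv_same in Hd; discriminate).
  rewrite setv_other in Hd by congruence.
  rewrite (Kx_dep n i l Hli (setv w (Dir i x) false) w) in HKl.
  2: { intros v Hv. apply setv_other. intros ->. destruct Hv as [[Hv _]|Hv]; [now apply Hv|discriminate]. }
  assert (Hki : forall u, u <> x -> wm (Dir i u) = w (Dir i u) /\ wm (Ind i u) = w (Ind i u)).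
  { intros u Hu. split; apply mask_keep; try congruence; intros [E|[a [b [Ha [E|E]]]]]; try congruence;
      injection E as <- <-; contradiction. }
  assert (Hka : forall a u, ~ A a -> a <> i -> wm (Dir a u) = w (Dir a u) /\ wm (Ind a u) = w (Ind a u)).
  { intros a u Ha Hai. split; apply mask_keep; try congruence; intros [E|[a' [b [Ha' [E|E]]]]]; try congruence;
      injection E as <- <-; contradiction. }
  apply Lrn_cover; auto. exists l. split; [assumption|]. split; [assumption|].
  split; [rewrite (proj1 (Hki l Hlx)); assumption|].
  destruct HKl as [Ht [Hti HKl]]. split; [assumption|]. split; [assumption|].
  destruct HKl as [-> |[Hil [m [Hm Hdm]]]]; [now left|right].
  split; [rewrite (proj2 (Hki l Hlx)); assumption|].
  assert (HmA : ~ A m).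
  { intros [Hc Hb]. apply HK. split; [assumption|]. split; [assumption|]. right. split; [assumption|]. now exists m. }
  assert (Hmi : m <> i) by apply (bko_in n i w l m Hli Hm).
  exists m. split; [|rewrite (proj1 (Hka m t HmA Hmi)); assumption].
  clear Hdm Hmi. induction Hm as [v ->|u v Hr IH Hv Huv]; [now apply Rch_base|].
  assert (Hui : u <> i) by apply (bko_in n i w l u Hli Hr).
  assert (HuA : ~ A u).
  { intros [Hc Hb]. apply HmA. split; [assumption|]. destruct (Nat.eq_dec v x) as [->|]; [now apply Rch_base|].
    apply (Rch_step _ _ _ u v Hb); [tauto|assumption]. }
  apply (Rch_step _ _ _ u v (IH HuA)); [assumption|].
  unfold bwd, ind_edge. rewrite (proj1 (Hka u v HuA Hui)), (proj2 (Hka u v HuA Hui)). exact Huv.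
Qed.

(** A disjoint-occurrence inequality of van den Berg and Kesten type: reveal what the link to [x]
    brings; by [Qx_mask] the rest is learned from unread coins, and by monotonicity it is dominated
    by a fresh copy of what [i] learns. *)
Lemma split_bound i x (phi psi : R -> R) : (i < n)%nat -> (x < n)%nat -> x <> i ->
  (forall s, 0 <= s -> 0 <= phi s) -> (forall s, 0 <= s -> 0 <= psi s) -> (forall s s', 0 <= s <= s' -> psi s <= psi s') ->
  Expect ks pr (fun w => ind (w (Dir i x) = true) * (phi (card n (Kx n w i x)) * psi (card n (Qx w i x)))) <=
  pbar * (Expect ks pr (fun w => phi (card n (Kx n w i x))) * Expect ks pr (fun w => psi (card n (Lrn n w i)))).
Proof.
  intros Hi Hx Hxi Hphi Hpsi Hmon.
  set (EL := Expect ks pr (fun w => psi (card n (Lrn n w i)))).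
  set (X := fun w => (Ax w i x, Kx n w i x)).
  set (g := fun (s : (nat -> Prop) * (nat -> Prop)) w => phi (card n (snd s)) *
     (ind (w (Dir i x) = true) * psi (card n (Lrn n (mask i x (fst s) w) i)))).
  eapply Rle_trans.
  { apply (Expect_le ks pr _ (fun w => g (X w) w) Hok). intros w _.
    assert (P1 := Hphi _ (card_nonneg n (Kx n w i x))). assert (I := ind_pos (w (Dir i x) = true)).
    assert (psi (card n (Qx w i x)) <= psi (card n (Lrn n (mask i x (Ax w i x) w) i))).
    { apply Hmon. split; [apply card_nonneg|]. apply card_le. intros t _. now apply Qx_mask. }
    set (a := psi (card n (Qx w i x))) in *.
    replace (ind (w (Dir i x) = true) * (phi (card n (Kx n w i x)) * a))
      with (phi (card n (Kx n w i x)) * (ind (w (Dir i x) = true) * a)) by ring.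
    apply Rmult_le_compat_l; [assumption|]. apply Rmult_le_compat_l; assumption. }
  eapply Rle_trans.
  { apply (Expect_fresh ks pr X (fun s => Dx i x (fst s)) g (fun s => phi (card n (snd s)) * (pbar * EL)) Hok).
    - intros w w' E. unfold X in *.
      assert (Ec : w (Ind i x) = w' (Ind i x)) by (apply E; now left).
      destruct (w (Ind i x)) eqn:Hc.
      + assert (Eb : bko n w i x = bko n w' i x).
        { apply Rch_closed_ext. intros a u Ha. apply edge_eq; apply E; right; exists a, u; (split; [split; auto|auto]). }
        f_equal.
        * extensionality m. unfold Ax. now rewrite <- Ec, Eb, Hc.
        * extensionality t. apply propositional_extensionality. unfold Kx. rewrite <- Eb, <- Ec, Hc.
          assert (Ed : forall m, bko n w i x m -> w' (Dir m t) = w (Dir m t)).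
          { intros m Hm. symmetry. apply E. right. exists m, t. split; [split; auto|auto]. }
          split; intros [H1 [H2 H3]]; (split; [assumption|]); (split; [assumption|]); (destruct H3 as [|[_ [m [Hm Hd]]]]; [now left|right]);
            (split; [reflexivity|]); exists m; (split; [assumption|]); [rewrite <- Ed|rewrite Ed]; auto.
      + f_equal.
        * extensionality m. apply propositional_extensionality. unfold Ax. rewrite <- Ec, Hc. split; intros [H _]; discriminate.
        * extensionality t. apply propositional_extensionality. unfold Kx. rewrite <- Ec, Hc.
          split; intros [H1 [H2 [H3|[H3 _]]]]; try discriminate; auto.
    - intros w _. set (s := X w). assert (HAi : ~ fst s i) by now apply Ax_noti.
      intros w1 w2 E. unfold g. f_equal. f_equal.
      + rewrite (E (Dir i x)); [reflexivity|]. intros [H|[a [u [Ha [H|H]]]]]; try discriminate. injection H as -> ->. contradiction.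
      + replace (mask i x (fst s) w1) with (mask i x (fst s) w2); [reflexivity|].
        extensionality v. unfold mask. em (Dx i x (fst s) v \/ v = Dir i x); [reflexivity|]. symmetry. apply E. tauto.
    - intros w _. unfold g. rewrite Expect_scal. apply Rmult_le_compat_l; [apply Hphi, card_nonneg|].
      set (A := fst (X w)).
      rewrite (Expect_indep ks pr (fun v => v = Dir i x)).
      + apply Rmult_le_compat.
        * apply Expect_ind_range, Hok.
        * apply Expect_nonneg; [apply Hok|]. intros; apply Hpsi, card_nonneg.
        * apply (uq_dir n beta delta q bl c1 c2 Hnet); auto.
        * apply Expect_le; [apply Hok|]. intros w' _. apply Hmon. split; [apply card_nonneg|].
          apply card_le. intros t _. apply Lrn_mono. apply mask_le.
      + apply dep_var.
      + intros w1 w2 E. replace (mask i x A w1) with (mask i x A w2); [reflexivity|].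
        extensionality v. unfold mask. em (Dx i x A v \/ v = Dir i x); [reflexivity|]. symmetry. apply E. tauto. }
  simpl. rewrite (Expect_ext ks pr _ (fun w => (pbar * EL) * phi (card n (Kx n w i x)))) by (intros; ring).
  rewrite Expect_scal. right. ring.
Qed.

(** On the event that [x] is the only firm [i] listens to, [i] learns all of [Kx]. These events are
    disjoint over [x], have probability of order [1 / n], and involve coins that [Kx] does not
    read. *)
Lemma Kx_sum i s : (i < n)%nat ->
  pbar * nsum n i (fun x => Expect ks pr (fun w => card n (Kx n w i x) ^ s)) <=
  c2 * c2 / (bl * (c1 * c1)) * exp (2 * (c2 * c2)) * Expect ks pr (fun w => card n (Lrn n w i) ^ s).
Proof.
  intros Hi.
  assert (PB := uq_pbar n beta delta q bl c1 c2 Hnet). fold pbar in PB.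
  assert (N := uq_n n beta delta q bl c1 c2 Hnet).
  set (p1 := bl * (c1 * c1)). assert (Hp1 : 0 < p1).
  { destruct Hnet. apply Rmult_lt_0_compat; [assumption|nra]. }
  set (on := fun x w => w (Dir i x) = true /\ forall l, (l < n)%nat -> l <> i -> l <> x -> w (Dir i l) <> true).
  assert (H1 : nsum n i (fun x => p1 / INR n * exp (- (2 * (c2 * c2))) * Expect ks pr (fun w => card n (Kx n w i x) ^ s))
     <= Expect ks pr (fun w => card n (Lrn n w i) ^ s)).
  { apply Rle_trans with (nsum n i (fun x => Expect ks pr (fun w => ind (on x w) * card n (Kx n w i x) ^ s))).
    - apply nsum_le. intros x Hx Hxi.
      assert (Hdir : p1 / INR n <= Expect ks pr (fun w => ind (w (Dir i x) = true))).
      { assert (E := EN_Dir n beta delta q i x Hi Hx (not_eq_sym Hxi)). unfold EN in E. fold ks pr in E. rewrite E.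
        apply (net_p _ _ _ _ _ _ _ Hnet i x Hi Hx). }
      set (no := fun w => prodR n (fun l => pw (l <> i /\ l <> x) (1 - ind (w (Dir i l) = true)))).
      assert (Hno : exp (- (2 * (c2 * c2))) <= Expect ks pr no).
      { assert (EP := Expect_prodR ks pr n (fun l v => v = Dir i l) (fun l w => pw (l <> i /\ l <> x) (1 - ind (w (Dir i l) = true)))).
        change (Expect ks pr no) with
          (Expect ks pr (fun w => prodR n (fun l => pw (l <> i /\ l <> x) (1 - ind (w (Dir i l) = true))))).
        rewrite EP; clear EP.
        - apply Rle_trans with (prodR n (fun _ => exp (- (2 * pbar)))).
          + rewrite prodR_exp, sumR_const. right. f_equal. unfold pbar. field. lra.
          + apply prodR_le. intros l Hl. split; [left; apply exp_pos|]. unfold pw. em (l <> i /\ l <> x).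
            * rewrite Expect_minus, Expect_const. assert (D := uq_dir n beta delta q bl c1 c2 Hnet i l Hi Hl ltac:(intros ->; tauto)). fold ks pr pbar in D.
              assert (0 <= Expect ks pr (fun w => ind (w (Dir i l) = true))) by apply (Expect_ind_range ks pr _ Hok).
              eapply Rle_trans; [|apply one_sub_ge_exp; lra]. apply exp_le_mono. nra.
            * rewrite Expect_const. rewrite <- exp_0. apply exp_le_mono. lra.
        - intros l _ w w' E. unfold pw. em (l <> i /\ l <> x); [|reflexivity]. now rewrite E.
        - intros l l' v _ _ -> E. now injection E. }
      rewrite (Expect_ext ks pr (fun w => ind (on x w) * card n (Kx n w i x) ^ s)
        (fun w => ind (w (Dir i x) = true) * (no w * card n (Kx n w i x) ^ s))).
      2: { intros w _. rewrite <- Rmult_assoc. f_equal. unfold on. rewrite ind_and. f_equal. unfold ind at 1, no.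
           em (forall l, (l < n)%nat -> l <> i -> l <> x -> w (Dir i l) <> true).
           - symmetry. apply prodR_one. intros l Hl. unfold pw. em (l <> i /\ l <> x); [|reflexivity].
             rewrite ind_false; [ring|]. apply n0; tauto.
           - apply not_all_ex_not in n0. destruct n0 as [l n0]. apply imply_to_and in n0. destruct n0 as [Hl n0].
             apply imply_to_and in n0. destruct n0 as [Hli n0]. apply imply_to_and in n0. destruct n0 as [Hlx n0]. apply NNPP in n0.
             symmetry. apply (prodR_zero n _ l Hl). rewrite pw_true by auto. rewrite ind_true by assumption. ring. }
      assert (K0 : 0 <= Expect ks pr (fun w => card n (Kx n w i x) ^ s)).
      { apply Expect_nonneg; [apply Hok|]. intros; apply pow_le, card_nonneg. }
      rewrite (Expect_indep ks pr (fun v => v = Dir i x)).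
      + rewrite (Expect_indep ks pr (fun v => exists l, l <> x /\ v = Dir i l)).
        * rewrite Rmult_assoc. assert (E0 := exp_pos (- (2 * (c2 * c2)))).
          assert (0 < p1 / INR n) by (apply Rdiv_lt_0_compat; lra).
          apply Rmult_le_compat; [lra|apply Rmult_le_pos; lra|assumption|]. apply Rmult_le_compat_r; assumption.
        * apply dep_prodR. intros l _ w w' E. unfold pw. em (l <> i /\ l <> x); [|reflexivity].
          rewrite E; [reflexivity|]. exists l. tauto.
        * intros w w' E. rewrite (Kx_dep n i x Hxi w w'); [reflexivity|]. intros v Hv. apply E.
          intros [l [Hl ->]]. destruct Hv as [[Hv _]|Hv]; [now apply Hv|discriminate].
      + apply dep_var.
      + intros w w' E. f_equal.
        * apply prodR_ext. intros l _. unfold pw. em (l <> i /\ l <> x); [|reflexivity]. rewrite E; [reflexivity|].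
          intros X; injection X as ->. tauto.
        * rewrite (Kx_dep n i x Hxi w w'); [reflexivity|]. intros v Hv. apply E.
          intros ->. destruct Hv as [[Hv _]|Hv]; [now apply Hv|discriminate].
    - rewrite <- Expect_nsum. apply Expect_le; [apply Hok|]. intros w _.
      apply Rle_trans with (nsum n i (fun x => card n (Lrn n w i) ^ s * ind (on x w))).
      + apply nsum_le. intros x Hx Hxi. unfold ind. em (on x w); [|lra]. rewrite Rmult_1_l, Rmult_1_r.
        apply pow_incr. split; [apply card_nonneg|]. apply card_le. intros t _ HK. apply Lrn_cover; auto.
        exists x. split; [assumption|]. split; [assumption|]. split; [apply o|assumption].
      + rewrite nsum_scal.
        assert (0 <= card n (Lrn n w i) ^ s) by (apply pow_le, card_nonneg).
        assert (nsum n i (fun x => ind (on x w)) <= 1); [|nra].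
        apply Rle_trans with (card n (fun x => x <> i /\ on x w)).
        * apply sumR_le. intros x _. destruct (Nat.eq_dec x i); [apply ind_pos|]. apply ind_le. tauto.
        * apply card_le_1. intros x x' Hx Hx' [Hxi [Hd Ho]] [Hxi' [Hd' Ho']].
          destruct (Nat.eq_dec x x') as [|Hne]; [assumption|]. exfalso. apply (Ho x' Hx' Hxi' (not_eq_sym Hne)). assumption. }
  rewrite nsum_scal in H1. set (SK := nsum n i (fun x => Expect ks pr (fun w => card n (Kx n w i x) ^ s))) in *.
  assert (E1 : exp (2 * (c2 * c2)) * exp (- (2 * (c2 * c2))) = 1) by (rewrite <- exp_plus, Rplus_opp_r; apply exp_0).
  assert (Hc2 : 0 < c2 * c2) by (destruct Hnet; nra).
  assert (P2 := exp_pos (2 * (c2 * c2))).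
  apply Rle_trans with (c2 * c2 / p1 * exp (2 * (c2 * c2)) * (p1 / INR n * exp (- (2 * (c2 * c2))) * SK)).
  - right. replace (c2 * c2 / p1 * exp (2 * (c2 * c2)) * (p1 / INR n * exp (- (2 * (c2 * c2))) * SK))
      with (c2 * c2 / INR n * (exp (2 * (c2 * c2)) * exp (- (2 * (c2 * c2)))) * SK) by (field; lra).
    rewrite E1. unfold pbar. ring.
  - apply Rmult_le_compat_l; [|assumption]. apply Rmult_le_pos; [|lra]. left. apply Rdiv_lt_0_compat; lra.
Qed.

(** With at least two pivotal links, each of them splits the technology properly between [Kx] and
    [Qx]. The number of pivotal links is at most the number [r + 2] of other ideas, which linearises
    the factorial moment. *)
Lemma PP_mixed i p r : (i < n)%nat -> (forall j, (j < n)%nat -> 0 <= p j <= 1) ->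
  lsum (blists n) (fun t => wt n (S (S (S r))) p i t * PP n beta delta q i (Tof n t i)) <=
  (INR r + 2) * nsum n i (fun x => Expect ks pr (fun w => ind (w (Dir i x) = true) *
     (card n (Kx n w i x) * card n (Qx w i x) * (card n (Kx n w i x) + card n (Qx w i x)) ^ r))).
Proof.
  intros Hi Hp. set (k := S (S (S r))).
  assert (W0 : forall t, 0 <= wt n k p i t) by (intros; apply wt_nonneg; intros; now apply Hp).
  rewrite <- nsum_scal.
  rewrite (nsum_ext n i _ (fun x => Expect ks pr (fun w => (INR r + 2) * (ind (w (Dir i x) = true) *
     (card n (Kx n w i x) * card n (Qx w i x) * (card n (Kx n w i x) + card n (Qx w i x)) ^ r)))))
    by (intros; now rewrite Expect_scal).
  rewrite <- Expect_nsum.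
  rewrite (lsum_ext (blists n) _ (fun t => Expect ks pr (fun w => wt n k p i t * (fT n i (Tof n t i) w * (npiv n i (Tof n t i) w * (npiv n i (Tof n t i) w - 1))))))
    by (intros; rewrite Expect_scal; reflexivity).
  rewrite <- Expect_lsum. apply Expect_le; [apply Hok|]. intros w Hw.
  set (ev := fun t x => (forall j, Tof n t i j -> Kx n w i x j \/ Qx w i x j) /\
     ~ (forall j, Tof n t i j -> Kx n w i x j) /\ ~ (forall j, Tof n t i j -> Qx w i x j)).
  apply Rle_trans with (lsum (blists n) (fun t => nsum n i (fun x => (INR r + 2) * (ind (w (Dir i x) = true) * (wt n k p i t * ind (ev t x)))))).
  - apply lsum_le. intros t Ht.
    rewrite nsum_scal.
    rewrite (nsum_ext n i (fun x => ind (w (Dir i x) = true) * (wt n k p i t * ind (ev t x)))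
      (fun x => wt n k p i t * (ind (w (Dir i x) = true) * ind (ev t x)))) by (intros; ring).
    rewrite nsum_scal.
    match goal with |- _ <= ?a * (?b * ?c) => replace (a * (b * c)) with (b * (a * c)) by ring end.
    destruct (classic (tech_of k i t)) as [Htk|Htk]; [|unfold wt; rewrite (ind_false _ Htk); lra].
    apply Rmult_le_compat_l; [apply W0|]. set (T := Tof n t i).
    assert (HT := Tof_ok n t i).
    assert (CT : card n T = INR r + 2).
    { unfold T. rewrite (card_Tof n k t i Hi (blists_length n t Ht) Htk). unfold k. rewrite !S_INR. ring. }
    assert (S0 : 0 <= nsum n i (fun x => ind (w (Dir i x) = true) * ind (ev t x))).
    { apply nsum_nonneg. intros; apply Rmult_le_pos; apply ind_pos. }
    assert (P := pos_INR r).
    unfold fT. unfold ind at 1. em (hT n w i T /\ sec n w i T); [|rewrite Rmult_0_l; apply Rmult_le_pos; lra].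
    destruct a as [Hh _]. rewrite Rmult_1_l.
    assert (Hnp := npiv_le_card n i T Hi HT w Hh). rewrite CT in Hnp.
    assert (Np0 : 0 <= npiv n i T w) by apply card_nonneg.
    destruct (card_INR n (piv n i T w)) as [m Hm]. fold (npiv n i T w) in Hm.
    destruct (le_lt_dec m 1) as [Hm1|Hm2].
    { assert (npiv n i T w <= 1) by (rewrite Hm; apply (le_INR m 1); lia).
      apply Rle_trans with 0; [nra|apply Rmult_le_pos; lra]. }
    assert (Hnp2 : 2 <= npiv n i T w) by (rewrite Hm; apply (le_INR 2 m); lia).
    assert (K : npiv n i T w <= nsum n i (fun x => ind (w (Dir i x) = true) * ind (ev t x))).
    { apply sumR_le. intros x Hx. destruct (Nat.eq_dec x i) as [->|Hxi].
      - rewrite ind_false; [lra|]. unfold piv; tauto.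
      - unfold ind at 1. em (piv n i T w x); [|apply Rmult_le_pos; apply ind_pos].
        destruct p0 as [_ [Hd Hn]]. rewrite (ind_true (w _ = true)), ind_true; auto; [lra|].
        assert (Hcov : forall j, T j -> Kx n w i x j \/ Qx w i x j).
        { intros j Hj. destruct (classic (Kx n w i x j)) as [|HK]; [now left|right]. split; [|assumption].
          assert (HL := Hh j Hj). apply NNPP. intros HnL. apply HK.
          apply Lrn_cover in HL; auto. destruct HL as [y [Hy [Hyi [Hdy HKy]]]].
          rewrite <- (Lrn_setx n i Hi w x y j Hy Hyi Hdy HKy HnL). assumption. }
        split; [exact Hcov|]. split.
        + intros Hall. (* another pivotal link x' covers an idea that x does not *)
          assert (Hx' : exists x', (x' < n)%nat /\ x' <> x /\ piv n i T w x').
          { apply NNPP. intros Hno. assert (npiv n i T w <= 1); [|lra].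
            rewrite <- (card_single n x Hx). apply card_le. intros v Hv Hpv. apply NNPP. intros Hne. apply Hno. exists v. auto. }
          destruct Hx' as [x' [Hx' [Hne [Hxi' [Hd' Hn']]]]]. apply Hn'.
          intros j Hj. apply NNPP. intros HnL. apply Hne. symmetry.
          apply (Lrn_setx n i Hi w x' x j Hx Hxi Hd (Hall j Hj) HnL).
        + intros Hall. apply Hn. intros j Hj. apply (Hall j Hj). }
    assert ((npiv n i T w - 1) * npiv n i T w <= (INR r + 2) * npiv n i T w) by nra.
    assert ((INR r + 2) * npiv n i T w <= (INR r + 2) * nsum n i (fun x => ind (w (Dir i x) = true) * ind (ev t x))) by nra.
    lra.
  - unfold nsum. rewrite lsum_sumR_swap. apply sumR_le. intros x Hx. destruct (Nat.eq_dec x i) as [->|Hxi].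
    + rewrite lsum_zero by auto. lra.
    + rewrite !lsum_scal. assert (P := pos_INR r). apply Rmult_le_compat_l; [lra|]. apply Rmult_le_compat_l; [apply ind_pos|].
      apply mixed_count; auto. intros j HK [_ HQ]. contradiction.
Qed.

(** With two ideas there is one idea to learn, hence at most one pivotal link. *)
Lemma PP_singleton i p : (i < n)%nat -> (forall j, (j < n)%nat -> 0 <= p j <= 1) ->
  lsum (blists n) (fun t => wt n 2 p i t * PP n beta delta q i (Tof n t i)) <= 0.
Proof.
  intros Hi Hp. rewrite <- (lsum_zero (blists n) (fun _ => 0)) by auto. apply lsum_le. intros t Ht.
  assert (W0 : 0 <= wt n 2 p i t) by (apply wt_nonneg; intros; now apply Hp).
  destruct (classic (tech_of 2 i t)) as [Htk|Htk]; [|unfold wt; rewrite (ind_false _ Htk); lra].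
  enough (PP n beta delta q i (Tof n t i) <= 0) by nra.
  fold ks pr. rewrite <- (Expect_const ks pr 0). apply Expect_le; [apply Hok|]. intros w _.
  unfold fT, ind. em (hT n w i (Tof n t i) /\ sec n w i (Tof n t i)); [|lra].
  assert (K := npiv_le_card n i (Tof n t i) Hi (Tof_ok n t i) w (proj1 a)).
  rewrite (card_Tof n 2 t i Hi (blists_length n t Ht) Htk) in K. simpl in K.
  assert (0 <= npiv n i (Tof n t i) w) by apply card_nonneg. nra.
Qed.

End Near.

(** Tightness of the number of ideas learned: the backward cluster is tight, and on a bounded
    cluster [Lrn_truncated] with Markov's inequality suffices. *)
Lemma Lrn_tail delta bl c1 c2 tau : 0 < delta <= 1 -> 0 < bl < 1 -> 0 < c1 <= c2 -> 0 < tau ->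
  exists M eps N, 0 < M /\ 0 < eps /\ forall n beta q, (N <= n)%nat -> net_ok n beta delta q bl c1 c2 ->
  lam0 n beta delta q <= 1 + eps -> forall x, (x < n)%nat ->
  EN n beta delta q (fun w => ind (M < card n (Lrn n w x))) <= tau.
Proof.
  intros Hd Hbl Hc Ht. assert (HcC := consts_ok _ _ _ _ Hd Hbl Hc).
  destruct (cluster_tail (delta * bl * c1) c2 (tau / 2) HcC ltac:(lra)) as [M1 [e1 [N1 [HM1 [He1 T1]]]]].
  assert (C2 : 0 < c2 * c2) by nra.
  set (M := 2 * M1 * (c2 * c2) / tau). assert (HM : 0 < M) by (apply Rdiv_lt_0_compat; nra).
  exists M, e1, N1. split; [assumption|]. split; [assumption|]. intros n beta q HN Hnet Hl x Hx.
  assert (Hok := net_okp _ _ _ _ _ _ _ Hnet).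
  assert (Bo := bwd_ok _ _ _ _ _ _ _ Hnet).
  assert (BT := T1 _ _ _ _ _ _ _ Bo HN). cbv beta in BT. rewrite bwd_lam in BT.
  specialize (BT Hl (fun v => v = x) (fun v => (v < n)%nat /\ v <> x) ltac:(now intros v ->) ltac:(tauto)).
  rewrite card_single in BT by assumption.
  assert (LT := Lrn_truncated n beta delta q bl c1 c2 Hnet x M1 Hx ltac:(lra)).
  eapply Rle_trans.
  { apply (Expect_le _ _ _ (fun w => ind (M1 < card n (Bk n w x)) + / M * (ind (card n (Bk n w x) <= M1) * card n (Lrn n w x))) Hok).
    intros w _. assert (CL := card_nonneg n (Lrn n w x)). assert (IM : 0 < / M) by now apply Rinv_0_lt_compat.
    assert (I := ind_range (M1 < card n (Bk n w x))).
    unfold ind at 1. em (M < card n (Lrn n w x)).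
    - destruct (Rle_dec (card n (Bk n w x)) M1) as [Hb|Hb].
      + rewrite (ind_true (card n (Bk n w x) <= M1)) by assumption.
        assert (1 < / M * card n (Lrn n w x)).
        { apply (Rmult_lt_reg_l M); auto. rewrite <- Rmult_assoc, Rinv_r; lra. }
        lra.
      + rewrite (ind_true (M1 < _)) by lra. assert (0 <= ind (card n (Bk n w x) <= M1)) by apply ind_pos.
        assert (0 <= / M * (ind (card n (Bk n w x) <= M1) * card n (Lrn n w x))) by (apply Rmult_le_pos; [lra|apply Rmult_le_pos; lra]). lra.
    - assert (0 <= ind (card n (Bk n w x) <= M1)) by apply ind_pos.
      assert (0 <= / M * (ind (card n (Bk n w x) <= M1) * card n (Lrn n w x))) by (apply Rmult_le_pos; [lra|apply Rmult_le_pos; lra]). lra. }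
  rewrite Expect_plus, Expect_scal.
  assert (/ M * Expect (keys n) (prob beta delta (fun _ => 0) q) (fun w => ind (card n (Bk n w x) <= M1) * card n (Lrn n w x)) <= tau / 2).
  { apply Rle_trans with (/ M * (M1 * (c2 * c2))); [apply Rmult_le_compat_l; [left; now apply Rinv_0_lt_compat|assumption]|].
    right. unfold M. field. lra. }
  change (Expect (keys n) (prob beta delta (fun _ => 0) q) (fun w => ind (M1 < card n (Bk n w x))) <= tau / 2 * 1) in BT. lra.
Qed.

Section Moments.

Variables (n : nat) (beta : nat -> R) (delta : R) (q : nat -> R) (bl c1 c2 : R).
Hypothesis Hnet : net_ok n beta delta q bl c1 c2.
Variables (i : nat) (p : nat -> R).
Hypothesis Hi : (i < n)%nat.
Hypothesis Hp : forall j, (j < n)%nat -> 1/2 <= p j <= 1.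

Let ks := keys n.
Let pr := prob beta delta (fun _ => 0) q.
Let pbar := c2 * c2 / INR n.
Let Hok : okp ks pr := net_okp _ _ _ _ _ _ _ Hnet.
Let C3 := c2 * c2 / (bl * (c1 * c1)) * exp (2 * (c2 * c2)).
Let EL (s : nat) := Expect ks pr (fun w => card n (Lrn n w i) ^ s).

Lemma EL_nonneg s : 0 <= EL s.
Proof. apply Expect_nonneg; [apply Hok|]. intros; apply pow_le, card_nonneg. Qed.

(** Lower moments are negligible once the moment of order [r] is large. *)
Lemma EL_lower_order s r M : (s < r)%nat -> 1 <= M -> EL s <= M ^ r + EL r / M.
Proof.
  intros Hs HM. unfold EL.
  replace (Expect ks pr (fun w => card n (Lrn n w i) ^ r) / M) with (/ M * Expect ks pr (fun w => card n (Lrn n w i) ^ r)) by lra.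
  rewrite <- Expect_scal, <- (Expect_const ks pr (M ^ r)), <- Expect_plus. apply Expect_le; [apply Hok|]. intros w _.
  assert (C0 := card_nonneg n (Lrn n w i)). set (L := card n (Lrn n w i)) in *.
  assert (0 < / M) by (apply Rinv_0_lt_compat; lra).
  destruct (Rle_dec L M) as [Hle|Hle].
  - assert (L ^ s <= M ^ r).
    { apply Rle_trans with (M ^ s); [apply pow_incr; lra|apply Rle_pow; [assumption|lia]]. }
    assert (0 <= / M * L ^ r) by (apply Rmult_le_pos; [lra|now apply pow_le]). lra.
  - assert (0 <= M ^ r) by (apply pow_le; lra).
    assert (L ^ s <= / M * L ^ r); [|lra].
    apply (Rmult_le_reg_l M); [lra|]. rewrite <- Rmult_assoc, Rinv_r, Rmult_1_l by lra.
    apply Rle_trans with (L * L ^ s); [apply Rmult_le_compat_r; [now apply pow_le|lra]|].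
    change (L * L ^ s) with (L ^ S s). apply Rle_pow; [lra|lia].
Qed.

(** If one of the two sets has at most [M] ideas, only a lower moment appears. If both exceed [M],
    two nearly independent rare events have to occur, and the top moment is multiplied by the tail
    probability [tau]. *)
Lemma mixed_moment a b M tau : (0 < a)%nat -> (0 < b)%nat -> 1 <= M ->
  (forall x, (x < n)%nat -> Expect ks pr (fun w => ind (M - 1 < card n (Lrn n w x))) <= tau) ->
  nsum n i (fun x => Expect ks pr (fun w => ind (w (Dir i x) = true) * (card n (Kx n w i x) ^ a * card n (Qx n w i x) ^ b)))
  <= c2 * c2 * M ^ a * EL b + C3 * M ^ b * EL a + (C3 + c2 * c2) * tau * EL (a + b).
Proof.
  intros Ha Hb HM Htail.
  assert (N := uq_n n beta delta q bl c1 c2 Hnet).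
  assert (PB := uq_pbar n beta delta q bl c1 c2 Hnet). fold pbar in PB.
  assert (Htau : 0 <= tau) by (eapply Rle_trans; [|apply (Htail i Hi)]; apply Expect_ind_range, Hok).
  set (K := fun s x => Expect ks pr (fun w => card n (Kx n w i x) ^ s)).
  assert (K0 : forall s x, 0 <= K s x) by (intros; apply Expect_nonneg; [apply Hok|]; intros; apply pow_le, card_nonneg).
  assert (TL : Expect ks pr (fun w => ind (M < card n (Lrn n w i))) <= tau).
  { eapply Rle_trans; [|apply (Htail i Hi)]. apply Expect_le; [apply Hok|]. intros w _. apply ind_le. lra. }
  assert (TK : forall x, (x < n)%nat -> x <> i -> Expect ks pr (fun w => ind (M < card n (Kx n w i x))) <= tau).
  { intros x Hx Hxi. eapply Rle_trans; [|apply (Htail x Hx)]. apply Expect_le; [apply Hok|]. intros w _. apply ind_le. intros H.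
    assert (card n (Kx n w i x) <= 1 + card n (Lrn n w x)); [|lra].
    rewrite <- (card_single n x Hx). eapply Rle_trans; [|apply card_union_le]. apply card_le.
    intros t _ [Ht [Hti HK]]. destruct (Nat.eq_dec t x); [now left|right]. destruct HK as [|[_ [m [Hm Hd]]]]; [contradiction|].
    split; [assumption|]. split; [assumption|]. exists m. split; [|assumption].
    eapply Rch_mono; [| | |apply Hm]; auto. tauto. }
  assert (Step : forall x, (x < n)%nat -> x <> i ->
    Expect ks pr (fun w => ind (w (Dir i x) = true) * (card n (Kx n w i x) ^ a * card n (Qx n w i x) ^ b)) <=
    pbar * (M ^ a * EL b + M ^ b * K a x + tau * K (a + b)%nat x + tau * EL (a + b))).
  { intros x Hx Hxi.
    assert (SB := split_bound n beta delta q bl c1 c2 Hnet i x). fold ks pr pbar in SB.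
    assert (B1 := SB (fun _ => M ^ a) (fun s => s ^ b) Hi Hx Hxi ltac:(intros; apply pow_le; lra) ltac:(intros; now apply pow_le) ltac:(intros; now apply pow_incr)).
    assert (B2 := SB (fun s => s ^ a) (fun _ => M ^ b) Hi Hx Hxi ltac:(intros; now apply pow_le) ltac:(intros; apply pow_le; lra) ltac:(intros; lra)).
    assert (B3 := SB (fun s => s ^ (a + b)) (fun s => ind (M < s)) Hi Hx Hxi ltac:(intros; now apply pow_le) ltac:(intros; apply ind_pos) ltac:(intros; apply ind_le; lra)).
    assert (B4 := SB (fun s => ind (M < s)) (fun s => s ^ (a + b)) Hi Hx Hxi ltac:(intros; apply ind_pos) ltac:(intros; now apply pow_le) ltac:(intros; now apply pow_incr)).
    cbv beta in B1, B2, B3, B4. rewrite !Expect_const in B1, B2. fold (EL b) in B1. fold (K a x) in B2. fold (K (a + b)%nat x) in B3. fold (EL (a + b)) in B4.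
    apply Rle_trans with (Expect ks pr (fun w => ind (w (Dir i x) = true) * (M ^ a * card n (Qx n w i x) ^ b)
      + ind (w (Dir i x) = true) * (card n (Kx n w i x) ^ a * M ^ b)
      + (ind (w (Dir i x) = true) * (card n (Kx n w i x) ^ (a + b) * ind (M < card n (Qx n w i x)))
         + ind (w (Dir i x) = true) * (ind (M < card n (Kx n w i x)) * card n (Qx n w i x) ^ (a + b))))).
    - apply Expect_le; [apply Hok|]. intros w _. rewrite <- !Rmult_plus_distr_l. apply Rmult_le_compat_l; [apply ind_pos|].
      assert (u0 := card_nonneg n (Kx n w i x)). assert (v0 := card_nonneg n (Qx n w i x)).
      set (u := card n (Kx n w i x)) in *. set (v := card n (Qx n w i x)) in *.
      assert (ua : 0 <= u ^ a) by now apply pow_le. assert (vb : 0 <= v ^ b) by now apply pow_le.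
      assert (Ma : 0 <= M ^ a) by (apply pow_le; lra). assert (Mb : 0 <= M ^ b) by (apply pow_le; lra).
      assert (uab : 0 <= u ^ (a + b)) by now apply pow_le. assert (vab : 0 <= v ^ (a + b)) by now apply pow_le.
      assert (I1 := ind_range (M < v)). assert (I2 := ind_range (M < u)).
      destruct (Rle_dec u M) as [Hu|Hu].
      { assert (u ^ a <= M ^ a) by (apply pow_incr; lra). nra. }
      destruct (Rle_dec v M) as [Hv|Hv].
      { assert (v ^ b <= M ^ b) by (apply pow_incr; lra). nra. }
      rewrite !ind_true in * by lra. rewrite pow_add in *. rewrite pow_add in *.
      (* The larger one takes the whole power [a + b]; the other contributes only the indicator that
         it exceeds [M]. *)
      destruct (Rle_dec u v) as [Huv|Huv].
      + assert (u ^ a <= v ^ a) by (apply pow_incr; lra). nra.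
      + assert (v ^ b <= u ^ b) by (apply pow_incr; lra). nra.
    - rewrite !Expect_plus.
      assert (Q1 : K (a + b)%nat x * Expect ks pr (fun w => ind (M < card n (Lrn n w i))) <= tau * K (a + b)%nat x)
        by (rewrite (Rmult_comm tau); apply Rmult_le_compat_l; auto).
      assert (Q2 : Expect ks pr (fun w => ind (M < card n (Kx n w i x))) * EL (a + b) <= tau * EL (a + b))
        by (apply Rmult_le_compat_r; [apply EL_nonneg|auto]).
      apply (Rmult_le_compat_l pbar) in Q1; [|lra]. apply (Rmult_le_compat_l pbar) in Q2; [|lra]. lra. }
  eapply Rle_trans; [apply nsum_le; apply Step|].
  rewrite nsum_scal, !nsum_plus, (nsum_scal _ _ (M ^ b)), (nsum_scal _ _ tau (fun x => K (a + b)%nat x)).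
  assert (Hone : forall X, 0 <= X -> pbar * nsum n i (fun _ => X) <= c2 * c2 * X).
  { intros X HX. apply Rle_trans with (pbar * (INR n * X)).
    - apply Rmult_le_compat_l; [lra|]. rewrite <- sumR_const. apply nsum_le_sumR; intros; lra.
    - unfold pbar. right. field. lra. }
  assert (H1 := Hone (M ^ a * EL b) ltac:(apply Rmult_le_pos; [apply pow_le; lra|apply EL_nonneg])).
  assert (H2 := Hone (tau * EL (a + b)) ltac:(apply Rmult_le_pos; [lra|apply EL_nonneg])).
  assert (H3 := Kx_sum n beta delta q bl c1 c2 Hnet i a Hi). assert (H4 := Kx_sum n beta delta q bl c1 c2 Hnet i (a + b) Hi).
  fold ks pr pbar C3 in H3, H4. fold (EL a) in H3. fold (EL (a + b)) in H4.
  change (fun x => Expect ks pr (fun w => card n (Kx n w i x) ^ a)) with (K a) in H3.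
  change (fun x => Expect ks pr (fun w => card n (Kx n w i x) ^ (a + b))) with (K (a + b)%nat) in H4.
  change (nsum n i (fun x => K (a + b)%nat x)) with (nsum n i (K (a + b)%nat)).
  apply (Rmult_le_compat_l (M ^ b)) in H3; [|apply pow_le; lra].
  apply (Rmult_le_compat_l tau) in H4; [|lra].
  lra.
Qed.

(** [GG] with leaks ignored; by [GT_lower] it is comparable to [GG]. *)
Definition HH (k : nat) : R := lsum (blists n) (fun t => wt n k p i t * EN n beta delta q (fun w => ind (hT n w i (Tof n t i)))).

Lemma HH_es r : HH (S r) = Expect ks pr (fun w => es n r (wS i p (Lrn n w i))).
Proof.
  unfold HH, EN.
  rewrite (lsum_ext (blists n) _ (fun t => Expect ks pr (fun w => wt n (S r) p i t * ind (hT n w i (Tof n t i)))))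
    by (intros; now rewrite Expect_scal).
  rewrite <- Expect_lsum. apply Expect_ext. intros w _. rewrite <- es_subset by assumption. reflexivity.
Qed.

(** Since every idea is discovered with probability at least [1/2], the number of technologies
    within reach controls the power of the number of ideas learned, by the bound on symmetric
    polynomials. *)
Lemma HH_moment r C : (forall n a, (forall j, (j < n)%nat -> 0 <= a j <= 1) -> sumR n a ^ r <= C * (1 + es n r a)) ->
  EL r <= 2 ^ r * C * (1 + HH (S r)).
Proof.
  intros HC. rewrite HH_es. rewrite <- (Expect_const ks pr 1), <- Expect_plus, <- Expect_scal.
  apply Expect_le; [apply Hok|]. intros w _.
  assert (Hp' : forall j, (j < n)%nat -> 0 <= p j <= 1) by (intros j Hj; specialize (Hp j Hj); lra).
  assert (K := HC n (wS i p (Lrn n w i)) (wS_nonneg i p n _ Hp')).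
  rewrite Rmult_assoc. eapply Rle_trans; [|apply Rmult_le_compat_l; [apply pow_le; lra|apply K]].
  rewrite <- Rpow_mult_distr. apply pow_incr. split; [apply card_nonneg|].
  rewrite <- sumR_scal. apply sumR_le. intros j Hj. unfold wS, noi. specialize (Hp j Hj).
  destruct (Nat.eq_dec j i) as [->|].
  - rewrite ind_false; [lra|]. unfold Lrn; tauto.
  - assert (I := ind_pos (Lrn n w i j)). nra.
Qed.

Lemma EL_mean r : (0 < r)%nat -> Expect ks pr (fun w => card n (Bk n w i)) - 2 <= EL r.
Proof.
  intros Hr. rewrite <- (Expect_const ks pr 2), <- Expect_minus. apply Expect_le; [apply Hok|]. intros w Hw.
  assert (card n (Bk n w i) <= 1 + card n (Lrn n w i)).
  { rewrite <- (card_single n i Hi). eapply Rle_trans; [|apply card_union_le]. apply card_le.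
    intros v _ Hv. inversion Hv as [v' Hv' E|u v' Hu [Hv1 Hv2] Huv E]; subst; [now left|right].
    split; [assumption|]. split; [assumption|]. exists u. split; [assumption|apply Huv]. }
  assert (C0 := card_nonneg n (Lrn n w i)). set (L := card n (Lrn n w i)) in *.
  assert (0 <= L ^ r) by now apply pow_le.
  destruct (Rle_dec L 1); [lra|]. assert (L ^ 1 <= L ^ r) by (apply Rle_pow; [lra|lia]). rewrite pow_1 in H1. lra.
Qed.

Lemma GG_HH k : exp (- (2 * (c2 * c2))) * HH k <= GG n k beta delta p q i.
Proof.
  unfold HH, GG. rewrite <- lsum_scal. apply lsum_le. intros t _.
  assert (W : 0 <= wt n k p i t) by (apply wt_nonneg; intros j Hj; specialize (Hp j Hj); lra).
  assert (K := GT_lower n beta delta q bl c1 c2 Hnet i (Tof n t i) Hi (Tof_ok n t i)).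
  apply (Rmult_le_compat_l (wt n k p i t)) in K; [|assumption]. lra.
Qed.

End Moments.

(** The top moment of the number of ideas learned is at most a constant times [1 + HH], and the mean
    cluster size makes [HH] large. The mixed moments that bound the summed [PP] consist of lower
    moments and a small multiple of the top one, so they are a small fraction of [HH], hence of
    [GG]. *)
Lemma near_critical (k : nat) delta bl c1 c2 tau K0 : (2 <= k)%nat ->
  0 < delta <= 1 -> 0 < bl < 1 -> 0 < c1 <= c2 -> 0 < tau ->
  exists eps N, 0 < eps /\ forall n beta q, (N <= n)%nat -> net_ok n beta delta q bl c1 c2 ->
  1 - eps <= lam0 n beta delta q <= 1 + eps ->
  forall i p, (i < n)%nat -> (forall j, (j < n)%nat -> 1/2 <= p j <= 1) ->
  lsum (blists n) (fun t => wt n k p i t * PP n beta delta q i (Tof n t i)) <= tau * GG n k beta delta p q i /\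
  K0 <= GG n k beta delta p q i.
Proof.
  intros Hk Hd Hbl Hc Ht. assert (HcC := consts_ok _ _ _ _ Hd Hbl Hc).
  destruct k as [|[|r0]]; try lia. set (r := S r0).
  destruct (es_lower r) as [Cr [HCr Hes]].
  set (C5 := 2 ^ r * Cr). assert (HC5 : 0 < C5) by (apply Rmult_lt_0_compat; [apply pow_lt; lra|assumption]).
  set (C3 := c2 * c2 / (bl * (c1 * c1)) * exp (2 * (c2 * c2))).
  assert (C2p : 0 < c2 * c2) by nra.
  assert (HC3 : 0 < C3).
  { apply Rmult_lt_0_compat; [|apply exp_pos]. apply Rdiv_lt_0_compat; [assumption|]. apply Rmult_lt_0_compat; nra. }
  set (C4 := C3 + c2 * c2).
  set (C6 := (INR r0 + 1) * 2 ^ r0 * (2 * C4)).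
  assert (P2 : 0 < 2 ^ r0) by (apply pow_lt; lra). assert (Pr := pos_INR r0).
  assert (HC6 : 0 < C6) by (unfold C6, C4; apply Rmult_lt_0_compat; nra).
  set (ec := exp (- (2 * (c2 * c2)))). assert (Hec : 0 < ec) by apply exp_pos.
  set (tau' := tau * ec). assert (Ht' : 0 < tau') by (unfold tau'; nra).
  set (tau1 := tau' / (8 * C6 * C5)). assert (Ht1 : 0 < tau1) by (apply Rdiv_lt_0_compat; nra).
  destruct (Lrn_tail delta bl c1 c2 tau1 Hd Hbl Hc Ht1) as [M0 [e1 [N1 [HM0 [He1 HT1]]]]].
  set (M := M0 + 1). assert (HM : 1 <= M) by (unfold M; lra).
  assert (HMr : 1 <= M ^ r) by (apply pow_R1_Rle; assumption).
  set (M2 := 1 + 8 * C6 * C5 * M ^ r / tau').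
  assert (HM2a : 0 < 8 * C6 * C5 * M ^ r / tau') by (apply Rdiv_lt_0_compat; [|lra]; apply Rmult_lt_0_compat; nra).
  assert (HM2 : 1 <= M2) by (unfold M2; lra).
  (* The size of [HH] beyond which the constant terms of the moment bounds, and the prescribed [K0],
     are absorbed. *)
  set (H0 := 1 + (4 * C6 * (M ^ r * M2 ^ r) / tau' + Rabs K0 / ec)).
  destruct (large_mean (delta * bl * c1) c2 (2 + C5 * (1 + H0)) HcC) as [e2 [N2 [He2 HT2]]].
  { assert (0 < M2 ^ r) by (apply pow_lt; lra).
    assert (0 <= Rabs K0 / ec) by (apply Rmult_le_pos; [apply Rabs_pos|left; now apply Rinv_0_lt_compat]).
    unfold H0. nra. }
  exists (Rmin e1 e2), (N1 + N2)%nat. split; [now apply Rmin_glb_lt|].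
  intros n beta q HN Hnet [Hl1 Hl2] i p Hi Hp.
  assert (L1 : lam0 n beta delta q <= 1 + e1) by (eapply Rle_trans; [apply Hl2|]; apply Rplus_le_compat_l, Rmin_l).
  assert (L2 : 1 - e2 <= lam0 n beta delta q) by (assert (X := Rmin_r e1 e2); lra).
  assert (Hp' : forall j, (j < n)%nat -> 0 <= p j <= 1) by (intros j Hj; specialize (Hp j Hj); lra).
  set (H := HH n beta delta q i p (S r)).
  set (EL := fun s : nat => Expect (keys n) (prob beta delta (fun _ => 0) q) (fun w => card n (Lrn n w i) ^ s)).
  assert (EH : EL r <= C5 * (1 + H)) by apply (HH_moment n beta delta q bl c1 c2 Hnet i p Hi Hp r Cr Hes).
  assert (HHbig : H0 <= H).
  { assert (Bo := bwd_ok _ _ _ _ _ _ _ Hnet).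
    assert (BT := HT2 _ _ _ _ _ _ _ Bo ltac:(lia)). cbv beta in BT. rewrite bwd_lam in BT. specialize (BT L2 i Hi).
    assert (EM := EL_mean n beta delta q bl c1 c2 Hnet i Hi r ltac:(unfold r; lia)). change (Expect (keys n) (prob beta delta (fun _ => 0) q) (fun w => card n (Bk n w i)) - 2 <= EL r) in EM.
    change (2 + C5 * (1 + H0) <= Expect (keys n) (prob beta delta (fun _ => 0) q) (fun w => card n (Bk n w i))) in BT.
    apply (Rmult_le_reg_l C5); lra. }
  assert (GH := GG_HH n beta delta q bl c1 c2 Hnet i p Hi Hp (S r)). fold H ec in GH.
  assert (M2r : 0 < M2 ^ r) by (apply pow_lt; lra).
  assert (Q1 : 0 <= 4 * C6 * (M ^ r * M2 ^ r) / tau') by (left; apply Rdiv_lt_0_compat; [apply Rmult_lt_0_compat; nra|lra]).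
  assert (Q2 : 0 <= Rabs K0 / ec) by (apply Rmult_le_pos; [apply Rabs_pos|left; now apply Rinv_0_lt_compat]).
  assert (H1 : 1 <= H) by (unfold H0 in HHbig; lra).
  split.
  2: { eapply Rle_trans; [|apply GH]. apply Rle_trans with (Rabs K0); [apply Rle_abs|].
       apply Rle_trans with (ec * (Rabs K0 / ec)); [right; field; lra|]. apply Rmult_le_compat_l; [lra|]. unfold H0 in HHbig. lra. }
  apply Rle_trans with (tau' * H).
  2: { unfold tau'. rewrite Rmult_assoc. apply Rmult_le_compat_l; lra. }
  unfold r in *. destruct r0 as [|r1].
  { eapply Rle_trans; [apply (PP_singleton n beta delta q bl c1 c2 Hnet i p Hi Hp')|]. nra. }
  eapply Rle_trans; [apply (PP_mixed n beta delta q bl c1 c2 Hnet i p r1 Hi Hp')|].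
  set (ks := keys n). set (pr := prob beta delta (fun _ => 0) q).
  assert (Htail : forall x, (x < n)%nat -> Expect ks pr (fun w => ind (M - 1 < card n (Lrn n w x))) <= tau1).
  { intros x Hx. replace (M - 1) with M0 by (unfold M; ring). apply (HT1 n beta q ltac:(lia) Hnet L1 x Hx). }
  set (Fm := fun a b => nsum n i (fun x => Expect ks pr (fun w => ind (w (Dir i x) = true) * (card n (Kx n w i x) ^ a * card n (Qx n w i x) ^ b)))).
  assert (FB : forall a b, (0 < a)%nat -> (0 < b)%nat -> (a + b = S (S r1))%nat ->
     Fm a b <= C4 * (M ^ S (S r1) * M2 ^ S (S r1) + (M ^ S (S r1) / M2 + tau1) * EL (S (S r1)))).
  { intros a b Ha Hb Hab.
    eapply Rle_trans; [apply (mixed_moment n beta delta q bl c1 c2 Hnet i Hi a b M tau1 Ha Hb HM Htail)|].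
    rewrite Hab. change (c2 * c2 * M ^ a * EL b + C3 * M ^ b * EL a + (C3 + c2 * c2) * tau1 * EL (S (S r1)) <= C4 * (M ^ S (S r1) * M2 ^ S (S r1) + (M ^ S (S r1) / M2 + tau1) * EL (S (S r1)))).
    assert (La := EL_lower_order n beta delta q bl c1 c2 Hnet i Hi a (S (S r1)) M2 ltac:(lia) HM2).
    assert (Lb := EL_lower_order n beta delta q bl c1 c2 Hnet i Hi b (S (S r1)) M2 ltac:(lia) HM2).
    change (EL a <= M2 ^ S (S r1) + EL (S (S r1)) / M2) in La.
    change (EL b <= M2 ^ S (S r1) + EL (S (S r1)) / M2) in Lb.
    set (Y := M2 ^ S (S r1) + EL (S (S r1)) / M2) in *.
    assert (Ea : 0 <= EL a) by apply (EL_nonneg n beta delta q bl c1 c2 Hnet i a).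
    assert (Eb : 0 <= EL b) by apply (EL_nonneg n beta delta q bl c1 c2 Hnet i b).
    assert (Ma : 0 <= M ^ a <= M ^ S (S r1)) by (split; [apply pow_le; lra|apply Rle_pow; [assumption|lia]]).
    assert (Mb : 0 <= M ^ b <= M ^ S (S r1)) by (split; [apply pow_le; lra|apply Rle_pow; [assumption|lia]]).
    set (MM := M ^ S (S r1)) in *.
    assert (T1 : c2 * c2 * (M ^ a * EL b) <= c2 * c2 * (MM * Y)) by (apply Rmult_le_compat_l; [lra|apply Rmult_le_compat; lra]).
    assert (T2 : C3 * (M ^ b * EL a) <= C3 * (MM * Y)) by (apply Rmult_le_compat_l; [lra|apply Rmult_le_compat; lra]).
    replace (C4 * (MM * M2 ^ S (S r1) + (MM / M2 + tau1) * EL (S (S r1))))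
      with (C3 * (MM * Y) + c2 * c2 * (MM * Y) + (C3 + c2 * c2) * tau1 * EL (S (S r1))) by (unfold C4, Y; field; lra).
    lra. }
  assert (F1 := FB (S r1) 1%nat ltac:(lia) ltac:(lia) ltac:(lia)).
  assert (F2 := FB 1%nat (S r1) ltac:(lia) ltac:(lia) ltac:(lia)).
  set (BB := C4 * (M ^ S (S r1) * M2 ^ S (S r1) + (M ^ S (S r1) / M2 + tau1) * EL (S (S r1)))) in *.
  assert (Hsum : nsum n i (fun x => Expect ks pr (fun w => ind (w (Dir i x) = true) *
     (card n (Kx n w i x) * card n (Qx n w i x) * (card n (Kx n w i x) + card n (Qx n w i x)) ^ r1))) <= 2 ^ r1 * (Fm (S r1) 1%nat + Fm 1%nat (S r1))).
  { unfold Fm. rewrite <- nsum_plus, <- nsum_scal. apply nsum_le. intros x Hx Hxi.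
    rewrite <- Expect_plus, <- Expect_scal. apply Expect_le; [apply (net_okp _ _ _ _ _ _ _ Hnet)|]. intros w _.
    rewrite <- Rmult_plus_distr_l.
    match goal with |- ?a * ?b <= ?c * (?a * ?d) => replace (c * (a * d)) with (a * (c * d)) by ring end.
    apply Rmult_le_compat_l; [apply ind_pos|].
    assert (u0 := card_nonneg n (Kx n w i x)). assert (v0 := card_nonneg n (Qx n w i x)).
    set (u := card n (Kx n w i x)) in *. set (v := card n (Qx n w i x)) in *.
    rewrite !pow_1. simpl pow.
    assert (ur : 0 <= u ^ r1) by now apply pow_le. assert (vr : 0 <= v ^ r1) by now apply pow_le.
    assert (uv : 0 <= u * v) by nra. assert (P2r : 0 < 2 ^ r1) by (apply pow_lt; lra).
    assert (Hs : (u + v) ^ r1 <= 2 ^ r1 * (u ^ r1 + v ^ r1)).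
    { destruct (Rle_dec u v).
      - apply Rle_trans with ((2 * v) ^ r1); [apply pow_incr; lra|]. rewrite Rpow_mult_distr. apply Rmult_le_compat_l; lra.
      - apply Rle_trans with ((2 * u) ^ r1); [apply pow_incr; lra|]. rewrite Rpow_mult_distr. apply Rmult_le_compat_l; lra. }
    apply (Rmult_le_compat_l (u * v)) in Hs; [|assumption].
    eapply Rle_trans; [apply Hs|]. right. ring. }
  assert (EL0 : 0 <= EL (S (S r1))) by apply (EL_nonneg n beta delta q bl c1 c2 Hnet i (S (S r1))).
  apply Rle_trans with (C6 * (M ^ S (S r1) * M2 ^ S (S r1) + (M ^ S (S r1) / M2 + tau1) * EL (S (S r1)))).
  - apply Rle_trans with ((INR r1 + 2) * (2 ^ r1 * (2 * BB))).
    + apply Rmult_le_compat_l; [assert (X := pos_INR r1); lra|]. eapply Rle_trans; [apply Hsum|].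
      apply Rmult_le_compat_l; [apply pow_le; lra|]. lra.
    + assert (X0 : 0 <= M ^ S (S r1) * M2 ^ S (S r1) + (M ^ S (S r1) / M2 + tau1) * EL (S (S r1))).
      { assert (0 <= M ^ S (S r1) / M2) by (apply Rmult_le_pos; [lra|left; apply Rinv_0_lt_compat; lra]).
        assert (0 <= M ^ S (S r1) * M2 ^ S (S r1)) by nra. assert (0 <= (M ^ S (S r1) / M2 + tau1) * EL (S (S r1))) by (apply Rmult_le_pos; lra). lra. }
      set (XX := M ^ S (S r1) * M2 ^ S (S r1) + (M ^ S (S r1) / M2 + tau1) * EL (S (S r1))) in *.
      unfold BB, C6. rewrite S_INR. change (2 ^ S r1) with (2 * 2 ^ r1).
      assert (0 < 2 ^ r1) by (apply pow_lt; lra). assert (0 <= C4 * XX) by (unfold C4; nra).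
      assert (X := pos_INR r1).
      assert (0 <= (INR r1 + 2) * (2 ^ r1 * (2 * (C4 * XX)))) by (apply Rmult_le_pos; [lra|]; apply Rmult_le_pos; lra).
      nra.
  - set (MM := M ^ S (S r1)) in *. set (MM2 := M2 ^ S (S r1)) in *.
    assert (A1 : C6 * (MM * MM2) <= tau' / 4 * H).
    { apply Rle_trans with (tau' / 4 * (4 * C6 * (MM * MM2) / tau')); [right; field; lra|].
      apply Rmult_le_compat_l; [lra|]. unfold H0 in HHbig. lra. }
    assert (A2 : EL (S (S r1)) <= C5 * (2 * H)) by (eapply Rle_trans; [apply EH|]; apply Rmult_le_compat_l; lra).
    assert (A3 : MM / M2 <= tau' / (8 * C6 * C5)).
    { apply (Rmult_le_reg_r M2); [lra|]. replace (MM / M2 * M2) with MM by (field; lra).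
      apply Rle_trans with (tau' / (8 * C6 * C5) * (8 * C6 * C5 * MM / tau')); [right; field; lra|].
      apply Rmult_le_compat_l; [fold tau1; lra|]. unfold M2. lra. }
    assert (A4 : (MM / M2 + tau1) * EL (S (S r1)) <= (2 * tau1) * (C5 * (2 * H))).
    { apply Rmult_le_compat; [|assumption| |assumption].
      - assert (0 <= MM / M2) by (apply Rmult_le_pos; [lra|left; apply Rinv_0_lt_compat; lra]). lra.
      - fold tau1 in A3. lra. }
    apply (Rmult_le_compat_l C6) in A4; [|lra].
    replace (C6 * (2 * tau1 * (C5 * (2 * H)))) with (tau' / 2 * H) in A4 by (unfold tau1; field; lra).
    rewrite Rmult_plus_distr_l. nra.
Qed.

(** * The spectral radius of the criticality matrix *)

(** The matrix has rank one, with column vector [delta * beta * q] and row vector [q]; applying [q]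
    to the eigenvalue equation yields a two-dimensional real system for the real and imaginary
    parts. *)
Lemma lambda_lam0 n beta delta q : (0 < n)%nat -> 0 < delta ->
  (forall j, (j < n)%nat -> 0 < beta j /\ 0 < q j) -> lambda n beta delta q = lam0 n beta delta q.
Proof.
  intros Hn Hd Hq. set (L := lam0 n beta delta q).
  assert (L0 : 0 <= L).
  { apply Rmult_le_pos; [lra|]. apply sumR_nonneg. intros j Hj. destruct (Hq j Hj). apply Rmult_le_pos; [lra|nra]. }
  assert (Hsum : forall (x : nat -> R) i, sumR n (fun j => crit_matrix beta delta q i j * x j) = delta * (beta i * q i) * sumR n (fun j => q j * x j)).
  { intros x i. rewrite <- sumR_scal. apply sumR_ext. intros j _. unfold crit_matrix, iota. ring. }
  assert (HS : forall s : R, sumR n (fun i => q i * (delta * (beta i * q i) * s)) = L * s).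
  { intros s. unfold L, lam0. rewrite <- sumR_scal, Rmult_comm, <- sumR_scal. apply sumR_ext. intros j _. ring. }
  assert (Hlub : is_lub (fun m => exists a b, eigenvalue n (crit_matrix beta delta q) a b /\ m = sqrt (a * a + b * b)) L).
  { split.
    - intros m [a [b [[xr [xi [[j [Hj Hne]] E]]] ->]]].
      set (Sr := sumR n (fun j => q j * xr j)). set (Si := sumR n (fun j => q j * xi j)).
      assert (E1 : L * Sr = a * Sr + (- b) * Si).
      { rewrite <- HS. unfold Sr at 2, Si. rewrite <- !sumR_scal, <- sumR_plus. apply sumR_ext. intros i Hi.
        destruct (E i Hi) as [E1 _]. rewrite Hsum in E1. fold Sr in E1. rewrite E1. ring. }
      assert (E2 : L * Si = b * Sr + a * Si).
      { rewrite <- HS. unfold Sr, Si at 2. rewrite <- !sumR_scal, <- sumR_plus. apply sumR_ext. intros i Hi.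
        destruct (E i Hi) as [_ E2]. rewrite Hsum in E2. fold Si in E2. rewrite E2. ring. }
      (* Either the functional [q] kills the eigenvector and the eigenvalue is zero, or the
         eigenvalue is [L] itself. *)
      destruct (Req_dec (Sr * Sr + Si * Si) 0) as [Z|Z].
      + assert (Sr = 0) by nra. assert (Si = 0) by nra. destruct (E j Hj) as [F1 F2]. rewrite Hsum in F1, F2.
        fold Sr in F1. fold Si in F2. rewrite H in F1. rewrite H0 in F2. rewrite Rmult_0_r in F1, F2.
        assert (K : (a * a + b * b) * (xr j * xr j + xi j * xi j) = 0) by nra.
        apply Rmult_integral in K. destruct K as [K|K]; [rewrite K, sqrt_0; assumption|].
        exfalso. destruct Hne; nra.
      + assert (K : ((a - L) * (a - L) + b * b) * (Sr * Sr + Si * Si) = 0) by nra.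
        apply Rmult_integral in K. destruct K as [K|K]; [|contradiction].
        assert (a = L) by nra. assert (b = 0) by nra. subst a b. rewrite Rmult_0_l, Rplus_0_r, sqrt_square; lra.
    - intros b Hb. apply Hb. exists L, 0. split; [|rewrite Rmult_0_l, Rplus_0_r, sqrt_square; lra].
      exists (fun i => beta i * q i), (fun _ => 0). split.
      + exists 0%nat. split; [assumption|]. left. destruct (Hq 0%nat Hn). nra.
      + intros i Hi. rewrite !Hsum. split.
        * rewrite (sumR_ext n (fun j => q j * (beta j * q j)) (fun j => beta j * (q j * q j))) by (intros; ring).
          unfold L, lam0. ring.
        * rewrite (sumR_ext n (fun j => q j * 0) (fun j => 0)) by (intros; ring). rewrite sumR_const. ring. }
  apply (is_lub_u _ _ _ (epsilon_spec (inhabits 0) (fun r => is_lub (fun m => exists a b, eigenvalue n (crit_matrix beta delta q) a b /\ m = sqrt (a * a + b * b)) r) (ex_intro _ L Hlub)) Hlub).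
Qed.

(** * First-order conditions *)

Definition WS (n k : nat) (p : nat -> R) (i : nat) (F : (nat -> Prop) -> R) : R :=
  lsum (blists n) (fun t => wt n k p i t * F (Tof n t i)).

(** Only technologies of [k] ideas carry weight, so the comparison is needed just for nonempty sets
    of size [k - 1]. *)
Lemma WS_le n k p i F G : (2 <= k)%nat -> (i < n)%nat -> (forall j, (j < n)%nat -> 0 <= p j) ->
  (forall T : nat -> Prop, (forall t, T t -> (t < n)%nat /\ t <> i) -> (exists t, T t) -> card n T = INR k - 1 -> F T <= G T) ->
  WS n k p i F <= WS n k p i G.
Proof.
  intros Hk Hi Hp H. apply lsum_le. intros t Ht. apply blists_length in Ht.
  destruct (classic (tech_of k i t)) as [E|E].
  - apply Rmult_le_compat_l; [now apply wt_nonneg|].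
    assert (C := card_Tof n k t i Hi Ht E). apply H; [apply Tof_ok| |assumption].
    apply NNPP. intros Hn. apply le_INR in Hk. change (INR 2) with (1 + 1) in Hk.
    unfold card in C. rewrite sumR_zero in C; [lra|]. intros j _. apply ind_false. intros HT. apply Hn. now exists j.
  - unfold wt. rewrite ind_false by assumption. lra.
Qed.

Lemma WS_plus n k p i F G : WS n k p i (fun T => F T + G T) = WS n k p i F + WS n k p i G.
Proof. unfold WS. rewrite <- lsum_plus. apply lsum_ext. intros. ring. Qed.

Lemma WS_scal n k p i a F : WS n k p i (fun T => a * F T) = a * WS n k p i F.
Proof. unfold WS. rewrite <- lsum_scal. apply lsum_ext. intros. ring. Qed.

Lemma upd_id (q : nat -> R) i : upd q i (q i) = q.
Proof. apply functional_extensionality. intros j. unfold upd. destruct (Nat.eq_dec j i); congruence. Qed.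

Definition SX n k beta delta p q i := WS n k p i (X1 n beta delta q i).
Definition SY n k beta delta p q i := WS n k p i (Y1 n beta delta q i).

Lemma FF_balance n k beta delta p q i y :
  y * FF n beta delta q i k p y = SX n k beta delta p (upd q i y) i - SY n k beta delta p (upd q i y) i.
Proof.
  unfold FF, SX, SY, WS. rewrite <- lsum_scal.
  replace (lsum (blists n) (fun t => wt n k p i t * X1 n beta delta (upd q i y) i (Tof n t i)) - lsum (blists n) (fun t => wt n k p i t * Y1 n beta delta (upd q i y) i (Tof n t i)))
    with (lsum (blists n) (fun t => wt n k p i t * X1 n beta delta (upd q i y) i (Tof n t i)) + (-1) * lsum (blists n) (fun t => wt n k p i t * Y1 n beta delta (upd q i y) i (Tof n t i))) by ring.
  rewrite <- lsum_scal, <- lsum_plus. apply lsum_ext. intros t _.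
  transitivity (wt n k p i t * (y * D1 n beta delta q i (fT n i (Tof n t i)) y)); [ring|]. rewrite D1_XY. ring.
Qed.

(** Up to a self term, [zz] of firm [i] is [delta * q i * Bq]. Hence [lam0] is, up to the self
    terms, the average of all [zz] with weights [beta * q], and bounds for every firm carry over to
    it. *)
Definition Bq (n : nat) (beta q : nat -> R) : R := sumR n (fun j => beta j * q j).

Section Aggregate.

Variables (n k : nat) (beta : nat -> R) (delta : R) (p q : nat -> R) (i : nat).
Hypothesis Hact : act_ok n beta delta q.
Hypothesis Hk : (2 <= k)%nat.
Hypothesis Hi : (i < n)%nat.
Hypothesis Hp : forall j, (j < n)%nat -> 0 <= p j.

Let G := GG n k beta delta p q i.
Let ks := keys n.
Let pr := prob beta delta (fun _ => 0) q.

Lemma SX_upper_k : SX n k beta delta p q i <= (INR k - 1) * G.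
Proof.
  unfold G. change (GG n k beta delta p q i) with (WS n k p i (GT n beta delta q i)). rewrite <- WS_scal.
  apply WS_le; auto. intros T HT _ HC. rewrite <- HC. now apply X1_upper_card.
Qed.

Lemma SX_upper_PP : SX n k beta delta p q i <= G + WS n k p i (PP n beta delta q i).
Proof.
  unfold G. change (GG n k beta delta p q i) with (WS n k p i (GT n beta delta q i)). rewrite <- WS_plus.
  apply WS_le; auto. intros T HT _ HC. now apply X1_upper_PP.
Qed.

Lemma SY_lower : zz n beta delta q i * G <= SY n k beta delta p q i.
Proof.
  unfold G. change (GG n k beta delta p q i) with (WS n k p i (GT n beta delta q i)). rewrite <- WS_scal.
  apply WS_le; auto. intros T HT _ HC. now apply Y1_lower.
Qed.

Lemma SX_lower : (1 - nsum n i (px beta q i)) * G <= SX n k beta delta p q i.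
Proof.
  unfold G. change (GG n k beta delta p q i) with (WS n k p i (GT n beta delta q i)). rewrite <- WS_scal.
  apply WS_le; auto. intros T HT Hne HC.
  eapply Rle_trans; [|apply (X1_lower n beta delta q i T Hact Hi HT Hne)].
  replace ((1 - nsum n i (px beta q i)) * GT n beta delta q i T)
    with (GT n beta delta q i T - GT n beta delta q i T * nsum n i (px beta q i)) by ring.
  apply Rplus_le_compat_l, Ropp_le_contravar. rewrite <- nsum_scal. apply nsum_le. intros x Hx Hxi.
  rewrite Rmult_comm. apply Rmult_le_compat_r; [now apply px_nonneg with (n := n) (delta := delta)|].
  apply Expect_le; [now apply act_okp|]. intros w _. assert (I := ind_range (touch n w i T x)).
  assert (J := ind_pos (hT n w i T /\ sec n w i T)). unfold fT. nra.
Qed.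

Lemma SY_upper s : s < 1 -> (forall j, (j < n)%nat -> j <> i -> py beta q i j <= s) -> nsum n i (py beta q i) <= s ->
  SY n k beta delta p q i <= s / (1 - s) * G.
Proof.
  intros Hs Hj Hsum. unfold G. change (GG n k beta delta p q i) with (WS n k p i (GT n beta delta q i)). rewrite <- WS_scal.
  apply WS_le; auto. intros T HT _ _. assert (Hok := act_okp _ _ _ _ Hact).
  apply Rle_trans with (GT n beta delta q i T / (1 - s) * nsum n i (py beta q i)).
  - rewrite <- nsum_scal. apply nsum_le. intros j Hjn Hji. rewrite Rmult_comm.
    apply Rmult_le_compat_r; [now apply py_nonneg with (n := n) (delta := delta)|].
    assert (F0 : forall w, 0 <= fT n i T w) by (intros; apply ind_pos).
    assert (E1 : 0 <= Expect (keys n) (prob beta delta (fun _ => 0) q) (fun w => fT n i T (setv w (Dir j i) true))) by (apply Expect_nonneg; auto).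
    assert (E0 : 0 <= Expect (keys n) (prob beta delta (fun _ => 0) q) (fun w => fT n i T (setv w (Dir j i) false))) by (apply Expect_nonneg; auto).
    assert (K := Expect_off_le _ _ (fT n i T) (Dir j i) Hok (NoDup_keys n) ltac:(apply in_keys_Dir; auto) (fun w _ => F0 w)).
    change (prob beta delta (fun _ => 0) q (Dir j i)) with (py beta q i j) in K.
    specialize (Hj j Hjn Hji). apply (Rmult_le_reg_l (1 - s)); [lra|].
    replace ((1 - s) * (GT n beta delta q i T / (1 - s))) with (GT n beta delta q i T) by (field; lra).
    change (GT n beta delta q i T) with (Expect (keys n) (prob beta delta (fun _ => 0) q) (fT n i T)). nra.
  - assert (G0 := G_nonneg n beta delta q i T Hact).
    replace (s / (1 - s) * GT n beta delta q i T) with (GT n beta delta q i T / (1 - s) * s) by lra.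
    apply Rmult_le_compat_l; [|assumption]. apply Rmult_le_pos; [assumption|left; apply Rinv_0_lt_compat; lra].
Qed.

Lemma nsum_py : nsum n i (py beta q i) = q i * (Bq n beta q - beta i * q i).
Proof.
  unfold Bq. rewrite <- (sumR_single n i (beta i * q i) Hi).
  replace (sumR n (fun j => beta j * q j) - sumR n (fun j => if Nat.eq_dec j i then beta i * q i else 0))
    with (sumR n (fun j => beta j * q j) + (-1) * sumR n (fun j => if Nat.eq_dec j i then beta i * q i else 0)) by ring.
  rewrite <- sumR_scal, <- sumR_plus, <- sumR_scal. apply sumR_ext. intros j Hj. unfold py.
  destruct (Nat.eq_dec j i); [subst|]; ring.
Qed.

Lemma bq_le : beta i * q i <= Bq n beta q.
Proof.
  apply (sumR_ge_term n (fun j => beta j * q j)); [|assumption]. intros j Hj. destruct Hact as [_ H]. destruct (H j Hj). nra.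
Qed.

(** If [q i * Bq] were small, both kinds of links at [i] would be rare: then nearly every success
    hangs on one link and leaks hardly occur, so [SX] is at least [3/4] and [SY] at most [1/3] of
    [GG]. *)
Lemma openness_low bl : 0 < bl -> (forall j, (j < n)%nat -> bl <= beta j) -> 0 < G ->
  SX n k beta delta p q i <= SY n k beta delta p q i -> bl / 4 < q i * Bq n beta q.
Proof.
  intros Hbl Hbeta HG HXY. apply Rnot_le_lt. intros Hle.
  destruct Hact as [Hd Hq]. destruct (Hq i Hi) as [Hbi Hqi]. assert (BL := Hbeta i Hi).
  assert (S1 : nsum n i (py beta q i) <= 1/4) by (rewrite nsum_py; nra).
  assert (S2 : nsum n i (px beta q i) <= 1/4).
  { apply Rle_trans with (sumR n (px beta q i)).
    - apply nsum_le_sumR; intros x Hx; [now apply px_nonneg with (n := n) (delta := delta)|lra].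
    - apply Rle_trans with (q i / bl * Bq n beta q).
      + unfold Bq. rewrite <- sumR_scal. apply sumR_le. intros x Hx.
        destruct (Hq x Hx) as [Hbx Hqx]. specialize (Hbeta x Hx).
        replace (q i / bl * (beta x * q x)) with ((beta x / bl) * (q i * q x)) by lra.
        apply Rmult_le_compat_r; [nra|]. apply Rle_trans with 1; [lra|].
        apply (Rmult_le_reg_r bl); [lra|]. unfold Rdiv. rewrite Rmult_assoc, Rinv_l; lra.
      + apply (Rmult_le_reg_l bl); [lra|]. replace (bl * (q i / bl * Bq n beta q)) with (q i * Bq n beta q) by (field; lra). lra. }
  assert (HX := SX_lower).
  assert (HY : SY n k beta delta p q i <= (1/4) / (1 - 1/4) * G).
  { apply SY_upper; [lra| |assumption]. intros j Hj Hji. eapply Rle_trans; [|apply S1].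
    assert (N := sumR_ge_term n (fun x => if Nat.eq_dec x i then 0 else py beta q i x) j).
    cbv beta in N. destruct (Nat.eq_dec j i); [contradiction|]. apply N; [|assumption].
    intros x Hx. destruct (Nat.eq_dec x i); [lra|]. now apply py_nonneg with (n := n) (delta := delta). }
  assert ((3/4) * G <= (1 - nsum n i (px beta q i)) * G) by nra. lra.
Qed.

(** At most [k - 1] links can be pivotal, whereas leaks grow with [zz]. *)
Lemma openness_high : 0 < G -> SY n k beta delta p q i <= SX n k beta delta p q i -> delta * (q i * Bq n beta q) <= INR k.
Proof.
  intros HG HXY. assert (HY := SY_lower). assert (HX := SX_upper_k).
  assert (Z : zz n beta delta q i <= INR k - 1) by nra.
  unfold zz in Z. rewrite nsum_py in Z. destruct Hact as [Hd Hq]. destruct (Hq i Hi) as [Hbi Hqi].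
  assert (beta i * (q i * q i) <= 1) by nra. nra.
Qed.

End Aggregate.

Lemma WS_GT n k beta delta p q i : GG n k beta delta p q i = WS n k p i (GT n beta delta q i).
Proof. reflexivity. Qed.

Lemma nsum_pbar n beta delta q bl c1 c2 i : net_ok n beta delta q bl c1 c2 -> (i < n)%nat ->
  0 <= nsum n i (py beta q i) <= c2 * c2.
Proof.
  intros Hnet Hi. assert (N := net_n_pos _ _ _ _ _ _ _ Hnet). split.
  - apply nsum_nonneg. intros j Hj _. apply py_nonneg with (n := n) (delta := delta); auto. eapply net_act; eauto.
  - apply Rle_trans with (sumR n (fun _ => c2 * c2 / INR n)).
    + assert (0 <= c2 * c2 / INR n) by (apply Rmult_le_pos; [nra|left; now apply Rinv_0_lt_compat]).
      apply nsum_le_sumR; intros j Hj; [assumption|]. intros _. apply (net_p _ _ _ _ _ _ _ Hnet j i Hj Hi).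
    + rewrite sumR_const. right. field. lra.
Qed.

(** [crowd_rare] bounds redundancy and crowds by [tau] times the probability of [hT]; [GT_lower]
    turns this into a fraction of [GT], and [tau] is chosen to make it [eta / 2]. The regime reaches
    slightly above one, so that it overlaps the supercritical one. *)
Lemma subcritical_expansion (k : nat) delta bl c1 c2 eta : (2 <= k)%nat ->
  0 < delta <= 1 -> 0 < bl < 1 -> 0 < c1 <= c2 -> 0 < eta ->
  exists eps N, 0 < eps /\ forall n beta q, (N <= n)%nat -> net_ok n beta delta q bl c1 c2 ->
  lam0 n beta delta q <= 1 + eps ->
  c2 * c2 / INR n <= eta /\
  forall i p, (i < n)%nat -> (forall j, (j < n)%nat -> 0 <= p j) ->
  (1 - eta) * GG n k beta delta p q i <= SX n k beta delta p q i /\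
  SY n k beta delta p q i <= (zz n beta delta q i + eta) * GG n k beta delta p q i /\
  WS n k p i (fun T => nsum n i (fun j => py beta q i j * Cw n beta delta q i T j)) <= eta * GG n k beta delta p q i.
Proof.
  intros Hk Hd Hbl Hc He. assert (C2 : 0 < c2 * c2) by nra.
  set (E2 := exp (2 * (c2 * c2))). assert (HE2 : 0 < E2) by apply exp_pos.
  set (tau := eta / (2 * (c2 * c2) * E2)). assert (Ht : 0 < tau) by (apply Rdiv_lt_0_compat; [assumption|nra]).
  destruct (crowd_rare k delta bl c1 c2 tau Hd Hbl Hc Ht) as [eps [N1 [Heps HC]]].
  set (e4 := eta / (4 * (1 + c2 * c2))). assert (He4 : 0 < e4) by (apply Rdiv_lt_0_compat; lra).
  destruct (INR_large (c2 * c2 / e4)) as [N2 HN2].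
  exists eps, (N1 + N2)%nat. split; [assumption|]. intros n beta q HN Hnet Hlam.
  assert (Nn := net_n_pos _ _ _ _ _ _ _ Hnet).
  set (pb := c2 * c2 / INR n). assert (Hpb0 : 0 < pb) by (apply Rdiv_lt_0_compat; assumption).
  assert (Hpb : pb <= e4).
  { unfold pb. apply (Rmult_le_reg_r (INR n)); [assumption|]. unfold Rdiv at 1. rewrite Rmult_assoc, Rinv_l, Rmult_1_r by lra.
    specialize (HN2 n ltac:(lia)). apply (Rmult_le_compat_l e4) in HN2; [|lra].
    replace (e4 * (c2 * c2 / e4)) with (c2 * c2) in HN2 by (field; lra). lra. }
  assert (E4 : e4 * (4 * (1 + c2 * c2)) = eta) by (unfold e4; field; lra).
  assert (Hpb2 : pb <= 1 / 2) by apply (uq_pbar n beta delta q bl c1 c2 Hnet).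
  split; [nra|].
  intros i p Hi Hp. assert (Hact := net_act _ _ _ _ _ _ _ Hnet). assert (Hok := act_okp _ _ _ _ Hact).
  assert (Key : forall T : nat -> Prop, (forall t, T t -> (t < n)%nat /\ t <> i) -> card n T = INR k - 1 ->
     pb * sumR n (fun b => EN n beta delta q (fun w => ind (hT n w i T /\ crowd' n w i T b))) <= eta / 2 * GT n beta delta q i T).
  { intros T HT HcT. assert (K := HC n beta q ltac:(lia) Hnet Hlam i T Hi HT ltac:(lra)).
    assert (L := GT_lower n beta delta q bl c1 c2 Hnet i T Hi HT). rewrite exp_Ropp in L. fold E2 in L.
    apply (Rmult_le_compat_l E2) in L; [|lra]. rewrite <- Rmult_assoc, Rinv_r, Rmult_1_l in L by lra.
    apply (Rmult_le_compat_l (tau * INR n)) in L; [|nra].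
    eapply Rle_trans; [apply Rmult_le_compat_l; [lra|]; eapply Rle_trans; [apply K|apply L]|].
    right. unfold pb, tau. field. repeat split; lra. }
  assert (Z := nsum_pbar n beta delta q bl c1 c2 i Hnet Hi).
  assert (CwB : forall T : nat -> Prop, (forall t, T t -> (t < n)%nat /\ t <> i) -> (exists t, T t) -> card n T = INR k - 1 ->
     nsum n i (fun j => py beta q i j * Cw n beta delta q i T j) <= eta / 2 * GT n beta delta q i T).
  { intros T HT Hne HcT. eapply Rle_trans; [|apply (Key T HT HcT)]. rewrite <- sumR_scal.
    assert (E0 : forall b, 0 <= EN n beta delta q (fun w => ind (hT n w i T /\ crowd' n w i T b))) by (intros; apply Expect_ind_range, Hok).
    apply nsum_le_sumR; intros j Hj; [apply Rmult_le_pos; [lra|apply E0]|].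
    intros Hji. apply Rmult_le_compat.
    - now apply py_nonneg with (n := n) (delta := delta).
    - apply Expect_ind_range, Hok.
    - apply (net_p _ _ _ _ _ _ _ Hnet j i Hj Hi).
    - apply Expect_le; [apply Hok|]. intros w _. apply ind_le. intros [? ?]. split; [assumption|now apply crowd_crowd']. }
  rewrite WS_GT, <- !WS_scal.
  split; [|split]; apply WS_le; auto; intros T HT Hne HcT; assert (G0 := G_nonneg n beta delta q i T Hact).
  - eapply Rle_trans; [|apply (X1_lower n beta delta q i T Hact Hi HT Hne)].
    assert (nsum n i (fun x => px beta q i x * Expect (keys n) (prob beta delta (fun _ => 0) q) (fun w => fT n i T w * ind (touch n w i T x))) <= eta / 2 * GT n beta delta q i T); [|nra].
    eapply Rle_trans; [|apply (Key T HT HcT)]. rewrite <- sumR_scal.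
    assert (E0 : forall b, 0 <= EN n beta delta q (fun w => ind (hT n w i T /\ crowd' n w i T b))) by (intros; apply Expect_ind_range, Hok).
    apply nsum_le_sumR; intros x Hx; [apply Rmult_le_pos; [lra|apply E0]|].
    intros Hxi. apply Rmult_le_compat.
    + now apply px_nonneg with (n := n) (delta := delta).
    + apply Expect_nonneg; [apply Hok|]. intros. apply Rmult_le_pos; apply ind_pos.
    + apply (net_p _ _ _ _ _ _ _ Hnet i x Hi Hx).
    + apply Expect_le; [apply Hok|]. intros w _. unfold fT. rewrite <- ind_and. apply ind_le.
      intros [[? _] ?]. split; [assumption|now apply touch_crowd'].
  - eapply Rle_trans; [apply (Y1_upper n beta delta q i T Hact Hi HT pb ltac:(lra))|].
    { intros j Hj _. apply (net_p _ _ _ _ _ _ _ Hnet j i Hj Hi). }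
    assert (CB := CwB T HT Hne HcT). change (nsum n i (fun j => py beta q i j * Expect (keys n) (prob beta delta (fun _ => 0) q) (fun w => ind (hT n w i T /\ crowd n w i T j))))
      with (nsum n i (fun j => py beta q i j * Cw n beta delta q i T j)).
    assert (zz n beta delta q i * GT n beta delta q i T / (1 - pb) <= (zz n beta delta q i + eta / 2) * GT n beta delta q i T); [|lra].
    apply (Rmult_le_reg_r (1 - pb)); [lra|].
    replace (zz n beta delta q i * GT n beta delta q i T / (1 - pb) * (1 - pb)) with (zz n beta delta q i * GT n beta delta q i T) by (field; lra).
    replace ((zz n beta delta q i + eta / 2) * GT n beta delta q i T * (1 - pb)) with ((zz n beta delta q i + eta / 2) * (1 - pb) * GT n beta delta q i T) by ring.
    apply Rmult_le_compat_r; [assumption|].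
    assert (zz n beta delta q i <= c2 * c2) by (unfold zz; nra).
    nra.
  - assert (CB := CwB T HT Hne HcT). nra.
Qed.

Lemma supercritical_expansion (k : nat) delta bl c1 c2 eps eta : (2 <= k)%nat ->
  0 < delta <= 1 -> 0 < bl < 1 -> 0 < c1 <= c2 -> 0 < eps -> 0 < eta ->
  exists N, forall n beta q, (N <= n)%nat -> net_ok n beta delta q bl c1 c2 -> 1 + eps <= lam0 n beta delta q ->
  forall i p, (i < n)%nat -> (forall j, (j < n)%nat -> 0 <= p j) ->
  SX n k beta delta p q i <= (1 + eta) * GG n k beta delta p q i.
Proof.
  intros Hk Hd Hbl Hc He Ht. destruct (PP_super k delta bl c1 c2 eps eta Hd Hbl Hc He Ht) as [N HN].
  exists N. intros n beta q Hn Hnet Hl i p Hi Hp. assert (Hact := net_act _ _ _ _ _ _ _ Hnet).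
  eapply Rle_trans; [apply SX_upper_PP; auto|].
  assert (WS n k p i (PP n beta delta q i) <= eta * GG n k beta delta p q i); [|lra].
  rewrite WS_GT, <- WS_scal. apply WS_le; auto. intros T HT _ HcT. apply HN; auto. lra.
Qed.

Lemma lam0_Bq n beta delta q : lam0 n beta delta q * Bq n beta q = sumR n (fun j => beta j * q j * (delta * (q j * Bq n beta q))).
Proof.
  unfold lam0. rewrite Rmult_assoc, (Rmult_comm (sumR n _)), <- Rmult_assoc, <- sumR_scal.
  apply sumR_ext. intros j _. ring.
Qed.

Lemma zz_Bq n beta delta q i : (i < n)%nat -> zz n beta delta q i = delta * (q i * Bq n beta q) - delta * (beta i * (q i * q i)).
Proof. intros Hi. unfold zz. rewrite nsum_py by assumption. ring. Qed.

Lemma balanced_critical (k : nat) delta bl c1 c2 eps : (2 <= k)%nat ->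
  0 < delta <= 1 -> 0 < bl < 1 -> 0 < c1 <= c2 -> 0 < eps ->
  exists N, forall n beta q p, (N <= n)%nat -> net_ok n beta delta q bl c1 c2 -> (forall j, (j < n)%nat -> 0 <= p j) ->
  (forall i, (i < n)%nat -> 0 < GG n k beta delta p q i /\ SX n k beta delta p q i = SY n k beta delta p q i) ->
  1 - eps <= lam0 n beta delta q <= 1 + eps.
Proof.
  intros Hk Hd Hbl Hc He.
  destruct (subcritical_expansion k delta bl c1 c2 (eps / 2) Hk Hd Hbl Hc ltac:(lra)) as [e1 [N1 [He1 H1]]].
  (* The regimes have to meet: up to [1 + e2] the subcritical expansion is valid, above it the
     supercritical one leads to a contradiction. *)
  set (e2 := Rmin e1 eps). assert (He2 : 0 < e2) by now apply Rmin_glb_lt.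
  destruct (supercritical_expansion k delta bl c1 c2 e2 (e2 / 4) Hk Hd Hbl Hc He2 ltac:(lra)) as [N2 H2].
  destruct (INR_large (4 * (c2 * c2) / e2)) as [N3 H3].
  exists (N1 + N2 + N3)%nat. intros n beta q p HN Hnet Hp Hbal.
  assert (Nn := net_n_pos _ _ _ _ _ _ _ Hnet).
  assert (Hn : (0 < n)%nat) by (apply INR_lt; assumption).
  assert (Hact := net_act _ _ _ _ _ _ _ Hnet).
  assert (bq : forall j, (j < n)%nat -> 0 < beta j * q j).
  { intros j Hj. assert (Q := net_q_pos _ _ _ _ _ _ _ Hnet j Hj). assert (B := nk_beta _ _ _ _ _ _ _ Hnet j Hj).
    apply Rmult_lt_0_compat; lra. }
  assert (B0 : 0 < Bq n beta q) by (eapply Rlt_le_trans; [apply (bq 0%nat Hn)|]; now apply bq_le with (delta := delta)).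
  assert (L := lam0_Bq n beta delta q).
  destruct (Rle_dec (lam0 n beta delta q) (1 + e2)) as [Hle|Hgt].
  - assert (Hle1 : lam0 n beta delta q <= 1 + e1) by (eapply Rle_trans; [apply Hle|]; apply Rplus_le_compat_l, Rmin_l).
    destruct (H1 n beta q ltac:(lia) Hnet Hle1) as [_ K].
    split; [|eapply Rle_trans; [apply Hle|]; apply Rplus_le_compat_l, Rmin_r].
    apply (Rmult_le_reg_r (Bq n beta q)); [assumption|]. rewrite L. unfold Bq at 1. rewrite <- sumR_scal.
    apply sumR_le. intros i Hi. rewrite Rmult_comm. specialize (bq i Hi). apply Rmult_le_compat_l; [lra|].
    destruct (K i p Hi Hp) as [KX [KY _]]. destruct (Hbal i Hi) as [HG HE].
    assert (1 - eps / 2 <= zz n beta delta q i + eps / 2) by nra.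
    rewrite zz_Bq in H by assumption.
    assert (0 <= beta i * q i * q i) by (assert (Q := net_q_pos _ _ _ _ _ _ _ Hnet i Hi); nra). nra.
  - exfalso. assert (K := H2 n beta q ltac:(lia) Hnet ltac:(lra)).
    specialize (H3 n ltac:(lia)).
    assert (Hs : c2 * c2 / INR n <= e2 / 4).
    { apply (Rmult_le_reg_r (INR n)); [assumption|]. unfold Rdiv at 1. rewrite Rmult_assoc, Rinv_l, Rmult_1_r by lra.
      apply (Rmult_le_compat_l (e2 / 4)) in H3; [|lra].
      replace (e2 / 4 * (4 * (c2 * c2) / e2)) with (c2 * c2) in H3 by (field; lra). lra. }
    apply Hgt. apply (Rmult_le_reg_r (Bq n beta q)); [assumption|]. rewrite L. unfold Bq at 2. rewrite <- sumR_scal.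
    apply sumR_le. intros i Hi. rewrite (Rmult_comm (1 + e2)). specialize (bq i Hi). apply Rmult_le_compat_l; [lra|].
    destruct (Hbal i Hi) as [HG HE]. specialize (K i p Hi Hp).
    assert (YL := SY_lower n k beta delta p q i Hact Hk Hi Hp).
    assert (zz n beta delta q i <= 1 + e2 / 4) by nra.
    rewrite zz_Bq in H by assumption. assert (NP := net_p _ _ _ _ _ _ _ Hnet i i Hi Hi). nra.
Qed.

(* At a stationary point near criticality the second derivative of [GG] in [q i] is approximately
   [(0 - 2 + 1) * GG / q_i^2]. *)
Lemma stationary_concave (k : nat) delta bl c1 c2 : (2 <= k)%nat ->
  0 < delta <= 1 -> 0 < bl < 1 -> 0 < c1 <= c2 ->
  exists eps N, 0 < eps /\ forall n beta q y i p, (N <= n)%nat -> (i < n)%nat ->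
  net_ok n beta delta (upd q i y) bl c1 c2 -> 1 - eps <= lam0 n beta delta (upd q i y) <= 1 + eps ->
  (forall j, (j < n)%nat -> 1/2 <= p j <= 1) ->
  0 < GG n k beta delta p (upd q i y) i -> FF n beta delta q i k p y = 0 -> FF2 n beta delta q i k p y < 0.
Proof.
  intros Hk Hd Hbl Hc. assert (C2 : 0 < c2 * c2) by nra.
  set (eta := 1 / (100 * (1 + c2 * c2))).
  assert (He0 : eta * (100 * (1 + c2 * c2)) = 1) by (unfold eta; field; lra).
  assert (He : 0 < eta) by nra.
  assert (He1 : eta <= 1 / 100) by nra.
  destruct (subcritical_expansion k delta bl c1 c2 eta Hk Hd Hbl Hc He) as [e1 [N1 [Hep1 H1]]].
  destruct (near_critical k delta bl c1 c2 eta 0 Hk Hd Hbl Hc He) as [e2 [N2 [Hep2 H2]]].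
  exists (Rmin e1 e2), (N1 + N2)%nat. split; [now apply Rmin_glb_lt|].
  intros n beta q y i p HN Hi Hnet Hlam Hp HG HF. set (q' := upd q i y) in *.
  assert (M1 := Rmin_l e1 e2). assert (M2 := Rmin_r e1 e2).
  assert (Hp0 : forall j, (j < n)%nat -> 0 <= p j) by (intros j Hj; specialize (Hp j Hj); lra).
  destruct (H1 n beta q' ltac:(lia) Hnet ltac:(lra)) as [Hpb K1]. specialize (K1 i p Hi Hp0). destruct K1 as [KX [KY KC]].
  destruct (H2 n beta q' ltac:(lia) Hnet ltac:(lra) i p Hi Hp) as [KP _].
  change (lsum (blists n) (fun t => wt n k p i t * PP n beta delta q' i (Tof n t i))) with (WS n k p i (PP n beta delta q' i)) in KP.
  assert (Hact := net_act _ _ _ _ _ _ _ Hnet).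
  assert (Bal := FF_balance n k beta delta p q i y). rewrite HF, Rmult_0_r in Bal. fold q' in Bal.
  set (G := GG n k beta delta p q' i) in *.
  assert (XU := SX_upper_PP n k beta delta p q' i Hact Hk Hi Hp0). fold G in XU.
  assert (YL := SY_lower n k beta delta p q' i Hact Hk Hi Hp0). fold G in YL.
  set (z := zz n beta delta q' i) in *.
  (* Stationarity means [SX = SY], which pins [z] near one. *)
  assert (Z1 : 1 - 2 * eta <= z) by nra.
  assert (Z2 : z <= 1 + eta) by nra.
  set (pb := c2 * c2 / INR n) in *.
  assert (Z := nsum_pbar n beta delta q' bl c1 c2 i Hnet Hi). set (sp := nsum n i (py beta q' i)) in *.
  set (iv := / ((1 - pb) * (1 - pb))).
  assert (Tot : y * (y * FF2 n beta delta q i k p y) <=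
     WS n k p i (PP n beta delta q' i) + (- (2 * z)) * SX n k beta delta p q' i
     + z * z * iv * G + 2 * sp * WS n k p i (fun T => nsum n i (fun j => py beta q' i j * Cw n beta delta q' i T j))).
  { unfold FF2. rewrite <- !lsum_scal. unfold SX, G. rewrite WS_GT, <- !WS_scal, <- !WS_plus.
    apply Rle_trans with (WS n k p i (fun T => y * (y * D2 n beta delta q i (fT n i T) y))).
    - right. apply lsum_ext. intros. ring.
    - apply WS_le; auto. intros T HT _ _. rewrite D2_split by assumption. fold q'. rewrite YXs_eq.
      assert (A := XX_le_PP n beta delta q' i T Hact Hi HT). assert (B := XYs_le n beta delta q' i T Hact Hi HT).
      assert (C := YY_le n beta delta q' i T Hact Hi HT pb ltac:(lra)).
      specialize (C ltac:(intros j Hj _; apply (net_p _ _ _ _ _ _ _ Hnet j i Hj Hi))). fold z sp in B, C.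
      replace (z * z * GT n beta delta q' i T / ((1 - pb) * (1 - pb))) with (z * z * iv * GT n beta delta q' i T) in C by (unfold iv, Rdiv; ring).
      lra. }
  assert (Hp00 : 0 <= pb) by (apply (uq_pbar n beta delta q' bl c1 c2 Hnet)).
  assert (Hiv : 0 < iv <= 21 / 20).
  { split; [apply Rinv_0_lt_compat; nra|]. replace (21 / 20) with (/ (20 / 21)) by field. apply Rinv_le_contravar; [lra|nra]. }
  assert (T2 : z * (1 - eta) * G <= z * SX n k beta delta p q' i) by nra.
  assert (T3 : z * z * iv * G <= (103 / 100) * (21 / 20) * G).
  { apply Rmult_le_compat_r; [lra|]. apply Rmult_le_compat; try lra; nra. }
  assert (T4 : sp * WS n k p i (fun T => nsum n i (fun j => py beta q' i j * Cw n beta delta q' i T j)) <= sp * (eta * G)) by nra.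
  assert (T5 : sp * (eta * G) <= 1 / 100 * G) by nra.
  assert (T6 : (98 / 100) * (99 / 100) * G <= z * (1 - eta) * G) by (apply Rmult_le_compat_r; [lra|]; apply Rmult_le_compat; lra).
  assert (T7 : eta * G <= 1 / 100 * G) by nra.
  assert (Neg : y * (y * FF2 n beta delta q i k p y) < 0) by lra.
  apply Rnot_le_lt. intros Hge. nra.
Qed.

(** One condition for both uses: investment equilibria, and solutions of the variational inequality
    on the box where [q i] ranges over [[1 / n, 1]]. At the lower face only the upward derivative is
    constrained, at the upper face only the downward one. *)
Definition FOC (n k : nat) (beta : nat -> R) (delta : R) (p q : nat -> R) : Prop :=
  forall i, (i < n)%nat -> 0 <= p i /\ 0 < q i <= 1 /\ 0 < GG n k beta delta p q i /\
    (q i = 1 \/ FF n beta delta q i k p (q i) <= 0) /\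
    (INR n * q i <= 1 \/ 0 <= FF n beta delta q i k p (q i)).

(** Since [Bq] squared is the sum of [beta j * (q j * Bq)], two-sided bounds on [q j * Bq] force
    [Bq] to be of order [sqrt n]. At the lower face the upper bound is automatic, because
    [Bq <= n]. *)
Lemma foc_bounds (k : nat) delta bl : (2 <= k)%nat -> 0 < delta <= 1 -> 0 < bl < 1 ->
  exists N, forall n beta p q, (N <= n)%nat -> (forall j, bl <= beta j < 1) -> FOC n k beta delta p q ->
  bl * sqrt (INR n) / 2 <= Bq n beta q <= INR k / delta * sqrt (INR n) /\
  forall i, (i < n)%nat -> q i < 1 /\ bl / 4 < q i * Bq n beta q /\ delta * (q i * Bq n beta q) <= INR k.
Proof.
  intros Hk Hd Hbl. assert (Hk2 : 2 <= INR k) by (apply (le_INR 2); assumption).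
  set (K := INR k / delta). assert (HK : 2 <= K).
  { unfold K. apply (Rmult_le_reg_r delta); [lra|]. unfold Rdiv. rewrite Rmult_assoc, Rinv_l by lra. nra. }
  assert (HKd : K * delta = INR k) by (unfold K; field; lra).
  set (m := bl / (4 * K)). assert (Hm : 0 < m) by (apply Rdiv_lt_0_compat; lra).
  assert (HmK : m * (4 * K) = bl) by (unfold m; field; lra).
  destruct (INR_large (K / (bl * m) + 1)) as [N HN]. exists (S N). intros n beta p q Hn Hbeta HF.
  assert (Hact : act_ok n beta delta q).
  { split; [lra|]. intros j Hj. destruct (HF j Hj) as [_ [Hq _]]. specialize (Hbeta j). lra. }
  assert (Hp : forall j, (j < n)%nat -> 0 <= p j) by (intros j Hj; apply (HF j Hj)).
  set (B := Bq n beta q).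
  assert (BL : forall i, (i < n)%nat -> q i = 1 \/ bl / 4 < q i * B).
  { intros i Hi. destruct (HF i Hi) as [_ [Hq [HG [[H|H] _]]]]; [now left|right].
    assert (E := FF_balance n k beta delta p q i (q i)). rewrite upd_id in E.
    apply (openness_low n k beta delta p q i Hact Hk Hi Hp); [lra|intros; apply Hbeta|assumption|nra]. }
  assert (Bn : B <= INR n).
  { rewrite <- (Rmult_1_r (INR n)), <- sumR_const. apply sumR_le. intros j Hj.
    destruct (HF j Hj) as [_ [Hq _]]. specialize (Hbeta j). nra. }
  assert (BH : forall i, (i < n)%nat -> delta * (q i * B) <= INR k).
  { intros i Hi. destruct (HF i Hi) as [_ [Hq [HG [_ [H|H]]]]].
    - assert (q i * B <= 1) by nra. nra.
    - assert (E := FF_balance n k beta delta p q i (q i)). rewrite upd_id in E.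
      apply (openness_high n k beta delta p q i Hact Hk Hi Hp); [assumption|nra]. }
  assert (BH' : forall i, (i < n)%nat -> q i * B <= K).
  { intros i Hi. specialize (BH i Hi). apply (Rmult_le_reg_l delta); lra. }
  assert (Bpos : 0 < B).
  { assert (H0 : (0 < n)%nat) by lia. eapply Rlt_le_trans; [|apply (bq_le n beta delta q 0%nat Hact H0)].
    destruct (HF 0%nat H0) as [_ [Hq _]]. specialize (Hbeta 0%nat). nra. }
  (* A firm with [q i = 1] would bound [Bq] by [K]; then every [q j] is at least [m], and [Bq] grows
     linearly in [n]. *)
  assert (Hlt : forall i, (i < n)%nat -> q i < 1).
  { intros i Hi. destruct (HF i Hi) as [_ [Hq _]]. destruct (Rlt_dec (q i) 1) as [|Hq1]; [assumption|exfalso].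
    assert (Eq : q i = 1) by lra. assert (BK := BH' i Hi). rewrite Eq, Rmult_1_l in BK.
    assert (Hj : forall j, (j < n)%nat -> m <= q j).
    { intros j Hj. destruct (HF j Hj) as [_ [Hqj _]]. destruct (BL j Hj) as [E|E]; nra. }
    assert (INR n * (bl * m) <= B).
    { rewrite <- sumR_const. apply sumR_le. intros j Hjn. specialize (Hj j Hjn). specialize (Hbeta j). apply Rmult_le_compat; lra. }
    specialize (HN n ltac:(lia)). assert (0 < bl * m) by nra.
    apply (Rmult_le_compat_r (bl * m)) in HN; [|lra].
    replace ((K / (bl * m) + 1) * (bl * m)) with (K + bl * m) in HN by (field; nra). lra. }
  assert (BL' : forall i, (i < n)%nat -> bl / 4 < q i * B).
  { intros i Hi. destruct (BL i Hi) as [E|E]; [specialize (Hlt i Hi); lra|assumption]. }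
  split; [|intros i Hi; auto].
  assert (S0 : 0 <= sqrt (INR n)) by apply sqrt_pos. assert (S2 := sqrt_sqrt (INR n) ltac:(lra)). set (s := sqrt (INR n)) in *.
  assert (B2 : B * B = sumR n (fun j => beta j * (q j * B))).
  { unfold B at 1, Bq. rewrite Rmult_comm, <- sumR_scal. apply sumR_ext. intros; ring. }
  assert (B2l : INR n * (bl * (bl / 4)) <= B * B).
  { rewrite B2, <- sumR_const. apply sumR_le. intros j Hj. specialize (BL' j Hj). specialize (Hbeta j). apply Rmult_le_compat; lra. }
  assert (B2u : B * B <= INR n * (1 * K)).
  { rewrite B2, <- sumR_const. apply sumR_le. intros j Hj. specialize (BH' j Hj). specialize (BL' j Hj). specialize (Hbeta j). apply Rmult_le_compat; lra. }
  rewrite <- S2 in B2l, B2u. split; apply Rnot_lt_le; intros Hc.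
  - nra.
  - assert ((K * s) * (K * s) < B * B) by (apply Rmult_le_0_lt_compat; nra). nra.
Qed.

(** The constants are quotients of the bounds on [q i * Bq] and [Bq] assumed in [net_of_bounds]. *)
Definition c1_of (k : nat) (delta bl : R) : R := bl * delta / (16 * INR k).
Definition c2_of (k : nat) (delta bl : R) : R := 8 * INR k / (delta * bl).

Lemma c_of_ok k delta bl : (2 <= k)%nat -> 0 < delta <= 1 -> 0 < bl < 1 -> 0 < c1_of k delta bl <= c2_of k delta bl.
Proof.
  intros Hk Hd Hbl. assert (Hk2 : 2 <= INR k) by (apply (le_INR 2); assumption). unfold c1_of, c2_of.
  assert (0 < delta * bl <= 1) by nra.
  split; [apply Rdiv_lt_0_compat; nra|]. apply Rle_trans with 1.
  - apply (Rmult_le_reg_r (16 * INR k)); [lra|]. unfold Rdiv. rewrite Rmult_assoc, Rinv_l by lra. nra.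
  - apply (Rmult_le_reg_r (delta * bl)); [lra|]. unfold Rdiv. rewrite Rmult_assoc, Rinv_l by lra. nra.
Qed.

(** The bounds are twice as loose as those of [foc_bounds], so that they survive a deviation by one
    firm. *)
Lemma net_of_bounds n k beta delta q bl : (2 <= k)%nat -> 0 < delta <= 1 -> 0 < bl < 1 -> (forall j, bl <= beta j < 1) ->
  2 * (c2_of k delta bl * c2_of k delta bl) <= INR n -> 0 < Bq n beta q ->
  bl * sqrt (INR n) / 4 <= Bq n beta q <= 2 * (INR k / delta * sqrt (INR n)) ->
  (forall i, (i < n)%nat -> bl / 8 <= q i * Bq n beta q /\ delta * (q i * Bq n beta q) <= 2 * INR k) ->
  net_ok n beta delta q bl (c1_of k delta bl) (c2_of k delta bl).
Proof.
  intros Hk Hd Hbl Hbeta Hn HB0 HB Hq. assert (Hk2 : 2 <= INR k) by (apply (le_INR 2); assumption).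
  constructor; auto; [lra|now apply c_of_ok|].
  intros j Hj. destruct (Hq j Hj) as [H1 H2]. set (s := sqrt (INR n)) in *.
  assert (Hdb : 0 < delta * bl) by nra. unfold c1_of, c2_of. split.
  - apply (Rmult_le_reg_r (16 * INR k)); [lra|]. unfold Rdiv. rewrite Rmult_assoc, Rinv_l, Rmult_1_r by lra.
    destruct HB as [_ HB]. apply (Rmult_le_compat_l (8 * (delta * q j))) in HB; [|nra].
    replace (8 * (delta * q j) * (2 * (INR k / delta * s))) with (s * q j * (16 * INR k)) in HB by (field; lra). nra.
  - apply (Rmult_le_reg_r (delta * bl)); [lra|]. unfold Rdiv. rewrite (Rmult_assoc (8 * INR k)), Rinv_l, Rmult_1_r by lra.
    destruct HB as [HB _]. apply (Rmult_le_compat_l (4 * (delta * q j))) in HB; [|nra]. nra.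
Qed.

(** The last clause concerns unilateral deviations: one firm changes [Bq] by less than one, so
    stationary points of its own problem also have order [1 / sqrt n]. The lower face is excluded
    because [1 / n] is of smaller order. *)
Lemma foc_net (k : nat) delta bl : (2 <= k)%nat -> 0 < delta <= 1 -> 0 < bl < 1 ->
  exists N, forall n beta p q, (N <= n)%nat -> (forall j, bl <= beta j < 1) -> FOC n k beta delta p q ->
  net_ok n beta delta q bl (c1_of k delta bl) (c2_of k delta bl) /\
  (forall i, (i < n)%nat -> FF n beta delta q i k p (q i) = 0) /\
  (forall i y, (i < n)%nat -> 0 < y <= 1 -> 0 < GG n k beta delta p (upd q i y) i -> FF n beta delta q i k p y = 0 ->
    net_ok n beta delta (upd q i y) bl (c1_of k delta bl) (c2_of k delta bl)).
Proof.
  intros Hk Hd Hbl. assert (Hk2 : 2 <= INR k) by (apply (le_INR 2); assumption).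
  destruct (foc_bounds k delta bl Hk Hd Hbl) as [N1 H1].
  set (c1 := c1_of k delta bl). set (c2 := c2_of k delta bl). assert (Hc : 0 < c1 <= c2) by now apply c_of_ok.
  destruct (INR_large (2 * (c2 * c2) + 1 + (4 / bl) * (4 / bl) + 2 / (c1 * c1))) as [N2 H2].
  exists (N1 + N2)%nat. intros n beta p q Hn Hbeta HF.
  destruct (H1 n beta p q ltac:(lia) Hbeta HF) as [HB Hq]. specialize (H2 n ltac:(lia)).
  assert (I1 : 0 < 2 / (c1 * c1)) by (apply Rdiv_lt_0_compat; nra).
  assert (I2 : 0 < 4 / bl) by (apply Rdiv_lt_0_compat; lra).
  assert (S0 : 0 <= sqrt (INR n)) by apply sqrt_pos. assert (S2 := sqrt_sqrt (INR n) ltac:(nra)). set (s := sqrt (INR n)) in *.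
  assert (S4 : 4 <= bl * s).
  { assert (4 / bl <= s) by nra.
    apply (Rmult_le_compat_l bl) in H; [|lra]. replace (bl * (4 / bl)) with 4 in H by (field; lra). lra. }
  set (B := Bq n beta q) in *. assert (B2 : 2 <= B) by lra.
  assert (Hnet : net_ok n beta delta q bl c1 c2).
  { apply net_of_bounds; auto; fold B s c2; [nra|lra|lra|]. intros i Hi. destruct (Hq i Hi) as [_ [? ?]]. lra. }
  split; [assumption|]. split.
  - intros i Hi. destruct (HF i Hi) as [_ [Hqi [_ [[A|A] [C|C]]]]]; destruct (Hq i Hi) as [Hlt _]; try lra.
    exfalso. assert (Q := nk_q _ _ _ _ _ _ _ Hnet i Hi). fold s in Q.
    assert (C' : s * c1 <= 1) by nra.
    assert (s * c1 * (s * c1) <= 1) by (assert (0 <= s * c1) by nra; nra).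
    replace (s * c1 * (s * c1)) with (INR n * (c1 * c1)) in H by nra.
    assert (2 / (c1 * c1) * (c1 * c1) <= INR n * (c1 * c1)) by nra.
    replace (2 / (c1 * c1) * (c1 * c1)) with 2 in H0 by (field; nra). lra.
  - intros i y Hi Hy HG H0.
    assert (EB : Bq n beta (upd q i y) = B - beta i * q i + beta i * y).
    { unfold B, Bq. transitivity (sumR n (fun j => beta j * q j) + sumR n (fun j => if Nat.eq_dec j i then beta i * y - beta i * q i else 0)).
      - rewrite <- sumR_plus. apply sumR_ext. intros j _. unfold upd. destruct (Nat.eq_dec j i) as [->|]; ring.
      - rewrite sumR_single by assumption. ring. }
    destruct (HF i Hi) as [_ [Hqi _]]. assert (Hbi := Hbeta i).
    set (B' := Bq n beta (upd q i y)) in *.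
    assert (B / 2 <= B' <= 2 * B) by nra.
    assert (Hact : act_ok n beta delta (upd q i y)).
    { split; [lra|]. intros j Hj. specialize (Hbeta j). destruct (HF j Hj) as [_ [Hqj _]]. unfold upd. destruct (Nat.eq_dec j i); lra. }
    assert (Hp : forall j, (j < n)%nat -> 0 <= p j) by (intros j Hj; apply (HF j Hj)).
    assert (E := FF_balance n k beta delta p q i y). rewrite H0, Rmult_0_r in E.
    assert (OL := openness_low n k beta delta p (upd q i y) i Hact Hk Hi Hp bl ltac:(lra) ltac:(intros; apply Hbeta) HG ltac:(lra)).
    assert (OH := openness_high n k beta delta p (upd q i y) i Hact Hk Hi Hp HG ltac:(lra)).
    fold B' in OL, OH. rewrite upd_same in OL, OH.
    apply net_of_bounds; auto; fold B' s c2; [nra|lra|lra|].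
    intros j Hj. destruct (Nat.eq_dec j i) as [->|Hji]; [rewrite upd_same; lra|]. rewrite upd_other by assumption.
    destruct (Hq j Hj) as [_ [Q1 Q2]]. destruct (HF j Hj) as [_ [Hqj _]]. split; nra.
Qed.

Lemma sub_crit_upd n beta delta q bl c1 c2 i y : (i < n)%nat ->
  net_ok n beta delta q bl c1 c2 -> net_ok n beta delta (upd q i y) bl c1 c2 ->
  Rabs (lam0 n beta delta (upd q i y) - lam0 n beta delta q) <= c2 * c2 / INR n.
Proof.
  intros Hi H1 H2.
  assert (E : lam0 n beta delta (upd q i y) - lam0 n beta delta q = delta * (beta i * (y * y)) - delta * (beta i * (q i * q i))).
  { unfold lam0. rewrite (sumR_ext n (fun j => beta j * (upd q i y j * upd q i y j))
      (fun j => beta j * (q j * q j) + (if Nat.eq_dec j i then beta i * (y * y) - beta i * (q i * q i) else 0))).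
    - rewrite sumR_plus, sumR_single by assumption. ring.
    - intros j _. unfold upd. destruct (Nat.eq_dec j i) as [->|]; ring. }
  rewrite E. assert (A := net_p _ _ _ _ _ _ _ H1 i i Hi Hi). assert (B := net_p _ _ _ _ _ _ _ H2 i i Hi Hi).
  rewrite upd_same in B. destruct H1 as [Hd Hb0 Hb _ _ _]. assert (bi := Hb i Hi).
  apply Rabs_le. split; nra.
Qed.

Lemma foc_critical (k : nat) delta bl eps : (2 <= k)%nat -> 0 < delta <= 1 -> 0 < bl < 1 -> 0 < eps ->
  exists N, forall n beta p q, (N <= n)%nat -> (forall j, bl <= beta j < 1) -> FOC n k beta delta p q ->
  1 - eps <= lam0 n beta delta q <= 1 + eps.
Proof.
  intros Hk Hd Hbl He. destruct (foc_net k delta bl Hk Hd Hbl) as [N1 H1].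
  destruct (balanced_critical k delta bl _ _ eps Hk Hd Hbl (c_of_ok k delta bl Hk Hd Hbl) He) as [N2 H2].
  exists (N1 + N2)%nat. intros n beta p q Hn Hbeta HF. destruct (H1 n beta p q ltac:(lia) Hbeta HF) as [Hnet [H0 _]].
  apply (H2 n beta q p ltac:(lia) Hnet); [intros j Hj; apply (HF j Hj)|]. intros i Hi. split; [apply (HF i Hi)|].
  assert (E := FF_balance n k beta delta p q i (q i)). rewrite upd_id, H0 in E by assumption. lra.
Qed.

Lemma deriv_right_max g x d b : derivable_pt_lim g x d -> x < b -> (forall y, x < y <= b -> g y <= g x) -> d <= 0.
Proof.
  intros Hd Hb Hg. apply Rnot_lt_le. intros Hpos. destruct (Hd d Hpos) as [dl Hdl]. assert (D := cond_pos dl).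
  set (h := Rmin (dl / 2) (b - x)). assert (Hh : 0 < h) by (apply Rmin_glb_lt; lra).
  assert (h1 : h <= dl / 2) by apply Rmin_l. assert (h2 : h <= b - x) by apply Rmin_r.
  assert (K := Hdl h ltac:(lra) ltac:(rewrite Rabs_pos_eq; lra)). apply Rabs_def2 in K.
  specialize (Hg (x + h) ltac:(lra)).
  assert ((g (x + h) - g x) / h <= 0); [|lra]. apply (Rmult_le_reg_r h); [lra|].
  unfold Rdiv. rewrite Rmult_assoc, Rinv_l; lra.
Qed.

Lemma deriv_left_max g x d a : derivable_pt_lim g x d -> a < x -> (forall y, a <= y < x -> g y <= g x) -> 0 <= d.
Proof.
  intros Hd Ha Hg.
  assert (Hd' : derivable_pt_lim (fun t => g (- t)) (- x) (d * - 1)).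
  { apply (derivable_pt_lim_comp Ropp g); [apply derivable_pt_lim_opp, derivable_pt_lim_id|].
    now rewrite Ropp_involutive. }
  assert (K := deriv_right_max _ _ _ (- a) Hd' ltac:(lra)).
  assert (d * -1 <= 0); [|lra]. apply K. intros y Hy. rewrite Ropp_involutive. apply Hg. lra.
Qed.

(** A closed firm has no listening links, so [SX] vanishes, while [SX_lower] bounds it below by
    [GG]. *)
Lemma GG_closed n k beta delta p q i : act_ok n beta delta q -> (2 <= k)%nat -> (i < n)%nat ->
  (forall j, (j < n)%nat -> 0 <= p j) -> q i = 0 -> GG n k beta delta p q i <= 0.
Proof.
  intros Hact Hk Hi Hp H0. assert (K := SX_lower n k beta delta p q i Hact Hk Hi Hp).
  assert (P0 : forall x, px beta q i x = 0) by (intros; unfold px; rewrite H0; ring).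
  assert (N0 : forall f, (forall x, f x = 0) -> nsum n i f = 0).
  { intros f Hf. apply sumR_zero. intros x _. destruct (Nat.eq_dec x i); auto. }
  rewrite (N0 _ P0) in K. unfold SX, WS in K. rewrite lsum_zero in K; [lra|].
  intros t _. unfold X1. rewrite N0; [ring|]. intros x. rewrite P0. ring.
Qed.

(** Deviating to zero investment shows that a positive [p i] is paid for by a positive [GG], hence
    [q i] is positive; one-sided derivatives of the maximum give the rest. *)
Lemma equilibrium_FOC n k delta bl beta c p q : (2 <= k)%nat -> 0 < delta <= 1 -> 0 < bl < 1 ->
  (forall i, bl <= beta i < 1) -> cost_ok c ->
  investment_equilibrium n k delta beta c p q -> FOC n k beta delta p q.
Proof.
  intros Hk Hd Hbl Hbeta [_ [_ [Hinc [_ [c0 _]]]]] [[Hval Heq] Hpos] i Hi.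
  destruct (Hval i Hi) as [Hpi Hqi]. assert (Hp0 := Hpos i Hi).
  assert (Hact : act_ok n beta delta q).
  { split; [lra|]. intros j Hj. destruct (Hval j Hj). specialize (Hbeta j). lra. }
  assert (Hp : forall j, (j < n)%nat -> 0 <= p j) by (intros j Hj; destruct (Hval j Hj); lra).
  assert (Dev : forall x y, valid_action x y -> x * GG n k beta delta p (upd q i y) i - c x <= p i * GG n k beta delta p q i - c (p i)).
  { intros x y Hxy. assert (K := Heq i Hi x y Hxy). rewrite !payoff_eq, GG_upd in K by assumption. now rewrite upd_same in K. }
  assert (HG : 0 < GG n k beta delta p q i).
  { assert (K := Dev 0 (q i) ltac:(split; lra)). rewrite c0 in K.
    assert (c 0 < c (p i)) by (apply Hinc; unfold in01; lra). rewrite c0 in H. nra. }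
  assert (Q0 : 0 < q i).
  { destruct (Rlt_dec 0 (q i)); [assumption|exfalso]. assert (K := GG_closed n k beta delta p q i Hact Hk Hi Hp ltac:(lra)). lra. }
  assert (Max : forall y, 0 <= y <= 1 -> GG n k beta delta p (upd q i y) i <= GG n k beta delta p (upd q i (q i)) i).
  { intros y Hy. rewrite upd_id. assert (K := Dev (p i) y ltac:(split; lra)). apply (Rmult_le_reg_l (p i)); lra. }
  assert (D := GG_deriv n beta delta q i Hi k p (q i)).
  split; [lra|]. split; [lra|]. split; [assumption|]. split.
  - destruct (Rlt_dec (q i) 1) as [Hlt|]; [right|left; lra].
    apply (deriv_right_max _ _ _ 1 D Hlt). intros y Hy. apply Max. lra.
  - right. apply (deriv_left_max _ _ _ 0 D Q0). intros y Hy. apply Max. lra.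
Qed.

Lemma equilibria_critical k delta bl c beta : (2 <= k)%nat -> 0 < delta <= 1 -> 0 < bl < 1 ->
  (forall i, bl <= beta i < 1) -> cost_ok c -> forall (p q : nat -> nat -> R) (N : nat),
  (forall n, (N <= n)%nat -> investment_equilibrium n k delta beta c (p n) (q n)) -> critical beta delta q.
Proof.
  intros Hk Hd Hbl Hbeta Hc p q N Heq eps He.
  destruct (foc_critical k delta bl (eps / 2) Hk Hd Hbl ltac:(lra)) as [N1 H1].
  exists (S (N + N1)). intros n Hn.
  assert (HF := equilibrium_FOC n k delta bl beta c (p n) (q n) Hk Hd Hbl Hbeta Hc (Heq n ltac:(lia))).
  rewrite lambda_lam0; [|lia|lra|intros j Hj; specialize (Hbeta j); destruct (HF j Hj) as [_ [? _]]; lra].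
  assert (K := H1 n beta (p n) (q n) ltac:(lia) Hbeta HF). apply Rabs_def1; lra.
Qed.

(** * A variational inequality on boxes *)

Definition bsum {A} (L : list A) (f : A -> bool) : bool := fold_right (fun a s => xorb (f a) s) false L.

Lemma bsum_ext {A} (L : list A) f g : (forall a, In a L -> f a = g a) -> bsum L f = bsum L g.
Proof. induction L; simpl; intros H; [reflexivity|]. rewrite IHL, H; auto. Qed.

Lemma bsum_cons {A} (a : A) L f : bsum (a :: L) f = xorb (f a) (bsum L f).
Proof. reflexivity. Qed.

Lemma bsum_xor {A} (L : list A) f g : bsum L (fun a => xorb (f a) (g a)) = xorb (bsum L f) (bsum L g).
Proof. induction L; simpl; [reflexivity|]. rewrite IHL. destruct (f a), (g a), (bsum L f), (bsum L g); reflexivity. Qed.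

Lemma bsum_and {A} (L : list A) c f : bsum L (fun a => c && f a) = c && bsum L f.
Proof. induction L; simpl; [now rewrite andb_false_r|]. rewrite IHL. destruct c, (f a), (bsum L f); reflexivity. Qed.

Lemma bsum_false {A} (L : list A) f : (forall a, In a L -> f a = false) -> bsum L f = false.
Proof. induction L; simpl; intros H; [reflexivity|]. rewrite IHL, H; auto. Qed.

Lemma bsum_true {A} (L : list A) f : bsum L f = true -> exists a, In a L /\ f a = true.
Proof.
  intros H. apply NNPP. intros Hn. rewrite bsum_false in H; [discriminate|].
  intros a Ha. destruct (f a) eqn:E; [|reflexivity]. exfalso. apply Hn. now exists a.
Qed.

Lemma bsum_swap {A B} (L : list A) (M : list B) f : bsum L (fun a => bsum M (f a)) = bsum M (fun b => bsum L (fun a => f a b)).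
Proof.
  induction L; simpl; [symmetry; now apply bsum_false|]. now rewrite IHL, <- bsum_xor.
Qed.

Definition rem (j : nat) (D : list nat) : list nat := filter (fun k => negb (k =? j)) D.

Lemma bsum_rem j D f : bsum (rem j D) f = bsum D (fun k => negb (k =? j) && f k).
Proof. induction D as [|a D IH]; simpl; [reflexivity|]. destruct (a =? j); simpl; now rewrite IH. Qed.

Lemma rem_rem j k D : rem j (rem k D) = rem k (rem j D).
Proof. induction D as [|a D IH]; simpl; [reflexivity|]. destruct (a =? j) eqn:E1, (a =? k) eqn:E2; simpl; rewrite ?E1, ?E2; simpl; congruence. Qed.

Lemma in_rem j k D : In k (rem j D) <-> In k D /\ k <> j.
Proof. unfold rem. rewrite filter_In, negb_true_iff, Nat.eqb_neq. tauto. Qed.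

Lemma bsum_sym (D : list nat) g : (forall j k, g j k = g k j) -> (forall j, g j j = false) ->
  bsum D (fun j => bsum D (g j)) = false.
Proof.
  intros Hs Hd. induction D as [|a D IH]; simpl; [reflexivity|].
  rewrite Hd, bsum_xor, IH. rewrite (bsum_ext D (fun j => g j a) (g a)) by auto.
  destruct (bsum D (g a)); reflexivity.
Qed.

Lemma bsum_rem_sym D g : (forall j k, g j k = g k j) -> bsum D (fun j => bsum (rem j D) (g j)) = false.
Proof.
  intros Hs. rewrite (bsum_ext D _ (fun j => bsum D (fun k => negb (k =? j) && g j k))) by (intros; apply bsum_rem).
  apply bsum_sym; intros; [now rewrite Nat.eqb_sym, Hs|]. now rewrite Nat.eqb_refl.
Qed.

Lemma bsum_rem_swap D g : bsum D (fun j => bsum (rem j D) (g j)) = bsum D (fun k => bsum (rem k D) (fun j => g j k)).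
Proof.
  rewrite (bsum_ext D _ (fun j => bsum D (fun k => negb (k =? j) && g j k))) by (intros; apply bsum_rem).
  rewrite bsum_swap. apply bsum_ext. intros k _. rewrite bsum_rem. apply bsum_ext. intros j _. now rewrite Nat.eqb_sym.
Qed.

Definition put (x : nat -> nat) (j a : nat) : nat -> nat := fun t => if t =? j then a else x t.
Definition inc (x : nat -> nat) (j : nat) : nat -> nat := put x j (S (x j)).

Lemma put_eq x j a : put x j a j = a.
Proof. unfold put. now rewrite Nat.eqb_refl. Qed.

Lemma put_neq x j a t : t <> j -> put x j a t = x t.
Proof. intros H. unfold put. now apply Nat.eqb_neq in H as ->. Qed.

Lemma put_comm x j k a b : j <> k -> put (put x j a) k b = put (put x k b) j a.
Proof.
  intros H. apply functional_extensionality. intros t. unfold put.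
  destruct (t =? j) eqn:E1, (t =? k) eqn:E2; auto. apply Nat.eqb_eq in E1, E2. congruence.
Qed.

Lemma inc_comm x j k : inc (inc x j) k = inc (inc x k) j.
Proof.
  destruct (Nat.eq_dec j k) as [->|H]; [reflexivity|]. unfold inc. rewrite !put_neq by auto. now apply put_comm.
Qed.

Lemma inc_put x j a : inc (put x j a) j = put x j (S a).
Proof. unfold inc. rewrite put_eq. apply functional_extensionality. intros t. unfold put. destruct (t =? j); reflexivity. Qed.

Section Labels.

Variable l : nat -> (nat -> nat) -> bool.

(* The mod 2 cup product of the coboundaries of the labels [l i, ..., l (i + m - 1)],
   evaluated on the cube with lowest vertex [x] and directions [D]. *)
Fixpoint cup (m i : nat) (x : nat -> nat) (D : list nat) : bool :=
  match m with
  | O => true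
  | S m' => bsum D (fun j => xorb (l i (inc x j)) (l i x) && cup m' (S i) (inc x j) (rem j D))
  end.

(** A cup product of coboundaries is a cocycle: its sum over all faces of a cube vanishes. Double
    sums over two directions cancel in pairs mod 2. *)
Lemma cup_closed m : forall i x D,
  xorb (bsum D (fun j => cup m i (inc x j) (rem j D))) (bsum D (fun j => cup m i x (rem j D))) = false.
Proof.
  induction m as [|m IH]; intros i x D; [simpl; now destruct (bsum D (fun _ => true))|]. cbn [cup].
  rewrite (bsum_ext D (fun j => bsum (rem j D) (fun k => xorb (l i (inc (inc x j) k)) (l i (inc x j)) && cup m (S i) (inc (inc x j) k) (rem k (rem j D))))
    (fun j => xorb (bsum (rem j D) (fun k => l i (inc (inc x j) k) && cup m (S i) (inc (inc x j) k) (rem k (rem j D))))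
                   (l i (inc x j) && bsum (rem j D) (fun k => cup m (S i) (inc (inc x j) k) (rem k (rem j D)))))).
  2: { intros j _. rewrite <- bsum_and, <- bsum_xor. apply bsum_ext. intros k _. now destruct (l i (inc (inc x j) k)), (l i (inc x j)), (cup m (S i) (inc (inc x j) k) (rem k (rem j D))). }
  rewrite bsum_xor, bsum_rem_sym by (intros; now rewrite inc_comm, rem_rem).
  rewrite (bsum_rem_swap D (fun j k => xorb (l i (inc x k)) (l i x) && cup m (S i) (inc x k) (rem k (rem j D)))).
  rewrite (bsum_ext D (fun k => bsum (rem k D) (fun j => xorb (l i (inc x k)) (l i x) && cup m (S i) (inc x k) (rem k (rem j D))))
    (fun k => xorb (l i (inc x k) && bsum (rem k D) (fun j => cup m (S i) (inc x k) (rem j (rem k D)))) (l i x && bsum (rem k D) (fun j => cup m (S i) (inc x k) (rem j (rem k D)))))).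
  2: { intros k _. rewrite bsum_and. rewrite (bsum_ext (rem k D) (fun j => cup m (S i) (inc x k) (rem k (rem j D))) (fun j => cup m (S i) (inc x k) (rem j (rem k D)))) by (intros; now rewrite rem_rem).
       now destruct (l i (inc x k)), (l i x), (bsum (rem k D) (fun j => cup m (S i) (inc x k) (rem j (rem k D)))). }
  rewrite bsum_xor, bsum_and.
  assert (E : forall j, bsum (rem j D) (fun k => cup m (S i) (inc (inc x j) k) (rem k (rem j D))) = bsum (rem j D) (fun k => cup m (S i) (inc x j) (rem k (rem j D)))).
  { intros j. apply xorb_eq. apply (IH (S i) (inc x j) (rem j D)). }
  rewrite <- (bsum_ext D _ _ (fun j _ => E j)).
  rewrite (bsum_rem_sym D (fun j k => cup m (S i) (inc (inc x j) k) (rem k (rem j D)))) by (intros; now rewrite inc_comm, rem_rem).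
  rewrite (bsum_ext D _ (fun j => l i (inc x j) && bsum (rem j D) (fun k => cup m (S i) (inc x j) (rem k (rem j D))))) by (intros; now rewrite E).
  rewrite andb_false_r, xorb_false_r, xorb_false_l. apply xorb_nilpotent.
Qed.

(** The Leibniz rule: the remaining factors are closed, so the product is the coboundary of [l i]
    times them. *)
Lemma cup_boundary m i x D : cup (S m) i x D =
  bsum D (fun j => xorb (l i (inc x j) && cup m (S i) (inc x j) (rem j D)) (l i x && cup m (S i) x (rem j D))).
Proof.
  cbn [cup]. rewrite bsum_xor, bsum_and, <- (xorb_eq _ _ (cup_closed m (S i) x D)), <- bsum_and, <- bsum_xor.
  apply bsum_ext. intros j _. now destruct (l i (inc x j)), (l i x), (cup m (S i) (inc x j) (rem j D)).
Qed.

Lemma cup_constant j v : forall m i y E, (forall z, z j = y j -> l j z = v) -> ~ In j E ->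
  (i <= j < i + m)%nat -> cup m i y E = false.
Proof.
  induction m as [|m IH]; intros i y E Hc Hj Hi; [lia|]. cbn [cup]. apply bsum_false. intros b Hb.
  assert (Hbj : j <> b) by congruence. assert (Hy : inc y b j = y j) by now apply put_neq.
  destruct (Nat.eq_dec i j) as [->|].
  - rewrite !Hc by auto. now rewrite xorb_nilpotent.
  - rewrite IH; [now rewrite andb_false_r|intros z Hz; apply Hc; congruence|rewrite in_rem; tauto|lia].
Qed.

(** A nonzero product has, for each label, an edge of the cube along which that label changes. *)
Lemma cup_bichromatic m : forall i y E, cup m i y E = true -> forall a, (i <= a < i + m)%nat ->
  exists z z', l a z = true /\ l a z' = false /\
    forall b, (In b E -> (y b <= z b <= S (y b))%nat /\ (y b <= z' b <= S (y b))%nat) /\ (~ In b E -> z b = y b /\ z' b = y b).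
Proof.
  induction m as [|m IH]; intros i y E H a Ha; [lia|]. cbn [cup] in H.
  apply bsum_true in H. destruct H as [j [Hj H]]. apply andb_prop in H. destruct H as [H1 H2].
  destruct (Nat.eq_dec a i) as [->|].
  - assert (K : forall b, (In b E -> (y b <= inc y j b <= S (y b))%nat) /\ (~ In b E -> inc y j b = y b)).
    { intros b. unfold inc. destruct (Nat.eq_dec b j) as [->|]; [rewrite put_eq|rewrite put_neq by assumption]; split; try tauto; lia. }
    destruct (l i (inc y j)) eqn:E1, (l i y) eqn:E2; try discriminate.
    + exists (inc y j), y. split; [assumption|]. split; [assumption|]. intros b. destruct (K b) as [K1 K2]. split; intros Hb; [split; [auto|lia]|auto].
    + exists y, (inc y j). split; [assumption|]. split; [assumption|]. intros b. destruct (K b) as [K1 K2]. split; intros Hb; [split; [lia|auto]|auto].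
  - destruct (IH (S i) (inc y j) (rem j E) H2 a ltac:(lia)) as [z [z' [Hz [Hz' Hb]]]].
    exists z, z'. split; [assumption|]. split; [assumption|]. intros b. destruct (Hb b) as [B1 B2]. rewrite in_rem in B1, B2.
    destruct (Nat.eq_dec b j) as [->|Hbj].
    + destruct (B2 ltac:(tauto)) as [-> ->]. unfold inc. rewrite put_eq. split; [lia|tauto].
    + unfold inc in B1, B2. rewrite put_neq in B1, B2 by assumption. split; intros; [apply B1|apply B2]; tauto.
Qed.

Variable N : nat.

Fixpoint gsum (L : list nat) (x : nat -> nat) (F : (nat -> nat) -> bool) : bool :=
  match L with
  | [] => F x
  | j :: L' => bsum (seq 0 N) (fun a => gsum L' (put x j a) F)
  end.

Lemma gsum_ext L : forall x F G, (forall y, (forall b, ~ In b L -> y b = x b) -> F y = G y) -> gsum L x F = gsum L x G.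
Proof.
  induction L as [|j L IH]; intros x F G H; [now apply H|]. cbn [gsum]. apply bsum_ext. intros a _. apply IH.
  intros y Hy. apply H. intros b Hb. rewrite Hy by (simpl in Hb; tauto). apply put_neq. simpl in Hb. intuition.
Qed.

Lemma gsum_bsum {A} (S : list A) L : forall x (F : A -> (nat -> nat) -> bool),
  gsum L x (fun y => bsum S (fun s => F s y)) = bsum S (fun s => gsum L x (F s)).
Proof.
  induction L as [|j L IH]; intros x F; [reflexivity|]. cbn [gsum]. rewrite bsum_swap. apply bsum_ext. intros a _. apply IH.
Qed.

Lemma gsum_put L j a F : ~ In j L -> forall x, gsum L (put x j a) F = gsum L x (fun y => F (put y j a)).
Proof.
  induction L as [|b L IH]; intros Hj x; [reflexivity|]. cbn [gsum]. apply bsum_ext. intros c _.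
  rewrite put_comm by (simpl in Hj; intuition). apply IH. simpl in Hj; tauto.
Qed.

Lemma rem_notin j L : ~ In j L -> rem j L = L.
Proof.
  induction L as [|a L IH]; simpl; intros H; [reflexivity|].
  destruct (a =? j) eqn:E; [apply Nat.eqb_eq in E; tauto|]. rewrite IH; tauto.
Qed.

Lemma bsum_telescope (f : nat -> bool) M : bsum (seq 0 M) (fun a => xorb (f (S a)) (f a)) = xorb (f M) (f 0%nat).
Proof.
  rewrite bsum_xor. unfold bsum.
  assert (FR : forall (g : nat -> bool) s A, fold_right (fun a s => xorb (g a) s) s A = xorb (fold_right (fun a s => xorb (g a) s) false A) s).
  { intros g s A. induction A; simpl; [now destruct s|]. rewrite IHA. now rewrite xorb_assoc. }
  induction M as [|M IHM]; [simpl; now rewrite xorb_nilpotent|]. rewrite seq_S, !fold_right_app, FR, (FR f). simpl.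
  rewrite !xorb_false_r.
  transitivity (xorb (xorb (f M) (f 0%nat)) (xorb (f (S M)) (f M))); [rewrite <- IHM|destruct (f M), (f (S M)), (f 0%nat); reflexivity].
  destruct (f M), (f (S M)), (fold_right (fun a s => xorb (f (S a)) s) false (seq 0 M)), (fold_right (fun a s => xorb (f a) s) false (seq 0 M)); reflexivity.
Qed.

(** Stokes' formula on the grid: interior faces cancel, and only the two opposite faces in direction
    [j] remain. *)
Lemma gsum_telescope L j h : NoDup L -> In j L -> forall x,
  gsum L x (fun y => xorb (h (inc y j)) (h y)) = gsum (rem j L) x (fun y => xorb (h (put y j N)) (h (put y j 0))).
Proof.
  induction L as [|b L IH]; intros Hnd Hin x; [contradiction|]. inversion Hnd as [|? ? Hb Hnd' E]; subst. cbn [gsum].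
  simpl. destruct (b =? j) eqn:E; simpl.
  - apply Nat.eqb_eq in E. subst b. fold (rem j L). rewrite rem_notin by assumption.
    rewrite (bsum_ext _ _ (fun a => gsum L x (fun y => xorb (h (inc (put y j a) j)) (h (put y j a))))) by (intros; now apply (gsum_put L j a (fun y => xorb (h (inc y j)) (h y)))).
    rewrite <- (gsum_bsum (seq 0 N) L x (fun a y => xorb (h (inc (put y j a) j)) (h (put y j a)))).
    apply gsum_ext. intros y _. rewrite <- (bsum_telescope (fun a => h (put y j a))). apply bsum_ext. intros a _. now rewrite inc_put.
  - apply Nat.eqb_neq in E. apply bsum_ext. intros a _. apply IH; [assumption|]. simpl in Hin. tauto.
Qed.

Lemma gsum_true L : NoDup L -> forall x F, gsum L x F = true ->
  exists y, F y = true /\ (forall j, In j L -> (y j < N)%nat) /\ (forall j, ~ In j L -> y j = x j).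
Proof.
  induction L as [|j L IH]; intros Hnd x F H; [exists x; simpl; tauto|]. inversion Hnd as [|? ? Hb Hnd' E]; subst.
  cbn [gsum] in H. apply bsum_true in H. destruct H as [a [Ha H]]. apply in_seq in Ha.
  destruct (IH Hnd' _ _ H) as [y [H1 [H2 H3]]]. exists y. split; [assumption|]. split.
  - intros b [->|Hbin]; [|auto]. rewrite H3 by assumption. rewrite put_eq. lia.
  - intros b Hbn. simpl in Hbn. rewrite H3 by tauto. apply put_neq. intuition.
Qed.

Hypothesis l_low : forall j z, z j = 0%nat -> l j z = false.
Hypothesis l_high : forall j z, z j = N -> l j z = true.

(** Induction on the dimension. Of the boundary faces in direction [i], only the far one has [l i]
    true, and it gives the sum of one dimension less; on faces in another direction [j] the label
    [l j] is constant, so the product vanishes. *)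
Lemma gsum_cup m : forall i x, gsum (seq i m) x (fun y => cup m i y (seq i m)) = true.
Proof.
  induction m as [|m IH]; intros i x; [reflexivity|].
  set (D := seq i (S m)). assert (Hnd : NoDup D) by apply seq_NoDup.
  rewrite (gsum_ext D x _ (fun y => bsum D (fun j => xorb (l i (inc y j) && cup m (S i) (inc y j) (rem j D)) (l i y && cup m (S i) y (rem j D))))) by (intros; apply cup_boundary).
  rewrite (gsum_bsum D D x (fun j y => xorb (l i (inc y j) && cup m (S i) (inc y j) (rem j D)) (l i y && cup m (S i) y (rem j D)))).
  assert (T : forall j, In j D -> gsum D x (fun y => xorb (l i (inc y j) && cup m (S i) (inc y j) (rem j D)) (l i y && cup m (S i) y (rem j D)))
     = gsum (rem j D) x (fun y => xorb (l i (put y j N) && cup m (S i) (put y j N) (rem j D)) (l i (put y j 0) && cup m (S i) (put y j 0) (rem j D)))).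
  { intros j Hj. apply (gsum_telescope D j (fun y => l i y && cup m (S i) y (rem j D)) Hnd Hj x). }
  rewrite (bsum_ext D _ _ T). unfold D at 1. cbn [seq]. rewrite bsum_cons.
  assert (Hi : ~ In i (seq (S i) m)) by (rewrite in_seq; lia).
  assert (R : rem i D = seq (S i) m).
  { cbn [seq]. simpl. rewrite Nat.eqb_refl. now apply rem_notin. }
  rewrite R. rewrite (gsum_ext _ x _ (fun y => cup m (S i) (put y i N) (seq (S i) m))).
  2: { intros y _. rewrite (l_high i) by apply put_eq. rewrite (l_low i) by apply put_eq. now rewrite xorb_false_r. }
  rewrite <- (gsum_put (seq (S i) m) i N (fun y => cup m (S i) y (seq (S i) m)) Hi), IH.
  rewrite bsum_false; [reflexivity|]. intros j Hj. apply in_seq in Hj.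
  assert (Z : forall y v, v = 0%nat \/ v = N -> cup m (S i) (put y j v) (rem j D) = false).
  { intros y v [->| ->].
    - apply (cup_constant j false); [intros z Hz; apply l_low; now rewrite put_eq in Hz|rewrite in_rem; tauto|lia].
    - apply (cup_constant j true); [intros z Hz; apply l_high; now rewrite put_eq in Hz|rewrite in_rem; tauto|lia]. }
  rewrite (gsum_ext _ x _ (fun _ => false)) by (intros; rewrite !Z by auto; now rewrite !andb_false_r).
  clear. generalize x. induction (rem j D) as [|b E IH]; intros y; [reflexivity|]. cbn [gsum]. apply bsum_false. auto.
Qed.

Lemma bichromatic_cube d : exists y, (forall j, (j < d)%nat -> (y j < N)%nat) /\
  forall a, (a < d)%nat -> exists z z', l a z = true /\ l a z' = false /\
    forall b, (b < d)%nat -> (y b <= z b <= S (y b))%nat /\ (y b <= z' b <= S (y b))%nat.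
Proof.
  destruct (gsum_true (seq 0 d) (seq_NoDup d 0) _ _ (gsum_cup d 0 (fun _ => 0%nat))) as [y [H1 [H2 _]]].
  exists y. split; [intros j Hj; apply H2, in_seq; lia|]. intros a Ha.
  destruct (cup_bichromatic d 0 y _ H1 a ltac:(lia)) as [z [z' [Hz [Hz' Hb]]]].
  exists z, z'. split; [assumption|]. split; [assumption|]. intros b Hbd. apply Hb, in_seq. lia.
Qed.

End Labels.

(** * Limits of bichromatic cubes on refining grids *)

Lemma fun_choice {A B} (Q : A -> B -> Prop) : (forall x, exists y, Q x y) -> exists f, forall x, Q x (f x).
Proof.
  intros H. exists (fun x => proj1_sig (constructive_indefinite_description _ (H x))).
  intros x. apply (proj2_sig (constructive_indefinite_description _ (H x))).
Qed.

Lemma Un_cv_sub u l phi : Un_cv u l -> (forall m, (m <= phi m)%nat) -> Un_cv (fun m => u (phi m)) l.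
Proof. intros H Hp eps He. destruct (H eps He) as [N HN]. exists N. intros m Hm. apply HN. specialize (Hp m). lia. Qed.

Lemma Un_cv_near u v l C : Un_cv u l -> 0 <= C -> (forall m, Rabs (v m - u m) <= C / INR (S m)) -> Un_cv v l.
Proof.
  intros H HC Hv eps He. destruct (H (eps / 2) ltac:(lra)) as [N1 H1]. destruct (INR_unbounded (2 * C / eps)) as [N2 H2].
  exists (N1 + N2)%nat. intros m Hm. specialize (H1 m ltac:(lia)). specialize (Hv m). unfold Rdist in *.
  assert (Hs : 2 * C / eps < INR (S m)) by (eapply Rlt_le_trans; [apply H2|apply le_INR; lia]).
  assert (Hp : 0 < INR (S m)) by (apply lt_0_INR; lia).
  assert (C / INR (S m) < eps / 2).
  { apply (Rmult_lt_reg_r (INR (S m))); [assumption|]. unfold Rdiv at 1. rewrite Rmult_assoc, Rinv_l, Rmult_1_r by lra.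
    apply (Rmult_lt_compat_l (eps / 2)) in Hs; [|lra]. replace (eps / 2 * (2 * C / eps)) with C in Hs by (field; lra). lra. }
  replace (v m - l) with ((v m - u m) + (u m - l)) by ring. eapply Rle_lt_trans; [apply Rabs_triang|lra].
Qed.

Lemma Un_cv_range u l a b : Un_cv u l -> (forall m, a <= u m <= b) -> a <= l <= b.
Proof.
  intros H Hu. split; apply Rnot_lt_le; intros Hc.
  - destruct (H (a - l) ltac:(lra)) as [N HN]. specialize (HN N ltac:(lia)). specialize (Hu N). apply Rabs_def2 in HN. lra.
  - destruct (H (l - b) ltac:(lra)) as [N HN]. specialize (HN N ltac:(lia)). specialize (Hu N). apply Rabs_def2 in HN. lra.
Qed.

Lemma Un_cv_event u l c : Un_cv u l -> (exists N, forall m, (N <= m)%nat -> u m = c) -> l = c.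
Proof.
  intros H [N HN]. apply NNPP. intros Hc. assert (P := Rabs_pos_lt (l - c) ltac:(lra)).
  destruct (H _ P) as [M HM]. specialize (HM (N + M)%nat ltac:(lia)). rewrite HN in HM by lia.
  unfold Rdist in HM. rewrite Rabs_minus_sym in HM. lra.
Qed.

Lemma Bolzano_Weierstrass_box d lo hi (u : nat -> nat -> R) : (forall m b, (b < d)%nat -> lo b <= u m b <= hi b) ->
  exists phi x, (forall m, (m <= phi m)%nat) /\ forall b, (b < d)%nat -> Un_cv (fun m => u (phi m) b) (x b).
Proof.
  induction d as [|d IH]; intros Hu; [exists (fun m => m), (fun _ => 0); split; [auto|lia]|].
  destruct (IH ltac:(intros; apply Hu; lia)) as [phi [x [Hphi Hx]]].
  destruct (Bolzano_Weierstrass (fun m => u (phi m) d) _ (compact_P3 (lo d) (hi d)) ltac:(intros; apply Hu; lia)) as [xd Hxd].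
  destruct (fun_choice (fun m k => (m <= k)%nat /\ Rabs (u (phi k) d - xd) <= 1 / INR (S m))) as [psi Hpsi].
  { intros m. assert (Hp : 0 < 1 / INR (S m)) by (apply Rdiv_lt_0_compat; [lra|apply lt_0_INR; lia]).
    destruct (Hxd (disc xd (mkposreal _ Hp)) m) as [k [Hk Hd]]; [exists (mkposreal _ Hp); intros t Ht; exact Ht|].
    exists k. split; [assumption|]. left. exact Hd. }
  exists (fun m => phi (psi m)), (fun b => if Nat.eq_dec b d then xd else x b). split.
  - intros m. specialize (Hphi (psi m)). destruct (Hpsi m). lia.
  - intros b Hb. destruct (Nat.eq_dec b d) as [->|].
    + apply (Un_cv_near (fun _ => xd) _ xd 1); [intros eps He; exists 0%nat; intros; unfold Rdist; rewrite Rminus_diag, Rabs_R0; lra|lra|].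
      intros m. apply Hpsi.
    + apply (Un_cv_sub (fun m => u (phi m) b) (x b) psi); [apply Hx; lia|]. intros m. apply Hpsi.
Qed.

(** Each grid is labelled by the sign of [f a], with values forced on the faces. Small cubes on
    which all labels take both values accumulate at some [x]; there each [f a] vanishes, unless the
    vertices with one of the labels come from the face where that label is forced. *)
Lemma variational_inequality (d : nat) (lo hi : nat -> R) (f : nat -> (nat -> R) -> R) :
  (forall b, (b < d)%nat -> lo b < hi b) ->
  (forall a, (a < d)%nat -> forall (u : nat -> nat -> R) x, (forall m b, (b < d)%nat -> lo b <= u m b <= hi b) ->
     (forall b, (b < d)%nat -> Un_cv (fun m => u m b) (x b)) -> Un_cv (fun m => f a (u m)) (f a x)) ->
  exists x, (forall b, (b < d)%nat -> lo b <= x b <= hi b) /\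
    forall a, (a < d)%nat -> (x a = lo a \/ 0 <= f a x) /\ (x a = hi a \/ f a x <= 0).
Proof.
  intros Hlh Hf.
  set (pt := fun (M : nat) (z : nat -> nat) b => lo b + (hi b - lo b) * (INR (z b) / INR (S M))).
  set (lab := fun (M a : nat) (z : nat -> nat) => if z a =? 0 then false else if z a =? S M then true else
     if Rle_dec (f a (pt M z)) 0 then true else false).
  assert (Hcell : forall M, exists y, (forall j, (j < d)%nat -> (y j < S M)%nat) /\
    forall a, (a < d)%nat -> exists z z', lab M a z = true /\ lab M a z' = false /\
    forall b, (b < d)%nat -> (y b <= z b <= S (y b))%nat /\ (y b <= z' b <= S (y b))%nat).
  { intros M. apply bichromatic_cube; intros j z Hz; unfold lab; rewrite Hz; [reflexivity|]. now rewrite Nat.eqb_refl. }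
  destruct (fun_choice _ Hcell) as [Y HY].
  assert (Hpt : forall M z b, (b < d)%nat -> (z b <= S M)%nat -> lo b <= pt M z b <= hi b).
  { intros M z b Hb Hz. specialize (Hlh b Hb). unfold pt. apply le_INR in Hz. assert (P := pos_INR (z b)).
    assert (Hp : 0 < INR (S M)) by (apply lt_0_INR; lia).
    assert (0 <= INR (z b) / INR (S M) <= 1); [|nra]. split; [apply Rmult_le_pos; [lra|left; now apply Rinv_0_lt_compat]|].
    apply (Rmult_le_reg_r (INR (S M))); [assumption|]. unfold Rdiv. rewrite Rmult_assoc, Rinv_l; lra. }
  destruct (Bolzano_Weierstrass_box d lo hi (fun M => pt M (Y M))) as [phi [x [Hphi Hx]]].
  { intros M b Hb. apply Hpt; [assumption|]. destruct (HY M) as [H _]. specialize (H b Hb). lia. }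
  exists x. split.
  { intros b Hb. apply (Un_cv_range _ _ _ _ (Hx b Hb)). intros m. apply Hpt; [assumption|]. destruct (HY (phi m)) as [H _]. specialize (H b Hb). lia. }
  assert (Hlim : forall (Z : nat -> nat -> nat), (forall m b, (b < d)%nat -> (Y (phi m) b <= Z m b <= S (Y (phi m) b))%nat) ->
    (forall m b, (b < d)%nat -> lo b <= pt (phi m) (Z m) b <= hi b) /\
    forall b, (b < d)%nat -> Un_cv (fun m => pt (phi m) (Z m) b) (x b)).
  { intros Z HZ. split.
    - intros m b Hb. apply Hpt; [assumption|]. destruct (HY (phi m)) as [H _]. specialize (H b Hb). specialize (HZ m b Hb). lia.
    - intros b Hb. specialize (Hlh b Hb). apply (Un_cv_near _ _ _ (hi b - lo b) (Hx b Hb)); [lra|]. intros m.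
      destruct (HZ m b Hb) as [Z1 Z2]. apply le_INR in Z1, Z2. rewrite S_INR in Z2.
      assert (Hm : INR (S m) <= INR (S (phi m))) by (apply le_INR; specialize (Hphi m); lia).
      assert (Hp : 0 < INR (S m)) by (apply lt_0_INR; lia).
      unfold pt. replace (lo b + (hi b - lo b) * (INR (Z m b) / INR (S (phi m))) - (lo b + (hi b - lo b) * (INR (Y (phi m) b) / INR (S (phi m)))))
        with ((hi b - lo b) * ((INR (Z m b) - INR (Y (phi m) b)) * / INR (S (phi m)))) by lra.
      assert (I1 : 0 < / INR (S (phi m))) by (apply Rinv_0_lt_compat; lra).
      assert (I2 : / INR (S (phi m)) <= / INR (S m)) by (apply Rinv_le_contravar; lra).
      assert (0 <= (INR (Z m b) - INR (Y (phi m) b)) * / INR (S (phi m)) <= / INR (S m)) by nra.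
      rewrite Rabs_pos_eq by nra. apply Rmult_le_compat_l; lra. }
  intros a Ha.
  destruct (fun_choice (fun m (zz : (nat -> nat) * (nat -> nat)) => lab (phi m) a (fst zz) = true /\ lab (phi m) a (snd zz) = false /\
    forall b, (b < d)%nat -> (Y (phi m) b <= fst zz b <= S (Y (phi m) b))%nat /\ (Y (phi m) b <= snd zz b <= S (Y (phi m) b))%nat)) as [Z HZ].
  { intros m. destruct (HY (phi m)) as [_ H]. destruct (H a Ha) as [z [z' H']]. now exists (z, z'). }
  assert (HS : forall m, INR (S (phi m)) <> 0) by (intros; apply not_0_INR; lia).
  split.
  (* Near [x] the function is negative, so vertices with the label false can only lie on the lower
     face. *)
  - destruct (Rle_dec 0 (f a x)) as [|Hneg]; [now right|left].
    destruct (Hlim (fun m => snd (Z m))) as [L1 L2]; [intros; now apply HZ|].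
    apply (Un_cv_event _ _ _ (L2 a Ha)).
    destruct (Hf a Ha (fun m => pt (phi m) (snd (Z m))) x L1 L2 (- f a x) ltac:(lra)) as [N HN]. exists N. intros m Hm. specialize (HN m Hm). apply Rabs_def2 in HN.
    destruct (HZ m) as [_ [Hl _]]. unfold lab in Hl.
    destruct (snd (Z m) a =? 0) eqn:E0; [|destruct (snd (Z m) a =? S (phi m)); [discriminate|]; destruct (Rle_dec (f a (pt (phi m) (snd (Z m)))) 0); [discriminate|lra]].
    apply Nat.eqb_eq in E0. unfold pt. rewrite E0. simpl (INR 0). unfold Rdiv. ring.
  - destruct (Rle_dec (f a x) 0) as [|Hpos]; [now right|left].
    destruct (Hlim (fun m => fst (Z m))) as [L1 L2]; [intros; now apply HZ|].
    apply (Un_cv_event _ _ _ (L2 a Ha)).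
    destruct (Hf a Ha (fun m => pt (phi m) (fst (Z m))) x L1 L2 (f a x) ltac:(lra)) as [N HN]. exists N. intros m Hm. specialize (HN m Hm). apply Rabs_def2 in HN.
    destruct (HZ m) as [Hl _]. unfold lab in Hl.
    destruct (fst (Z m) a =? 0) eqn:E0; [discriminate|]. destruct (fst (Z m) a =? S (phi m)) eqn:E1; [|destruct (Rle_dec (f a (pt (phi m) (fst (Z m)))) 0); [lra|discriminate]].
    apply Nat.eqb_eq in E1. unfold pt. rewrite E1. field. apply HS.
Qed.

(** * Existence *)

Lemma Expect_pos pr (w0 : Outcome) ks : forall f, okp ks pr ->
  (forall v, In v ks -> if w0 v then 0 < pr v else pr v < 1) -> (forall w, 0 <= f w) ->
  (forall w, supp ks w -> (forall v, In v ks -> w v = w0 v) -> 0 < f w) -> 0 < Expect ks pr f.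
Proof.
  induction ks as [|v ks IH]; intros f Hok Hpr H0 Hf; simpl; [apply Hf; [discriminate|contradiction]|].
  assert (Hv := Hpr v (or_introl eq_refl)). assert (Rv := Hok v (or_introl eq_refl)).
  assert (Hok' : okp ks pr) by (intros u Hu; apply Hok; now right).
  assert (K : 0 < Expect ks pr (fun w => f (setv w v (w0 v)))).
  { apply IH; auto; [intros; apply Hpr; now right|]. intros w Hs Hw. apply Hf.
    - intros u Hu. unfold setv in Hu. destruct (Var_eq_dec u v); [now left|right; auto].
    - intros u Hu. unfold setv. destruct (Var_eq_dec u v) as [->|Hne]; [reflexivity|]. destruct Hu; [congruence|auto]. }
  assert (T : forall b, 0 <= Expect ks pr (fun w => f (setv w v b))) by (intros; now apply Expect_nonneg).
  assert (T1 := T true). assert (T2 := T false). destruct (w0 v); nra.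
Qed.

Lemma GT_pos n beta delta q i (T : nat -> Prop) : 0 < delta <= 1 -> (i < n)%nat ->
  (forall j, (j < n)%nat -> 0 < beta j < 1 /\ 0 < q j <= 1) -> (forall t, T t -> (t < n)%nat /\ t <> i) ->
  0 < GT n beta delta q i T.
Proof.
  intros Hd Hi Hq HT.
  assert (Hact : act_ok n beta delta q) by (split; [lra|]; intros j Hj; specialize (Hq j Hj); lra).
  (* The witness outcome: [i] listens directly to all of [T], nobody else listens to anyone, and all
     indirect coins succeed, which is possible even for [delta = 1]. *)
  apply (Expect_pos _ (fun v => match v with Disc _ => false | Ind _ _ => true
      | Dir a b => if excluded_middle_informative (a = i /\ T b) then true else false end)).
  - now apply act_okp.
  - intros [a|a b|a b] Hv; simpl; [lra| |lra]. apply in_keys_Dir in Hv. destruct Hv as [Ha [Hb _]].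
    destruct (Hq a Ha), (Hq b Hb). assert (0 < q a * q b <= 1) by nra. em (a = i /\ T b); unfold iota; nra.
  - intros; apply ind_pos.
  - intros w Hs Hw. rewrite ind_true; [lra|]. split.
    + intros t Ht. destruct (HT t Ht) as [H1 H2]. split; [assumption|]. split; [assumption|]. exists i. split; [now apply Rch_base|].
      rewrite Hw by (apply in_keys_Dir; auto). em (i = i /\ T t); tauto.
    + intros j Hj Hji [Hl _]. assert (Hin := Hs _ Hl). rewrite Hw in Hl by assumption.
      destruct (excluded_middle_informative (j = i /\ T i)) as [[? _]|]; [contradiction|discriminate].
Qed.

Lemma blists_count n : forall k, (k <= n)%nat -> exists t, In t (blists n) /\ length (filter (fun b => b) t) = k.
Proof.
  induction n as [|n IH]; intros k Hk; [exists []; split; [now left|simpl; lia]|]. destruct k as [|k].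
  - destruct (IH 0%nat ltac:(lia)) as [t [Ht E]]. exists (false :: t). split; [simpl; apply in_or_app; right; now apply in_map|assumption].
  - destruct (IH k ltac:(lia)) as [t [Ht E]]. exists (true :: t). split; [simpl; apply in_or_app; left; now apply in_map|simpl; lia].
Qed.

Lemma blists_tech n : forall k i, (i < n)%nat -> (1 <= k <= n)%nat -> exists t, In t (blists n) /\ tech_of k i t.
Proof.
  induction n as [|n IH]; intros k i Hi Hk; [lia|]. destruct i as [|i].
  - destruct (blists_count n (k - 1) ltac:(lia)) as [t [Ht E]]. exists (true :: t).
    split; [simpl; apply in_or_app; left; now apply in_map|]. split; [simpl; lia|reflexivity].
  - destruct (Nat.eq_dec k (S n)) as [->|].
    + destruct (IH n i ltac:(lia) ltac:(lia)) as [t [Ht [E M]]]. exists (true :: t).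
      split; [simpl; apply in_or_app; left; now apply in_map|]. split; [simpl; lia|exact M].
    + destruct (IH k i ltac:(lia) ltac:(lia)) as [t [Ht [E M]]]. exists (false :: t).
      split; [simpl; apply in_or_app; right; now apply in_map|]. split; [exact E|exact M].
Qed.

Lemma lsum_ge_term {A} (L : list A) f a : (forall b, 0 <= f b) -> In a L -> f a <= lsum L f.
Proof.
  intros H. induction L as [|b L IH]; intros Hin; [contradiction|]. rewrite lsum_cons.
  assert (0 <= lsum L f) by (apply lsum_nonneg; auto). assert (B := H b).
  destruct Hin as [->|Hin]; [lra|]. specialize (IH Hin). lra.
Qed.

Lemma GG_pos n k beta delta p q i : 0 < delta <= 1 -> (i < n)%nat -> (1 <= k <= n)%nat ->
  (forall j, (j < n)%nat -> 0 < beta j < 1 /\ 0 < q j <= 1) -> (forall j, (j < n)%nat -> 0 < p j) ->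
  0 < GG n k beta delta p q i.
Proof.
  intros Hd Hi Hk Hq Hp. destruct (blists_tech n k i Hi Hk) as [t [Ht E]].
  assert (Hg : forall t, 0 < GT n beta delta q i (Tof n t i)) by (intros; apply GT_pos; auto; apply Tof_ok).
  apply Rlt_le_trans with (wt n k p i t * GT n beta delta q i (Tof n t i)).
  - apply Rmult_lt_0_compat; [|apply Hg]. unfold wt. rewrite ind_true, Rmult_1_l by assumption.
    apply prodR_pos. intros j Hj. unfold pw. em (Tof n t i j); [auto|lra].
  - apply (lsum_ge_term (blists n) (fun t => wt n k p i t * GT n beta delta q i (Tof n t i))); [|assumption].
    intros s. apply Rmult_le_pos; [apply wt_nonneg; intros j Hj; left; auto|left; apply Hg].
Qed.

Lemma GG_bound n k beta delta p q i : act_ok n beta delta q -> (forall j, (j < n)%nat -> 0 <= p j <= 1) ->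
  GG n k beta delta p q i <= lsum (blists n) (fun _ => 1).
Proof.
  intros Hact Hp. apply lsum_le. intros t _.
  assert (G := Expect_ind_range _ _ (fun w => hT n w i (Tof n t i) /\ sec n w i (Tof n t i)) (act_okp _ _ _ _ Hact)).
  assert (W : 0 <= wt n k p i t <= 1).
  { split; [apply wt_nonneg; intros; now apply Hp|]. unfold wt. assert (I := ind_range (tech_of k i t)).
    assert (P : 0 <= prodA n (Tof n t i) p <= 1); [|nra]. split; [apply prodA_nonneg; intros; now apply Hp|].
    rewrite <- (prodR_one n (fun _ => 1)) by reflexivity. apply prodR_le. intros j Hj. specialize (Hp j Hj). unfold pw. em (Tof n t i j); lra. }
  unfold GT, EN. nra.
Qed.

Lemma Un_cv_const c : Un_cv (fun _ => c) c.
Proof. intros eps He. exists 0%nat. intros. unfold Rdist. rewrite Rminus_diag, Rabs_R0. lra. Qed.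

Lemma Un_cv_sumR n (u : nat -> nat -> R) x : (forall j, (j < n)%nat -> Un_cv (fun m => u m j) (x j)) ->
  Un_cv (fun m => sumR n (u m)) (sumR n x).
Proof.
  induction n; simpl; intros H; [apply Un_cv_const|].
  apply (CV_plus (fun m => sumR n (u m)) (fun m => u m n)); auto.
Qed.

Lemma Un_cv_prodR n (u : nat -> nat -> R) x : (forall j, (j < n)%nat -> Un_cv (fun m => u m j) (x j)) ->
  Un_cv (fun m => prodR n (u m)) (prodR n x).
Proof.
  induction n; simpl; intros H; [apply Un_cv_const|].
  apply (CV_mult (fun m => prodR n (u m)) (fun m => u m n)); auto.
Qed.

Lemma Un_cv_lsum {A} (L : list A) (u : nat -> A -> R) x : (forall a, Un_cv (fun m => u m a) (x a)) ->
  Un_cv (fun m => lsum L (u m)) (lsum L x).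
Proof.
  intros H. induction L as [|a L IH]; [apply (Un_cv_const 0)|].
  apply (CV_plus (fun m => u m a) (fun m => lsum L (u m))); auto.
Qed.

Section Continuity.

Variables (n k : nat) (beta : nat -> R) (delta : R) (pm qm : nat -> nat -> R) (p q : nat -> R).
Hypothesis Hp : forall j, (j < n)%nat -> Un_cv (fun m => pm m j) (p j).
Hypothesis Hq : forall j, (j < n)%nat -> Un_cv (fun m => qm m j) (q j).

Lemma Un_cv_EN f : Un_cv (fun m => EN n beta delta (qm m) f) (EN n beta delta q f).
Proof.
  apply (Un_cv_Expect _ (fun m => prob beta delta (fun _ => 0) (qm m))).
  intros [a|a b|a b] Hv; simpl; [apply Un_cv_const| |apply Un_cv_const].
  apply in_keys_Dir in Hv. destruct Hv as [Ha [Hb _]].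
  apply (CV_mult (fun _ => beta a) (fun m => qm m a * qm m b)); [apply Un_cv_const|].
  apply (CV_mult (fun m => qm m a) (fun m => qm m b)); auto.
Qed.

Lemma Un_cv_wt i t : Un_cv (fun m => wt n k (pm m) i t) (wt n k p i t).
Proof.
  apply (CV_mult (fun _ => ind (tech_of k i t)) (fun m => prodA n (Tof n t i) (pm m))); [apply Un_cv_const|].
  apply (Un_cv_prodR n (fun m j => pw (Tof n t i j) (pm m j))). intros j Hj. unfold pw. em (Tof n t i j); [auto|apply Un_cv_const].
Qed.

Lemma Un_cv_GG i : Un_cv (fun m => GG n k beta delta (pm m) (qm m) i) (GG n k beta delta p q i).
Proof.
  apply (Un_cv_lsum (blists n) (fun m t => wt n k (pm m) i t * GT n beta delta (qm m) i (Tof n t i))). intros t.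
  apply (CV_mult (fun m => wt n k (pm m) i t) (fun m => GT n beta delta (qm m) i (Tof n t i))); [apply Un_cv_wt|apply Un_cv_EN].
Qed.

Lemma Un_cv_FF i : (i < n)%nat -> Un_cv (fun m => FF n beta delta (qm m) i k (pm m) (qm m i)) (FF n beta delta q i k p (q i)).
Proof.
  intros Hi.
  apply (Un_cv_lsum (blists n) (fun m t => wt n k (pm m) i t * D1 n beta delta (qm m) i (fT n i (Tof n t i)) (qm m i))). intros t.
  apply (CV_mult (fun m => wt n k (pm m) i t) (fun m => D1 n beta delta (qm m) i (fT n i (Tof n t i)) (qm m i))); [apply Un_cv_wt|].
  unfold D1. rewrite upd_id.
  assert (S : forall (g : nat -> R) (F : nat -> Outcome -> R),
    Un_cv (fun m => nsum n i (fun x => g x * qm m x * EN n beta delta (upd (qm m) i (qm m i)) (F x))) (nsum n i (fun x => g x * q x * EN n beta delta q (F x)))).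
  { intros g F.
    apply (Un_cv_sumR n (fun m x => if Nat.eq_dec x i then 0 else g x * qm m x * EN n beta delta (upd (qm m) i (qm m i)) (F x))).
    intros x Hx. destruct (Nat.eq_dec x i); [apply Un_cv_const|].
    apply (CV_mult (fun m => g x * qm m x) (fun m => EN n beta delta (upd (qm m) i (qm m i)) (F x))).
    - apply (CV_mult (fun _ => g x) (fun m => qm m x)); [apply Un_cv_const|auto].
    - intros eps He. destruct (Un_cv_EN (F x) eps He) as [N HN]. exists N. intros m Hm. rewrite upd_id. auto. }
  apply (CV_plus (fun m => nsum n i (fun x => beta i * qm m x * EN n beta delta (upd (qm m) i (qm m i)) (dl (Dir i x) (fT n i (Tof n t i)))))
    (fun m => nsum n i (fun x => beta x * qm m x * EN n beta delta (upd (qm m) i (qm m i)) (dl (Dir x i) (fT n i (Tof n t i)))))).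
  - apply (S (fun _ => beta i)).
  - apply (S beta (fun x => dl (Dir x i) (fT n i (Tof n t i)))).
Qed.

End Continuity.

Lemma convex_support c c' : (forall x, in01 x -> limit1_in (fun y => (c y - c x) / (y - x)) (fun y => in01 y /\ y <> x) (c' x) x) ->
  (forall x y t, in01 x -> in01 y -> 0 <= t <= 1 -> c (t * x + (1 - t) * y) <= t * c x + (1 - t) * c y) ->
  forall a x, in01 a -> in01 x -> c a + c' a * (x - a) <= c x.
Proof.
  intros Hd Hc a x Ha Hx. apply Rnot_lt_le. intros Hlt.
  destruct (Req_dec x a) as [->|Hne]; [lra|].
  set (gap := c a + c' a * (x - a) - c x). assert (Hg : 0 < gap) by (unfold gap; lra).
  assert (Hxa : 0 < Rabs (x - a)) by (apply Rabs_pos_lt; lra).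
  destruct (Hd a Ha (gap / Rabs (x - a)) ltac:(apply Rdiv_lt_0_compat; lra)) as [al [Hal Hlim]].
  set (t := Rmin 1 (al / (2 * Rabs (x - a)))).
  assert (Ht : 0 < t) by (apply Rmin_glb_lt; [lra|apply Rdiv_lt_0_compat; lra]).
  assert (Ht1 : t <= 1) by apply Rmin_l. assert (Ht2 : t <= al / (2 * Rabs (x - a))) by apply Rmin_r.
  set (y := t * x + (1 - t) * a). assert (Ey : y - a = t * (x - a)) by (unfold y; ring).
  assert (Hy : in01 y) by (unfold in01, y in *; split; nra).
  assert (Hya : y <> a) by nra.
  assert (D : Rabs ((c y - c a) / (y - a) - c' a) < gap / Rabs (x - a)).
  { apply (Hlim y). split; [split; assumption|]. simpl. unfold Rdist. rewrite Ey, Rabs_mult, (Rabs_pos_eq t) by lra.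
    apply (Rmult_le_compat_r (Rabs (x - a))) in Ht2; [|lra].
    replace (al / (2 * Rabs (x - a)) * Rabs (x - a)) with (al / 2) in Ht2 by (field; lra). lra. }
  set (s := (c y - c a) / (y - a)) in *.
  assert (Es : t * ((x - a) * s) = c y - c a) by (unfold s; rewrite Ey; field; split; lra).
  assert (Cy : c y <= t * c x + (1 - t) * c a) by (apply Hc; [assumption|assumption|lra]).
  assert (S1 : (x - a) * s <= c x - c a) by nra.
  assert (S2 : Rabs ((x - a) * s - (x - a) * c' a) < gap).
  { rewrite <- Rmult_minus_distr_l, Rabs_mult. apply (Rmult_lt_compat_l (Rabs (x - a))) in D; [|assumption].
    replace (Rabs (x - a) * (gap / Rabs (x - a))) with gap in D by (field; lra). exact D. }
  apply Rabs_def2 in S2. unfold gap in S2. lra.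
Qed.

Lemma strict_local_max g h z d : (forall y, derivable_pt_lim g y (h y)) -> derivable_pt_lim h z d -> h z = 0 -> d < 0 ->
  exists eta, 0 < eta /\ forall y, y <> z -> Rabs (y - z) < eta -> g y < g z.
Proof.
  intros Hg Hh Hz Hd. destruct (Hh (- d) ltac:(lra)) as [eta He]. exists eta. split; [apply cond_pos|].
  assert (Sg : forall y, y <> z -> Rabs (y - z) < eta -> h y / (y - z) < 0).
  { intros y Hy Hyz. assert (K := He (y - z) ltac:(lra) Hyz). replace (z + (y - z)) with y in K by ring.
    rewrite Hz, Rminus_0_r in K. apply Rabs_def2 in K. lra. }
  intros y Hy Hyz. destruct (Rlt_dec y z) as [Hlt|Hge].
  - destruct (MVT_cor2 g h y z Hlt ltac:(intros; apply Hg)) as [xi [E Hxi]].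
    rewrite Rabs_left in Hyz by lra. assert (K := Sg xi ltac:(lra) ltac:(rewrite Rabs_left; lra)).
    assert (0 < h xi); [|nra]. apply Rnot_le_lt. intros Hn.
    assert (0 <= h xi / (xi - z)); [|lra]. replace (h xi / (xi - z)) with ((- h xi) * / (z - xi)) by (field; lra).
    apply Rmult_le_pos; [lra|left; apply Rinv_0_lt_compat; lra].
  - destruct (MVT_cor2 g h z y ltac:(lra) ltac:(intros; apply Hg)) as [xi [E Hxi]].
    rewrite Rabs_pos_eq in Hyz by lra. assert (K := Sg xi ltac:(lra) ltac:(rewrite Rabs_pos_eq; lra)).
    assert (h xi < 0); [|nra]. apply Rnot_le_lt. intros Hn.
    assert (0 <= h xi / (xi - z)); [|lra]. apply Rmult_le_pos; [lra|left; apply Rinv_0_lt_compat; lra].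
Qed.

(* A minimum of [g] between [x0] and [y] can only be at [y], as every stationary point is a strict local maximum. *)
Lemma unimodal_max g h h' x0 y : (forall y, derivable_pt_lim g y (h y)) -> (forall y, derivable_pt_lim h y (h' y)) ->
  h x0 = 0 -> (forall z, Rmin x0 y <= z <= Rmax x0 y -> h z = 0 -> h' z < 0) -> g y <= g x0.
Proof.
  intros Hg Hh H0 Hneg. destruct (Req_dec y x0) as [->|Hne]; [lra|].
  assert (Hlt : Rmin x0 y < Rmax x0 y) by (unfold Rmin, Rmax; destruct (Rle_dec x0 y); lra).
  set (a := Rmin x0 y) in *. set (b := Rmax x0 y) in *.
  destruct (continuity_ab_min g a b ltac:(lra)) as [z [Hmin Hz]].
  { intros c _. apply derivable_continuous_pt. exists (h c). apply Hg. }
  assert (Hab : (x0 = a /\ y = b) \/ (x0 = b /\ y = a)) by (unfold a, b, Rmin, Rmax; destruct (Rle_dec x0 y); auto).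
  assert (NZ : h z = 0 -> False).
  { intros E. destruct (strict_local_max g h z (h' z) Hg (Hh z) E (Hneg z Hz E)) as [eta [He K]].
    destruct (Rlt_dec z b) as [Hzb|Hzb].
    - set (s := Rmin (eta / 2) (b - z)). assert (0 < s) by (apply Rmin_glb_lt; lra).
      assert (s <= eta / 2) by apply Rmin_l. assert (s <= b - z) by apply Rmin_r.
      specialize (K (z + s) ltac:(lra) ltac:(rewrite Rabs_pos_eq; lra)). specialize (Hmin (z + s) ltac:(lra)). lra.
    - set (s := Rmin (eta / 2) (z - a)). assert (0 < s) by (apply Rmin_glb_lt; lra).
      assert (s <= eta / 2) by apply Rmin_l. assert (s <= z - a) by apply Rmin_r.
      specialize (K (z - s) ltac:(lra) ltac:(rewrite Rabs_left; lra)). specialize (Hmin (z - s) ltac:(lra)). lra. }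
  destruct (Req_dec z x0) as [->|Hzx]; [exfalso; auto|].
  destruct (Req_dec z y) as [->|Hzy]; [apply Hmin; destruct Hab; lra|]. exfalso. apply NZ.
  assert (Dg := derivable_pt_lim_opp g z (h z) (Hg z)).
  assert (- h z <= 0) by (apply (deriv_right_max _ _ _ b Dg ltac:(lra)); intros t Ht; unfold opp_fct; specialize (Hmin t ltac:(lra)); lra).
  assert (0 <= - h z) by (apply (deriv_left_max _ _ _ a Dg ltac:(lra)); intros t Ht; unfold opp_fct; specialize (Hmin t ltac:(lra)); lra).
  lra.
Qed.

Lemma limit1_in_Un_cv f (D : R -> Prop) l x u : limit1_in f D l x -> (forall m : nat, D (u m)) -> Un_cv u x -> Un_cv (fun m => f (u m)) l.
Proof.
  intros Hl HD Hu eps He. destruct (Hl eps He) as [al [Hal H]]. destruct (Hu al Hal) as [N HN]. exists N. intros m Hm.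
  apply H. split; [apply HD|apply HN, Hm].
Qed.

(** The box bounds [p] away from [0] and [1], and each face in a [p] direction is excluded by
    comparing [GG] with the marginal cost. Global optimality then follows from unimodality of [GG]
    in [q i] and convexity of the cost. *)
Lemma equilibrium_exists k delta bl c beta : (2 <= k)%nat -> 0 < delta <= 1 -> 0 < bl < 1 ->
  (forall i, bl <= beta i < 1) -> cost_ok c ->
  exists N : nat, forall n, (N <= n)%nat -> exists p q : nat -> R, investment_equilibrium n k delta beta c p q.
Proof.
  intros Hk Hd Hbl Hbeta [[c' [Hc' Hcc]] [Hc0 [_ [Hconv [cz Hinf]]]]].
  assert (Sup := convex_support c c' Hc' Hconv).
  assert (Hc := c_of_ok k delta bl Hk Hd Hbl). set (c1 := c1_of k delta bl) in *. set (c2 := c2_of k delta bl) in *.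
  destruct (foc_net k delta bl Hk Hd Hbl) as [N1 H1].
  destruct (stationary_concave k delta bl c1 c2 Hk Hd Hbl Hc) as [e2 [N2 [He2 H2]]].
  (* This makes [GG] exceed the marginal cost at [1/2], which rules out the lower face of the
     investments. *)
  destruct (near_critical k delta bl c1 c2 1 (c' (1/2) + 1) Hk Hd Hbl Hc ltac:(lra)) as [e3 [N3 [He3 H3]]].
  set (e := Rmin (e2 / 2) e3). assert (He : 0 < e) by (apply Rmin_glb_lt; lra).
  assert (Ea : e <= e2 / 2) by apply Rmin_l. assert (Eb : e <= e3) by apply Rmin_r.
  destruct (foc_critical k delta bl e Hk Hd Hbl He) as [N4 H4].
  destruct (INR_large (2 * (c2 * c2) / e2)) as [N5 H5].
  exists (k + N1 + N2 + N3 + N4 + N5)%nat. intros n Hn.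
  assert (Hn2 : 2 <= INR n) by (apply (le_INR 2); lia).
  set (Kmax := lsum (blists n) (fun _ => 1)).
  (* [Kmax] bounds [GG] for this [n]; by convexity the marginal cost at [ph] is at least the cost
     there, which exceeds [Kmax] and rules out the upper face. *)
  destruct (Hinf Kmax) as [eta [Heta HK]]. set (ph := 1 - Rmin (eta / 2) (1/4)).
  assert (Hph : 1/2 < ph < 1 /\ 1 - eta < ph).
  { assert (0 < Rmin (eta / 2) (1/4)) by (apply Rmin_glb_lt; lra). assert (A := Rmin_l (eta / 2) (1/4)). assert (B := Rmin_r (eta / 2) (1/4)).
    unfold ph. lra. }
  assert (HKph : Kmax < c' ph).
  { assert (K := HK ph ltac:(lra)). assert (S := Sup ph 0 ltac:(unfold in01; lra) ltac:(unfold in01; lra)). rewrite cz in S.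
    assert (C0 := Hc0 ph ltac:(unfold in01; lra)). nra. }
  assert (In0 : 0 < 1 / INR n < 1).
  { split; [apply Rdiv_lt_0_compat; lra|]. apply (Rmult_lt_reg_r (INR n)); [lra|]. unfold Rdiv. rewrite Rmult_assoc, Rinv_l; lra. }
  (* The first [n] coordinates are the [q i], the last [n] the [p i]. *)
  destruct (variational_inequality (n + n)
    (fun b => if lt_dec b n then 1 / INR n else 1/2) (fun b => if lt_dec b n then 1 else ph)
    (fun a x => if lt_dec a n then FF n beta delta x a k (fun j => x (n + j)%nat) (x a)
                else GG n k beta delta (fun j => x (n + j)%nat) x (a - n) - c' (x a))) as [x [Hbox Hvi]].
  { intros b _. destruct (lt_dec b n); lra. }
  { intros a Ha u x Hu Hx.
    assert (Cp : forall j, (j < n)%nat -> Un_cv (fun m => u m (n + j)%nat) (x (n + j)%nat)) by (intros; apply Hx; lia).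
    assert (Cq : forall j, (j < n)%nat -> Un_cv (fun m => u m j) (x j)) by (intros; apply Hx; lia).
    destruct (lt_dec a n) as [Han|Han].
    - apply (Un_cv_FF n k beta delta (fun m j => u m (n + j)%nat) u (fun j => x (n + j)%nat) x Cp Cq a Han).
    - apply (CV_minus (fun m => GG n k beta delta (fun j => u m (n + j)%nat) (u m) (a - n)) (fun m => c' (u m a))).
      + apply (Un_cv_GG n k beta delta (fun m j => u m (n + j)%nat) u (fun j => x (n + j)%nat) x Cp Cq).
      + assert (R : forall m, 1/2 <= u m a <= ph) by (intros m; specialize (Hu m a Ha); destruct (lt_dec a n); [contradiction|assumption]).
        assert (Rx := Un_cv_range _ _ _ _ (Hx a Ha) R).
        apply (limit1_in_Un_cv c' in01 _ (x a)); [apply Hcc; unfold in01; lra|intros m; specialize (R m); unfold in01; lra|auto]. }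
  set (q := x) in *. set (p := fun j => x (n + j)%nat) in *.
  assert (Hq : forall i, (i < n)%nat -> 1 / INR n <= q i <= 1).
  { intros i Hi. specialize (Hbox i ltac:(lia)). destruct (lt_dec i n); [assumption|contradiction]. }
  assert (Hp : forall i, (i < n)%nat -> 1/2 <= p i <= ph).
  { intros i Hi. specialize (Hbox (n + i)%nat ltac:(lia)). destruct (lt_dec (n + i) n); [lia|assumption]. }
  assert (Hact : act_ok n beta delta q) by (split; [lra|]; intros j Hj; specialize (Hq j Hj); specialize (Hbeta j); lra).
  assert (Gpos : forall i y, (i < n)%nat -> 0 < y <= 1 -> 0 < GG n k beta delta p (upd q i y) i).
  { intros i y Hi Hy. apply GG_pos; auto; [lia| |intros j Hj; specialize (Hp j Hj); lra].
    intros j Hj. specialize (Hbeta j). specialize (Hq j Hj). unfold upd. destruct (Nat.eq_dec j i); lra. }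
  assert (HF : FOC n k beta delta p q).
  { intros i Hi. destruct (Hvi i ltac:(lia)) as [V1 V2]. destruct (lt_dec i n) as [_|]; [|contradiction].
    assert (Qi := Hq i Hi). assert (Pi := Hp i Hi). split; [lra|]. split; [lra|]. split; [|split; [assumption|]].
    - rewrite <- (upd_id q i). apply Gpos; [assumption|lra].
    - destruct V1 as [V1|V1]; [left|now right]. rewrite V1. right. field. lra. }
  destruct (H1 n beta p q ltac:(lia) Hbeta HF) as [Hnet [HF0 Hnet']].
  assert (Hlam := H4 n beta p q ltac:(lia) Hbeta HF).
  assert (Hp1 : forall j, (j < n)%nat -> 1/2 <= p j <= 1) by (intros j Hj; specialize (Hp j Hj); lra).
  assert (HG : forall i, (i < n)%nat -> GG n k beta delta p q i = c' (p i)).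
  { intros i Hi. destruct (H3 n beta q ltac:(lia) Hnet ltac:(lra) i p Hi Hp1) as [_ GB].
    assert (GU := GG_bound n k beta delta p q i Hact ltac:(intros j Hj; specialize (Hp1 j Hj); lra)). fold Kmax in GU.
    destruct (Hvi (n + i)%nat ltac:(lia)) as [V1 V2]. destruct (lt_dec (n + i) n); [lia|].
    replace (n + i - n)%nat with i in V1, V2 by lia. change (q (n + i)%nat) with (p i) in V1, V2.
    change (fun j => q (n + j)%nat) with p in V1, V2.
    destruct V1 as [V1|V1].
    - exfalso. destruct V2 as [V2|V2]; [lra|]. rewrite V1 in V2. lra.
    - destruct V2 as [V2|V2]; [exfalso; rewrite V2 in V1|]; lra. }
  assert (Hmax : forall i y, (i < n)%nat -> 0 <= y <= 1 -> GG n k beta delta p (upd q i y) i <= GG n k beta delta p q i).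
  { intros i y Hi Hy. assert (Qi := Hq i Hi). destruct (Req_dec y 0) as [->|Hy0].
    - apply Rle_trans with 0; [|rewrite <- (upd_id q i); left; apply Gpos; [assumption|lra]].
      apply GG_closed; auto; [|intros j Hj; specialize (Hp j Hj); lra|apply upd_same].
      split; [lra|]. intros j Hj. specialize (Hbeta j). specialize (Hq j Hj). unfold upd. destruct (Nat.eq_dec j i); lra.
    - rewrite <- (upd_id q i) at 2.
      apply (unimodal_max (fun y => GG n k beta delta p (upd q i y) i) (FF n beta delta q i k p) (FF2 n beta delta q i k p) (q i) y
        (GG_deriv n beta delta q i Hi k p) (FF_deriv n beta delta q i Hi k p) (HF0 i Hi)).
      intros z Hz E.
      assert (Hz1 : 0 < z <= 1) by (unfold Rmin, Rmax in Hz; destruct (Rle_dec (q i) y); lra).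
      assert (Nz := Hnet' i z Hi Hz1 (Gpos i z Hi Hz1) E).
      apply (H2 n beta q z i p ltac:(lia) Hi Nz); auto.
      (* A stationary deviation moves [lam0] by [O(1 / n)], so it stays in the window where
         stationary points are strict maxima. *)
      assert (B := sub_crit_upd n beta delta q bl c1 c2 i z Hi Hnet Nz).
      assert (Small : c2 * c2 / INR n <= e2 / 2).
      { specialize (H5 n ltac:(lia)). apply (Rmult_le_reg_r (INR n)); [lra|]. unfold Rdiv at 1. rewrite Rmult_assoc, Rinv_l, Rmult_1_r by lra.
        apply (Rmult_le_compat_l (e2 / 2)) in H5; [|lra]. replace (e2 / 2 * (2 * (c2 * c2) / e2)) with (c2 * c2) in H5 by (field; lra). lra. }
      unfold Rabs in B. destruct (Rcase_abs _) in B; lra. }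
  exists p, q. split; [split|].
  - intros i Hi. specialize (Hq i Hi). specialize (Hp i Hi). split; lra.
  - intros i Hi t y [Ht Hy]. rewrite !payoff_eq, GG_upd, upd_same by assumption.
    (* Joint deviations reduce to separate ones: no [y] yields more than [GG = c' (p i)], and the
       tangent of the convex cost at [p i] does the rest. *)
    assert (Pi := Hp i Hi). assert (M := Hmax i y Hi Hy). rewrite (HG i Hi) in *.
    assert (S := Sup (p i) t ltac:(unfold in01; lra) ltac:(unfold in01; lra)). nra.
  - intros i Hi. specialize (Hp i Hi). lra.
Qed.

Theorem theorem2 :
  forall (k : nat) (delta beta_low : R) (c : R -> R) (beta : nat -> R),
    (2 <= k)%nat ->
    0 < delta <= 1 ->
    0 < beta_low < 1 ->
    (forall i, beta_low <= beta i < 1) ->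
    cost_ok c ->
    (exists N : nat, forall n, (N <= n)%nat ->
        exists p q : nat -> R, investment_equilibrium n k delta beta c p q) /\
    (forall (p q : nat -> nat -> R) (N : nat),
        (forall n, (N <= n)%nat -> investment_equilibrium n k delta beta c (p n) (q n)) ->
        critical beta delta q).
Proof.
  intros k delta beta_low c beta Hk Hd Hbl Hbeta Hc. split.
  - now apply (equilibrium_exists k delta beta_low).
  - now apply (equilibria_critical k delta beta_low c).
Qed.
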